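(* Let $n^*\ge n\ge1$ and $n_0\ge1$ be integers. Let $S$ be a Haar distributed $(n^*+n)\times(n^*+n)$ unitary matrix and $t$ its $n\times n^*$ submatrix formed by rows $n^*+1,\dots,n^*+n$ and columns $1,\dots,n^*$. Replace each entry $x+iy$ of $t$ by the real $2\times2$ block $\begin{pmatrix}x&y\\-y&x\end{pmatrix}$, obtaining a real $2n\times2n^*$ matrix, and append $n_0$ rows of zeros, obtaining the $(2n+n_0)\times2n^*$ real matrix $\hat t$. Let $\vec x=\vec g/\|\vec g\|$ with $\vec g$ a column vector of $2n+n_0$ independent standard real Gaussians, independent of $S$, and $\Pi:=\mathbf 1-\vec x\vec x^T$. Then the $2n$ non-zero eigenvalues $1>x_1>x_2>\dots>x_{2n}>0$ of $M:=\Pi\hat t\hat t^T\Pi$ have joint probability density $$\frac1C\prod_{j=1}^{2n}x_j^{(a-1)/2}\prod_{l=1}^n\Big(\frac{x_{2l}}{x_{2l-1}}\Big)^{-A/2}\prod_{1\le j<k\le n}(x_{2j-1}-x_{2k-1})(x_{2j}-x_{2k})$$ with $a=n^*-n$, $A=n^*-n-n_0+1$, and $C$ the normalization constant. *)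

(* Defs.v *)
From HB Require Import structures.
From mathcomp Require Import all_boot all_order all_algebra.
From mathcomp Require Import complex spectral.
From mathcomp Require Import all_classical all_reals all_analysis.

Set Implicit Arguments.
Unset Strict Implicit.
Unset Printing Implicit Defensive.

Import Order.TTheory GRing.Theory Num.Theory.
Local Open Scope ring_scope.
Local Open Scope classical_set_scope.

Section Defs.
Variable R : realType.

Definition mxentry {T : nmodType} m k (A : 'M[T]_(m, k)) (i j : nat) : T :=
  match @insub _ (fun x => x < m)%N 'I_m i, @insub _ (fun x => x < k)%N 'I_k j with
  | Some i', Some j' => A i' j'
  | _, _ => 0
  end.

Definition tsub (nstar n : nat) (S : 'M[R[i]]_(nstar + n)) : 'M[R[i]]_(n, nstar) :=
  \matrix_(i < n, j < nstar) S (rshift nstar i) (lshift n j).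

(* hat t : each entry x+iy replaced by the block [[x, y], [-y, x]],
   followed by n0 zero rows *)
Definition that (nstar n n0 : nat) (t : 'M[R[i]]_(n, nstar)) :
    'M[R]_(2 * n + n0, 2 * nstar) :=
  \matrix_(r < 2 * n + n0, c < 2 * nstar)
    if (r < 2 * n)%N then
      let z := mxentry t r./2 c./2 in
      if odd r == odd c then complex.Re z
      else if ~~ odd r then complex.Im z else - complex.Im z
    else 0.

Definition unitvec D (g : 'cV[R]_D) : 'cV[R]_D :=
  (Num.sqrt (\sum_(k < D) g k 0 ^+ 2))^-1 *: g.

Definition projPi D (g : 'cV[R]_D) : 'M[R]_D :=
  1%:M - unitvec g *m (unitvec g)^T.

Definition Mmat (nstar n n0 : nat) (S : 'M[R[i]]_(nstar + n))
    (g : 'cV[R]_(2 * n + n0)) : 'M[R]_(2 * n + n0) :=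
  let T := that n0 (tsub S) in
  projPi g *m T *m T^T *m projPi g.

Definition inboxC m k (lr hr li hi : 'M[R]_(m, k)) (X : 'M[R[i]]_(m, k)) : Prop :=
  forall i j, (lr i j < complex.Re (X i j) <= hr i j) /\
              (li i j < complex.Im (X i j) <= hi i j).

Definition inboxV D (c d v : 'cV[R]_D) : Prop :=
  forall k, c k 0 < v k 0 <= d k 0.

Fixpoint iint (k : nat) (B : nat -> set R) (f : seq R -> R) : \bar R :=
  match k with
  | 0 => (f [::])%:E
  | k'.+1 => (\int[@lebesgue_measure R]_(x in B 0%N)
                iint k' (fun j => B j.+1) (fun s => f (x :: s)))%E
  end.

(* the (unnormalized) density; coordinate j (0-based) is x_{j+1} *)
Definition rho (nstar n n0 : nat) (s : seq R) : R :=
  let a : R := nstar%:R - n%:R in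
  let A : R := nstar%:R - n%:R - n0%:R + 1 in
  if (size s == 2 * n)%N && sorted (fun x y => y < x) (1 :: rcons s 0) then
    (\prod_(j < 2 * n) (s`_j `^ ((a - 1) / 2))) *
    (\prod_(l < n) ((s`_(2 * l).+1 / s`_(2 * l)) `^ (- A / 2))) *
    (\prod_(j < n) \prod_(k < n | (j < k)%N)
        ((s`_(2 * j) - s`_(2 * k)) * (s`_(2 * j).+1 - s`_(2 * k).+1)))
  else 0.

(* the event: the non-zero eigenvalues of M are exactly 2n distinct reals
   s_0 > s_1 > ... > s_{2n-1} (i.e. char_poly M = X^n0 prod (X - s_j)),
   with a_j < s_j <= b_j *)
Definition eig_event (nstar n n0 : nat) {Omega : Type}
    (S : Omega -> 'M[R[i]]_(nstar + n)) (g : Omega -> 'cV[R]_(2 * n + n0))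
    (a b : nat -> R) : set Omega :=
  [set w | exists s : seq R,
     [/\ size s = (2 * n)%N,
         sorted (fun x y => y < x) s,
         (forall j, (j < 2 * n)%N -> a j < s`_j <= b j) &
         char_poly (Mmat (S w) (g w)) = 'X^n0 * \prod_(y <- s) ('X - y%:P)]].

End Defs.

(* Main.v *)
(* Write H = t t^dagger, p_j = tr H^j.  All laws are compared through polynomials in traces.

   If A is a random Hermitian matrix of size s whose law is invariant under conjugation, then
   perturbing the first basis vector to second order gives a recursion which expresses any moment
   of the entries (A^i)_00, jointly with traces, through traces alone.  The same recursion holds
   for the barycentric weights of interlacing points under the Dixon-Anderson (Dirichlet) density
   of total weight s.  Hence deleting a row and column of A is, on traces, a Dixon-Anderson step.
   Starting from the projection r' r'^dagger (r' the last n columns of S), whose traces are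
   deterministic, n such steps give the Jacobi density prod y_j^a Delta(y)^2 for the spectrum y of H.

   Let xi be the complexification of the first 2n coordinates of x.  Then tr M^j is a polynomial in
   p_i and tau_i = Re xi^dagger H^i xi.  Stein's identity for |g'|^2/|g|^2 shows that the functional
   E F(p, tau) satisfies the recursion with s = n + n0/2, so the two copies of y contained in the
   spectrum of T T^T become y and an interlacing z, with an extra node 0 of weight n0/2.
   Antisymmetrizing in y and in z turns the interlacing integral, through a Cauchy determinant,
   into the integral over the chamber x_1 > x_2 > ... of the theorem.

   Finally the trace moments determine the counting functions #{i : x_i > c}, hence the law of the
   ordered spectrum, by polynomial approximation and dominated convergence. *)

Require Import Defs.
From HB Require Import structures.
From mathcomp Require Import all_boot all_order all_algebra.
From mathcomp Require Import complex spectral.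
From mathcomp Require Import all_classical all_reals all_analysis.
From mathcomp Require Import measurable_realfun fingroup perm ring lra zify.
Set Implicit Arguments.
Unset Strict Implicit.
Unset Printing Implicit Defensive.
Import Order.TTheory GRing.Theory Num.Theory numFieldNormedType.Exports.
Local Open Scope ring_scope.
Local Open Scope classical_set_scope.

(** * Trace polynomials and rank-one compressions *)

(** No interlacing domain and no matrix density is ever integrated over. Between the matrix
    expectation and the chamber integral, everything is an identity of linear functionals on
    polynomials ([momf]) given by their values on monomials. The Dixon-Anderson measure becomes a
    determinant of one-dimensional functionals on the full intervals (0, y_j) instead of the gaps
    between nodes; row operations show that both determinants agree. Identities with denominators
    such as vdm y then hold only at generic points, which suffices: a polynomial is determined by
    its values at distinct coordinates above 1. The recursion is solved once and abstractly:
    [elimination] yields a trace polynomial valid for every functional with the same s, so the two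
    sides are never compared moment by moment. Normalizations are carried as an unknown [C0], which
    the test function 1 fixes at the end. The exponent a - n0/2 of the larger variables may be below
    -1, so single variables cannot be integrated separately over the unit interval; the chamber
    integral converges because all sums of consecutive shifted exponents down to the smallest
    variable are positive. *)

Inductive TP (R : realType) : ((nat -> R) -> R) -> Prop :=
| TP_const c : TP (fun _ => c)
| TP_var j : (0 < j)%N -> TP (fun p => p j)
| TP_add F G : TP F -> TP G -> TP (fun p => F p + G p)
| TP_mul F G : TP F -> TP G -> TP (fun p => F p * G p).

(** The second argument collects compression moments such as (A^j)_00. Index 0 is excluded in both
    inductives: tr A^0 is the dimension, and the objects compared have different dimensions, so that
    only positive powers agree. *)
Inductive TP2 (R : realType) : ((nat -> R) -> (nat -> R) -> R) -> Prop :=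
| TP2_const c : TP2 (fun _ _ => c)
| TP2_var j : (0 < j)%N -> TP2 (fun p _ => p j)
| TP2_tau j : (0 < j)%N -> TP2 (fun _ t => t j)
| TP2_add F G : TP2 F -> TP2 G -> TP2 (fun p t => F p t + G p t)
| TP2_mul F G : TP2 F -> TP2 G -> TP2 (fun p t => F p t * G p t).

Lemma TP_TP2 (R : realType) (F : (nat -> R) -> R) : TP F -> TP2 (fun p _ => F p).
Proof.
elim=> [c|j j0|{}F G _ HF _ HG|{}F G _ HF _ HG].
- exact: TP2_const.
- exact: TP2_var.
- exact: TP2_add HF HG.
- exact: TP2_mul HF HG.
Qed.

Lemma TP_subst (R : realType) (F : (nat -> R) -> R) (q : nat -> (nat -> R) -> (nat -> R) -> R) :
  (forall j, (0 < j)%N -> TP2 (q j)) -> TP F -> TP2 (fun p t => F (fun j => q j p t)).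
Proof.
move=> Hq; elim=> [c|j j0|{}F G _ HF _ HG|{}F G _ HF _ HG].
- exact: TP2_const.
- exact: Hq.
- exact: TP2_add HF HG.
- exact: TP2_mul HF HG.
Qed.

(** With t m = u A^m v and B = (1 - v u) A this is u A^m B^k v: each step expands one factor B = A -
    v (u A), and the second term splits off the scalar t m. *)
Fixpoint cword (R : pzRingType) (t : nat -> R) (k : nat) : nat -> R :=
  if k is k'.+1 then fun m => cword t k' m.+1 - t m * cword t k' 1%N else t.

(** The difference tr B^j - tr A^j for the rank-one compression B = (1 - v u) A, as a polynomial in
    the numbers u A^m v with m > 0. *)
Definition newt (R : pzRingType) (t : nat -> R) (j : nat) : R :=
  - \sum_(k < j) cword t k (j - k).

Lemma cword_ext (R : pzRingType) (t t' : nat -> R) :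
  (forall m, (0 < m)%N -> t m = t' m) ->
  forall k m, (0 < m)%N -> cword t k m = cword t' k m.
Proof. by move=> H; elim=> [|k IH] m m0 /=; rewrite ?H ?IH. Qed.

Lemma newt_ext (R : pzRingType) (t t' : nat -> R) j :
  (forall m, (0 < m)%N -> t m = t' m) -> newt t j = newt t' j.
Proof.
move=> H; congr (- _); apply: eq_bigr => k _; apply: cword_ext => //.
by rewrite subn_gt0.
Qed.

Lemma newt_morph (R S : pzRingType) (f : {rmorphism R -> S}) (t : nat -> R) j :
  f (newt t j) = newt (f \o t) j.
Proof.
have H k : forall m, f (cword t k m) = cword (f \o t) k m.
  by elim: k => [|k IH] m //=; rewrite rmorphB rmorphM !IH.
by rewrite rmorphN rmorph_sum; congr (- _); apply: eq_bigr => k _; rewrite H.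
Qed.

Lemma TP2_sum (R : realType) (I : Type) (r : seq I) (F : I -> (nat -> R) -> (nat -> R) -> R) :
  (forall i, TP2 (F i)) -> TP2 (fun p t => \sum_(i <- r) F i p t).
Proof.
move=> H; elim: r => [|i r IH].
  have -> : (fun p t => \sum_(i <- [::]) F i p t) = (fun _ _ => 0).
    by apply/funext => p; apply/funext => t; rewrite big_nil.
  exact: TP2_const.
have -> : (fun p t => \sum_(j <- i :: r) F j p t) =
          (fun p t => F i p t + \sum_(j <- r) F j p t).
  by apply/funext => p; apply/funext => t; rewrite big_cons.
exact: TP2_add.
Qed.

Lemma TP2_scale (R : realType) (c : R) F : TP2 F -> TP2 (fun p t => c * F p t).
Proof. exact: TP2_mul (TP2_const _). Qed.

Lemma TP_scale (R : realType) (c : R) F : TP F -> TP (fun p => c * F p).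
Proof. exact: TP_mul (TP_const _). Qed.

Lemma TP2_cword (R : realType) k m : (0 < m)%N ->
  TP2 (fun (_ : nat -> R) t => cword t k m).
Proof.
elim: k m => [|k IH] m m0 /=; first exact: TP2_tau.
apply: TP2_add; first exact: IH.
have -> : (fun (_ t : nat -> R) => - (t m * cword t k 1%N)) =
          (fun _ t => -1 * (t m * cword t k 1%N)).
  by apply/funext => p; apply/funext => t; rewrite mulN1r.
apply: TP2_scale; apply: TP2_mul; first exact: TP2_tau.
exact: IH.
Qed.

Lemma TP2_newt (R : realType) j : TP2 (fun (_ : nat -> R) t => newt t j).
Proof.
have -> : (fun (_ t : nat -> R) => newt t j) =
          (fun _ t => -1 * \sum_(k < j) cword t k (j - k)).
  by apply/funext => p; apply/funext => t; rewrite mulN1r.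
apply: TP2_scale; apply: TP2_sum => k; apply: TP2_cword.
by rewrite subn_gt0.
Qed.

(** A^j - B^j telescopes into the terms B^k (A - B) A^(j-k-1). Since A - B = v (u A) has rank one,
    cyclicity turns each trace into the scalar u A^(j-k) B^k v. *)
Lemma trace_newt (R : comNzRingType) q (A : 'M[R]_q) (u : 'rV_q) (v : 'cV_q) j :
  \tr (((1%:M - v *m u) *m A) ^+ j) =
  \tr (A ^+ j) + newt (fun i => (u *m (A ^+ i) *m v) 0 0) j.
Proof.
set B := _ *m A; set t := fun i => _.
have BE : B = A - v *m (u *m A) by rewrite /B mulmxBl mul1mx mulmxA.
have cE k : forall m, (u *m (A ^+ m *m B ^+ k) *m v) 0 0 = cword t k m.
  elim: k => [|k IH] m /=; first by rewrite expr0 mulmx1.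
  have -> : u *m (A ^+ m *m B ^+ k.+1) *m v = u *m (A ^+ m.+1 *m B ^+ k) *m v
     - (u *m A ^+ m *m v) *m (u *m (A *m B ^+ k) *m v).
    rewrite exprS -[B * _]/(B *m _) {1}BE !mulmxBl !mulmxBr !mulmxBl.
    by rewrite exprSr -[A ^+ m * A]/(A ^+ m *m A) !mulmxA.
  by rewrite -!IH expr1 [LHS]mxE [X in _ + X]mxE [X in _ - X]mxE big_ord1.
have tel : A ^+ j - B ^+ j = \sum_(k < j) B ^+ k * (A - B) * A ^+ (j - k.+1).
  elim: j => [|j IH]; first by rewrite !expr0 subrr big_ord0.
  rewrite big_ord_recr /= subnn expr0 mulr1.
  have -> : \sum_(k < j) B ^+ k * (A - B) * A ^+ (j.+1 - k.+1) =
     (\sum_(k < j) B ^+ k * (A - B) * A ^+ (j - k.+1)) * A.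
    rewrite big_distrl; apply: eq_bigr => k _ /=.
    by rewrite -!mulrA -exprSr subSn.
  by rewrite -IH mulrBl mulrBr -!exprSr addrA subrK.
suff H : \sum_(k < j) cword t k (j - k) = \tr (A ^+ j) - \tr (B ^+ j).
  by rewrite /newt H opprB addrC subrK.
rewrite -raddfB /= tel raddf_sum /=.
apply: eq_bigr => k _.
have -> : A - B = v *m (u *m A) by rewrite BE opprB addrC subrK.
have -> : B ^+ k * (v *m (u *m A)) * A ^+ (j - k.+1) =
    (B ^+ k *m v) *m (u *m A ^+ (j - k)).
  rewrite -!mulrA -[RHS]mulmxA; congr (_ *m _).
  rewrite -[_ * _]/(_ *m _) -!mulmxA; congr (_ *m (_ *m _)).
  by rewrite -[_ *m _]/(_ * _) -exprS subnSK.
by rewrite mxtrace_mulC -cE /mxtrace big_ord1 !mulmxA.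
Qed.

Lemma char_poly_similar (F : fieldType) q (P A : 'M[F]_q) :
  P \in unitmx -> char_poly (P *m A *m invmx P) = char_poly A.
Proof.
move=> Pu; rewrite /char_poly.
have -> : char_poly_mx (P *m A *m invmx P) =
    map_mx polyC P *m char_poly_mx A *m map_mx polyC (invmx P).
  rewrite /char_poly_mx !map_mxM mulmxBr mulmxBl scalar_mxC -(mulmxA _ _ (map_mx _ (invmx P))).
  by rewrite -!mulmxA -(map_mxM _ P) mulmxV // map_mx1 mulmx1.
rewrite !det_mulmx mulrC mulrA -det_mulmx -map_mxM mulVmx // map_mx1 det1 mul1r.
by [].
Qed.

Lemma trig_mulmx (R : pzRingType) q (A B : 'M[R]_q) :
  is_trig_mx A -> is_trig_mx B ->
  is_trig_mx (A *m B) /\ forall i, (A *m B) i i = A i i * B i i.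
Proof.
move=> /is_trig_mxP HA /is_trig_mxP HB; split.
  apply/is_trig_mxP => i k ik; rewrite mxE big1 // => j _.
  have [ij|ji] := ltnP i j; first by rewrite HA // mul0r.
  by rewrite HB ?mulr0 // (leq_ltn_trans ji).
move=> i; rewrite mxE (bigD1 i) //= big1 ?addr0 // => j ji.
have [ij|{}ij] := ltnP i j; first by rewrite HA // mul0r.
by rewrite HB ?mulr0 // ltn_neqAle ij andbT.
Qed.

Lemma trace_pow_closed (C : numClosedFieldType) q (A : 'M[C]_q) (e : seq C) j :
  char_poly A = \prod_(x <- e) ('X - x%:P) ->
  \tr (A ^+ j) = \sum_(x <- e) x ^+ j.
Proof.
case: q A => [|q] A HA.
  have : size (char_poly A) = 1%N by rewrite size_char_poly.
  rewrite HA size_prod_XsubC => -[/size0nil ->].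
  by rewrite big_nil /mxtrace big_ord0.
have [P PU] := @Schur C q.+1 A isT; rewrite /similar_to /= => Ttrig.
have Pu := unitarymx_unit PU.
rewrite conjumx // in Ttrig; set T := P *m A *m invmx P in Ttrig.
have HT : char_poly T = char_poly A by rewrite char_poly_similar.
have pe : perm_eq e [seq T i i | i <- index_enum 'I_q.+1].
  by apply: prod_XsubC_eq; rewrite -HA -HT char_poly_trig // big_map.
rewrite (perm_big _ pe) big_map.
have Tj k : T ^+ k = P *m A ^+ k *m invmx P.
  elim: k => [|k IH]; first by rewrite !expr0 mulmx1 mulmxV.
  rewrite !exprS IH -[_ * _]/(_ *m _) /T !mulmxA mulmxKV //.
have -> : \tr (A ^+ j) = \tr (T ^+ j) by rewrite Tj mxtrace_mulC mulKmx.
have [_ Hd] : is_trig_mx (T ^+ j) /\ forall i, (T ^+ j) i i = T i i ^+ j.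
  elim: j => [|j [IH1 IH2]].
    by rewrite expr0; split=> [|i]; rewrite ?scalar_mx_is_trig // mxE eqxx.
  rewrite exprS; have [H1 H2] := trig_mulmx Ttrig IH1; split=> // i.
  by rewrite [LHS]H2 IH2 exprS.
by apply: eq_bigr => i _; rewrite Hd.
Qed.

Lemma trace_pow (R : realType) q (A : 'M[R]_q) (e : seq R) j :
  char_poly A = \prod_(x <- e) ('X - x%:P) ->
  \tr (A ^+ j) = \sum_(x <- e) x ^+ j.
Proof.
move=> HA; apply: (@complexI R).
have HC : char_poly (map_mx (real_complex R) A) =
    \prod_(x <- [seq (x%:C)%C | x <- e]) ('X - x%:P).
  rewrite -map_char_poly HA rmorph_prod big_map; apply: eq_bigr => x _ /=.
  by rewrite rmorphB /= map_polyX map_polyC.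
have := trace_pow_closed j HC; rewrite big_map -rmorphXn trace_map_mx => ->.
by rewrite rmorph_sum; apply: eq_bigr => x _; rewrite -rmorphXn.
Qed.

(** With u and v the first basis vectors, (1 - v u) A is A with its first row set to zero, and the
    traces of its positive powers are those of the minor. *)
Lemma trace_corner (R : comNzRingType) q (A : 'M[R]_q.+1) j : (0 < j)%N ->
  \tr ((row' 0 (col' 0 A)) ^+ j) = \tr (A ^+ j) + newt (fun i => (A ^+ i) 0 0) j.
Proof.
move=> j0.
have := trace_newt A (delta_mx 0 0) (delta_mx 0 0) j.
set B := _ *m A.
have -> : newt (fun i => ((delta_mx 0 0 : 'rV[R]_q.+1) *m A ^+ i *m (delta_mx 0 0 : 'cV[R]_q.+1)) 0 0) j =
          newt (fun i => (A ^+ i) 0 0) j.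
  by apply: newt_ext => m _; rewrite -rowE -colE !mxE.
move=> <-.
have B0 k : B 0 k = 0.
  rewrite /B mulmxBl mul1mx -mulmxA -rowE !mxE big_ord1 !mxE.
  by rewrite !eqxx mul1r subrr.
have BS i k : B (lift 0 i) k = A (lift 0 i) k.
  rewrite /B mulmxBl mul1mx -mulmxA -rowE !mxE big_ord1 !mxE.
  by rewrite eq_sym (negPf (neq_lift _ _)) mul0r subr0.
case: j j0 => // j _.
have H0 k l : (B ^+ k.+1) 0 l = 0.
  by rewrite exprS mxE big1 // => i _; rewrite B0 mul0r.
have HS k i l : (B ^+ k.+1) (lift 0 i) (lift 0 l) = ((row' 0 (col' 0 A)) ^+ k.+1) i l.
  elim: k i l => [|k IH] i l; first by rewrite !expr1 BS !mxE.
  rewrite !(exprS _ k.+1) !mxE big_ord_recl H0 mulr0 add0r.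
  by apply: eq_bigr => m _; rewrite IH BS !mxE.
rewrite /mxtrace big_ord_recl H0 add0r; apply: eq_bigr => i _.
by rewrite -HS.
Qed.

(** The bordered matrix [M] is reduced to triangular form in two ways; using [E], the adjugate of
    the diagonal part, avoids inverses. *)
Lemma det_diag_rank1 (R : idomainType) n (d c : 'I_n -> R) :
  (forall i, d i != 0) ->
  \det (diag_mx (\row_i d i) + const_mx 1 *m (\row_i c i) : 'M[R]_n) =
  \prod_i d i + \sum_i c i * \prod_(k | k != i) d k.
Proof.
move=> d0; set D := diag_mx _; set u : 'cV[R]_n := const_mx 1; set c' : 'rV[R]_n := \row_i c i.
pose p := \prod_i d i; pose E : 'M[R]_n := diag_mx (\row_i \prod_(k | k != i) d k).
have DE : D *m E = p%:M.
  apply/matrixP => i j; rewrite mul_diag_mx !mxE; case: eqP => [->|_].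
    by rewrite !mulrb /p [RHS](bigD1 j).
  by rewrite !mulr0n mulr0.
pose M : 'M[R]_(1 + n) := block_mx 1%:M (- c') u D.
have M1 : \det M = \det (D + u *m c').
  have -> : M = block_mx 1%:M 0 u 1%:M *m block_mx 1%:M (- c') 0 (D + u *m c').
    rewrite mulmx_block !mul1mx !mulmx1 !mul0mx !addr0 mulmxN addrC.
    by congr (block_mx _ _ _ _); rewrite addrK.
  by rewrite det_mulmx det_lblock det_ublock !det1 !mul1r.
have dD : \det D = p by rewrite det_diag; apply: eq_bigr => i _; rewrite mxE.
have M2 : \det M * p = (p + \sum_i c i * \prod_(k | k != i) d k) * p.
  have MK : M *m block_mx p%:M 0 (- (E *m u)) 1%:M =
      block_mx (p%:M + c' *m (E *m u)) (- c') 0 D.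
    rewrite mulmx_block !mul1mx !mulmx1 !mulmx0 !add0r mulmxN mulNmx opprK.
    have -> : D *m - (E *m u) = - (p%:M *m u) by rewrite mulmxN mulmxA DE.
    rewrite mul_scalar_mx mul_mx_scalar subrr.
    by congr (block_mx _ _ _ _).
  have := congr1 determinant MK.
  rewrite det_mulmx det_lblock det_ublock det1 mulr1 dD det_scalar1 => ->.
  congr (_ * _); rewrite det_mx11 mxE mxE eqxx mulr1n; congr (_ + _).
  rewrite mxE; apply: eq_bigr => i _; rewrite mul_diag_mx !mxE mulr1.
  by [].
have p0 : p != 0 by apply/prodf_neq0 => i _.
by rewrite -M1; apply: (mulIf p0); rewrite M2.
Qed.

(** The hypothesis says that the [z j] are the zeros of sum_i w_i / (x - d_i). Together with 0 they
    are the eigenvalues of (1 - e w) diag(d), where e is the column of ones, so [trace_newt] yields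
    their power sums. *)
Lemma psum_interlace (R : realType) M (d w : 'I_M.+1 -> R) (z : 'I_M -> R) k :
  \prod_j ('X - (z j)%:P) = \sum_i w i *: \prod_(l | l != i) ('X - (d l)%:P) ->
  \sum_j z j ^+ k.+1 = \sum_i d i ^+ k.+1 + newt (fun m => \sum_i w i * d i ^+ m) k.+1.
Proof.
move=> H.
have mon (I : finType) (P : pred I) (f : I -> R) :
    \prod_(l | P l) ('X - (f l)%:P) \is monic /\
    size (\prod_(l | P l) ('X - (f l)%:P)) = #|P|.+1.
  split; first by apply: monic_prod => i _; apply: monicXsubC.
  by rewrite -big_filter size_prod_XsubC -cardE.
(* Comparison of leading coefficients. The row w then annihilates 1 - e w, which is where the
   eigenvalue 0 of [B] comes from. *)
have sw : \sum_i w i = 1.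
  have := congr1 (fun p : {poly R} => p`_M) H.
  have [m s] := mon _ predT z.
  have lc (p : {poly R}) : p \is monic -> size p = M.+1 -> p`_M = 1.
    by move=> /monicP <- sp; rewrite /lead_coef sp.
  rewrite lc // ?s ?card_ord // coef_sum => ->; apply: eq_bigr => i _.
  have [m' s'] := mon _ (predC1 i) d.
  by rewrite coefZ lc ?mulr1 // s' cardC1 card_ord.
pose A : 'M[R]_M.+1 := diag_mx (\row_i d i).
have Ak m : A ^+ m = diag_mx (\row_i d i ^+ m).
  elim: m => [|m IH].
    by rewrite expr0; apply/matrixP => i j; rewrite !mxE expr0.
  rewrite exprS IH -[_ * _]/(_ *m _) mulmx_diag; congr diag_mx.
  by apply/rowP => i; rewrite !mxE exprS.
have := trace_newt A (\row_i w i) (const_mx 1) k.+1.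
rewrite Ak.
have -> : \tr (diag_mx (\row_i d i ^+ k.+1)) = \sum_i d i ^+ k.+1.
  by rewrite mxtrace_diag; apply: eq_bigr => i _; rewrite mxE.
have -> : newt (fun i => (\row_i w i *m A ^+ i *m (const_mx 1 : 'cV[R]_M.+1)) 0 0) k.+1 =
    newt (fun m => \sum_i w i * d i ^+ m) k.+1.
  apply: newt_ext => m _; rewrite Ak mul_mx_diag mxE; apply: eq_bigr => i _.
  by rewrite !mxE mulr1.
move=> <-.
set B := _ *m A.
have cB : char_poly B = \prod_(x <- 0 :: [seq z j | j <- index_enum 'I_M]) ('X - x%:P).
  rewrite big_cons big_map subr0 H.
  rewrite /char_poly.
  have -> : char_poly_mx B = diag_mx (\row_i ('X - (d i)%:P)) +
      const_mx 1 *m \row_i ((w i * d i)%:P).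
    rewrite /char_poly_mx /B mulmxBl mul1mx -mulmxA mul_mx_diag.
    apply/matrixP => i j; rewrite !mxE !big_ord1 !mxE mul1r mul1r.
    rewrite rmorphB /= rmorphMn /= opprB addrA mulrnBl.
    by rewrite -addrA [X in _ + X]addrC addrA.
  rewrite det_diag_rank1 => [|i]; last by rewrite polyXsubC_eq0.
  have XE i : (w i * d i)%:P * \prod_(l | l != i) ('X - (d l)%:P) =
     'X * (w i *: \prod_(l | l != i) ('X - (d l)%:P)) -
     w i *: \prod_l ('X - (d l)%:P).
    rewrite [X in _ - _ *: X](bigD1 i) //= -!mul_polyC polyCM; ring.
  rewrite (eq_bigr _ (fun i _ => XE i)) big_split /= sumrN -scaler_suml sw scale1r.
  by rewrite addrCA subrr addr0 mulr_sumr.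
by rewrite (trace_pow k.+1 cB) big_cons expr0n add0r big_map.
Qed.

(** * Elimination of the compression moments *)

(** A sum over the positions of a word: [g] gets the letter there and the remaining word in its
    order. Nested twice it runs over ordered pairs of distinct positions, the shape needed in
    [goodR]. *)
Fixpoint rsum (V : nmodType) (T : Type) (g : T -> seq T -> V) (s : seq T) : V :=
  if s is x :: s' then g x s' + rsum (fun y r => g y (x :: r)) s' else 0.

Lemma rsumD (V : nmodType) (T : Type) (f g : T -> seq T -> V) s :
  rsum (fun x r => f x r + g x r) s = rsum f s + rsum g s.
Proof. by elim: s f g => [|x s IH] f g /=; rewrite ?addr0 // IH addrACA. Qed.

Lemma rsum_mull (R : pzRingType) (T : Type) (c : R) (f : T -> seq T -> R) s :
  c * (rsum f s) = rsum (fun x r => c * f x r) s.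
Proof. by elim: s f => [|x s IH] f /=; rewrite ?mulr0 // mulrDr IH. Qed.

Lemma rsum_sum (V : nmodType) (T : Type) (I : Type) (l : seq I) (P : pred I) (f : I -> T -> seq T -> V) s :
  \sum_(i <- l | P i) rsum (f i) s = rsum (fun x r => \sum_(i <- l | P i) f i x r) s.
Proof.
elim: s f => [|x s IH] f /=; first by rewrite big1.
by rewrite big_split; congr (_ + _); apply: IH.
Qed.

Lemma eq_rsum (V : nmodType) (T : Type) (f g : T -> seq T -> V) s :
  (forall x r, f x r = g x r) -> rsum f s = rsum g s.
Proof. by elim: s f g => [|x s IH] f g H //=; rewrite H; congr (_ + _); apply: IH. Qed.

Lemma eq_rsum_in (V : nmodType) (T : eqType) (f g : T -> seq T -> V) s (P : pred T) :
  all P s ->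
  (forall x r, P x -> all P r -> (size r).+1 = size s -> f x r = g x r) -> rsum f s = rsum g s.
Proof.
elim: s f g => [|x s IH] f g //= /andP[Px Ps] H; rewrite H //; congr (_ + _).
by apply: IH => // y r Py Pr sr; apply: H => //=; rewrite ?Px ?sr.
Qed.

Definition wprod (R : pzSemiRingType) (t : nat -> R) (s : seq nat) := \prod_(i <- s) t i.

Lemma rsum_wprod (R : comPzRingType) (Z : Type) (t : Z -> nat -> R) (f : (Z -> R) -> R) s :
  rsum (fun i r => f (fun z => t z i * wprod (t z) r)) s = (size s)%:R * f (fun z => wprod (t z) s).
Proof.
suff H c : rsum (fun i r => f (fun z => c z * (t z i * wprod (t z) r))) s =
    (size s)%:R * f (fun z => c z * wprod (t z) s).
  have E (g : Z -> R) : (fun z => 1 * g z) = g by apply/funext => z; rewrite mul1r.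
  by have := H (fun _ => 1); rewrite E => <-; apply: eq_rsum => i r; rewrite E.
elim: s c => [|i s IH] c /=; first by rewrite mul0r.
rewrite -natr1 mulrDl mul1r addrC; congr (_ + _); last first.
  by congr f; apply/funext => z; rewrite /wprod big_cons.
have -> : (fun z => c z * wprod (t z) (i :: s)) = (fun z => (c z * t z i) * wprod (t z) s).
  by apply/funext => z; rewrite /wprod big_cons mulrA.
by rewrite -IH; apply: eq_rsum => j r; congr f; apply/funext => z; rewrite /wprod big_cons; ring.
Qed.

(* Such a functional is determined by its restriction to the functions of p alone (lemma elimination);
   random conjugation-invariant matrices of size s, with t_i the (0,0) entry of the i-th power, and the
   Dixon-Anderson density with total weight s both give one. *)
Record good (R : realType) (s : R) (L : ((nat -> R) -> (nat -> R) -> R) -> R) : Prop := Good {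
  goodD : forall F G, TP2 F -> TP2 G -> L (fun p t => F p t + G p t) = L F + L G;
  goodZ : forall c F, TP2 F -> L (fun p t => c * F p t) = c * L F;
  goodR : forall Psi w, TP Psi -> all (fun i => (0 < i)%N) w ->
    (size w)%:R * (s + (size w)%:R - 1) * L (fun p t => Psi p * wprod t w) =
    rsum (fun i r => L (fun p t => (Psi p * p i) * wprod t r)) w +
    rsum (fun i r => rsum (fun k r' => L (fun p t => Psi p * wprod t ((i + k)%N :: r'))) r) w }.

Lemma TP2_wprod (R : realType) w : all (fun i => (0 < i)%N) w ->
  TP2 (fun (_ t : nat -> R) => wprod t w).
Proof.
elim: w => [|i w IH] /=.
  move=> _; have -> : (fun _ t : nat -> R => wprod t [::]) = (fun _ _ => 1).
    by apply/funext => p; apply/funext => t; rewrite /wprod big_nil.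
  exact: TP2_const.
move=> /andP[i0 /IH H].
have -> : (fun _ t : nat -> R => wprod t (i :: w)) = (fun _ t => t i * wprod t w).
  by apply/funext => p; apply/funext => t; rewrite /wprod big_cons.
by apply: TP2_mul => //; apply: TP2_tau.
Qed.

Lemma TP2_expand (R : realType) (F : (nat -> R) -> (nat -> R) -> R) : TP2 F ->
  exists2 l : seq (((nat -> R) -> R) * seq nat),
    (forall x, List.In x l -> TP x.1 /\ all (fun i => (0 < i)%N) x.2) &
    F = (fun p t => \sum_(x <- l) x.1 p * wprod t x.2).
Proof.
elim=> [c|j j0|j j0|{}F G _ [l1 H1 ->] _ [l2 H2 ->]|{}F G _ [l1 H1 ->] _ [l2 H2 ->]].
- exists [:: ((fun _ => c), [::])]; first by move=> x [<-|] //; split=> //; apply: TP_const.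
  by apply/funext => p; apply/funext => t; rewrite big_seq1 /wprod big_nil mulr1.
- exists [:: ((fun p => p j), [::])]; first by move=> x [<-|] //; split=> //; apply: TP_var.
  by apply/funext => p; apply/funext => t; rewrite big_seq1 /wprod big_nil mulr1.
- exists [:: ((fun p => 1), [:: j])].
    by move=> x [<-|] //; split; rewrite /= ?j0 //; apply: TP_const.
  by apply/funext => p; apply/funext => t; rewrite big_seq1 /wprod big_seq1 mul1r.
- exists (l1 ++ l2); last by apply/funext => p; apply/funext => t; rewrite big_cat.
  by move=> x /(@List.in_app_or _ _ _ _) [/H1|/H2].
- exists (flatten [seq [seq ((fun p => x.1 p * y.1 p), x.2 ++ y.2) | y <- l2] | x <- l1]).
    elim: l1 H1 => [|x l1 IH] H1 //= y /(@List.in_app_or _ _ _ _) [|]; last first.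
      by apply: IH => z Hz; apply: H1; right.
    elim: l2 H2 {IH} => [|z l2 IH] H2 //= [<-|]; last first.
      by apply: IH => u Hu; apply: H2; right.
    have [a b] := H1 x (or_introl erefl); have [c d] := H2 z (or_introl erefl).
    by split=> /=; [apply: TP_mul|rewrite all_cat b d].
  apply/funext => p; apply/funext => t; rewrite big_flatten big_map big_distrl /=.
  apply: eq_bigr => x _; rewrite big_map big_distrr /=; apply: eq_bigr => y _.
  by rewrite /wprod big_cat mulrACA.
Qed.

(** The order of quantifiers matters: one [Ft] serves all functionals that are good for the same s.
    This is what identifies the matrix side with the interlacing side. *)
Definition reducible (R : realType) (s : R)
    (G : (((nat -> R) -> (nat -> R) -> R) -> R) -> R) :=
  exists2 Ft, TP Ft & forall L, good s L -> G L = L (fun p _ => Ft p).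

Lemma reducible0 (R : realType) (s : R) : reducible s (fun _ => 0).
Proof.
exists (fun _ => 0); first exact: TP_const.
move=> L gL; rewrite -[LHS](mul0r (L (fun _ _ => 0))) -(goodZ gL _ (TP2_const _)).
by congr L; apply/funext => p; apply/funext => t; rewrite mul0r.
Qed.

Lemma reducibleD (R : realType) (s : R) G1 G2 : reducible s G1 -> reducible s G2 ->
  reducible s (fun L => G1 L + G2 L).
Proof.
move=> [F1 T1 H1] [F2 T2 H2]; exists (fun p => F1 p + F2 p); first exact: TP_add.
by move=> L gL; rewrite (goodD gL) ?H1 ?H2 //; apply: TP_TP2.
Qed.

Lemma reducibleZ (R : realType) (s c : R) G1 : reducible s G1 ->
  reducible s (fun L => c * G1 L).
Proof.
move=> [F1 T1 H1]; exists (fun p => c * F1 p); first exact: TP_scale.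
by move=> L gL; rewrite (goodZ gL) ?H1 //; apply: TP_TP2.
Qed.

Lemma reducible_rsum (R : realType) (s : R) (T : eqType) (P : pred T) g (w : seq T) :
  all P w ->
  (forall x r, P x -> all P r -> (size r).+1 = size w -> reducible s (fun L => g L x r)) ->
  reducible s (fun L => rsum (g L) w).
Proof.
elim: w g => [|x w IH] g /=; first by move=> _ _; apply: reducible0.
move=> /andP[Px Pw] H; apply: reducibleD; first exact: H.
apply: (IH (fun L y r => g L y (x :: r))) => // y r Py Pr sr; apply: H => //=.
  by rewrite Px.
by rewrite sr.
Qed.

(** Every word on the right of [goodR] is one letter shorter, so the recursion is solved by
    induction on the length. The coefficient K (s + K - 1) of a word of length K > 0 is nonzero
    because s > 0. *)
Lemma reducible_word (R : realType) (s : R) Psi w : 0 < s -> TP Psi ->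
  all (fun i => (0 < i)%N) w ->
  reducible s (fun L => L (fun p t => Psi p * wprod t w)).
Proof.
move=> s0; have [n] := ubnP (size w); elim: n w Psi => // n IH w Psi sw TPsi pw.
have [w0|w0] := posnP (size w).
  move/size0nil: w0 => ->; exists Psi => // L gL; congr L.
  by apply/funext => p; apply/funext => t; rewrite /wprod big_nil mulr1.
set c := (size w)%:R * (s + (size w)%:R - 1).
have c0 : c != 0.
  rewrite mulf_neq0 // ?pnatr_eq0 ?gt_eqF //.
  by rewrite -addrA ltr_wpDr // subr_ge0 ler1n.
suff [Ft TFt HFt] : reducible s (fun L => c^-1 *
    (rsum (fun i r => L (fun p t => (Psi p * p i) * wprod t r)) w +
    rsum (fun i r => rsum (fun k r' => L (fun p t => Psi p * wprod t ((i + k)%N :: r'))) r) w)).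
  exists Ft => // L gL; rewrite -HFt //; rewrite -(goodR gL) // -/c.
  by rewrite mulrA mulVf // mul1r.
apply/reducibleZ/reducibleD.
  apply: (reducible_rsum pw) => i r i0 pr sr; apply: (IH r) => //.
    by rewrite sr.
  by apply: TP_mul => //; apply: TP_var.
apply: (reducible_rsum pw) => i r i0 pr sr.
apply: (reducible_rsum pr) => k r' k0 pr' sr'; apply: (IH ((i + k)%N :: r')) => //=.
  by rewrite sr'; move: sw; rewrite -sr ltnS.
by rewrite addn_gt0 i0.
Qed.

Lemma elimination (R : realType) (s : R) F : 0 < s -> TP2 F ->
  exists2 Ft, TP Ft & forall L, good s L -> L F = L (fun p _ => Ft p).
Proof.
move=> s0 /TP2_expand [l Hl ->].
elim: l Hl => [|x l IH] Hl.
  have [Ft TFt HF] := reducible0 s; exists Ft => // L gL; rewrite -HF //.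
  rewrite -[RHS](mul0r (L (fun _ _ => 0))) -(goodZ gL _ (TP2_const _)).
  by congr L; apply/funext => p; apply/funext => t; rewrite mul0r big_nil.
have [Tx px] := Hl x (or_introl erefl).
have {}Hl y : List.In y l -> TP y.1 /\ all (fun i => (0 < i)%N) y.2.
  by move=> Hy; apply: Hl; right.
have {}IH := IH Hl.
have [Ft TFt HF] := reducibleD (reducible_word s0 Tx px) IH.
exists Ft => // L gL; rewrite -HF // -(goodD gL); last first.
- elim: l Hl {IH HF} => [|y l IH] Hl.
    have -> : (fun p t : nat -> R => \sum_(x <- [::]) x.1 p * wprod t x.2) = (fun _ _ => 0).
      by apply/funext => p; apply/funext => t; rewrite big_nil.
    exact: TP2_const.
  have -> : (fun p t : nat -> R => \sum_(x <- y :: l) x.1 p * wprod t x.2) =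
     (fun p t => y.1 p * wprod t y.2 + \sum_(x <- l) x.1 p * wprod t x.2).
    by apply/funext => p; apply/funext => t; rewrite big_cons.
  have [Ty py] := Hl y (or_introl erefl).
  apply: TP2_add; first by apply: TP2_mul; [apply: TP_TP2|apply: TP2_wprod].
  by apply: IH => z Hz; apply: Hl; right.
- by apply: TP2_mul; [apply: TP_TP2|apply: TP2_wprod].
by congr L; apply/funext => p; apply/funext => t; rewrite big_cons.
Qed.

(** * Moment functionals and the Dixon-Anderson integral *)

Definition mono (R : realType) (I : finType) (e : {ffun I -> nat}) (x : I -> R) : R :=
  \prod_i x i ^+ e i.

Definition pf (R : realType) (I : finType) (f : (I -> R) -> R) : Prop :=
  exists l : seq (R * {ffun I -> nat}), forall x, f x = \sum_(t <- l) t.1 * mono t.2 x.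

(* The linear extension of x^e |-> m e to polynomial functions; junk value 0 elsewhere. *)
Definition momf (R : realType) (I : finType) (m : {ffun I -> nat} -> R) (f : (I -> R) -> R) : R :=
  if pselect (pf f) is left H then \sum_(t <- projT1 (cid H)) t.1 * m t.2 else 0.

(** [lam j] recovers the coefficient of degree j of a polynomial of degree below L from its values
    at L nodes; the nodes start at 2 so that all of them exceed 1. *)
Lemma vandermonde_dual (R : realType) L : exists lam : 'I_L -> 'I_L -> R,
  forall j k : 'I_L, \sum_t lam j t * (t%:R + 2) ^+ k = (j == k)%:R.
Proof.
pose V : 'M[R]_L := (Vandermonde L (\row_t ((t : 'I_L)%:R + 2)))^T.
have Vu : V \in unitmx.
  rewrite unitmx_tr unitmxE det_Vandermonde unitfE.
  apply/prodf_neq0 => i _; apply/prodf_neq0 => j ij; rewrite !mxE.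
  by rewrite opprD addrACA subrr addr0 subr_eq0 eqr_nat gtn_eqF.
exists (fun j t => invmx V j t) => j k.
have := congr1 (fun M : 'M[R]_L => M j k) (mulVmx Vu).
by rewrite !mxE => <-; apply: eq_bigr => t _; rewrite !mxE.
Qed.

(** On exponents below L, the prescribed numbers [m] are the moments of a signed measure [om] on a
    finite grid with coordinates above 1. A relation valid at the grid points therefore holds for
    [m], which makes [momf] independent of the chosen expansion. *)
Lemma moment_wd (R : realType) (I : finType) (m : {ffun I -> nat} -> R)
    (l : seq (R * {ffun I -> nat})) :
  (forall x : I -> R, (forall i, 1 < x i) -> \sum_(t <- l) t.1 * mono t.2 x = 0) ->
  \sum_(t <- l) t.1 * m t.2 = 0.
Proof.
move=> H.
pose L := (\max_(t <- l) \max_i (t.2 i)).+1.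
have bL t : t \in l -> forall i, (t.2 i < L)%N.
  move=> tl i; rewrite ltnS /L (big_rem t) //= leq_max.
  by rewrite (leq_bigmax i).
have [lam Hlam] := vandermonde_dual R L.
pose om (g : {ffun I -> 'I_L}) := \sum_(e : {ffun I -> 'I_L})
   m [ffun i => (e i : nat)] * \prod_i lam (e i) (g i).
have Hom t : t \in l -> m t.2 = \sum_g om g * mono t.2 (fun i => (g i)%:R + 2).
  move=> tl.
  pose e0 : {ffun I -> 'I_L} := [ffun i => Ordinal (bL t tl i)].
  under eq_bigr do rewrite mulr_suml.
  rewrite exchange_big /= (bigD1 e0) //= [X in _ + X]big1 ?addr0.
    have -> : [ffun i => (e0 i : nat)] = t.2 by apply/ffunP => i; rewrite !ffunE.
    under eq_bigr do rewrite -mulrA; rewrite -mulr_sumr -[LHS]mulr1; congr (_ * _).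
    under eq_bigr do rewrite /mono -big_split /=.
    rewrite -(bigA_distr_bigA (fun i (u : 'I_L) => lam (e0 i) u * (u%:R + 2) ^+ t.2 i)).
    rewrite big1 // => i _; rewrite ffunE.
    by have /= := Hlam (Ordinal (bL t tl i)) (Ordinal (bL t tl i)); rewrite eqxx => ->.
  move=> e ne.
  under eq_bigr do rewrite -mulrA; rewrite -mulr_sumr.
  under eq_bigr do rewrite /mono -big_split /=.
  rewrite -(bigA_distr_bigA (fun i (u : 'I_L) => lam (e i) u * (u%:R + 2) ^+ t.2 i)).
  have [i Hi] : exists i, e i != e0 i.
    apply/existsP; apply: contraNT ne; rewrite negb_exists => /forallP Hf.
    by apply/eqP/ffunP => i; have := Hf i; rewrite negbK => /eqP.
  rewrite (bigD1 i) //= -{1}[t.2 i]/(nat_of_ord (Ordinal (bL t tl i))) Hlam.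
  rewrite ffunE in Hi.
  by rewrite (negPf Hi) mul0r mulr0.
rewrite big_seq_cond (eq_bigr (fun t : R * {ffun I -> nat} => \sum_g om g * (t.1 * mono t.2 (fun i => (g i)%:R + 2)))).
  rewrite exchange_big big1 //= => g _; rewrite -mulr_sumr -big_seq_cond H ?mulr0 // => i.
  by rewrite ltr_wpDl ?ltr1n.
by move=> t /andP[tl _]; rewrite (Hom t tl) mulr_sumr; apply: eq_bigr => g _; rewrite mulrCA.
Qed.

Section momf.
Variables (R : realType) (I : finType).
Implicit Types (m : {ffun I -> nat} -> R) (f g : (I -> R) -> R).

Lemma momfE m f (l : seq (R * {ffun I -> nat})) : pf f ->
  (forall x, (forall i, 1 < x i) -> f x = \sum_(t <- l) t.1 * mono t.2 x) ->
  momf m f = \sum_(t <- l) t.1 * m t.2.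
Proof.
move=> pff Hl; rewrite /momf; case: pselect => [H|//].
case: cid => l' /= Hl'; apply/eqP; rewrite -subr_eq0 -sumrN.
have E (F : {ffun I -> nat} -> R) : \sum_(t <- l') t.1 * F t.2 + \sum_(t <- l) - (t.1 * F t.2) =
   \sum_(t <- l' ++ [seq (- t.1, t.2) | t <- l]) t.1 * F t.2.
  by rewrite big_cat big_map; congr (_ + _); apply: eq_bigr => t _; rewrite mulNr.
rewrite E; apply/eqP/moment_wd => x Hx.
by rewrite -(E (fun e => mono e x)) sumrN -Hl' Hl // subrr.
Qed.

(** Integrands need to agree only where all coordinates exceed 1; there x_i and 1 - x_i are
    invertible, as the barycentric formulas require. *)
Lemma momf_eq m f g : pf f -> pf g -> (forall x, (forall i, 1 < x i) -> f x = g x) ->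
  momf m f = momf m g.
Proof.
move=> pff [l Hl] H; rewrite (momfE m pff (l := l)) => [|x Hx]; last by rewrite H // Hl.
by rewrite (momfE m _ (l := l)) //; exists l.
Qed.

Lemma pf_const c : pf (fun _ : I -> R => c).
Proof.
exists [:: (c, [ffun=> 0%N])] => x; rewrite big_seq1 /mono big1 ?mulr1 // => i _.
by rewrite ffunE.
Qed.

Lemma pf_mono (e : {ffun I -> nat}) : pf (mono e : (I -> R) -> R).
Proof. by exists [:: (1, e)] => x; rewrite big_seq1 mul1r. Qed.

Lemma pf_coord i : pf (fun x : I -> R => x i).
Proof.
exists [:: (1, [ffun j => (j == i : nat)])] => x; rewrite big_seq1 /mono mul1r.
by rewrite (bigD1 i) //= big1 ?mulr1 ?ffunE ?eqxx // => j ji; rewrite ffunE (negPf ji).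
Qed.

Lemma pf_add f g : pf f -> pf g -> pf (fun x => f x + g x).
Proof. by move=> [l Hl] [k Hk]; exists (l ++ k) => x; rewrite big_cat Hl Hk. Qed.

Lemma mono_mul (e e' : {ffun I -> nat}) (x : I -> R) :
  mono e x * mono e' x = mono [ffun i => (e i + e' i)%N] x.
Proof. by rewrite /mono -big_split; apply: eq_bigr => i _; rewrite ffunE exprD. Qed.

Lemma pf_mul f g : pf f -> pf g -> pf (fun x => f x * g x).
Proof.
move=> [l Hl] [k Hk].
exists [seq ((t.1 * u.1, [ffun i => (t.2 i + u.2 i)%N]) : R * {ffun I -> nat})
          | t : R * {ffun I -> nat} <- l, u : R * {ffun I -> nat} <- k] => x.
rewrite Hl Hk big_distrl big_allpairs_dep; apply: eq_bigr => t _ /=.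
by rewrite big_distrr; apply: eq_bigr => u _ /=; rewrite mulrACA mono_mul.
Qed.

Lemma pf_ext f g : pf g -> (forall x, f x = g x) -> pf f.
Proof. by move=> pg H; have -> : f = g by exact/funext. Qed.

Lemma pf_sum (J : Type) (r : seq J) (P : pred J) (F : J -> (I -> R) -> R) :
  (forall j, pf (F j)) -> pf (fun x => \sum_(j <- r | P j) F j x).
Proof.
move=> H; elim: r => [|j r IH].
  by apply: (pf_ext (pf_const 0)) => x; rewrite big_nil.
have [Pj|Pj] := boolP (P j).
  by apply: (pf_ext (pf_add (H j) IH)) => x; rewrite big_cons Pj.
by apply: (pf_ext IH) => x; rewrite big_cons (negPf Pj).
Qed.

Lemma pf_prod (J : Type) (r : seq J) (P : pred J) (F : J -> (I -> R) -> R) :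
  (forall j, pf (F j)) -> pf (fun x => \prod_(j <- r | P j) F j x).
Proof.
move=> H; elim: r => [|j r IH].
  by apply: (pf_ext (pf_const 1)) => x; rewrite big_nil.
have [Pj|Pj] := boolP (P j).
  by apply: (pf_ext (pf_mul (H j) IH)) => x; rewrite big_cons Pj.
by apply: (pf_ext IH) => x; rewrite big_cons (negPf Pj).
Qed.

Lemma pf_exp f k : pf f -> pf (fun x => f x ^+ k).
Proof.
move=> pff; apply: (pf_ext (pf_prod (index_enum 'I_k) predT (fun _ => pff))) => x.
by rewrite prodr_const card_ord.
Qed.

Lemma pf_scale c f : pf f -> pf (fun x => c * f x).
Proof. exact: pf_mul (pf_const c). Qed.

Lemma pf_sub f g : pf f -> pf g -> pf (fun x => f x - g x).
Proof.
by move=> pff pg; apply: (pf_ext (pf_add pff (pf_scale (-1) pg))) => x; rewrite mulN1r.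
Qed.

Lemma pf_horner f (p : {poly R}) : pf f -> pf (fun x => p.[f x]).
Proof.
move=> pff; apply: (pf_ext (pf_sum (index_enum 'I_(size p)) predT
  (fun i => pf_scale (p`_i) (pf_exp i pff)))) => x.
by rewrite horner_coef.
Qed.

Lemma pf_det k (A : 'I_k -> 'I_k -> (I -> R) -> R) :
  (forall i j, pf (A i j)) -> pf (fun x => \det (\matrix_(i, j) A i j x)).
Proof.
move=> H; apply: (pf_ext (pf_sum (index_enum {perm 'I_k}) predT (fun s : {perm 'I_k} =>
  pf_scale ((-1) ^+ s) (pf_prod (index_enum 'I_k) predT (fun i => H i (s i)))))) => x.
by apply: eq_bigr => s _; congr (_ * _); apply: eq_bigr => i _; rewrite mxE.
Qed.

Lemma momf_mono m e : momf m (mono e) = m e.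
Proof.
rewrite (momfE m (pf_mono e) (l := [:: (1, e)])) ?big_seq1 ?mul1r // => x _.
by rewrite big_seq1 mul1r.
Qed.

Lemma momfD m f g : pf f -> pf g -> momf m (fun x => f x + g x) = momf m f + momf m g.
Proof.
move=> pff pg; have [l Hl] := pff; have [k Hk] := pg.
rewrite (momfE m (pf_add pff pg) (l := l ++ k)) => [|x _]; last by rewrite big_cat Hl Hk.
by rewrite big_cat (momfE m pff (l := l)) // (momfE m pg (l := k)).
Qed.

Lemma momfZ m c f : pf f -> momf m (fun x => c * f x) = c * momf m f.
Proof.
move=> pff; have [l Hl] := pff.
rewrite (momfE m (pf_scale c pff) (l := [seq (c * t.1, t.2) | t <- l])) => [|x _].
  by rewrite big_map (momfE m pff (l := l)) // mulr_sumr; apply: eq_bigr => t _; rewrite mulrA.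
by rewrite big_map Hl mulr_sumr; apply: eq_bigr => t _; rewrite mulrA.
Qed.

Lemma momf_sum m (J : Type) (r : seq J) (P : pred J) (F : J -> (I -> R) -> R) :
  (forall j, pf (F j)) ->
  momf m (fun x => \sum_(j <- r | P j) F j x) = \sum_(j <- r | P j) momf m (F j).
Proof.
move=> H; elim: r => [|j r IH].
  rewrite big_nil; have -> : (fun x => \sum_(j <- [::] | P j) F j x) = (fun x => 0 * 0).
    by apply/funext => x; rewrite big_nil mul0r.
  by rewrite momfZ ?mul0r //; apply: pf_const.
rewrite big_cons -IH; have [Pj|Pj] := boolP (P j).
  rewrite -momfD //; last exact: pf_sum.
  by congr momf; apply/funext => x; rewrite big_cons Pj.
by congr momf; apply/funext => x; rewrite big_cons (negPf Pj).
Qed.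

Lemma momf_msum (J : Type) (r : seq J) (P : pred J) (m : J -> {ffun I -> nat} -> R)
    (c : J -> R) f : pf f ->
  momf (fun e => \sum_(j <- r | P j) c j * m j e) f = \sum_(j <- r | P j) c j * momf (m j) f.
Proof.
move=> pff; have [l Hl] := pff; rewrite (momfE _ pff (l := l)) //.
under eq_bigr do rewrite mulr_sumr; rewrite exchange_big; apply: eq_bigr => j _ /=.
rewrite (momfE _ pff (l := l)) // mulr_sumr; apply: eq_bigr => t _; by rewrite mulrCA.
Qed.

End momf.

Definition lin (R : realType) (mu : nat -> R) (p : {poly R}) : R :=
  \sum_(k < size p) p`_k * mu k.

Lemma lin_wide (R : realType) (mu : nat -> R) (p : {poly R}) L : (size p <= L)%N ->
  lin mu p = \sum_(k < L) p`_k * mu k.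
Proof.
move=> sL; rewrite /lin (big_ord_widen _ (fun k => p`_k * mu k) sL) big_mkcond /=.
apply: eq_bigr => k _; case: ltnP => // pk; by rewrite nth_default ?mul0r.
Qed.

Lemma linD (R : realType) (mu : nat -> R) p q : lin mu (p + q) = lin mu p + lin mu q.
Proof.
pose L := maxn (size p) (size q).
rewrite !(@lin_wide _ mu _ L) ?leq_maxl ?leq_maxr //; last exact: size_polyD.
by rewrite -big_split; apply: eq_bigr => k _; rewrite coefD mulrDl.
Qed.

Lemma linZ (R : realType) (mu : nat -> R) c p : lin mu (c *: p) = c * lin mu p.
Proof.
rewrite (@lin_wide _ mu _ (size p)) ?size_scale_leq // mulr_sumr.
by apply: eq_bigr => k _; rewrite coefZ mulrA.
Qed.

Lemma lin_sum (R : realType) (mu : nat -> R) (J : Type) (r : seq J) (P : pred J) F :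
  lin mu (\sum_(j <- r | P j) F j) = \sum_(j <- r | P j) lin mu (F j).
Proof.
elim: r => [|j r IH]; first by rewrite !big_nil /lin size_poly0 big_ord0.
by rewrite !big_cons; case: ifP => // _; rewrite linD IH.
Qed.

Lemma linXn (R : realType) (mu : nat -> R) k : lin mu 'X^k = mu k.
Proof.
rewrite /lin size_polyXn big_ord_recr /= coefXn eqxx mul1r big1 ?add0r // => i _.
by rewrite coefXn ltn_eqF ?mul0r.
Qed.

Definition pmom (R : realType) (I : finType) (mu : I -> nat -> R) (e : {ffun I -> nat}) : R :=
  \prod_i mu i (e i).

Lemma momf_prod (R : realType) (I : finType) (mu : I -> nat -> R) (psi : I -> {poly R}) :
  momf (pmom mu) (fun x => \prod_i (psi i).[x i]) = \prod_i lin (mu i) (psi i).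
Proof.
pose L := (\max_i size (psi i))%N.
have HL i : (size (psi i) <= L)%N by rewrite (leq_bigmax i).
have -> : (fun x : I -> R => \prod_i (psi i).[x i]) =
   (fun x => \sum_(g : {ffun I -> 'I_L}) (\prod_i (psi i)`_(g i)) * mono [ffun i => (g i : nat)] x).
  apply/funext => x.
  under eq_bigr do rewrite (horner_coef_wide _ (HL _)).
  rewrite bigA_distr_bigA /=; apply: eq_bigr => g _; rewrite /mono big_split /=.
  by congr (_ * _); apply: eq_bigr => i _; rewrite ffunE.
rewrite momf_sum => [|g]; last by apply: pf_scale; apply: pf_mono.
under [RHS]eq_bigr do rewrite (lin_wide _ (HL _)).
rewrite bigA_distr_bigA; apply: eq_bigr => g _ /=.
rewrite momfZ ?momf_mono; last exact: pf_mono.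
by rewrite /pmom -big_split; apply: eq_bigr => i _; rewrite ffunE.
Qed.

Definition vdm (R : comPzRingType) k (x : 'I_k -> R) : R := \det (\matrix_(i, j) x i ^+ j).

Lemma pf_vdm (R : realType) k : pf (@vdm R k).
Proof. by apply: pf_det => i j; apply: pf_exp; apply: pf_coord. Qed.

(** The Leibniz expansion of the Vandermonde determinant hands one power to each tensor factor, and
    the result is a Leibniz expansion again. *)
Lemma momf_prod_vdm (R : realType) M (mu : 'I_M -> nat -> R) (psi : 'I_M -> {poly R}) :
  momf (pmom mu) (fun x => (\prod_j (psi j).[x j]) * vdm x) =
  \det (\matrix_(i, j) lin (mu i) (psi i * 'X^j)).
Proof.
have -> : (fun x : 'I_M -> R => (\prod_j (psi j).[x j]) * vdm x) =
  (fun x => \sum_(s : {perm 'I_M}) (-1) ^+ s * \prod_i (psi i * 'X^(s i)).[x i]).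
  apply/funext => x; rewrite /vdm mulr_sumr; apply: eq_bigr => s _.
  rewrite mulrCA; congr (_ * _); rewrite -big_split; apply: eq_bigr => i _ /=.
  by rewrite hornerM hornerXn mxE.
rewrite momf_sum => [|s]; last first.
  by apply: pf_scale; apply: pf_prod => i; apply: pf_horner; apply: pf_coord.
apply: eq_bigr => s _; rewrite momfZ; last first.
  by apply: pf_prod => i; apply: pf_horner; apply: pf_coord.
congr (_ * _); rewrite (momf_prod mu (fun i => psi i * 'X^(s i))).
by apply: eq_bigr => i _; rewrite mxE.
Qed.

(** By the recurrence, multiplication by the variable acts on the columns through the companion
    matrix C of p; multiplication by d - X thus contributes det (d - C) = p(d). *)
Lemma det_shift (R : fieldType) M (p : {poly R}) (a : 'I_M -> nat -> R) d :
  p \is monic -> size p = M.+1 ->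
  (forall j, \sum_(k < M.+1) p`_k * a j k = 0) ->
  \det (\matrix_(j, i < M) (d * a j i - a j i.+1)) = p.[d] * \det (\matrix_(j, i < M) a j i).
Proof.
move=> pm sp; have E : (size p).-1 = M by rewrite sp.
subst M => Ha; set A := \matrix_(j, i) a j i.
pose C := companionmx p.
have -> : \matrix_(j, i) (d * a j i - a j i.+1) = A *m (d%:M - C)^T.
  rewrite raddfB /= tr_scalar_mx mulmxBr mul_mx_scalar.
  apply/matrixP => j i; rewrite !mxE; congr (_ - _).
  under eq_bigr do rewrite !mxE.
  have [il|il] := eqVneq (i : nat) (size p).-2.
    have := Ha j; rewrite big_ord_recr /=.
    have -> : p`_(size p).-1 = 1 by have /monicP := pm.
    rewrite mul1r addrC => /eqP; rewrite addr_eq0 => /eqP.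
    have -> : i.+1 = (size p).-1 by rewrite il prednK // (leq_ltn_trans (leq0n i) (ltn_ord i)).
    move=> ->; rewrite -sumrN; apply: eq_bigr => k _; by rewrite mulrN mulrC.
  have il' : (i.+1 < (size p).-1)%N.
    by rewrite ltn_neqAle ltn_ord andbT; apply: contra il => /eqP Ei; apply/eqP; exact: (congr1 predn Ei).
  rewrite (bigD1 (Ordinal il')) //= eqxx mulr1 big1 ?addr0 // => k kn.
  by rewrite eq_sym (_ : (k == i.+1 :> nat) = false) ?mulr0 //; apply/negbTE; apply: contraNneq kn => kk; apply/eqP/val_inj.
rewrite det_mulmx det_tr mulrC; congr (_ * _).
have -> : p.[d] = (\det (char_poly_mx C)).[d] by rewrite -/(char_poly C) companionmxK.
rewrite -horner_evalE -det_map_mx; congr (\det _); apply/matrixP => i j.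
by rewrite !mxE /= /horner_eval hornerD hornerN hornerMn hornerX hornerC.
Qed.

(* The tensor functional of the J_i is a Dirichlet expectation in the barycentric
   weights w_i of the interlacing roots: J_i kills (q prod (X - d_l) omega)' / omega
   for the weight omega = prod |X - d_l|^(s_l - 1). *)
Section DixonAnderson.
Variables (R : realType) (M : nat) (d s : 'I_M.+1 -> R) (mu : 'I_M -> nat -> R).
Hypothesis dinj : injective d.
Hypothesis s0 : forall i, 0 < s i.

Definition nodal (i : 'I_M.+1) : {poly R} := \prod_(l | l != i) ('X - (d l)%:P).
Definition wder (q : {poly R}) : {poly R} :=
  q^`() * \prod_l ('X - (d l)%:P) + q * \sum_i s i *: nodal i.

Hypothesis mu_wder : forall j q, lin (mu j) (wder q) = 0.
Hypothesis nondeg : \det (\matrix_(i, j < M) mu i j) != 0.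

(** The residue at d_i of prod (X - z_j) / prod (X - d_l). For z interlacing d these are positive
    weights of sum 1, and the Dixon-Anderson density makes them Dirichlet distributed with
    parameters s_i. *)
Definition bary (i : 'I_M.+1) (z : 'I_M -> R) : R :=
  (\prod_j (d i - z j)) / \prod_(l | l != i) (d i - d l).

Lemma bary_den i : \prod_(l | l != i) (d i - d l) != 0.
Proof.
apply/prodf_neq0 => l li; rewrite subr_eq0; apply: contraNneq li => E.
by apply/eqP/esym/dinj.
Qed.

Lemma horner_nodal i j : (nodal i).[d j] = if i == j then \prod_(l | l != i) (d i - d l) else 0.
Proof.
rewrite /nodal horner_prod; case: eqP => [<-|/eqP ij].
  by apply: eq_bigr => l _; rewrite hornerXsubC.
by rewrite (bigD1 j) 1?eq_sym //= hornerXsubC subrr mul0r.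
Qed.

Lemma bary_interp z : \prod_j ('X - (z j)%:P) = \sum_i bary i z *: nodal i.
Proof.
apply/eqP; rewrite -subr_eq0; apply/eqP.
set p := _ - _; apply/eqP/negPn/negP => p0.
have := max_poly_roots (rs := [seq d i | i <- enum 'I_M.+1]) p0.
rewrite map_inj_uniq // enum_uniq size_map size_enum_ord.
have -> : all (root p) [seq d i | i <- enum 'I_M.+1].
  apply/allP => _ /mapP [i _ ->]; rewrite /root /p hornerD hornerN horner_sum.
  rewrite [X in _ - X](bigD1 i) //= [X in _ - (_ + X)]big1 ?addr0 => [|l li].
    rewrite hornerZ horner_nodal eqxx /bary divfK ?bary_den // horner_prod.
    by under eq_bigr do rewrite hornerXsubC; rewrite subrr.
  by rewrite hornerZ horner_nodal (negPf li) mulr0.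
move=> /(_ isT isT); apply/negP; rewrite -leqNgt.
apply: (leq_trans (size_polyD _ _)); rewrite size_polyN geq_max.
apply/andP; split; first by rewrite size_prod_XsubC /index_enum -enumT size_enum_ord.
apply: (leq_trans (size_sum _ _ _)); apply/bigmax_leqP => i _.
apply: (leq_trans (size_scale_leq _ _)).
by rewrite /nodal -big_filter size_prod_XsubC -cardE cardC1 card_ord.
Qed.

Let S := \sum_i s i.

Definition dpoly (c : seq 'I_M.+1) : {poly R} := \prod_(i <- c) ((d i)%:P - 'X).
Definition ddet (c : seq 'I_M.+1) : R :=
  \det (\matrix_(i, j < M) lin (mu i) (dpoly c * 'X^j)).

Lemma nodal_lead i : size (nodal i) = M.+1 /\ (nodal i)`_M = 1.
Proof.
have sz : size (nodal i) = M.+1.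
  by rewrite /nodal -big_filter size_prod_XsubC -cardE cardC1 card_ord.
split=> //; have /monicP : nodal i \is monic by apply: monic_prod => l _; apply: monicXsubC.
by rewrite /lead_coef sz.
Qed.

Lemma nodalX i : ('X - (d i)%:P) * nodal i = \prod_l ('X - (d l)%:P).
Proof. by rewrite [RHS](bigD1 i). Qed.

(** [wder] of [dpoly c] is again a multiple of [dpoly c], with cofactor [rho] of degree M and
    leading coefficient S + |c|. Since every [mu j] kills it, the sequences k |-> mu_j (dpoly c X^k)
    satisfy the recurrence of the monic multiple p of rho. [det_shift] gives the factor p(d_r), in
    which only the nodal polynomial of r survives. *)
Lemma ddet_rec r c :
  (S + (size c)%:R) * ddet (r :: c) =
  (s r + (count_mem r c)%:R) * (\prod_(l | l != r) (d r - d l)) * ddet c.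
Proof.
pose rho := \sum_i (s i + (count_mem i c)%:R) *: nodal i.
have rhoE : wder (dpoly c) = dpoly c * rho.
  rewrite /wder /rho.
  have -> : (dpoly c)^`() * \prod_l ('X - (d l)%:P) =
      dpoly c * \sum_i (count_mem i c)%:R *: nodal i.
    rewrite /dpoly; elim: c {rho} => [|i c IH].
      rewrite !big_nil derivC mul0r big1 ?mulr0 // => i _.
      by rewrite scale0r.
    rewrite !big_cons derivM derivB derivC derivX sub0r mulN1r mulrDl -mulrA IH.
    have -> : \sum_l (count_mem l (i :: c))%:R *: nodal l =
       nodal i + \sum_l (count_mem l c)%:R *: nodal l.
      rewrite [LHS](bigD1 i) // [X in _ + X](bigD1 i) //= eqxx natrD scalerDl scale1r -addrA.
      by congr (_ + (_ + _)); apply: eq_bigr => l li; rewrite eq_sym (negPf li).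
    rewrite mulrDr; congr (_ + _); last by rewrite mulrA.
    rewrite -(nodalX i); ring.
  rewrite -mulrDr; congr (_ * _); rewrite -big_split; apply: eq_bigr => i _ /=.
  by rewrite -scalerDl addrC.
have N0 : S + (size c)%:R != 0.
  rewrite gt_eqF // ltr_wpDr // /S (bigD1 ord0) //= ltr_wpDr // sumr_ge0 // => i _.
  exact: ltW.
have srho : size rho = M.+1 /\ rho`_M = S + (size c)%:R.
  have lead : rho`_M = S + (size c)%:R.
    rewrite /rho coef_sum.
    under eq_bigr do rewrite coefZ (nodal_lead _).2 mulr1.
    rewrite big_split /=; congr (_ + _); rewrite -natr_sum; congr (_%:R).
    elim: c {rho rhoE N0} => [|i c IH]; first by rewrite big1.
    rewrite big_split /= IH (bigD1 i) //= eqxx big1 ?addn0 // => l li.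
    by rewrite eq_sym (negPf li).
  split=> //; apply/eqP; rewrite eqn_leq; apply/andP; split; last first.
    by rewrite ltnNge; apply: contra N0 => /leq_sizeP/(_ M (leqnn _)) H; rewrite -lead H.
  apply: (leq_trans (size_sum _ _ _)); apply/bigmax_leqP => i _.
  by apply: (leq_trans (size_scale_leq _ _)); rewrite (nodal_lead i).1.
pose p := (S + (size c)%:R)^-1 *: rho.
have sp : size p = M.+1 by rewrite size_scale ?invr_eq0 // srho.1.
have pm : p \is monic.
  by rewrite monicE /lead_coef sp coefZ /= srho.2 mulVf.
pose a (j : 'I_M) (k : nat) := lin (mu j) (dpoly c * 'X^k).
have Ha j : \sum_(k < M.+1) p`_k * a j k = 0.
  have -> : \sum_(k < M.+1) p`_k * a j k = lin (mu j) (dpoly c * p).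
    rewrite -{2}[p]coefK poly_def sp mulr_sumr lin_sum; apply: eq_bigr => k _.
    by rewrite -linZ -scalerAr.
  by rewrite /p -scalerAr linZ -rhoE mu_wder mulr0.
have -> : ddet (r :: c) = p.[d r] * ddet c.
  rewrite -(det_shift _ pm sp Ha); congr (\det _); apply/matrixP => j i; rewrite !mxE /a.
  have -> : dpoly (r :: c) * 'X^i = d r *: (dpoly c * 'X^i) + (-1) *: (dpoly c * 'X^(i.+1)).
    by rewrite /dpoly big_cons exprS -!mul_polyC polyCN; ring.
  by rewrite linD !linZ mulN1r.
rewrite mulrA; congr (_ * _); rewrite /p hornerZ mulrA mulfV // mul1r.
rewrite /rho horner_sum (bigD1 r) //= big1 ?addr0 => [|i ir].
  by rewrite hornerZ horner_nodal eqxx.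
by rewrite hornerZ horner_nodal (negPf ir) mulr0.
Qed.

Definition wmono (c : seq 'I_M.+1) (z : 'I_M -> R) := \prod_(i <- c) bary i z.

Lemma pf_bary i : pf (bary i).
Proof.
apply: (@pf_mul _ _ (fun z => \prod_j (d i - z j)) (fun _ => _)); last exact: pf_const.
apply: pf_prod => j; by apply: pf_sub; [apply: pf_const|apply: pf_coord].
Qed.

Lemma pf_wmono c : pf (wmono c).
Proof. by apply: pf_prod => i; apply: pf_bary. Qed.

(** Expectation under the Dixon-Anderson law: the factor vdm z belongs to its density, the rest of
    which is contained in the [mu j]; the division normalizes the mass to 1. *)
Definition dexp (f : ('I_M -> R) -> R) : R :=
  momf (pmom mu) (fun z => f z * vdm z) / \det (\matrix_(i, j < M) mu i j).

Lemma dexpD f g : pf f -> pf g -> dexp (fun z => f z + g z) = dexp f + dexp g.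
Proof.
move=> pff pg; rewrite /dexp -mulrDl -momfD; try by apply: pf_mul => //; apply: pf_vdm.
by congr (momf _ _ / _); apply/funext => z; rewrite mulrDl.
Qed.

Lemma dexpZ c f : pf f -> dexp (fun z => c * f z) = c * dexp f.
Proof.
move=> pff; rewrite /dexp mulrA -momfZ; last by apply: pf_mul => //; apply: pf_vdm.
by congr (momf _ _ / _); apply/funext => z; rewrite mulrA.
Qed.

Lemma dexp_sum (J : Type) (r : seq J) (P : pred J) (F : J -> ('I_M -> R) -> R) :
  (forall j, pf (F j)) ->
  dexp (fun z => \sum_(j <- r | P j) F j z) = \sum_(j <- r | P j) dexp (F j).
Proof.
move=> H; rewrite /dexp -mulr_suml -momf_sum => [|j]; last by apply: pf_mul => //; apply: pf_vdm.
by congr (momf _ _ / _); apply/funext => z; rewrite mulr_suml.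
Qed.

Lemma dexp_wmono c : dexp (wmono c) =
  ddet c / (\prod_(i <- c) \prod_(l | l != i) (d i - d l)) / \det (\matrix_(i, j < M) mu i j).
Proof.
rewrite /dexp; congr (_ / _).
have -> : (fun z => wmono c z * vdm z) = (fun z =>
   (\prod_(i <- c) \prod_(l | l != i) (d i - d l))^-1 * ((\prod_j (dpoly c).[z j]) * vdm z)).
  apply/funext => z; rewrite mulrA; congr (_ * _); rewrite /wmono /bary big_split /= mulrC.
  rewrite prodfV; congr (_ * _); rewrite exchange_big /=; apply: eq_bigr => j _.
  by rewrite /dpoly horner_prod; apply: eq_bigr => i _; rewrite hornerD hornerN hornerX hornerC.
rewrite momfZ ?(momf_prod_vdm mu (fun _ => dpoly c)) 1?mulrC //; apply: pf_mul; last exact: pf_vdm.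
by apply: pf_prod => j; apply: pf_horner; apply: pf_coord.
Qed.

(** The moment recursion of the Dirichlet law with parameters s_i. *)
Lemma dexp_rec r c : (S + (size c)%:R) * dexp (wmono (r :: c)) =
  (s r + (count_mem r c)%:R) * dexp (wmono c).
Proof.
rewrite !dexp_wmono !mulrA ddet_rec big_cons invfM.
set D := \prod_(l | _) _; have D0 : D != 0 := bary_den r.
set x := ddet c; set y := (\prod_(_ <- c) _)^-1; set w := (\det _)^-1.
by field.
Qed.

Definition btau (z : 'I_M -> R) (m : nat) := \sum_i bary i z * d i ^+ m.

Lemma pf_btau m : pf (fun z => btau z m).
Proof. by apply: pf_sum => i; apply: (@pf_mul _ _ (bary i) (fun _ => _)); [apply: pf_bary|apply: pf_const]. Qed.

Lemma pf_wbtau w : pf (fun z => wprod (btau z) w).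
Proof. by apply: pf_prod => i; apply: pf_btau. Qed.

(** Induction on w: expanding its first factor as sum_q w_q d_q^i moves a letter q from w to c. The
    count of r in q :: c is larger by one exactly when q = r, and this produces the new term d_r^i
    of the [rsum]. *)
Lemma dexp_word r c w :
  (S + (size c + size w)%:R) * dexp (fun z => wmono (r :: c) z * wprod (btau z) w) =
  (s r + (count_mem r c)%:R) * dexp (fun z => wmono c z * wprod (btau z) w) +
  rsum (fun i v => d r ^+ i * dexp (fun z => wmono (r :: c) z * wprod (btau z) v)) w.
Proof.
elim: w c => [|i w IH] c /=.
  rewrite addn0 addr0.
  have E c' : (fun z => wmono c' z * wprod (btau z) [::]) = wmono c'.
    by apply/funext => z; rewrite /wprod big_nil mulr1.
  by rewrite !E dexp_rec.
have E c' v : dexp (fun z => wmono c' z * wprod (btau z) (i :: v)) =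
    \sum_q d q ^+ i * dexp (fun z => wmono (q :: c') z * wprod (btau z) v).
  rewrite -(eq_bigr _ (fun q _ => dexpZ _ (pf_mul (pf_wmono _) (pf_wbtau _)))).
  rewrite -dexp_sum => [|q]; last by apply: pf_scale; apply: pf_mul; [apply: pf_wmono|apply: pf_wbtau].
  congr dexp; apply/funext => z; rewrite /wprod big_cons /btau mulrCA mulr_suml.
  by apply: eq_bigr => q _; rewrite /wmono big_cons; ring.
have swap q v : dexp (fun z => wmono (q :: r :: c) z * wprod (btau z) v) =
    dexp (fun z => wmono (r :: q :: c) z * wprod (btau z) v).
  by congr dexp; apply/funext => z; rewrite /wmono !big_cons; ring.
rewrite !E mulr_sumr.
under eq_bigr => q _ do rewrite swap mulrCA addnS -addSn (IH (q :: c)) mulrDr.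
rewrite big_split /=.
have -> : \sum_q d q ^+ i * rsum (fun k v => d r ^+ k *
     dexp (fun z => wmono (r :: q :: c) z * wprod (btau z) v)) w =
   rsum (fun k v => d r ^+ k * dexp (fun z => wmono (r :: c) z * wprod (btau z) (i :: v))) w.
  under eq_bigr do rewrite rsum_mull.
  rewrite rsum_sum; apply: eq_rsum => k v; rewrite E mulr_sumr; apply: eq_bigr => q _.
  by rewrite swap mulrCA.
rewrite addrA; congr (_ + _).
under eq_bigr do rewrite natrD addrCA mulrDl mulrDr.
rewrite big_split /= addrC; congr (_ + _).
  by rewrite mulr_sumr; apply: eq_bigr => q _; rewrite mulrCA.
rewrite (bigD1 r) //= eqxx mul1r big1 ?addr0 // => q qr.
by rewrite (negPf qr) mul0r mulr0.
Qed.

(** The mixed Dirichlet moment, a quotient of rising factorials: the product of the (s_i)_(c_i),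
    with c_i the multiplicity of i in c, over (S)_(|c|). *)
Fixpoint wval (c : seq 'I_M.+1) : R :=
  if c is r :: c' then (s r + (count_mem r c')%:R) / (S + (size c')%:R) * wval c' else 1.

Lemma S_gt0 k : 0 < S + k%:R.
Proof.
rewrite ltr_wpDr // /S (bigD1 ord0) //= ltr_wpDr // sumr_ge0 // => i _.
exact: ltW.
Qed.

Lemma wval_gt0 c : 0 < wval c.
Proof.
elim: c => [|r c IH] //=; rewrite mulr_gt0 // divr_gt0 ?S_gt0 //.
by rewrite ltr_wpDr.
Qed.

Lemma dexp_wval c : dexp (wmono c) = wval c.
Proof.
elim: c => [|r c IH].
  rewrite /dexp /=.
  have -> : (fun z => wmono [::] z * vdm z) =
      (fun z : 'I_M -> R => (\prod_j (1 : {poly R}).[z j]) * vdm z).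
    apply/funext => z; rewrite /wmono big_nil big1 // => i _.
    by rewrite hornerC.
  rewrite (momf_prod_vdm mu (fun _ => 1)).
  have -> : \matrix_(i, j) lin (mu i) (1 * 'X^j) = \matrix_(i, j < M) mu i j.
    by apply/matrixP => i j; rewrite !mxE mul1r linXn.
  by rewrite divff.
rewrite /= -IH; apply: (mulfI (lt0r_neq0 (S_gt0 (size c)))); rewrite dexp_rec.
by rewrite [RHS]mulrA; congr (_ * _); rewrite mulrCA mulfV ?mulr1 // gt_eqF // S_gt0.
Qed.

Definition bpow (c : seq 'I_M.+1) (j : nat) : R := \sum_i (s i + (count_mem i c)%:R) * d i ^+ j.

Lemma dexp_btau c i w :
  (S + (size c + size w)%:R) * dexp (fun z => wmono c z * (btau z i * wprod (btau z) w)) =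
  bpow c i * dexp (fun z => wmono c z * wprod (btau z) w) +
  rsum (fun k v => dexp (fun z => wmono c z * wprod (btau z) ((i + k)%N :: v))) w.
Proof.
have E k v : dexp (fun z => wmono c z * (btau z k * wprod (btau z) v)) =
    \sum_q d q ^+ k * dexp (fun z => wmono (q :: c) z * wprod (btau z) v).
  rewrite -(eq_bigr _ (fun q _ => dexpZ _ (pf_mul (pf_wmono _) (pf_wbtau _)))).
  rewrite -dexp_sum => [|q]; last by apply: pf_scale; apply: pf_mul; [apply: pf_wmono|apply: pf_wbtau].
  congr dexp; apply/funext => z; rewrite /btau mulr_suml mulr_sumr.
  by apply: eq_bigr => q _; rewrite /wmono big_cons; ring.
rewrite E mulr_sumr.
under eq_bigr => q _ do rewrite mulrCA dexp_word mulrDr.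
rewrite big_split /=; congr (_ + _).
  by rewrite mulr_suml; apply: eq_bigr => q _; rewrite mulrCA mulrA.
under eq_bigr do rewrite rsum_mull.
rewrite rsum_sum; apply: eq_rsum => k v.
have -> : (fun z => wmono c z * wprod (btau z) ((i + k)%N :: v)) =
    (fun z => wmono c z * (btau z (i + k) * wprod (btau z) v)).
  by apply/funext => z; rewrite /wprod big_cons.
by rewrite E; apply: eq_bigr => q _; rewrite mulrA exprD.
Qed.

Lemma pf_TP2 p F : TP2 F -> pf (fun z => F p (btau z)).
Proof.
elim=> [c|j j0|j j0|{}F G _ HF _ HG|{}F G _ HF _ HG].
- exact: pf_const.
- exact: pf_const.
- exact: pf_btau.
- exact: pf_add.
- exact: pf_mul.
Qed.

(** A Dirichlet law weighted by the monomial [wmono c] is the Dirichlet law with s_i raised by the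
    multiplicity of i in c. The word c is therefore a means to increase the weight of chosen
    nodes. *)
Lemma dexp_good c : good (S + (size c)%:R)
  (fun F => dexp (fun z => wmono c z * F (bpow c) (btau z)) / wval c).
Proof.
split.
- move=> F G /pf_TP2 HF /pf_TP2 HG; rewrite -mulrDl -dexpD; try by apply: pf_mul => //; apply: pf_wmono.
  by congr (dexp _ / _); apply/funext => z; rewrite mulrDr.
- move=> x F /pf_TP2 HF; rewrite mulrA -dexpZ; try by apply: pf_mul => //; apply: pf_wmono.
  by congr (dexp _ / _); apply/funext => z; rewrite mulrCA.
move=> Psi w _ _.
pose ell f := dexp (fun z => wmono c z * f z) / wval c.
have ellZ x f : pf f -> ell (fun z => x * f z) = x * ell f.
  move=> pff; rewrite /ell mulrA -dexpZ; try by apply: pf_mul => //; apply: pf_wmono.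
  by congr (dexp _ / _); apply/funext => z; rewrite mulrCA.
rewrite -/(ell (fun z => Psi (bpow c) * wprod (btau z) w)) ellZ; last exact: pf_wbtau.
have -> : (size w)%:R * (S + (size c)%:R + (size w)%:R - 1) * (Psi (bpow c) * ell (fun z => wprod (btau z) w)) =
   Psi (bpow c) * (S + (size c)%:R + (size w)%:R - 1) * ((size w)%:R * ell (fun z => wprod (btau z) w)) by ring.
rewrite -(rsum_wprod btau ell) rsum_mull -rsumD.
apply: (@eq_rsum_in _ _ _ _ _ predT); first exact/all_predT.
move=> i v _ _ <-.
rewrite -/(ell (fun z => Psi (bpow c) * bpow c i * wprod (btau z) v)) ellZ; last exact: pf_wbtau.
have -> : rsum (fun k v' => ell (fun z => Psi (bpow c) * wprod (btau z) ((i + k)%N :: v'))) v =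
   Psi (bpow c) * rsum (fun k v' => ell (fun z => wprod (btau z) ((i + k)%N :: v'))) v.
  by rewrite rsum_mull; apply: eq_rsum => k v'; rewrite ellZ //; apply: pf_wbtau.
rewrite -(mulrA (Psi _) (bpow c i)) -mulrDr -(mulrA (Psi _)); congr (_ * _).
rewrite -natr1 !addrA addrK -addrA -natrD /ell.
rewrite [LHS]mulrA dexp_btau mulrDl; congr (_ + _); first exact/esym/mulrA.
by rewrite mulrC rsum_mull; apply: eq_rsum => k v'; rewrite mulrC.
Qed.
End DixonAnderson.

(** * Antisymmetrization of functionals and sums over permutations *)

Lemma momf_reindex (R : realType) (I : finType) (h g : I -> I) m (f : (I -> R) -> R) :
  cancel h g -> cancel g h -> pf f ->
  momf m (fun x => f (x \o h)) = momf (fun e : {ffun I -> nat} => m [ffun i => e (g i)]) f.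
Proof.
move=> hg gh pff; have [l Hl] := pff.
have Hm x e : mono e (x \o h) = mono [ffun i => e (g i)] x.
  rewrite /mono (reindex g) /=; last by exists h => i _.
  by apply: eq_bigr => i _; rewrite ffunE gh.
pose l' := [seq ((t.1, [ffun i => t.2 (g i)]) : R * {ffun I -> nat}) | t : R * {ffun I -> nat} <- l].
have Hl' x : f (x \o h) = \sum_(t <- l') t.1 * mono t.2 x.
  by rewrite Hl big_map; apply: eq_bigr => t _; rewrite Hm.
rewrite (@momfE _ _ _ _ l'); [|by exists l'|by []].
by rewrite (momfE _ pff (l := l)) // big_map.
Qed.

(** On an antisymmetric integrand a functional may be replaced by the signed sum of its transforms.
    Functionals that differ on monomials can have the same signed sum; product integrals and ordered
    integrals are matched in this way. *)
Lemma momf_antisym (R : realType) (I W : finType) (h g : W -> I -> I) (sg : W -> R) m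
    (f : (I -> R) -> R) :
  (forall w, cancel (h w) (g w)) -> (forall w, cancel (g w) (h w)) ->
  (forall w, sg w * sg w = 1) -> pf f ->
  (forall w x, f (x \o g w) = sg w * f x) ->
  #|W|%:R * momf m f =
  momf (fun e : {ffun I -> nat} => \sum_w sg w * m [ffun i => e (h w i)]) f.
Proof.
move=> hg gh sg2 pff Hf; rewrite momf_msum //.
have -> : #|W|%:R = \sum_(w : W) (1 : R) by rewrite sumr_const.
rewrite mulr_suml; apply: eq_bigr => w _; rewrite mul1r.
rewrite -(momf_reindex _ (gh w) (hg w)) //.
have -> : (fun x : I -> R => f (x \o g w)) = (fun x => sg w * f x).
  by apply/funext => x; rewrite Hf.
by rewrite momfZ // mulrA sg2 mul1r.
Qed.

Lemma vdm_perm (R : comPzRingType) k (x : 'I_k -> R) (s : {perm 'I_k}) :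
  vdm (x \o s) = (-1) ^+ s * vdm x.
Proof.
rewrite /vdm -det_perm -det_mulmx; congr (\det _); apply/matrixP => i j.
rewrite -row_permE !mxE; by [].
Qed.

Lemma vdmE (R : comPzRingType) k (x : 'I_k -> R) :
  vdm x = \prod_(i < k) \prod_(j < k | (i < j)%N) (x j - x i).
Proof.
rewrite /vdm -det_tr.
have -> : (\matrix_(i, j) x i ^+ j)^T = Vandermonde k (\row_i x i).
  by apply/matrixP => i j; rewrite !mxE.
by rewrite det_Vandermonde; apply: eq_bigr => i _; apply: eq_bigr => j _; rewrite !mxE.
Qed.

Lemma vdm_inj (R : idomainType) k (x : 'I_k -> R) : vdm x != 0 -> injective x.
Proof.
rewrite vdmE => /prodf_neq0 H i j xij; apply/eqP/negPn/negP => ij.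
have [lt|lt|/val_inj E] := ltngtP i j; last by rewrite E eqxx in ij.
  by have /prodf_neq0/(_ j lt) := H i isT; rewrite xij subrr eqxx.
by have /prodf_neq0/(_ i lt) := H j isT; rewrite xij subrr eqxx.
Qed.

Lemma inj_vdm (R : idomainType) k (x : 'I_k -> R) : injective x -> vdm x != 0.
Proof.
move=> xi; rewrite vdmE; apply/prodf_neq0 => i _; apply/prodf_neq0 => j ij.
by rewrite subr_eq0; apply: contraTneq ij => /xi ->; rewrite ltnn.
Qed.

Lemma sum_perm_lift (V : nmodType) n (g : {perm 'I_n.+1} -> V) :
  \sum_s g s = \sum_(p < n.+1) \sum_(t : {perm 'I_n}) g (lift_perm ord0 p t).
Proof.
rewrite (partition_big (fun s : {perm 'I_n.+1} => s ord0) predT) //=.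
apply: eq_bigr => p _.
pose unl (s : {perm 'I_n.+1}) k := odflt k (unlift (s ord0) (s (lift ord0 k))).
have unlI s : injective (unl s).
  move=> k1 k2; rewrite /unl.
  have H k : exists k', unlift (s ord0) (s (lift ord0 k)) = Some k' /\ s (lift ord0 k) = lift (s ord0) k'.
    case: unliftP => [k' ->|/eqP]; first by exists k'.
    by rewrite (inj_eq perm_inj) eq_sym (negPf (neq_lift _ _)).
  have [a [-> Ha]] := H k1; have [b [-> Hb]] := H k2 => /= E.
  by apply: (@lift_inj _ ord0); apply: (@perm_inj _ s); rewrite Ha Hb E.
rewrite (reindex (lift_perm ord0 p)) /=.
  by apply: eq_bigl => t; rewrite lift_perm_id eqxx.
exists (fun s => perm (unlI s)) => [t _|s].
  by apply/permP => k; rewrite permE /unl lift_perm_id lift_perm_lift liftK.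
rewrite inE => /eqP sp; apply/permP => k; case: (unliftP ord0 k) => [j|] ->.
  rewrite lift_perm_lift permE /unl -sp.
  case: unliftP => [//|/eqP].
  by rewrite (inj_eq perm_inj) eq_sym (negPf (neq_lift _ _)).
by rewrite lift_perm_id.
Qed.

Lemma sign_lift_perm (R : pzRingType) n (p : 'I_n.+1) (t : {perm 'I_n}) :
  (-1) ^+ (lift_perm ord0 p t) = (-1) ^+ p * (-1) ^+ t :> R.
Proof. by rewrite odd_lift_perm /= !signr_addb signr_odd. Qed.

(** * Ordered integrals and Cauchy determinants *)

Section Nested.
Variable R : realFieldType.

(* The integral of prod x_j^(al_j - 1) y_j^(be_j - 1) over 1 > x_0 > y_0 > x_1 > y_1 > ... > 0. *)
Definition nest n (al be : 'I_n -> R) : R :=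
  \prod_(j < n) ((\sum_(i < n | (j <= i)%N) (al i + be i)) *
           (be j + \sum_(i < n | (j < i)%N) (al i + be i)))^-1.

(** Separates the two largest variables x_0 and y_0, which are integrated last: by then their
    exponents have accumulated to T and T - al_0, where T is the sum of all al_i + be_i. *)
Lemma nestS n (al be : 'I_n.+1 -> R) :
  nest al be = ((\sum_i (al i + be i)) * (\sum_i (al i + be i) - al ord0))^-1 *
    nest (fun i => al (lift ord0 i)) (fun i => be (lift ord0 i)).
Proof.
rewrite /nest big_ord_recl; congr (_ * _).
  congr (_^-1); congr (_ * _).
  rewrite [in RHS]big_ord_recl /= [al ord0 + _]addrC addrAC addrK; congr (_ + _).
  rewrite big_mkcond big_ord_recl /= add0r; by apply: eq_bigr.
apply: eq_bigr => j _; congr (_^-1); congr (_ * (_ + _)).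
  by rewrite big_mkcond big_ord_recl /= add0r -big_mkcond.
by rewrite big_mkcond big_ord_recl /= add0r -big_mkcond.
Qed.

Definition cauchymx n (al be : 'I_n -> R) : 'M[R]_n :=
  \matrix_(i, j) (be j * (al i + be j))^-1.

(** Since (al_p + be_q) M_pq = 1 / be_q, the row expansions weighted by al and the column expansions
    weighted by be add up to a sum of cofactors with coefficients 1 / be_q. *)
Lemma cauchy_total n (al be : 'I_n -> R) :
  (forall j, be j != 0) -> (forall i j, al i + be j != 0) ->
  (\sum_i (al i + be i)) * \det (cauchymx al be) =
  \sum_p \sum_q (be q)^-1 * cofactor (cauchymx al be) p q.
Proof.
move=> b0 ab0; set M := cauchymx al be.
rewrite big_split mulrDl /= !mulr_suml.
have -> : \sum_i al i * \det M = \sum_p \sum_q al p * (M p q * cofactor M p q).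
  by apply: eq_bigr => p _; rewrite -mulr_sumr -expand_det_row.
have -> : \sum_i be i * \det M = \sum_q \sum_p be q * (M p q * cofactor M p q).
  by apply: eq_bigr => q _; rewrite -mulr_sumr -expand_det_col.
rewrite [X in _ + X]exchange_big -big_split; apply: eq_bigr => p _ /=.
rewrite -big_split; apply: eq_bigr => q _ /=.
rewrite !mxE !mulrA -mulrDl -mulrDl; congr (_ * _).
by congr (_ * _); rewrite -mulrDl invfM mulrCA mulfV ?mulr1.
Qed.

(** The sum over q on the left is the determinant of [N], obtained from M by replacing row p with
    the 1 / be_q. In the weighted expansions of det N, a row i != p contributes row p paired with
    the cofactors of row i, which is 0; row p itself contributes be_q / be_q = 1. *)
Lemma cauchy_row n (al be : 'I_n -> R) (p : 'I_n) :
  (forall j, be j != 0) -> (forall i j, al i + be j != 0) ->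
  (\sum_i (al i + be i) - al p) * \sum_q (be q)^-1 * cofactor (cauchymx al be) p q =
  \sum_q cofactor (cauchymx al be) p q.
Proof.
move=> b0 ab0; set M := cauchymx al be.
pose N : 'M[R]_n := \matrix_(i, j) if i == p then (be j)^-1 else M i j.
have cN q : cofactor N p q = cofactor M p q.
  rewrite /cofactor; congr (_ * \det _); apply/matrixP => i j.
  by rewrite !mxE eq_sym (negPf (neq_lift _ _)).
have dN : \det N = \sum_q (be q)^-1 * cofactor M p q.
  by rewrite (expand_det_row N p); apply: eq_bigr => q _; rewrite mxE eqxx cN.
rewrite -dN.
have -> : \sum_i (al i + be i) - al p = \sum_(i | i != p) al i + \sum_i be i.
  by rewrite big_split /= (bigD1 p) //= -addrA [al p + _]addrC addrK.
rewrite mulrDl !mulr_suml.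
under eq_bigr => i _ do rewrite (expand_det_row N i) mulr_sumr.
under [X in _ + X]eq_bigr => q _ do rewrite (expand_det_col N q) mulr_sumr.
rewrite [X in _ + X]exchange_big /= [X in _ + X](bigD1 p) //= addrCA -big_split /=.
rewrite [X in _ + X]big1 ?addr0.
  by apply: eq_bigr => q _; rewrite mxE eqxx mulrA mulfV // mul1r cN.
move=> i ip; rewrite -big_split /=.
have := congr1 (fun A : 'M[R]_n => A p i) (mul_mx_adj N).
rewrite !mxE eq_sym (negPf ip) mulr0n => {2}<-.
apply: eq_bigr => q _; rewrite !mxE eqxx (negPf ip) !mulrA -mulrDl -mulrDl.
by congr (_ * _ * _); rewrite -mulrDl invfM mulrCA mulfV ?mulr1.
Qed.

(** Induction, splitting by the images p and q of the first index under the two permutations.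
    [nestS] separates 1 / (T (T - al_p)) from each term, and [cauchy_total] followed by [cauchy_row]
    separates the same factors from the determinant. *)
Lemma nest_alt n (al be : 'I_n -> R) :
  (forall j, 0 < be j) -> (forall i j, 0 < al i + be j) ->
  \sum_(s : {perm 'I_n}) \sum_(t : {perm 'I_n})
     (-1) ^+ s * (-1) ^+ t * nest (al \o s) (be \o t) = \det (cauchymx al be).
Proof.
elim: n al be => [|n IH] al be b0 ab0.
  rewrite det_mx00 (bigD1 1%g) //= (bigD1 1%g) //= !odd_perm1 !mul1r.
  rewrite !big1 ?addr0; last 2 first.
  - by move=> t /eqP[]; apply/permP => -[].
  - by move=> s /eqP[]; apply/permP => -[].
  by rewrite /nest big_ord0.
have b0' j : be j != 0 by rewrite gt_eqF.
have ab0' i j : al i + be j != 0 by rewrite gt_eqF.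
set T := \sum_i (al i + be i).
have T0 : 0 < T.
  by rewrite /T (bigD1 ord0) //= ltr_wpDr // sumr_ge0 // => i _; apply: ltW.
have Tp p : 0 < T - al p.
  have -> : T - al p = be p + \sum_(i | i != p) (al i + be i).
    by rewrite /T (bigD1 p) //=; ring.
  by rewrite ltr_wpDr // sumr_ge0 // => i _; apply: ltW.
apply: (mulfI (lt0r_neq0 T0)); rewrite cauchy_total //.
rewrite sum_perm_lift mulr_sumr; apply: eq_bigr => p _.
apply: (mulfI (lt0r_neq0 (Tp p))); rewrite cauchy_row //.
under eq_bigr do rewrite sum_perm_lift.
rewrite exchange_big /= !mulr_sumr; apply: eq_bigr => q _.
rewrite /cofactor.
have -> : row' p (col' q (cauchymx al be)) =
   cauchymx (fun i => al (lift p i)) (fun j => be (lift q j)).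
  by apply/matrixP => i j; rewrite !mxE.
rewrite -IH // !mulr_sumr; apply: eq_bigr => s _; rewrite !mulr_sumr.
apply: eq_bigr => t _; rewrite nestS !sign_lift_perm /= lift_perm_id.
have -> : \sum_i (al (lift_perm ord0 p s i) + be (lift_perm ord0 q t i)) = T.
  rewrite /T !big_split /=; congr (_ + _).
    by rewrite [RHS](reindex_inj (@perm_inj _ (lift_perm ord0 p s))).
  by rewrite [RHS](reindex_inj (@perm_inj _ (lift_perm ord0 q t))).
have -> : nest (fun i => al (lift_perm ord0 p s (lift ord0 i)))
     (fun i => be (lift_perm ord0 q t (lift ord0 i))) =
   nest ((fun i => al (lift p i)) \o s) ((fun j => be (lift q j)) \o t).
  congr nest; apply/funext => i /=; by rewrite lift_perm_lift.
rewrite exprD invfM.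
have u0 := lt0r_neq0 T0; have v0 := lt0r_neq0 (Tp p).
have E (u T' S x : R) : u != 0 -> T' != 0 -> u * (T' * (S * (T'^-1 / u * x))) = S * x.
  by move=> *; field; apply/andP.
by rewrite E // mulrACA !mulrA.
Qed.

End Nested.

Lemma TP_ext (R : realType) (F : (nat -> R) -> R) (p q : nat -> R) :
  TP F -> (forall j, (0 < j)%N -> p j = q j) -> F p = F q.
Proof.
move=> + H; elim=> [c|j j0|{}F G _ HF _ HG|{}F G _ HF _ HG] //.
- exact: H.
- by rewrite HF HG.
- by rewrite HF HG.
Qed.

Lemma pf_TP (R : realType) (I : finType) (F : (nat -> R) -> R) (p : nat -> (I -> R) -> R) :
  TP F -> (forall j, pf (p j)) -> pf (fun x => F (fun j => p j x)).
Proof.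
move=> + H; elim=> [c|j j0|{}F G _ HF _ HG|{}F G _ HF _ HG] //.
- exact: pf_const.
- exact: pf_add.
- exact: pf_mul.
Qed.

Definition psum (R : pzSemiRingType) (I : finType) (x : I -> R) (j : nat) : R := \sum_i x i ^+ j.

Lemma pf_psum (R : realType) (I : finType) j : pf (fun x : I -> R => psum x j).
Proof. by apply: pf_sum => i; apply: pf_exp; apply: pf_coord. Qed.

Lemma psum_perm (R : pzSemiRingType) (I : finType) (x : I -> R) (s : {perm I}) :
  psum (x \o s) = psum x.
Proof. by apply/funext => j; rewrite /psum [RHS](reindex_inj (@perm_inj _ s)). Qed.

Lemma deriv_prodE (R : comNzRingType) n (f : 'I_n -> {poly R}) :
  deriv (\prod_i f i) = \sum_i deriv (f i) * \prod_(l | l != i) f l.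
Proof.
elim: n f => [|n IH] f; first by rewrite !big_ord0 derivC.
rewrite !big_ord_recl derivM IH; congr (_ * _ + _).
  rewrite [RHS]big_mkcond big_ord_recl /= mul1r.
  by [].
rewrite mulr_sumr; apply: eq_bigr => i _; rewrite mulrCA; congr (_ * _).
rewrite [RHS]big_mkcond big_ord_recl /=; congr (_ * _).
rewrite big_mkcond; apply: eq_bigr => l _.
by rewrite (inj_eq (@lift_inj _ _)).
Qed.

(* Dixon-Anderson with the extra node 0 of weight b and the nodes y_j of weight 1. *)
Section NodesWithZero.
Variables (R : realType) (M : nat) (b : R) (y : 'I_M -> R).
Hypothesis b0 : 0 < b.
Hypothesis yinj : injective y.
Hypothesis y0 : forall j, y j != 0.

Definition znode (i : 'I_M.+1) : R := if unlift ord0 i is Some j then y j else 0.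
Definition zwt (i : 'I_M.+1) : R := if unlift ord0 i is Some j then 1 else b.
Definition zmu (j : 'I_M) (k : nat) : R := y j ^+ k / (k%:R + b).

Lemma znode_inj : injective znode.
Proof.
move=> i k; rewrite /znode.
case: unliftP => [j ->|->]; case: unliftP => [l ->|->] //.
- by move=> /yinj ->.
- by move=> E; have := y0 j; rewrite E eqxx.
- by move=> E; have := y0 l; rewrite -E eqxx.
Qed.

Lemma zwt_gt0 i : 0 < zwt i.
Proof. by rewrite /zwt; case: unlift. Qed.

(** [zmu j] is integration over (0, y_j) against y_j^(-b) x^(b-1). As x f' + b f = x^(1-b) (x^b f)',
    only the boundary value f(y_j) remains. *)
Lemma lin_zmu j (f : {poly R}) : lin (zmu j) ('X * deriv f + b *: f) = f.[y j].
Proof.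
have H k : lin (zmu j) ('X * deriv 'X^k + b *: 'X^k) = ('X^k).[y j].
  have -> : 'X * deriv 'X^k + b *: 'X^k = (k%:R + b) *: 'X^k :> {poly R}.
    rewrite derivXn scalerDl; congr (_ + _); case: k => [|k].
      by rewrite mulr0n mulr0 scale0r.
    by rewrite mulrnAr -exprS scaler_nat.
  rewrite linZ linXn /zmu mulrCA mulfV ?mulr1 ?hornerXn // gt_eqF //.
  by rewrite ltr_wpDl.
rewrite -[f]coefK poly_def.
elim/big_rec: _ => [|i g _ IH].
  by rewrite derivC mulr0 scaler0 addr0 /lin size_poly0 big_ord0 horner0.
rewrite derivD mulrDr scalerDr addrACA linD IH hornerD; congr (_ + _).
by rewrite derivZ hornerZ -H -linZ scalerDr !scalerA [_ * b]mulrC -scalerAr.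
Qed.

(** For these nodes [wder] of q is x f' + b f with f = q prod (X - y_l), and this f vanishes at
    y_j. *)
Lemma zmu_wder j q : lin (zmu j) (wder znode zwt q) = 0.
Proof.
pose P : {poly R} := \prod_j ('X - (y j)%:P).
have nodeP : \prod_l ('X - (znode l)%:P) = 'X * P.
  rewrite big_ord_recl /znode unlift_none subr0; congr (_ * _).
  by apply: eq_bigr => i _; rewrite liftK.
have P' : deriv P = \sum_j \prod_(l | l != j) ('X - (y l)%:P).
  by rewrite deriv_prodE; apply: eq_bigr => i _; rewrite derivXsubC mul1r.
have sumP : \sum_i zwt i *: nodal znode i = b *: P + 'X * deriv P.
  rewrite big_ord_recl /zwt unlift_none; congr (_ *: _ + _).
    rewrite /nodal big_mkcond big_ord_recl /= mul1r.
    by apply: eq_bigr => i _; rewrite /znode liftK.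
  rewrite P' mulr_sumr; apply: eq_bigr => i _; rewrite liftK scale1r.
  rewrite /nodal big_mkcond big_ord_recl /= /znode unlift_none subr0.
  congr (_ * _); rewrite [RHS]big_mkcond; apply: eq_bigr => l _.
  by rewrite liftK (inj_eq (@lift_inj _ _)).
have -> : wder znode zwt q = 'X * deriv (q * P) + b *: (q * P).
  rewrite /wder nodeP sumP derivM -!mul_polyC; ring.
by rewrite lin_zmu hornerM /P horner_prod (bigD1 j) //= hornerXsubC subrr mul0r mulr0.
Qed.

Lemma zmu_det : \det (\matrix_(i, j < M) zmu i j) = vdm y / \prod_(i < M) (i%:R + b).
Proof.
have -> : \matrix_(i, j < M) zmu i j =
    (\matrix_(i, j) y i ^+ j) *m diag_mx (\row_j (j%:R + b)^-1).
  by apply/matrixP => i j; rewrite mul_mx_diag !mxE.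
rewrite det_mulmx det_diag; congr (_ * _); rewrite -prodfV.
by apply: eq_bigr => i _; rewrite mxE.
Qed.

Lemma zmu_nondeg : \det (\matrix_(i, j < M) zmu i j) != 0.
Proof.
rewrite zmu_det mulf_neq0 ?inj_vdm // invr_eq0; apply/prodf_neq0 => i _.
by rewrite gt_eqF // ltr_wpDl.
Qed.

Lemma zwt_sum : \sum_i zwt i = b + M%:R.
Proof.
rewrite big_ord_recl /zwt unlift_none; congr (_ + _).
by under eq_bigr do rewrite liftK; rewrite sumr_const card_ord.
Qed.

Lemma zdexp_newt (z : 'I_M -> R) j : (0 < j)%N ->
  psum y j + newt (btau znode z) j = psum z j.
Proof.
case: j => // j _.
rewrite /psum (psum_interlace j (bary_interp znode_inj z)) big_ord_recl.
rewrite [znode ord0]/znode unlift_none expr0n add0r; congr (_ + _).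
by apply: eq_bigr => i _; rewrite /znode liftK.
Qed.

(** Powers of this weight, and of the weight at a node 1 ([bary_one]), supply the factors z^b' and
    (1 - z)^a' of the Jacobi weight. *)
Lemma bary_zero (z : 'I_M -> R) :
  bary znode ord0 z = (\prod_j z j) / (\prod_j y j).
Proof.
rewrite /bary [X in _ / X]big_mkcond big_ord_recl /= mul1r -!prodf_div.
apply: eq_bigr => j _.
by rewrite /znode unlift_none liftK !sub0r invrN mulrNN.
Qed.

End NodesWithZero.

(** * Interlacing steps *)

Definition leb (R : realType) (I : finType) : {ffun I -> nat} -> R :=
  pmom (fun _ n => n.+1%:R^-1).

Definition join (T I J : Type) (y : I -> T) (z : J -> T) (s : I + J) : T :=
  match s with inl i => y i | inr j => z j end.

Lemma mono_join (R : realType) (I J : finType) (e : {ffun I + J -> nat}) (y : I -> R) (z : J -> R) :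
  mono e (join y z) = mono [ffun i => e (inl i)] y * mono [ffun j => e (inr j)] z.
Proof.
rewrite /mono big_sumType; congr (_ * _); by apply: eq_bigr => i _; rewrite ffunE.
Qed.

(** Fubini for functionals given by moments: the moments of the inner functional become polynomial
    in y after multiplication by [phi], and the exchange is linearity. *)
Lemma momf_iter0 (R : realType) (I J : finType) m (my : (I -> R) -> {ffun J -> nat} -> R)
    (phi : (I -> R) -> R) (H : (J -> R) -> R) :
  pf H -> (forall f, pf (fun y => phi y * my y f)) ->
  pf (fun y => phi y * momf (my y) H) /\
  momf m (fun y => phi y * momf (my y) H) = momf (fun f => momf m (fun y => phi y * my y f)) H.
Proof.
move=> pfH Hm; have [l Hl] := pfH.
have E : (fun y => phi y * momf (my y) H) = (fun y => \sum_(t <- l) t.1 * (phi y * my y t.2)).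
  apply/funext => y; rewrite (momfE _ pfH (l := l)) // mulr_sumr.
  by apply: eq_bigr => t _; rewrite mulrCA.
rewrite E; split; first by apply: pf_sum => t; apply: pf_scale.
rewrite momf_sum => [|t]; last exact: pf_scale.
rewrite (momfE _ pfH (l := l)) //; apply: eq_bigr => t _; by rewrite momfZ.
Qed.

Lemma momf_iter (R : realType) (I J : finType) m (my : (I -> R) -> {ffun J -> nat} -> R)
    (K : (I + J -> R) -> R) :
  pf K -> (forall f, pf (fun y => my y f)) ->
  pf (fun y => momf (my y) (fun z => K (join y z))) /\
  momf m (fun y => momf (my y) (fun z => K (join y z))) =
  momf (fun e : {ffun I + J -> nat} => momf m (fun y => mono [ffun i => e (inl i)] y * my y [ffun j => e (inr j)])) K.
Proof.
move=> pfK Hm; have [l Hl] := pfK.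
have E : (fun y => momf (my y) (fun z => K (join y z))) =
   (fun y => \sum_(t <- l) t.1 * (mono [ffun i => t.2 (inl i)] y * my y [ffun j => t.2 (inr j)])).
  apply/funext => y.
  have -> : (fun z => K (join y z)) = (fun z => \sum_(t <- l) (t.1 * mono [ffun i => t.2 (inl i)] y) *
      mono [ffun j => t.2 (inr j)] z).
    by apply/funext => z; rewrite Hl; apply: eq_bigr => t _; rewrite mono_join mulrA.
  rewrite momf_sum => [|t]; last by apply: pf_scale; apply: pf_mono.
  apply: eq_bigr => t _; rewrite momfZ; last exact: pf_mono.
  by rewrite momf_mono mulrA.
rewrite E.
have pfm (e : {ffun I + J -> nat}) : pf (fun y => mono [ffun i => e (inl i)] y * my y [ffun j => e (inr j)]).
  by apply: pf_mul => //; apply: pf_mono.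
split; first by apply: pf_sum => t; apply: pf_scale.
rewrite momf_sum => [|t]; last exact: pf_scale.
rewrite (momfE _ pfK (l := l)) //; apply: eq_bigr => t _; by rewrite momfZ.
Qed.

(** Puts a node 1 in front of u: besides its random eigenvalues, each compression of the projection
    has the eigenvalues 0 and 1 with known multiplicities. The node 0 is supplied by [znode]. *)
Definition ycons (R : realType) k (u : 'I_k -> R) (i : 'I_k.+1) : R :=
  if unlift ord0 i is Some j then u j else 1.

Lemma ycons0 (R : realType) k (u : 'I_k -> R) : ycons u ord0 = 1.
Proof. by rewrite /ycons unlift_none. Qed.

Lemma yconsS (R : realType) k (u : 'I_k -> R) i : ycons u (lift ord0 i) = u i.
Proof. by rewrite /ycons liftK. Qed.

Lemma vdm_ycons (R : realType) k (u : 'I_k -> R) :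
  vdm (ycons u) = (-1) ^+ k * \prod_i (1 - u i) * vdm u.
Proof.
rewrite !vdmE big_ord_recl; congr (_ * _).
  rewrite big_mkcond big_ord_recl /= mul1r.
  have -> : (-1) ^+ k = \prod_(i < k) (-1 : R) by rewrite prodr_const card_ord.
  rewrite -big_split; apply: eq_bigr => i _.
  by rewrite ycons0 yconsS /= mulN1r opprB.
apply: eq_bigr => i _; rewrite big_mkcond big_ord_recl /= mul1r [RHS]big_mkcond.
by apply: eq_bigr => j _; rewrite !yconsS.
Qed.

Lemma ycons_inj (R : realType) k (u : 'I_k -> R) : injective u -> (forall i, 1 < u i) ->
  injective (ycons u).
Proof.
move=> ui u1 i j; case: (unliftP ord0 i) => [i'|] ->; case: (unliftP ord0 j) => [j'|] ->; rewrite ?ycons0 ?yconsS //.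
- by move=> /ui ->.
- by move=> E; have := u1 i'; rewrite E ltxx.
- by move=> E; have := u1 j'; rewrite -E ltxx.
Qed.

(** What [elimination] gives for one interlacing step: q = 1 for the minors of a Hermitian matrix, q
    = 2 for M, because T T^T carries every eigenvalue of H twice. *)
Definition step_spec (R : realType) (s q : R) (F Gt : (nat -> R) -> R) :=
  forall L, good s L -> L (fun p t => F (fun j => q * p j + newt t j)) = L (fun p _ => Gt p).

Lemma bary_one (R : realType) k (u : 'I_k -> R) (z : 'I_k.+1 -> R) :
  bary (znode (ycons u)) (lift ord0 ord0) z = (\prod_j (1 - z j)) / (\prod_j (1 - u j)).
Proof.
have d1 : znode (ycons u) (lift ord0 ord0) = 1 by rewrite /znode liftK ycons0.
rewrite /bary d1; congr (_ / _).
rewrite big_mkcond big_ord_recl /= big_ord_recl /= mul1r.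
rewrite [znode _ ord0]/znode unlift_none subr0 mul1r.
by apply: eq_bigr => i _; rewrite /znode liftK yconsS.
Qed.

(** The sign comes from [vdm_ycons], the inverse from the Dirichlet moment of the word of extra
    nodes, and the product from the determinant of the functionals [zmu]. *)
Definition chain_c (R : realType) k a' b' : R :=
  (-1) ^+ k * (wval (zwt (1 : R)) (nseq b' ord0 ++ nseq a' (lift ord0 ord0) : seq 'I_k.+2))^-1 *
  \prod_(i < k.+1) (i%:R + 1).

Section ChainStep.
Variables (R : realType) (k a' b' : nat) (F Gt : (nat -> R) -> R).
Hypotheses (TPF : TP F) (TPG : TP Gt).
Hypothesis HG : step_spec (a'.+1 + k + b'.+1)%:R 1 F Gt.

Let H (z : 'I_k.+1 -> R) : R :=
  F (fun j => a'%:R + psum z j) * \prod_j (z j ^+ b' * (1 - z j) ^+ a') * vdm z.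

Lemma chain_pf_weight l (x y : nat) :
  pf (fun z : 'I_l -> R => \prod_j (z j ^+ x * (1 - z j) ^+ y)).
Proof.
apply: pf_prod => j; apply: pf_mul; apply: pf_exp; first exact: pf_coord.
by apply: pf_sub; [apply: pf_const|apply: pf_coord].
Qed.

Lemma chain_pf_psum l (x : R) (F' : (nat -> R) -> R) : TP F' ->
  pf (fun z : 'I_l -> R => F' (fun j => x + psum z j)).
Proof.
move=> TPF'; apply: (pf_TP (p := fun j z => x + psum z j) TPF') => j.
by apply: pf_add; [apply: pf_const|apply: pf_psum].
Qed.

Lemma chain_pfH : pf H.
Proof.
apply: pf_mul; last exact: pf_vdm.
by apply: pf_mul; [apply: chain_pf_psum|apply: chain_pf_weight].
Qed.

(** [HG] is applied to the Dixon-Anderson functional with nodes 0, 1 and u_i of weights b'.+1, a'.+1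
    and 1; the total is the s of [HG]. The step removes one copy of 0 and one of 1 and leaves k.+1
    new variables. *)
Lemma chain_inner (u : 'I_k -> R) : (forall i, 1 < u i) -> injective u ->
  Gt (fun j => a'.+1%:R + psum u j) * (\prod_j (u j ^+ b' * (1 - u j) ^+ a'.+1) * vdm u) =
  chain_c R k a' b' * momf (pmom (zmu 1 (ycons u))) H.
Proof.
move=> u1 ui.
(* The nodes 0 and 1 have weight 1 to begin with, so b' and a' further copies produce the weights
   b'.+1 and a'.+1. *)
pose c : seq 'I_k.+2 := nseq b' ord0 ++ nseq a' (lift ord0 ord0).
pose W := wval (zwt (1 : R)) c.
have W0 : 0 < W by apply: wval_gt0 => i; apply: zwt_gt0.
rewrite /chain_c -/c -/W.
have yi := ycons_inj ui u1.
have y0 j : ycons u j != 0.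
  case: (unliftP ord0 j) => [i|] ->; rewrite ?ycons0 ?yconsS ?oner_eq0 //.
  by rewrite gt_eqF // (lt_trans _ (u1 i)).
have := dexp_good (znode_inj yi y0) (zwt_gt0 ltr01) (@zmu_wder _ _ _ (ycons u) ltr01) c.
rewrite zwt_sum.
have -> : 1 + k.+1%:R + (size c)%:R = (a'.+1 + k + b'.+1)%:R :> R.
  by rewrite size_cat !size_nseq nat1r -natrD; congr (_%:R); lia.
move=> gL; have := HG gL.
set d := znode (ycons u); set mu := zmu 1 (ycons u).
set wt := zwt 1.
have pfw := pf_wmono d c.
have -> : dexp mu (fun z => wmono d c z * Gt (bpow d wt c)) / wval wt c = Gt (bpow d wt c).
  have -> : (fun z => wmono d c z * Gt (bpow d wt c)) = (fun z => Gt (bpow d wt c) * wmono d c z).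
    by apply/funext => z; rewrite mulrC.
  rewrite dexpZ // (dexp_wval (znode_inj yi y0) (zwt_gt0 ltr01) (@zmu_wder _ _ _ (ycons u) ltr01) (zmu_nondeg ltr01 yi)).
  by rewrite mulfK // gt_eqF.
have bpE j : (0 < j)%N -> bpow d wt c j = a'.+1%:R + psum u j.
  move=> j0; rewrite /bpow big_ord_recl /d /znode unlift_none expr0n gtn_eqF // mulr0 add0r.
  rewrite big_ord_recl /= liftK ycons0 expr1n mulr1 /wt /zwt liftK; congr (_ + _).
    by rewrite /c count_cat !count_nseq /= mul0n add0n ?eqxx mul1n -nat1r.
  apply: eq_bigr => i _; rewrite !liftK yconsS count_cat !count_nseq /=.
  by rewrite !mul0n addr0 mul1r.
rewrite (TP_ext (q := fun j => a'.+1%:R + psum u j) TPG bpE) => E.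
pose P := \prod_j (u j ^+ b' * (1 - u j) ^+ a').
have iterE (x : R) n : iter n ( *%R x) 1 = x ^+ n by elim: n => //= n ->; rewrite exprS.
have wm z : wmono d c z = P^-1 * \prod_j (z j ^+ b' * (1 - z j) ^+ a').
  rewrite /wmono /c big_cat /= !big_nseq !iterE /d bary_zero bary_one.
  have -> : \prod_i ycons u i = \prod_i u i.
    by rewrite big_ord_recl ycons0 mul1r; apply: eq_bigr => i _; rewrite yconsS.
  rewrite /P !big_split /= !prodrXl !exprMn !exprVn invfM; ring.
have momE : momf (pmom mu) (fun z => wmono d c z * F (fun j => 1 * bpow d wt c j + newt (btau d z) j) * vdm z) =
    P^-1 * momf (pmom mu) H.
  rewrite -momfZ; last exact: chain_pfH.
  congr momf; apply/funext => z; rewrite wm /H.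
  rewrite (TP_ext (q := fun j => a'%:R + psum z j) TPF) => [|j j0]; first by ring.
  rewrite mul1r bpE // -(zdexp_newt yi y0 z j0) addrA; congr (_ + _).
  rewrite -addn1 natrD -addrA; congr (_ + _).
  rewrite /psum big_ord_recl ycons0 expr1n; congr (_ + _).
  by apply: eq_bigr => i _; rewrite yconsS.
move: E; rewrite /dexp momE zmu_det vdm_ycons => <-.
have P0 : P != 0.
  apply/prodf_neq0 => i _; rewrite mulf_neq0 ?expf_neq0 //.
    by rewrite gt_eqF // (lt_trans _ (u1 i)).
  by rewrite subr_eq0 lt_eqF.
have Q0 : \prod_i (1 - u i) != 0.
  by apply/prodf_neq0 => i _; rewrite subr_eq0 lt_eqF.
have -> : \prod_j (u j ^+ b' * (1 - u j) ^+ a'.+1) = P * \prod_i (1 - u i).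
  by rewrite -big_split; apply: eq_bigr => i _ /=; rewrite exprSr mulrA.
have v0 := inj_vdm ui.
have W0' := lt0r_neq0 W0.
have N0 : \prod_(i < k.+1) (i%:R + 1) != 0 :> R.
  by apply/prodf_neq0 => i _; rewrite gt_eqF // ltr_wpDl.
rewrite -/W; move: (momf _ H) => h; clear wm momE W0 bpE.
rewrite !invfM invr_sign invrK.
move: (\prod_(i < k.+1) _) N0 (\prod_(i < k) (1 - u i)) Q0 (vdm u) v0 => N N0 Q Q0 v v0.
clearbody W P; move: ((-1) ^+ k) => sg.
by field; rewrite W0' v0 Q0 P0.
Qed.

(** The moments in the new variables after u has been integrated over the unit cube; prod u and one
    vdm u are what [chain_inner] leaves of the weight. *)
Definition m1 (f : {ffun 'I_k.+1 -> nat}) : R :=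
  momf (@leb R _) (fun u => (\prod_j u j * vdm u) * pmom (zmu 1 (ycons u)) f).

Lemma m1E f : m1 f = \prod_j (f j).+1%:R^-1 *
  \det (\matrix_(i < k, j < k) ((f (lift ord0 i) + j).+2%:R^-1)).
Proof.
rewrite /m1.
have -> : (fun u : 'I_k -> R => (\prod_j u j * vdm u) * pmom (zmu 1 (ycons u)) f) =
  (fun u => (\prod_j (f j).+1%:R^-1) * ((\prod_j ('X^((f (lift ord0 j)).+1) : {poly R}).[u j]) * vdm u)).
  apply/funext => u; rewrite /pmom /zmu big_ord_recl ycons0 expr1n mul1r [in RHS]big_ord_recl.
  have -> : \prod_(i < k) (ycons u (lift ord0 i) ^+ f (lift ord0 i) / ((f (lift ord0 i))%:R + 1)) =
      \prod_(i < k) u i ^+ f (lift ord0 i) * \prod_(i < k) (f (lift ord0 i)).+1%:R^-1.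
    by rewrite -big_split; apply: eq_bigr => i _; rewrite yconsS natr1.
  rewrite natr1.
  have -> : \prod_j ('X^((f (lift ord0 j)).+1) : {poly R}).[u j] = \prod_j u j * \prod_(i < k) u i ^+ f (lift ord0 i).
    by rewrite -big_split; apply: eq_bigr => j _ /=; rewrite hornerXn exprS.
  ring.
rewrite momfZ; last first.
  apply: pf_mul; last exact: pf_vdm.
  by apply: pf_prod => j; apply: pf_horner; apply: pf_coord.
congr (_ * _); rewrite /leb (momf_prod_vdm _ (fun j => 'X^((f (lift ord0 j)).+1))).
congr (\det _); apply/matrixP => i j; rewrite !mxE -exprD linXn.
by rewrite addSn.
Qed.

Definition m2 (f : {ffun 'I_k.+1 -> nat}) : R :=
  \det (\matrix_(i < k.+1, j < k.+1) ((f i + j).+1%:R^-1)).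

(** Up to the factors 1 / (f_i + 1), the signed sum is k! times the Laplace expansion of [B] along
    its column of ones. The column operations [U] express (f + 1) / (f + j + 1) = 1 - j / (f + j +
    1); they turn B into the matrix of [m2], up to the same factors, and have determinant (-1)^k
    k!. *)
Lemma m1_alt (f : {ffun 'I_k.+1 -> nat}) :
  \sum_(s : {perm 'I_k.+1}) (-1) ^+ s * m1 [ffun i => f (s i)] = (-1) ^+ k * m2 f.
Proof.
pose B : 'M[R]_k.+1 := \matrix_(i, j) if j == ord0 then 1 else ((f i + j).+1%:R^-1).
have BE : \sum_(s : {perm 'I_k.+1}) (-1) ^+ s * m1 [ffun i => f (s i)] =
    \prod_j (f j).+1%:R^-1 * (k`!%:R * \det B).
  have -> : \sum_(s : {perm 'I_k.+1}) (-1) ^+ s * m1 [ffun i => f (s i)] =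
     \prod_j (f j).+1%:R^-1 * \sum_(s : {perm 'I_k.+1}) (-1) ^+ s *
        \det (\matrix_(i < k, j < k) ((f (s (lift ord0 i)) + j).+2%:R^-1)).
    rewrite mulr_sumr; apply: eq_bigr => s _; rewrite m1E mulrCA; congr (_ * (_ * _)).
      rewrite [RHS](reindex_inj (@perm_inj _ s)).
      by apply: eq_bigr => j _; rewrite ffunE.
    by congr (\det _); apply/matrixP => i j; rewrite !mxE ffunE.
  congr (_ * _); rewrite sum_perm_lift (expand_det_col B ord0) mulr_sumr.
  apply: eq_bigr => p _; rewrite mxE eqxx mul1r /cofactor addn0.
  have -> : k`!%:R = \sum_(t : {perm 'I_k}) (1 : R).
    by rewrite sumr_const card_Sn.
  rewrite mulr_suml; apply: eq_bigr => t _; rewrite mul1r sign_lift_perm -mulrA; congr (_ * _).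
  set D := row' _ _.
  have -> : \matrix_(i < k, j < k) ((f (lift_perm ord0 p t (lift ord0 i)) + j).+2%:R^-1) = row_perm t D.
    apply/matrixP => i j; rewrite !mxE lift_perm_lift /=.
    by rewrite /bump /= add1n addnS.
  by rewrite row_permE det_mulmx det_perm mulrA -expr2 sqrr_sign mul1r.
rewrite BE.
pose U : 'M[R]_k.+1 := \matrix_(i, j) if i == ord0 then 1 else if i == j then - (j%:R) else 0.
have dU : \det U = (-1) ^+ k * k`!%:R.
  rewrite -det_tr det_trig; last first.
    apply/is_trig_mxP => i j ij; rewrite !mxE.
    have -> : (j == ord0) = false by apply/negbTE; rewrite -lt0n; apply: leq_ltn_trans ij.
    by rewrite gt_eqF.
  rewrite big_ord_recl !mxE eqxx mul1r.
  under eq_bigr do rewrite !mxE /= eqxx -mulN1r.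
  rewrite big_split /= prodr_const card_ord; congr (_ * _).
  by rewrite -natr_prod fact_prod big_add1 /= big_mkord.
have -> : m2 f = \prod_j (f j).+1%:R^-1 * \det B * \det U.
  have dd : \prod_j (f j).+1%:R^-1 = \det (diag_mx (\row_j (f j).+1%:R^-1)) :> R.
    by rewrite det_diag; apply: eq_bigr => j _; rewrite mxE.
  rewrite dd -!det_mulmx; congr (\det _); apply/matrixP => i j.
  rewrite -mulmxA mul_diag_mx !mxE (bigD1 ord0) //= !mxE eqxx mulr1.
  have [j0|j0] := eqVneq j ord0.
    rewrite big1 ?addr0 ?mulr1; first by rewrite j0 addn0.
    by move=> l l0; rewrite !mxE (negPf l0) j0 (negPf l0) mulr0.
  rewrite (bigD1 j) //= big1 ?addr0; last first.
    by move=> l /andP[l0 lj]; rewrite !mxE (negPf l0) (negPf lj) mulr0.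
  rewrite !mxE (negPf j0) eqxx.
  have x0 : (f i)%:R + 1 != 0 :> R by rewrite natr1 pnatr_eq0.
  have z0 : (f i)%:R + j%:R + 1 != 0 :> R by rewrite -natrD natr1 pnatr_eq0.
  rewrite -!natr1 natrD; move: ((f i)%:R : R) (j%:R : R) x0 z0 => a c x0 z0.
  by field; rewrite x0 z0.
by rewrite dU; have := signrMK k (\prod_j (f j).+1%:R^-1 * (k`!%:R * \det B)) => <-; ring.
Qed.

(** Integrating out u leaves the functional [m1] of the antisymmetric [H]. Its signed sum is a
    multiple of [m2], which is integration against vdm v over the whole unit cube: the interlacing
    constraint is gone, at the cost of the factor (k.+1)!. *)
Lemma chain_step :
  momf (@leb R _) (fun u : 'I_k -> R => Gt (fun j => a'.+1%:R + psum u j) *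
    \prod_j (u j ^+ b'.+1 * (1 - u j) ^+ a'.+1) * vdm u ^+ 2) =
  chain_c R k a' b' * (((k.+1)`!)%:R^-1 * (-1) ^+ k) * momf (@leb R _) (fun v : 'I_k.+1 -> R => F (fun j => a'%:R + psum v j) *
    \prod_j (v j ^+ b' * (1 - v j) ^+ a') * vdm v ^+ 2).
Proof.
set C := chain_c R k a' b'.
have pfm f : pf (fun u : 'I_k -> R => (\prod_j u j * vdm u) * pmom (zmu 1 (ycons u)) f).
  apply: pf_mul; first by apply: pf_mul; [apply: pf_prod => j; apply: pf_coord|apply: pf_vdm].
  apply: pf_prod => i; apply: (@pf_mul _ _ (fun u => _) (fun u => _)); last exact: pf_const.
  apply: pf_exp; case: (unliftP ord0 i) => [i'|] ->.
    have -> : (fun u : 'I_k -> R => ycons u (lift ord0 i')) = (fun u => u i').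
      by apply/funext => u; rewrite yconsS.
    exact: pf_coord.
  have -> : (fun u : 'I_k -> R => ycons u ord0) = (fun _ => 1).
    by apply/funext => u; rewrite ycons0.
  exact: pf_const.
have [pfI It] := momf_iter0 (@leb R _) chain_pfH pfm.
transitivity (momf (@leb R _) (fun u : 'I_k -> R => C * ((\prod_j u j * vdm u) * momf (pmom (zmu 1 (ycons u))) H))).
  apply: momf_eq.
  - apply: pf_mul; last by apply: pf_exp; apply: pf_vdm.
    by apply: pf_mul; [apply: chain_pf_psum|apply: chain_pf_weight].
  - exact: pf_scale.
  (* At coinciding u both sides vanish, so the formulas that divide by vdm u are used at distinct
     points only. *)
  move=> u u1; have [v0|v0] := eqVneq (vdm u) 0.
    by rewrite v0 expr0n mulr0 mulr0 mul0r mulr0.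
  rewrite [RHS]mulrCA -chain_inner //; last exact: vdm_inj.
  rewrite expr2.
  have -> : \prod_j (u j ^+ b'.+1 * (1 - u j) ^+ a'.+1) =
     \prod_j u j * \prod_j (u j ^+ b' * (1 - u j) ^+ a'.+1).
    by rewrite -big_split; apply: eq_bigr => j _; rewrite /= exprS mulrA.
  ring.
rewrite momfZ //; rewrite -[in RHS]mulrA; congr (_ * _).
rewrite It -/m1.
have kf : ((k.+1)`!)%:R != 0 :> R by rewrite pnatr_eq0 gtn_eqF // fact_gt0.
apply: (mulfI kf); rewrite -[in RHS]mulrA (mulVKf kf).
have -> : ((k.+1)`!)%:R = #|{: {perm 'I_k.+1}}|%:R :> R.
  by rewrite card_Sn.
rewrite (@momf_antisym _ _ {perm 'I_k.+1} (fun s i => s i) (fun s i => (s^-1)%g i) (fun s => (-1) ^+ s)); first last.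
- move=> s z; rewrite /H -[z \o _]/(z \o (s^-1)%g) psum_perm vdm_perm odd_permV.
  rewrite (reindex_inj (@perm_inj _ s)) /=.
  have -> : \prod_j ((z \o (s^-1)%g) (s j) ^+ b' * (1 - (z \o (s^-1)%g) (s j)) ^+ a') =
       \prod_j (z j ^+ b' * (1 - z j) ^+ a').
    by apply: eq_bigr => j _; rewrite /= permK.
  exact: mulrCA.
- exact: chain_pfH.
- by move=> s; rewrite -expr2 sqrr_sign.
- by move=> s i; rewrite permKV.
- by move=> s i; rewrite permK.
have -> : (fun e : {ffun 'I_k.+1 -> nat} => \sum_(w : {perm 'I_k.+1}) (-1) ^+ w * m1 [ffun i => e (w i)]) =
    (fun f => \sum_(i < 1) (-1) ^+ k * m2 f).
  by apply/funext => f; rewrite m1_alt big_ord1.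
rewrite (momf_msum (index_enum 'I_1) predT (fun _ => m2)); last exact: chain_pfH.
rewrite big_ord1; congr (_ * _).
have [l Hl] := chain_pfH.
rewrite (momfE _ chain_pfH (l := l)) //.
transitivity (momf (@leb R _) (fun v => \sum_(t <- l) t.1 * (mono t.2 v * vdm v))).
  rewrite momf_sum => [|t]; last by apply: pf_scale; apply: pf_mul; [apply: pf_mono|apply: pf_vdm].
  apply: eq_bigr => t _; rewrite momfZ; last by apply: pf_mul; [apply: pf_mono|apply: pf_vdm].
  congr (_ * _).
  have -> : (fun v : 'I_k.+1 -> R => mono t.2 v * vdm v) =
     (fun v => (\prod_j ('X^(t.2 j) : {poly R}).[v j]) * vdm v).
    by apply/funext => v; congr (_ * _); apply: eq_bigr => j _; rewrite hornerXn.
  rewrite /leb (momf_prod_vdm _ (fun j => 'X^(t.2 j))) /m2; congr (\det _).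
  by apply/matrixP => i j; rewrite !mxE -exprD linXn.
congr momf; apply/funext => v; rewrite expr2 mulrA -/(H v) Hl mulr_suml.
by apply: eq_bigr => t _; rewrite mulrA.
Qed.

End ChainStep.

Section RealStep.
Variables (R : realType) (n a : nat) (b : R) (F Gt : (nat -> R) -> R).
Hypotheses (b0 : 0 < b) (TPF : TP F) (TPG : TP Gt).
Hypothesis HG : step_spec (b + n%:R) 2 F Gt.

(** One of the two factors vdm y of the Jacobi weight is cancelled by the normalization of the
    Dixon-Anderson functional, which leaves vdm y times vdm z. *)
Definition yzfun (s : 'I_n + 'I_n -> R) : R :=
  F (psum s) * \prod_i s (inl i) ^+ a * vdm (s \o inl) * vdm (s \o inr).

(* Moments of the weight x^(-b) z^(b-1) on the chamber 1 > x_0 > z_0 > x_1 > ... > 0. *)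
Definition nmom (e : {ffun 'I_n + 'I_n -> nat}) : R :=
  nest (fun i => (e (inl i))%:R - b + 1) (fun j => (e (inr j))%:R + b).

(** The moments of y_j^(-b) z_j^(b-1) over 0 < z_j < y_j < 1, independently for each j. *)
Definition tmom (e : {ffun 'I_n + 'I_n -> nat}) : R :=
  \prod_j (((e (inr j))%:R + b) * ((e (inl j) + e (inr j)).+1%:R))^-1.

Lemma pf_comp_inj (I J : finType) (f : J -> I) (g : (J -> R) -> R) :
  pf g -> pf (fun s : I -> R => g (s \o f)).
Proof.
move=> [l Hl].
have -> : (fun s : I -> R => g (s \o f)) = (fun s => \sum_(t <- l) t.1 * \prod_j s (f j) ^+ t.2 j).
  by apply/funext => s; rewrite Hl.
by apply: pf_sum => t; apply: pf_scale; apply: pf_prod => j; apply: pf_exp; apply: pf_coord.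
Qed.

Lemma pf_yzfun : pf yzfun.
Proof.
apply: pf_mul; last by apply: pf_comp_inj; apply: pf_vdm.
apply: pf_mul; last by apply: pf_comp_inj; apply: pf_vdm.
apply: pf_mul.
  by apply: (pf_TP (p := fun j s => psum s j) TPF) => j; apply: pf_psum.
by apply: pf_prod => i; apply: pf_exp; apply: pf_coord.
Qed.

Lemma psum_join (y z : 'I_n -> R) : psum (join y z) = fun j => psum y j + psum z j.
Proof. by apply/funext => j; rewrite /psum big_sumType. Qed.

Lemma real_inner (y : 'I_n -> R) : (forall i, 1 < y i) -> injective y ->
  Gt (psum y) * \prod_j (y j ^+ a) * vdm y ^+ 2 =
  \prod_(i < n) (i%:R + b) * momf (pmom (zmu b y)) (fun z => yzfun (join y z)).
Proof.
move=> y1 yi.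
have y0 j : y j != 0 by rewrite gt_eqF // (lt_trans _ (y1 j)).
have := dexp_good (znode_inj yi y0) (zwt_gt0 b0) (@zmu_wder _ _ _ y b0) [::].
rewrite zwt_sum /= addr0 => gL; have := HG gL.
set d := znode y; set mu := zmu b y; set wt := zwt b.
have bpE j : (0 < j)%N -> bpow d wt [::] j = psum y j.
  move=> j0; rewrite /bpow big_ord_recl /d /znode unlift_none expr0n gtn_eqF // mulr0 add0r.
  by apply: eq_bigr => i _; rewrite /wt /zwt liftK addr0 mul1r.
rewrite (TP_ext (q := psum y) TPG bpE) !divr1.
have w0 z : wmono d [::] z = 1 by rewrite /wmono big_nil.
have -> : dexp mu (fun z => wmono d [::] z * Gt (psum y)) = Gt (psum y).
  have -> : (fun z => wmono d [::] z * Gt (psum y)) = (fun z => Gt (psum y) * wmono d [::] z).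
    by apply/funext => z; rewrite mulrC.
  rewrite dexpZ; last exact: pf_wmono.
  by rewrite (dexp_wval (znode_inj yi y0) (zwt_gt0 b0) (@zmu_wder _ _ _ y b0) (zmu_nondeg b0 yi)) mulr1.
move=> <-; rewrite /dexp zmu_det.
have pfin : pf (fun z : 'I_n -> R => F (fun j => psum y j + psum z j) * vdm z).
  apply: pf_mul; last exact: pf_vdm.
  apply: (pf_TP (p := fun j z => psum y j + psum z j) TPF) => j.
  by apply: pf_add; [apply: pf_const|apply: pf_psum].
have -> : (fun z => wmono d [::] z * F (fun j => 2 * bpow d wt [::] j + newt (btau d z) j) * vdm z) =
    (fun z => F (fun j => psum y j + psum z j) * vdm z).
  apply/funext => z; rewrite w0 mul1r; congr (_ * _); apply: TP_ext => // j j0.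
  rewrite bpE // -(zdexp_newt yi y0 z j0) addrA; congr (_ + _).
  by rewrite mulr_natl mulr2n.
have -> : (fun z => yzfun (join y z)) =
   (fun z => (\prod_j (y j ^+ a) * vdm y) * (F (fun j => psum y j + psum z j) * vdm z)).
  by apply/funext => z; rewrite /yzfun psum_join -[join y z \o inl]/y -[join y z \o inr]/z; ring.
rewrite momfZ //.
have v0 := inj_vdm yi.
have N0 : \prod_(i < n) (i%:R + b) != 0.
  by apply/prodf_neq0 => i _; rewrite gt_eqF // ltr_wpDl.
move: (momf _ _) => h; move: (vdm y) (\prod_(i < n) _) v0 N0 => v N v0 N0.
by field; rewrite v0 N0.
Qed.

Lemma tmomE (e : {ffun 'I_n + 'I_n -> nat}) : momf (@leb R _) (fun y => mono [ffun i => e (inl i)] y *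
   pmom (zmu b y) [ffun j => e (inr j)]) = tmom e.
Proof.
have -> : (fun y => mono [ffun i => e (inl i)] y * pmom (zmu b y) [ffun j => e (inr j)]) =
   (fun y : 'I_n -> R => (\prod_j ((e (inr j))%:R + b)^-1) * mono [ffun j => (e (inl j) + e (inr j))%N] y).
  apply/funext => y; rewrite /mono /pmom /zmu -!big_split; apply: eq_bigr => j _ /=.
  by rewrite !ffunE exprD mulrA mulrC.
rewrite momfZ ?momf_mono; last exact: pf_mono.
rewrite /leb /pmom /tmom -big_split; apply: eq_bigr => j _ /=.
by rewrite ffunE invfM.
Qed.

Let W := ({perm 'I_n} * {perm 'I_n})%type.
Let hw (w : W) (s : 'I_n + 'I_n) : 'I_n + 'I_n :=
  match s with inl i => inl (w.1 i) | inr j => inr (w.2 j) end.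
Let gw (w : W) (s : 'I_n + 'I_n) : 'I_n + 'I_n :=
  match s with inl i => inl ((w.1^-1)%g i) | inr j => inr ((w.2^-1)%g j) end.
Let sg (w : W) : R := (-1) ^+ w.1 * (-1) ^+ w.2.

Let al (e : {ffun 'I_n + 'I_n -> nat}) (i : 'I_n) : R := (e (inl i))%:R - b + 1.
Let be (e : {ffun 'I_n + 'I_n -> nat}) (j : 'I_n) : R := (e (inr j))%:R + b.

(** In al_i + be_j the parameter b cancels and a positive integer remains, so [nest_alt] applies
    although al_i may be negative. *)
Lemma nmom_alt (e : {ffun 'I_n + 'I_n -> nat}) : \sum_w sg w * nmom [ffun i => e (hw w i)] = \det (cauchymx (al e) (be e)).
Proof.
rewrite -nest_alt; last 2 first.
- by move=> j; rewrite /be ltr_wpDl.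
- move=> i j; rewrite /al /be.
  have -> : (e (inl i))%:R - b + 1 + ((e (inr j))%:R + b) = (e (inl i) + e (inr j)).+1%:R.
    by rewrite -natr1 natrD; ring.
  by rewrite ltr0n.
rewrite pair_big; apply: eq_bigr => w _; rewrite /sg /nmom; congr (_ * nest _ _).
- by apply/funext => i; rewrite ffunE.
- by apply/funext => i; rewrite ffunE.
Qed.

(** After reordering of its factors, the product depends on the two permutations only through their
    quotient; the sum is n! times a Leibniz expansion. *)
Lemma tmom_alt (e : {ffun 'I_n + 'I_n -> nat}) : \sum_w sg w * tmom [ffun i => e (hw w i)] = n`!%:R * \det (cauchymx (al e) (be e)).
Proof.
pose C i j : R := (be e j * (al e i + be e j))^-1.
have -> : \sum_w sg w * tmom [ffun i => e (hw w i)] =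
   \sum_(t : {perm 'I_n}) \sum_(s : {perm 'I_n}) (-1) ^+ s * (-1) ^+ t * \prod_j C (s j) (t j).
  rewrite exchange_big pair_big; apply: eq_bigr => w _; congr (_ * _).
  apply: eq_bigr => j _; rewrite !ffunE /C /al /be /=; congr ((_ * _)^-1).
  by rewrite -natr1 natrD; ring.
rewrite -card_Sn -sumr_const mulr_suml; apply: eq_bigr => t _; rewrite mul1r.
have tinj : injective (fun u : {perm 'I_n} => (t * u^-1)%g).
  by move=> u v /mulgI /invg_inj.
rewrite [LHS](reindex_inj tinj) /=; apply: eq_bigr => u _.
rewrite odd_permM odd_permV signr_addb (mulrC ((-1) ^+ t * _)) mulrA -expr2 sqrr_sign mul1r; congr (_ * _).
rewrite (reindex_inj (@perm_inj _ (u * t^-1)%g)) /=; apply: eq_bigr => i _.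
by rewrite mxE /C !permM permKV permK.
Qed.

Lemma Wcard : #|{: W}|%:R != 0 :> R.
Proof. by rewrite pnatr_eq0 card_prod muln_eq0 negb_or -!lt0n !card_Sn fact_gt0. Qed.

Lemma yz_antisym (m : {ffun 'I_n + 'I_n -> nat} -> R) : #|{: W}|%:R * momf m yzfun =
  momf (fun e : {ffun 'I_n + 'I_n -> nat} => \sum_w sg w * m [ffun i => e (hw w i)]) yzfun.
Proof.
apply: (momf_antisym (g := gw)).
- by move=> w [i|i] /=; rewrite permK.
- by move=> w [i|i] /=; rewrite permKV.
- by move=> w; rewrite /sg mulrACA -!expr2 !sqrr_sign mulr1.
- exact: pf_yzfun.
move=> w s; rewrite /yzfun.
have -> : psum (s \o gw w) = psum s.
  apply/funext => j; rewrite /psum !big_sumType /=; congr (_ + _).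
    by rewrite [RHS](reindex_inj (@perm_inj _ (w.1^-1)%g)).
  by rewrite [RHS](reindex_inj (@perm_inj _ (w.2^-1)%g)).
have -> : \prod_i (s \o gw w) (inl i) ^+ a = \prod_i s (inl i) ^+ a.
  by rewrite [RHS](reindex_inj (@perm_inj _ (w.1^-1)%g)).
have -> : (s \o gw w) \o inl = (s \o inl) \o (w.1^-1)%g by [].
have -> : (s \o gw w) \o inr = (s \o inr) \o (w.2^-1)%g by [].
rewrite !vdm_perm !odd_permV /sg.
move: (F _) (vdm (s \o inl)) (vdm (s \o inr)) (\prod_i _) ((-1) ^+ w.1) ((-1) ^+ w.2).
by move=> u1 u2 u3 u4 u5 u6; ring.
Qed.

(** The product functional [tmom] and the chamber functional [nmom] differ on monomials, but their
    signed sums over the permutations of y and of z are the same Cauchy determinant up to n!. *)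
Lemma real_step :
  momf (@leb R _) (fun y : 'I_n -> R => Gt (psum y) * \prod_j (y j ^+ a) * vdm y ^+ 2) =
  \prod_(i < n) (i%:R + b) * n`!%:R * momf nmom yzfun.
Proof.
have pfm f : pf (fun y : 'I_n -> R => pmom (zmu b y) f).
  apply: pf_prod => j; apply: (@pf_mul _ _ (fun y => _) (fun y => _)); last exact: pf_const.
  by apply: pf_exp; apply: pf_coord.
have [pfI It] := momf_iter (@leb R _) pf_yzfun pfm.
transitivity (momf (@leb R _) (fun y : 'I_n -> R =>
   \prod_(i < n) (i%:R + b) * momf (pmom (zmu b y)) (fun z => yzfun (join y z)))).
  apply: momf_eq.
  - apply: pf_mul; last by apply: pf_exp; apply: pf_vdm.
    apply: pf_mul; first by apply: (pf_TP (p := fun j s => psum s j) TPG) => j; apply: pf_psum.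
    by apply: pf_prod => i; apply: pf_exp; apply: pf_coord.
  - exact: pf_scale.
  move=> y y1; have [v0|v0] := eqVneq (vdm y) 0; last by apply: real_inner => //; apply: vdm_inj.
  rewrite v0 expr0n mulr0.
  have -> : (fun z => yzfun (join y z)) = (fun z => 0 * 1).
    by apply/funext => z; rewrite /yzfun -[join y z \o inl]/y v0 mulr0 !mul0r.
  by rewrite momfZ ?mul0r ?mulr0 //; apply: pf_const.
rewrite momfZ // It -mulrA; congr (_ * _).
have -> : (fun e : {ffun 'I_n + 'I_n -> nat} => momf (@leb R _) (fun y => mono [ffun i => e (inl i)] y * pmom (zmu b y) [ffun j => e (inr j)])) = tmom.
  by apply/funext => e; rewrite tmomE.
apply: (mulfI Wcard); rewrite mulrCA !yz_antisym.
have -> : (fun e : {ffun 'I_n + 'I_n -> nat} => \sum_w sg w * tmom [ffun i => e (hw w i)]) =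
   (fun e => \sum_(i < 1) n`!%:R * \det (cauchymx (al e) (be e))).
  by apply/funext => e; rewrite tmom_alt big_ord1.
rewrite (momf_msum (index_enum 'I_1) predT (fun _ e => \det (cauchymx (al e) (be e)))); last exact: pf_yzfun.
rewrite big_ord1; congr (_ * momf _ _).
by apply/funext => e; rewrite nmom_alt.
Qed.

End RealStep.

(** * Haar distributed unitary matrices *)

Definition adj (C : numClosedFieldType) m n (A : 'M[C]_(m, n)) : 'M[C]_(n, m) := map_mx Num.conj A^T.

Section Adjoint.
Variable C : numClosedFieldType.

Lemma adjE m n (A : 'M[C]_(m, n)) i j : adj A i j = Num.conj (A j i).
Proof. by rewrite !mxE. Qed.

Lemma adjK m n (A : 'M[C]_(m, n)) : adj (adj A) = A.
Proof. by apply/matrixP => i j; rewrite !adjE conjCK. Qed.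

Lemma adj_mul m n p (A : 'M[C]_(m, n)) (B : 'M[C]_(n, p)) : adj (A *m B) = adj B *m adj A.
Proof. by rewrite /adj trmx_mul map_mxM. Qed.

Lemma adj1 n : adj (1%:M : 'M[C]_n) = 1%:M.
Proof. by rewrite /adj trmx1 map_mx1. Qed.

Lemma adjD m n (A B : 'M[C]_(m, n)) : adj (A + B) = adj A + adj B.
Proof. by rewrite /adj linearD map_mxD. Qed.

Lemma adjB m n (A B : 'M[C]_(m, n)) : adj (A - B) = adj A - adj B.
Proof. by rewrite /adj linearB map_mxB. Qed.

Lemma adjZ m n c (A : 'M[C]_(m, n)) : adj (c *: A) = Num.conj c *: adj A.
Proof. by apply/matrixP => i j; rewrite !mxE rmorphM. Qed.

Lemma adj_exp n (A : 'M[C]_n) i : adj (A ^+ i) = adj A ^+ i.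
Proof.
elim: i => [|i IH]; first by rewrite !expr0 adj1.
by rewrite exprS exprSr -!mulmxE adj_mul IH.
Qed.

Lemma unitary_adj m n (A : 'M[C]_(m, n)) : (A \is unitarymx) <-> A *m adj A = 1%:M.
Proof. by split => /unitarymxP. Qed.

Lemma adj_unitary n (A : 'M[C]_n) : A \is unitarymx -> adj A *m A = 1%:M.
Proof. by move=> /unitary_adj; apply: mulmx1C. Qed.

Lemma conj_exp n (V A : 'M[C]_n) i : V \is unitarymx -> (V *m A *m adj V) ^+ i = V *m A ^+ i *m adj V.
Proof.
move=> HV; elim: i => [|i IH]; first by rewrite !expr0 mulmx1; apply/esym/unitary_adj.
rewrite !exprS IH -!mulmxE -!mulmxA; congr (_ *m (_ *m _)).
by rewrite !mulmxA adj_unitary // mul1mx.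
Qed.

Lemma mxtrace_conj n (V A : 'M[C]_n) : V \is unitarymx -> \tr (V *m A *m adj V) = \tr A.
Proof. by move=> HV; rewrite -mulmxA mxtrace_mulC -mulmxA adj_unitary // mulmx1. Qed.

(** Gram-Schmidt applied to a matrix all of whose rows are u: the other rows come from the
    completion, and the positivity of the first inner product excludes a phase. *)
Lemma unitary_first_row n (u : 'rV[C]_n.+1) : u *m adj u = 1%:M ->
  exists2 V : 'M[C]_n.+1, V \is unitarymx & row 0 V = u.
Proof.
move=> uu.
pose A : 'M[C]_n.+1 := \matrix_(i, j) u 0 j.
have rA : row 0 A = u by apply/rowP => j; rewrite !mxE.
have VU : schmidt A \is unitarymx by apply: schmidt_unitarymx.
exists (schmidt A) => //; set v := row 0 (schmidt A).
have : (u <= v)%MS.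
  have := row_schmidt_sub A 0; rewrite rA => /submx_trans; apply.
  apply/sumsmx_subP => k; rewrite leqn0 => k0; rewrite genmxE /v.
  by have -> : k = 0 by apply/val_inj/eqP.
case/sub_rVP => c uc.
have vv : v *m adj v = 1%:M.
  have /unitary_adj := VU => /matrixP /(_ 0 0); rewrite !mxE eqxx => H.
  apply/matrixP => i j; rewrite !ord1 !mxE eqxx -[RHS]H.
  by apply: eq_bigr => k _; rewrite !mxE.
have := form1_row_schmidt A 0; rewrite rA -/v dotmxE -/(adj v) {1}uc -scalemxAl vv !mxE eqxx mulr1 => c0.
move: uu; rewrite uc adjZ -scalemxAl -scalemxAr scalerA vv => /matrixP /(_ 0 0).
rewrite !mxE eqxx mulr1 -normCK => /eqP; rewrite sqrp_eq1 // ger0_norm // => /eqP ->.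
by rewrite scale1r.
Qed.

(** U acts as V on the range of the adjoint of F and as the identity on its orthogonal complement. A
    conjugation of the compressed matrix by V is thereby realized as a left multiplication of S. *)
Lemma unitary_extend m n (F : 'M[C]_(m, n)) (V : 'M[C]_m) : F *m adj F = 1%:M -> V \is unitarymx ->
  exists2 U : 'M[C]_n, U \is unitarymx & F *m U = V *m F.
Proof.
move=> FF HV.
have FQ : F *m (1%:M - adj F *m F) = 0 by rewrite mulmxBr mulmx1 mulmxA FF mul1mx subrr.
have QF : (1%:M - adj F *m F) *m adj F = 0 by rewrite mulmxBl mul1mx -mulmxA FF mulmx1 subrr.
exists (adj F *m V *m F + (1%:M - adj F *m F)); last first.
  by rewrite mulmxDr FQ addr0 !mulmxA FF mul1mx.
apply/unitary_adj; rewrite adjD adjB adj1 !adj_mul adjK.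
rewrite mulmxDr (mulmxDl _ _ (adj F *m _)) (mulmxDl _ _ (1%:M - _)).
have -> : adj F *m V *m F *m (adj F *m (adj V *m F)) = adj F *m F.
  rewrite -!mulmxA (mulmxA F (adj F)) FF mul1mx (mulmxA V); congr (_ *m _).
  by have /unitary_adj -> := HV; rewrite mul1mx.
have -> : (1%:M - adj F *m F) *m (adj F *m (adj V *m F)) = 0 by rewrite (mulmxA _ (adj F)) QF mul0mx.
have -> : adj F *m V *m F *m (1%:M - adj F *m F) = 0 by rewrite -mulmxA FQ mulmx0.
by rewrite add0r addr0 mulmxBr mulmx1 mulmxA QF mul0mx subr0 addrC subrK.
Qed.
End Adjoint.

Section HaarFunctional.
Variable R : realType.
Local Notation C := R[i].

Inductive MP N : ('M[C]_N -> R) -> Prop :=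
| MP_const c : MP (fun _ => c)
| MP_re i j : MP (fun S => complex.Re (S i j))
| MP_im i j : MP (fun S => complex.Im (S i j))
| MP_add f g : MP f -> MP g -> MP (fun S => f S + g S)
| MP_mul f g : MP f -> MP g -> MP (fun S => f S * g S).

(** What the argument uses of the Haar expectation, on polynomials in the entries only: linearity,
    left invariance, and dependence on the values at unitary matrices alone. *)
Record haarE N (E : ('M[C]_N -> R) -> R) : Prop := HaarE {
  haarD : forall f g, MP f -> MP g -> E (fun S => f S + g S) = E f + E g;
  haarZ : forall c f, MP f -> E (fun S => c * f S) = c * E f;
  haarU : forall U f, U \is unitarymx -> MP f -> E (fun S => f (U *m S)) = E f;
  haar_eq : forall f g, MP f -> MP g -> (forall S, S \is unitarymx -> f S = g S) -> E f = E g }.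

(** A common interface for closure under sums and products, instantiated with polynomials in the
    entries, measurable functions, bounded functions, bounded measurable functions and the
    multipliers [Adm]. *)
Record falg (T : Type) (A : (T -> R) -> Prop) : Prop := Falg {
  fa_const : forall c, A (fun _ => c);
  fa_add : forall f g, A f -> A g -> A (fun x => f x + g x);
  fa_mul : forall f g, A f -> A g -> A (fun x => f x * g x) }.

Section FunAlgebra.
Variables (T : Type) (A : (T -> R) -> Prop).
Hypothesis hA : falg A.

Lemma fa_opp f : A f -> A (fun x => - f x).
Proof.
move=> H; have -> : (fun x => - f x) = (fun x => -1 * f x).
  by apply/funext => x; rewrite mulN1r.
by apply: (fa_mul hA) => //; apply: (fa_const hA).
Qed.

Lemma fa_sum (I : Type) (r : seq I) (P : pred I) (F : I -> T -> R) :
  (forall i, A (F i)) -> A (fun x => \sum_(i <- r | P i) F i x).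
Proof.
move=> H; elim: r => [|i r IH].
  have -> : (fun x => \sum_(i <- [::] | P i) F i x) = (fun _ => 0).
    by apply/funext => x; rewrite big_nil.
  exact: (fa_const hA).
case Pi : (P i).
  have -> : (fun x => \sum_(i <- i :: r | P i) F i x) = (fun x => F i x + \sum_(i <- r | P i) F i x).
    by apply/funext => x; rewrite big_cons Pi.
  exact: (fa_add hA).
by have -> : (fun x => \sum_(i <- i :: r | P i) F i x) = (fun x => \sum_(i <- r | P i) F i x)
  by apply/funext => x; rewrite big_cons Pi.
Qed.

Lemma fa_prod (I : Type) (r : seq I) (P : pred I) (F : I -> T -> R) :
  (forall i, A (F i)) -> A (fun x => \prod_(i <- r | P i) F i x).
Proof.
move=> H; elim: r => [|i r IH].
  have -> : (fun x => \prod_(i <- [::] | P i) F i x) = (fun _ => 1).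
    by apply/funext => x; rewrite big_nil.
  exact: (fa_const hA).
case Pi : (P i).
  have -> : (fun x => \prod_(i <- i :: r | P i) F i x) = (fun x => F i x * \prod_(i <- r | P i) F i x).
    by apply/funext => x; rewrite big_cons Pi.
  exact: (fa_mul hA).
by have -> : (fun x => \prod_(i <- i :: r | P i) F i x) = (fun x => \prod_(i <- r | P i) F i x)
  by apply/funext => x; rewrite big_cons Pi.
Qed.

Lemma fa_exp f k : A f -> A (fun x => f x ^+ k).
Proof.
move=> H; have -> : (fun x => f x ^+ k) = (fun x => \prod_(i < k) f x).
  by apply/funext => x; rewrite prodr_const card_ord.
exact: fa_prod.
Qed.

Lemma fa_TP Psi (p : nat -> T -> R) : TP Psi -> (forall j, A (p j)) ->
  A (fun x => Psi (fun j => p j x)).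
Proof.
move=> TPs Hp; elim: TPs => [c|j _|F G _ HF _ HG|F G _ HF _ HG].
- exact: (fa_const hA).
- exact: Hp.
- exact: (fa_add hA).
- exact: (fa_mul hA).
Qed.

Lemma fa_TP2 Psi (p t : nat -> T -> R) : TP2 Psi -> (forall j, A (p j)) -> (forall j, A (t j)) ->
  A (fun x => Psi (fun j => p j x) (fun j => t j x)).
Proof.
move=> TPs Hp Ht; elim: TPs => [c|j _|j _|F G _ HF _ HG|F G _ HF _ HG].
- exact: (fa_const hA).
- exact: Hp.
- exact: Ht.
- exact: (fa_add hA).
- exact: (fa_mul hA).
Qed.

Definition CA (f : T -> C) := A (fun x => complex.Re (f x)) /\ A (fun x => complex.Im (f x)).

Lemma CA_const c : CA (fun _ => c).
Proof. by split; apply: (fa_const hA). Qed.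

Lemma CA_add f g : CA f -> CA g -> CA (fun x => f x + g x).
Proof.
move=> [f1 f2] [g1 g2]; split.
  have -> : (fun x => complex.Re (f x + g x)) = (fun x => complex.Re (f x) + complex.Re (g x)).
    by apply/funext => x; case: (f x) (g x) => ? ? [? ?].
  exact: (fa_add hA).
have -> : (fun x => complex.Im (f x + g x)) = (fun x => complex.Im (f x) + complex.Im (g x)).
  by apply/funext => x; case: (f x) (g x) => ? ? [? ?].
exact: (fa_add hA).
Qed.

Lemma CA_mul f g : CA f -> CA g -> CA (fun x => f x * g x).
Proof.
move=> [f1 f2] [g1 g2]; split.
  have -> : (fun x => complex.Re (f x * g x)) =
      (fun x => complex.Re (f x) * complex.Re (g x) + - (complex.Im (f x) * complex.Im (g x))).
    by apply/funext => x; case: (f x) (g x) => ? ? [? ?].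
  by apply: (fa_add hA); [apply: (fa_mul hA)|apply: fa_opp; apply: (fa_mul hA)].
have -> : (fun x => complex.Im (f x * g x)) =
   (fun x => complex.Re (f x) * complex.Im (g x) + complex.Im (f x) * complex.Re (g x)).
  by apply/funext => x; case: (f x) (g x) => ? ? [? ?].
by apply: (fa_add hA); apply: (fa_mul hA).
Qed.

Lemma CA_conj f : CA f -> CA (fun x => Num.conj (f x)).
Proof.
move=> [f1 f2]; split.
  by have -> : (fun x => complex.Re (Num.conj (f x))) = (fun x => complex.Re (f x))
    by apply/funext => x; case: (f x).
have -> : (fun x => complex.Im (Num.conj (f x))) = (fun x => - complex.Im (f x)).
  by apply/funext => x; case: (f x).
exact: fa_opp.
Qed.

Lemma CA_sum (I : Type) (r : seq I) (F : I -> T -> C) :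
  (forall i, CA (F i)) -> CA (fun x => \sum_(i <- r) F i x).
Proof.
move=> H; elim: r => [|i r IH].
  have -> : (fun x => \sum_(i <- [::]) F i x) = (fun _ => 0).
    by apply/funext => x; rewrite big_nil.
  exact: CA_const.
have -> : (fun x => \sum_(i <- i :: r) F i x) = (fun x => F i x + \sum_(i <- r) F i x).
  by apply/funext => x; rewrite big_cons.
exact: CA_add.
Qed.

Definition MA p q (M : T -> 'M[C]_(p, q)) := forall i j, CA (fun x => M x i j).

Lemma MA_const p q (M : 'M[C]_(p, q)) : MA (fun _ => M).
Proof. by move=> i j; apply: CA_const. Qed.

Lemma MA_mul p q r (M : T -> 'M[C]_(p, q)) (M' : T -> 'M[C]_(q, r)) :
  MA M -> MA M' -> MA (fun x => M x *m M' x).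
Proof.
move=> HM HM' i j.
have -> : (fun x => (M x *m M' x) i j) = (fun x => \sum_k M x i k * M' x k j).
  by apply/funext => x; rewrite mxE.
by apply: CA_sum => k; apply: CA_mul.
Qed.

Lemma MA_adj p q (M : T -> 'M[C]_(p, q)) : MA M -> MA (fun x => adj (M x)).
Proof.
move=> HM i j.
have -> : (fun x => adj (M x) i j) = (fun x => Num.conj (M x j i)).
  by apply/funext => x; rewrite adjE.
exact: CA_conj.
Qed.

Lemma MA_exp p (M : T -> 'M[C]_p) i : MA M -> MA (fun x => M x ^+ i).
Proof.
move=> HM; elim: i => [|i IH]; first exact: MA_const.
have -> : (fun x => M x ^+ i.+1) = (fun x => M x *m M x ^+ i).
  by apply/funext => x; rewrite exprS mulmxE.
exact: MA_mul.
Qed.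

Lemma CA_tr p (M : T -> 'M[C]_p) : MA M -> CA (fun x => \tr (M x)).
Proof. by move=> HM; apply: CA_sum => i; apply: HM. Qed.

End FunAlgebra.

Section Closure.
Variable N : nat.

Lemma MP_falg : falg (@MP N).
Proof. by split; [exact: MP_const|exact: MP_add|exact: MP_mul]. Qed.

Definition MP_sum := @fa_sum _ _ MP_falg.
Definition MP_prod := @fa_prod _ _ MP_falg.
Definition MP_TP := @fa_TP _ _ MP_falg.
Definition MP_TP2 := @fa_TP2 _ _ MP_falg.
Definition MPC_const := @CA_const _ _ MP_falg.
Definition MPC_mul := @CA_mul _ _ MP_falg.
Definition MPM_const := @MA_const _ _ MP_falg.
Definition MPM_mul := @MA_mul _ _ MP_falg.
Definition MPM_adj := @MA_adj _ _ MP_falg.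
Definition MPM_exp := @MA_exp _ _ MP_falg.
Definition MPC_tr := @CA_tr _ _ MP_falg.

Lemma MPM_id : MA (@MP N) id.
Proof. by move=> i j; split; [apply: MP_re|apply: MP_im]. Qed.

Lemma MP_compU U (f : 'M[C]_N -> R) : MP f -> MP (fun S => f (U *m S)).
Proof.
have H : MA (@MP N) (fun S : 'M[C]_N => U *m S) by apply: MPM_mul; [apply: MPM_const|apply: MPM_id].
elim=> [c|i j|i j|{}f g _ Hf _ Hg|{}f g _ Hf _ Hg].
- exact: MP_const.
- by case: (H i j).
- by case: (H i j).
- exact: MP_add.
- exact: MP_mul.
Qed.

End Closure.


(** A word perturbed to second order; the factor 2 is there because the nested [rsum] counts ordered
    pairs. *)
Lemma coef2_word (w : seq nat) (a b c : nat -> R) :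
  [/\ (\prod_(i <- w) ((a i)%:P + b i *: 'X + c i *: 'X^2))`_0 = wprod a w,
      (\prod_(i <- w) ((a i)%:P + b i *: 'X + c i *: 'X^2))`_1 = rsum (fun i r => b i * wprod a r) w &
      2 * (\prod_(i <- w) ((a i)%:P + b i *: 'X + c i *: 'X^2))`_2 =
      2 * rsum (fun i r => c i * wprod a r) w +
      rsum (fun i r => rsum (fun k r' => b i * b k * wprod a r') r) w].
Proof.
elim: w => [|x w [IH0 IH1 IH2]].
  by rewrite /wprod !big_nil !coef1 /= mulr0 addr0.
rewrite !big_cons.
set Q := \prod_(i <- w) _ in IH0 IH1 IH2 *.
have E k : ((a x)%:P + b x *: 'X + c x *: 'X^2)`_k = a x *+ (k == 0%N) + b x *+ (k == 1%N) + c x *+ (k == 2%N).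
  by rewrite !coefD coefC !coefZ coefX coefXn; case: k => [|[|[|k]]] /=; rewrite ?mulr0 ?mulr1.
have wc s : wprod a (x :: s) = a x * wprod a s by rewrite /wprod big_cons.
rewrite !coefM !big_ord_recl !big_ord0 !E /= !subn0 ?subSS ?subn0 IH0 IH1.
split.
- by rewrite wc; ring.
- rewrite /=.
  have -> : rsum (fun y r => b y * wprod a (x :: r)) w = a x * rsum (fun i r => b i * wprod a r) w.
    by rewrite rsum_mull; apply: eq_rsum => y r; rewrite wc mulrCA.
  by rewrite !mulr0n !mulr1n; ring.
rewrite /=.
have -> : rsum (fun y r => c y * wprod a (x :: r)) w = a x * rsum (fun y r => c y * wprod a r) w.
  by rewrite rsum_mull; apply: eq_rsum => y r; rewrite wc mulrCA.
have -> : rsum (fun k r' => b x * b k * wprod a r') w = b x * rsum (fun i r => b i * wprod a r) w.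
  by rewrite rsum_mull; apply: eq_rsum => y r; rewrite mulrA.
have -> : rsum (fun y r => b y * b x * wprod a r + rsum (fun y0 r0 => b y * b y0 * wprod a (x :: r0)) r) w =
   b x * rsum (fun i r => b i * wprod a r) w +
   a x * rsum (fun i r => rsum (fun k r' => b i * b k * wprod a r') r) w.
  rewrite !rsum_mull -rsumD; apply: eq_rsum => y r; congr (_ + _); first by ring.
  by rewrite rsum_mull; apply: eq_rsum => z r'; rewrite wc; ring.
move: IH2; move: (rsum _ w) (rsum _ w) (rsum _ w) (Q`_2) => r1 r2 r3 q H.
rewrite /= !mulr0n !mulr1n !addr0 !add0r.
rewrite !mulrDr (mulrCA 2 (a x)) H; ring.
Qed.


Lemma poly_ext (p q : {poly R}) : (forall x, p.[x] = q.[x]) -> p = q.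
Proof.
move=> H; apply/eqP; rewrite -subr_eq0; apply/negPn/negP => pq0.
have := max_poly_roots (rs := [seq i%:R | i <- iota 0 (size (p - q))]) pq0.
rewrite size_map size_iota ltnn => F; have {F} : false; last by [].
apply: F; first by apply/allP => x _; rewrite /root !hornerE H subrr.
by rewrite map_inj_uniq ?iota_uniq // => i j /eqP; rewrite eqr_nat => /eqP.
Qed.

Lemma coef2_norm K : [/\ ((1 + 'X^2) ^+ K : {poly R})`_0 = 1, ((1 + 'X^2) ^+ K : {poly R})`_1 = 0 &
  ((1 + 'X^2) ^+ K : {poly R})`_2 = K%:R].
Proof.
elim: K => [|K [I0 I1 I2]]; first by rewrite !expr0 !coef1.
have E k : (1 + 'X^2 : {poly R})`_k = (k == 0%N)%:R + (k == 2%N)%:R by rewrite coefD coef1 coefXn.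
rewrite exprS !coefM !big_ord_recl !big_ord0 !E /= !subn0 ?subSS ?subn0 I0 I1 I2 /=.
by rewrite -nat1r; split; ring.
Qed.

Lemma re_quad (zeta x0 x x1 : C) (eps : R) : zeta * Num.conj zeta = 1 ->
  complex.Re (x0 + eps%:C%C * Num.conj zeta * Num.conj x + (x + eps%:C%C * Num.conj zeta * x1) * (eps%:C%C * zeta)) =
  complex.Re x0 + 2 * complex.Re (zeta * x) * eps + complex.Re x1 * (eps * eps).
Proof.
case: zeta x0 x x1 => [z1 z2] [a1 a2] [a3 a4] [a5 a6] /(congr1 (@complex.Re R)) /=.
move=> zz.
have -> : a5 * (eps * eps) = a5 * (eps * eps) * (z1 * z1 - z2 * - z2) by rewrite zz mulr1.
by ring.
Qed.

Lemma size_word (a b c : nat -> R) w :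
  (size (\prod_(i <- w) ((a i)%:P + b i *: 'X + c i *: 'X^2) : {poly R})%R <= (2 * size w).+1)%N.
Proof.
elim: w => [|x w IH]; first by rewrite big_nil size_poly1.
rewrite big_cons (leq_trans (size_polyMleq _ _)) //.
have : (size ((a x)%:P + b x *: 'X + c x *: 'X^2 : {poly R})%R <= 3)%N.
  rewrite (leq_trans (size_polyD _ _)) // geq_max (leq_trans (size_polyD _ _)) ?geq_max.
    by rewrite (leq_trans (size_scale_leq _ _)) // size_polyXn.
  by rewrite (leq_trans (size_polyC_leq1 _)) // (leq_trans (size_scale_leq _ _)) // size_polyX.
move: IH; rewrite -[size (x :: w)]/(size w).+1.
by set p := size _; set q := size _; move: p q (size w) => p q k; lia.
Qed.

(** * Gram matrices of blocks of a Haar matrix and their trace recursion *)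

Section Gram0.
Variables (N m l : nat) (F : 'M[C]_(m, N)) (J : 'M[C]_(N, l)).

Definition gram (S : 'M[C]_N) : 'M[C]_m := F *m S *m J *m adj (F *m S *m J).
Definition gtr (S : 'M[C]_N) j : R := complex.Re (\tr (gram S ^+ j)).

Lemma gram_adj S j : adj (gram S ^+ j) = gram S ^+ j.
Proof. by rewrite adj_exp /gram adj_mul adjK. Qed.

Lemma MPM_gram j : MA (@MP N) (fun S => gram S ^+ j).
Proof.
have H : MA (@MP N) (fun S => F *m S *m J).
  by do 2 (apply: MPM_mul; last exact: MPM_const || exact: MPM_id); apply: MPM_const.
by apply: MPM_exp; apply: MPM_mul => //; apply: MPM_adj.
Qed.

Lemma MP_gtr j : MP (gtr ^~ j).
Proof. by case: (MPC_tr (MPM_gram j)). Qed.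

End Gram0.

Section Gram.
Variables (N m l : nat) (F : 'M[C]_(m.+1, N)) (J : 'M[C]_(N, l)).
Variable E : ('M[C]_N -> R) -> R.
Hypotheses (hE : haarE E) (FF : F *m adj F = 1%:M).
Local Notation gram := (gram F J).
Local Notation gtr := (gtr F J).
Local Notation MPM_gram := (MPM_gram F J).
Local Notation MP_gtr := (MP_gtr F J).

Definition gent (S : 'M[C]_N) j : R := complex.Re ((gram S ^+ j) 0 0).
Definition gquad (h : 'cV[C]_m.+1) (S : 'M[C]_N) j : R := complex.Re ((adj h *m gram S ^+ j *m h) 0 0).

Lemma MP_gent j : MP (gent ^~ j).
Proof. by case: (MPM_gram j 0 0). Qed.

Lemma MP_word Psi (t : 'M[C]_N -> nat -> R) w : TP Psi -> (forall j, MP (t ^~ j)) ->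
  MP (fun S => Psi (gtr S) * wprod (t S) w).
Proof.
move=> TPs Ht; apply: MP_mul; first by apply: (MP_TP (p := fun j => gtr ^~ j) TPs); apply: MP_gtr.
exact: MP_prod.
Qed.

(** After scaling, h is the first column of the adjoint of a unitary V, and conjugation of the Gram
    matrix by V comes from a left multiplication of S ([unitary_extend]). Each letter of w is
    quadratic in h, hence the power of |h|^2. *)
Lemma haar_quad Psi w h : TP Psi ->
  E (fun S => Psi (gtr S) * wprod (gquad h S) w) =
  complex.Re ((adj h *m h) 0 0) ^+ size w * E (fun S => Psi (gtr S) * wprod (gent S) w).
Proof.
move=> TPs; have [->|h0] := eqVneq h 0.
  case: w => [|i w].
    by rewrite expr0 mul1r; congr E; apply/funext => S; rewrite /wprod !big_nil.
  rewrite mulmx0 mxE /= expr0n mul0r.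
  have -> : (fun S => Psi (gtr S) * wprod (gquad 0 S) (i :: w)) = (fun S => 0 * 1).
    by apply/funext => S; rewrite /wprod big_cons /gquad mulmx0 mxE /= !mul0r mulr0.
  by rewrite (haarZ hE) ?mul0r //; apply: MP_const.
set r := complex.Re _.
have hh : (adj h *m h) 0 0 = r%:C%C.
  rewrite RRe_real // mxE; apply: sum_real => i _.
  by rewrite adjE mulrC -normCK realX.
have r0 : 0 < r.
  have : 0 <= (adj h *m h) 0 0 by rewrite mxE sumr_ge0 // => i _; rewrite adjE mulrC -normCK exprn_ge0.
  rewrite hh ler0c le_eqVlt => /orP[/eqP r0|//].
  case/eqP: h0; apply/colP => i; rewrite mxE.
  have /eqP : (adj h *m h) 0 0 = 0 by rewrite hh -r0.
  rewrite mxE psumr_eq0 => [/allP /(_ i (mem_index_enum _))|k _]; last first.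
    by rewrite adjE mulrC -normCK exprn_ge0.
  by rewrite /= adjE mulrC -normCK expf_eq0 /= normr_eq0 => /eqP.
pose c : C := (Num.sqrt r)%:C%C.
have c2 : c * c = r%:C%C by rewrite -rmorphM -expr2 sqr_sqrtr // ltW.
have c0 : c != 0.
  by apply/eqP => H; move: c2; rewrite H mul0r => /(@complexI R) /eqP; rewrite lt_eqF.
have cr : Num.conj c = c by rewrite conj_Creal // complex_real.
pose u := c^-1 *: h.
have uu : adj u *m adj (adj u) = 1%:M.
  rewrite adjK /u adjZ -scalemxAl -scalemxAr scalerA [adj h *m h]mx11_scalar hh -scalemx1 scalerA.
  have -> : Num.conj c^-1 = c^-1 by rewrite fmorphV; congr (_^-1).
  by rewrite -invfM c2 mulVf ?scale1r // -c2 mulf_neq0.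
have [V HV rV] := unitary_first_row uu.
have [U HU FU] := unitary_extend FF HV.
have gU S : gram (U *m S) = V *m gram S *m adj V.
  rewrite /gram (mulmxA F U) FU.
  by rewrite -!(mulmxA V) adj_mul !mulmxA.
have -> : (fun S => Psi (gtr S) * wprod (gquad h S) w) =
    (fun S => r ^+ size w * (Psi (gtr (U *m S)) * wprod (gent (U *m S)) w)).
  apply/funext => S.
  have -> : gtr (U *m S) = gtr S.
    by apply/funext => j; rewrite /gtr gU conj_exp // mxtrace_conj.
  rewrite mulrCA; congr (_ * _).
  have -> : gquad h S = (fun i => r * gent (U *m S) i).
    apply/funext => i; rewrite /gent gU conj_exp // /gquad.
    have -> : (V *m gram S ^+ i *m adj V) 0 0 = (adj u *m gram S ^+ i *m u) 0 0.
      have -> : (V *m gram S ^+ i *m adj V) 0 0 = (row 0 V *m gram S ^+ i *m adj (row 0 V)) 0 0.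
        rewrite !mxE; apply: eq_bigr => k _; rewrite !mxE; congr (_ * _).
        by apply: eq_bigr => k' _; rewrite !mxE.
      by rewrite rV adjK.
    have -> : h = c *: u by rewrite /u scalerA mulfV // scale1r.
    rewrite adjZ cr -!scalemxAl -scalemxAr scalerA c2 mxE.
    by case: ((adj u *m gram S ^+ i *m u) 0 0) => x y /=; rewrite mul0r subr0.
  by rewrite /wprod big_split /= big_const_seq count_predT iter_mulr_1.
rewrite (haarZ hE); last exact: (MP_compU U (MP_word _ TPs MP_gent)).
have HM := MP_word (t := gent) w TPs MP_gent.
exact: (congr1 (fun z => r ^+ size w * z) (haarU hE HU HM)).
Qed.


Lemma haar_sum (I : Type) (r : seq I) (G : I -> 'M[C]_N -> R) : (forall i, MP (G i)) ->
  E (fun S => \sum_(i <- r) G i S) = \sum_(i <- r) E (G i).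
Proof.
move=> HG; elim: r => [|i r IH].
  rewrite big_nil; have -> : (fun S => \sum_(i <- [::]) G i S) = (fun S => 0 * 1).
    by apply/funext => S; rewrite big_nil mul0r.
  by rewrite (haarZ hE) ?mul0r //; apply: MP_const.
rewrite big_cons -IH; have -> : (fun S => \sum_(i <- i :: r) G i S) = (fun S => G i S + \sum_(i <- r) G i S).
  by apply/funext => S; rewrite big_cons.
by rewrite (haarD hE) //; apply: MP_sum.
Qed.

Lemma MP_rsum (T : Type) (w : seq T) (G : T -> seq T -> 'M[C]_N -> R) : (forall x r, MP (G x r)) ->
  MP (fun S => rsum (fun x r => G x r S) w).
Proof.
elim: w G => [|x w IH] G HG; first exact: MP_const.
by apply: MP_add => //; apply: (IH (fun y r => G y (x :: r))).
Qed.

Lemma haar_rsum (T : Type) (w : seq T) (G : T -> seq T -> 'M[C]_N -> R) : (forall x r, MP (G x r)) ->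
  E (fun S => rsum (fun x r => G x r S) w) = rsum (fun x r => E (G x r)) w.
Proof.
elim: w G => [|x w IH] G HG /=.
  have -> : (fun S : 'M[C]_N => 0 : R) = (fun S => 0 * 1) by apply/funext => S; rewrite mul0r.
  by rewrite (haarZ hE) ?mul0r //; apply: MP_const.
rewrite (haarD hE) //; last by apply: (MP_rsum w (G := fun y r => G y (x :: r))).
by rewrite (IH (fun y r => G y (x :: r))).
Qed.

Lemma MP_coef_word (a b c : nat -> 'M[C]_N -> R) w k :
  (forall i, MP (a i)) -> (forall i, MP (b i)) -> (forall i, MP (c i)) ->
  MP (fun S => (\prod_(i <- w) ((a i S)%:P + b i S *: 'X + c i S *: 'X^2))`_k).
Proof.
move=> Ha Hb Hc; elim: w k => [|x w IH] k.
  have -> : (fun S => (\prod_(i <- [::]) ((a i S)%:P + b i S *: 'X + c i S *: 'X^2))`_k) = (fun S => (k == 0%N)%:R).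
    by apply/funext => S; rewrite big_nil coef1.
  exact: MP_const.
have -> : (fun S => (\prod_(i <- x :: w) ((a i S)%:P + b i S *: 'X + c i S *: 'X^2))`_k) =
   (fun S => \sum_(j < k.+1) (a x S * (j == 0%N :> nat)%:R + b x S * (j == 1%N :> nat)%:R + c x S * (j == 2%N :> nat)%:R) *
    (\prod_(i <- w) ((a i S)%:P + b i S *: 'X + c i S *: 'X^2))`_(k - j)).
  apply/funext => S; rewrite big_cons coefM; apply: eq_bigr => j _; congr (_ * _).
  by rewrite !coefD coefC !coefZ coefX coefXn; case: (nat_of_ord j) => [|j']; rewrite ?mulr0 ?mulr1.
apply: MP_sum => j; apply: MP_mul => //.
by apply: MP_add; [apply: MP_add|]; apply: MP_mul => //; apply: MP_const.
Qed.

(* The vector e_0 + eps zeta e_j has squared norm 1 + eps^2; comparing the coefficients of eps^2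
   in the homogeneity relation haar_quad gives one linear relation for each (zeta, j). *)
Lemma haar_second (zeta : C) (j : 'I_m) Psi w : TP Psi -> zeta * Num.conj zeta = 1 ->
  let b S i := 2 * complex.Re (zeta * (gram S ^+ i) 0 (lift 0 j)) in
  let c S i := complex.Re ((gram S ^+ i) (lift 0 j) (lift 0 j)) in
  E (fun S => Psi (gtr S) * (2 * rsum (fun i r => c S i * wprod (gent S) r) w +
     rsum (fun i r => rsum (fun k r' => b S i * b S k * wprod (gent S) r') r) w)) =
  2 * (size w)%:R * E (fun S => Psi (gtr S) * wprod (gent S) w).
Proof.
move=> TPs zz b c; set K := size w; set E0 := E (fun S => _ * wprod _ _).
have MPb i : MP (b ^~ i).
  apply: MP_mul; first exact: MP_const.
  by have [] := MPC_mul (@MPC_const N zeta) (MPM_gram i 0 (lift 0 j)).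
have MPc i : MP (c ^~ i) by case: (MPM_gram i (lift 0 j) (lift 0 j)).
pose Q S := \prod_(i <- w) ((gent S i)%:P + b S i *: 'X + c S i *: 'X^2).
have MPQ k : MP (fun S => (Q S)`_k).
  by apply: (MP_coef_word (a := fun i S => gent S i) (b := fun i S => b S i) (c := fun i S => c S i)) => // i; apply: MP_gent.
have MPPsi : MP (fun S => Psi (gtr S)).
  by apply: (MP_TP (p := fun j => gtr ^~ j) TPs); apply: MP_gtr.
pose h (eps : R) : 'cV[C]_m.+1 := \col_k (if k == 0 then 1 else if k == lift 0 j then eps%:C%C * zeta else 0).
have sumh (v : 'I_m.+1 -> C) eps : \sum_k v k * h eps k 0 = v 0 + v (lift 0 j) * (eps%:C%C * zeta).
  rewrite (bigD1 0) //= mxE eqxx mulr1 (bigD1 (lift 0 j)) //= mxE eqxx /=; congr (_ + _).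
  rewrite big1 ?addr0 // => k /andP[k0 kj]; by rewrite mxE (negPf k0) (negPf kj) mulr0.
have sumh' (v : 'I_m.+1 -> C) eps : \sum_k adj (h eps) 0 k * v k = v 0 + (eps%:C%C * Num.conj zeta) * v (lift 0 j).
  rewrite (bigD1 0) //= adjE mxE eqxx rmorph1 mul1r (bigD1 (lift 0 j)) //= adjE mxE eqxx /= rmorphM /=; congr (_ + _).
  rewrite conj_Creal ?complex_real //.
  rewrite big1 ?addr0 // => k /andP[k0 kj]; by rewrite adjE mxE (negPf k0) (negPf kj) rmorph0 mul0r.
have qh eps : gquad (h eps) = (fun S i => ((gent S i)%:P + b S i *: 'X + c S i *: 'X^2).[eps]).
    apply/funext => S; apply/funext => i; rewrite /gquad mxE sumh !mxE !sumh'.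
  have -> : (gram S ^+ i) (lift 0 j) 0 = Num.conj ((gram S ^+ i) 0 (lift 0 j)) by rewrite -{1}gram_adj adjE.
  by rewrite re_quad // !hornerE /= ?mulrA.
have nh eps : complex.Re ((adj (h eps) *m h eps) 0 0) = 1 + eps ^+ 2.
  rewrite mxE sumh !adjE !mxE eqxx /= rmorph1.
  rewrite eqxx rmorphM /= conj_Creal ?complex_real // mulrACA (mulrC _ zeta) zz mulr1.
  by rewrite -rmorphM -[1]/((1 : R)%:C%C) -rmorphD /= expr2.
pose PE := \poly_(k < (2 * K).+3) E (fun S => Psi (gtr S) * (Q S)`_k).
have PEE : PE = E0 *: (1 + 'X^2) ^+ K.
  apply: poly_ext => eps; rewrite horner_poly !hornerE.
  transitivity (E (fun S => Psi (gtr S) * wprod (gquad (h eps) S) w)).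
    transitivity (\sum_(k < (2 * K).+3) E (fun S => eps ^+ k * (Psi (gtr S) * (Q S)`_k))).
      apply: eq_bigr => k _; have HM : MP (fun S => Psi (gtr S) * (Q S)`_k) by apply: MP_mul.
      by rewrite (haarZ hE _ HM) mulrC.
    rewrite -haar_sum => [|k]; last by apply: MP_mul; [apply: MP_const|apply: MP_mul].
    congr E; apply/funext => S; rewrite qh.
    transitivity (Psi (gtr S) * (Q S).[eps]).
      rewrite (@horner_coef_wide _ (2 * K).+3); last by rewrite (leq_trans (size_word _ _ _ _)) // ltnW // ltnW.
      by rewrite mulr_sumr; apply: eq_bigr => k _; rewrite mulrC mulrA.
    by rewrite /Q horner_prod.
  by rewrite haar_quad // nh mulrC.
have := congr1 (fun p : {poly R} => p`_2) PEE.
rewrite /PE coef_poly /= coefZ; have [_ _ ->] := coef2_norm K => H.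
transitivity (E (fun S => 2 * (Psi (gtr S) * (Q S)`_2))).
  by congr E; apply/funext => S; rewrite [RHS]mulrCA; have [_ _ ->] := coef2_word w (gent S) (b S) (c S).
by rewrite (haarZ hE) ?H; [ring|apply: MP_mul].
Qed.

Lemma MP_TP2_gram F2 : TP2 F2 -> MP (fun S => F2 (gtr S) (gent S)).
Proof.
by move=> H; apply: (MP_TP2 (p := fun j => gtr ^~ j) (t := fun j => gent ^~ j) H); [apply: MP_gtr|apply: MP_gent].
Qed.

Lemma re_sumC (I : finType) (f : I -> C) : complex.Re (\sum_i f i) = \sum_i complex.Re (f i).
Proof. exact: (raddf_sum (@complex.Re R)). Qed.

Lemma gtrE S i : gtr S i = gent S i + \sum_(j < m) complex.Re ((gram S ^+ i) (lift 0 j) (lift 0 j)).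
Proof. by rewrite /gtr /mxtrace re_sumC big_ord_recl. Qed.

Lemma gent_add S i k : gent S (i + k) = gent S i * gent S k +
  \sum_(j < m) complex.Re ((gram S ^+ i) 0 (lift 0 j) * Num.conj ((gram S ^+ k) 0 (lift 0 j))).
Proof.
have H j : Num.conj ((gram S ^+ k) 0 j) = (gram S ^+ k) j 0 by rewrite -adjE gram_adj.
have im0 : complex.Im ((gram S ^+ k) 0 0) = 0.
  by have := H 0; case: ((gram S ^+ k) 0 0) => x y /= [] /eqP; rewrite eq_sym -addr_eq0 -mulr2n mulrn_eq0 => /eqP.
rewrite /gent exprD -mulmxE mxE re_sumC big_ord_recl; congr (_ + _).
  move: im0; case: ((gram S ^+ i) 0 0) ((gram S ^+ k) 0 0) => x y [x' y'] /= ->.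
  by rewrite mulr0 subr0.
by apply: eq_bigr => j _; rewrite H.
Qed.

(** [haar_second] is summed over j and over zeta = 1 and zeta = i. With A the Gram matrix, the two
    values of zeta turn products of real parts into Re (x conj y); the sum over j then completes
    (A^i)_00 to tr A^i, and (A^i)_00 (A^k)_00 to (A^(i+k))_00. *)
Lemma haar_good : good m.+1%:R (fun F2 => E (fun S => F2 (gtr S) (gent S))).
Proof.
split.
- by move=> F2 G2 T1 T2; apply: (haarD hE); apply: MP_TP2_gram.
- by move=> c F2 T1; apply: (haarZ hE); apply: MP_TP2_gram.
move=> Psi w TPs _; set K := size w; set E0 := E _.
pose b (z : C) j S i := 2 * complex.Re (z * (gram S ^+ i) 0 (lift 0 j)).
pose c (j : 'I_m) S i := complex.Re ((gram S ^+ i) (lift 0 j) (lift 0 j)).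
pose X z j S := 2 * rsum (fun i r => c j S i * wprod (gent S) r) w +
     rsum (fun i r => rsum (fun k r' => b z j S i * b z j S k * wprod (gent S) r') r) w.
have MPPsi : MP (fun S => Psi (gtr S)).
  by apply: (MP_TP (p := fun j => gtr ^~ j) TPs); apply: MP_gtr.
have MPw w' : MP (fun S => wprod (gent S) w') by apply: MP_prod; apply: MP_gent.
have MPX z j : MP (X z j).
  have MPc i : MP (c j ^~ i) by case: (MPM_gram i (lift 0 j) (lift 0 j)).
  have MPb i : MP (b z j ^~ i).
    apply: MP_mul; first exact: MP_const.
    by have [] := MPC_mul (@MPC_const N z) (MPM_gram i 0 (lift 0 j)).
  apply: MP_add; first apply: MP_mul (MP_const _ _) _.
    by apply: MP_rsum => i r; apply: MP_mul.
  by apply: MP_rsum => i r; apply: MP_rsum => k r'; apply: MP_mul => //; apply: MP_mul.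
have HX z j : z * Num.conj z = 1 -> E (fun S => Psi (gtr S) * X z j S) = 2 * K%:R * E0.
  exact: haar_second.
pose Y S := rsum (fun i r => gtr S i * wprod (gent S) r) w +
   rsum (fun i r => rsum (fun k r' => gent S (i + k) * wprod (gent S) r') r) w.
have MPY : MP Y.
  apply: MP_add; first by apply: MP_rsum => i r; apply: MP_mul => //; apply: MP_gtr.
  by apply: MP_rsum => i r; apply: MP_rsum => k r'; apply: MP_mul => //; apply: MP_gent.
have XY S : \sum_(j < m) (X 1 j S + X 'i%C j S) = 4 * Y S - 4 * K%:R ^+ 2 * wprod (gent S) w.
  have -> : \sum_(j < m) (X 1 j S + X 'i%C j S) =
    4 * (rsum (fun i r => (gtr S i - gent S i) * wprod (gent S) r) w +
         rsum (fun i r => rsum (fun k r' => (gent S (i + k) - gent S i * gent S k) * wprod (gent S) r') r) w).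
    rewrite mulrDr !rsum_mull.
    transitivity (\sum_(j < m) rsum (fun i r => 4 * (c j S i * wprod (gent S) r)) w +
       \sum_(j < m) rsum (fun i r => rsum (fun k r' =>
          4 * complex.Re ((gram S ^+ i) 0 (lift 0 j) * Num.conj ((gram S ^+ k) 0 (lift 0 j))) * wprod (gent S) r') r) w).
      rewrite -big_split; apply: eq_bigr => j _ /=; rewrite /X addrACA -mulrDr -rsumD; congr (_ + _).
        have -> : rsum (fun i r => 4 * (c j S i * wprod (gent S) r)) w = 4 * rsum (fun i r => c j S i * wprod (gent S) r) w.
          by rewrite rsum_mull.
        by ring.
      apply: eq_rsum => i r; rewrite -rsumD; apply: eq_rsum => k r'.
      rewrite -mulrDl; congr (_ * _); rewrite /b.
      by case: ((gram S ^+ i) _ _) ((gram S ^+ k) _ _) => x y [x' y'] /=; ring.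
    rewrite !rsum_sum; congr (_ + _); apply: eq_rsum => i r.
      by rewrite gtrE -mulr_sumr -mulr_suml addrAC subrr add0r.
    rewrite rsum_sum rsum_mull; apply: eq_rsum => k r'.
    by rewrite gent_add addrAC subrr add0r -mulr_suml -mulr_sumr mulrA.
  rewrite -mulrA -mulrBr /Y; congr (_ * _).
  have H1 : rsum (fun i r => gent S i * wprod (gent S) r) w = K%:R * wprod (gent S) w.
    exact: (rsum_wprod (Z := unit) (fun _ => gent S) (fun f => f tt) w).
  have H2 : rsum (fun i r => rsum (fun k r' => gent S i * gent S k * wprod (gent S) r') r) w =
       K%:R * (K%:R - 1) * wprod (gent S) w.
    rewrite -[K%:R * _]mulrC -mulrA -H1 rsum_mull.
    apply: (eq_rsum_in (P := predT)); first exact: all_predT.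
    move=> i r _ _ sr; rewrite /K -sr.
    transitivity (gent S i * rsum (fun k r' => gent S k * wprod (gent S) r') r).
      by rewrite rsum_mull; apply: eq_rsum => k r'; rewrite mulrA.
    rewrite (rsum_wprod (Z := unit) (fun _ => gent S) (fun f => f tt) r) /= -natr1 addrK; ring.
  have H3 : rsum (fun i r => (gtr S i - gent S i) * wprod (gent S) r) w =
      rsum (fun i r => gtr S i * wprod (gent S) r) w - K%:R * wprod (gent S) w.
    by rewrite -H1; apply/eqP; rewrite eq_sym subr_eq -rsumD; apply/eqP; apply: eq_rsum => i r; rewrite mulrBl subrK.
  have H4 : rsum (fun i r => rsum (fun k r' => (gent S (i + k) - gent S i * gent S k) * wprod (gent S) r') r) w =
      rsum (fun i r => rsum (fun k r' => gent S (i + k) * wprod (gent S) r') r) w - K%:R * (K%:R - 1) * wprod (gent S) w.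
    rewrite -H2; apply/eqP; rewrite eq_sym subr_eq -rsumD; apply/eqP; apply: eq_rsum => i r.
    by rewrite -rsumD; apply: eq_rsum => k r'; rewrite mulrBl subrK.
  rewrite H3 H4; ring.
have i1 : ('i%C : C) * Num.conj 'i%C = 1.
  by apply/eqP; rewrite eq_complex /=; apply/andP; split; apply/eqP; ring.
have S1 : E (fun S => Psi (gtr S) * \sum_(j < m) (X 1 j S + X 'i%C j S)) = m%:R * (4 * K%:R * E0).
  transitivity (E (fun S => \sum_(j < m) (Psi (gtr S) * X 1 j S + Psi (gtr S) * X 'i%C j S))).
    by congr E; apply/funext => S; rewrite mulr_sumr; apply: eq_bigr => j _; rewrite mulrDr.
  rewrite haar_sum => [|j]; last by apply: MP_add; apply: MP_mul.
  transitivity (\sum_(j < m) (4 * K%:R * E0)); last by rewrite sumr_const card_ord [RHS]mulr_natl.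
  apply: eq_bigr => j _; rewrite (haarD hE); try exact: MP_mul.
  by rewrite !HX ?rmorph1 ?mulr1 //; ring.
have S2 : E (fun S => Psi (gtr S) * \sum_(j < m) (X 1 j S + X 'i%C j S)) =
    4 * E (fun S => Psi (gtr S) * Y S) - 4 * K%:R ^+ 2 * E0.
  have -> : (fun S => Psi (gtr S) * \sum_(j < m) (X 1 j S + X 'i%C j S)) =
     (fun S => 4 * (Psi (gtr S) * Y S) + (- (4 * K%:R ^+ 2)) * (Psi (gtr S) * wprod (gent S) w)).
    by apply/funext => S; rewrite XY; ring.
  have MPPY : MP (fun S => Psi (gtr S) * Y S) by apply: MP_mul.
  have MPPw : MP (fun S => Psi (gtr S) * wprod (gent S) w) by apply: MP_mul.
  rewrite (haarD hE); try by apply: MP_mul => //; apply: MP_const.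
  by rewrite !(haarZ hE) // mulNr.
have EY : E (fun S => Psi (gtr S) * Y S) = K%:R * (m%:R + K%:R) * E0.
  have H : 4 * E (fun S => Psi (gtr S) * Y S) = 4 * (K%:R * (m%:R + K%:R) * E0).
    by move: S2; rewrite S1 => /eqP; rewrite eq_sym subr_eq => /eqP ->; ring.
  by apply: (mulfI _ H); rewrite pnatr_eq0.
have -> : K%:R * (m.+1%:R + K%:R - 1) * E0 = E (fun S => Psi (gtr S) * Y S).
  by rewrite EY -natr1; ring.
have MP1 i r : MP (fun S => Psi (gtr S) * gtr S i * wprod (gent S) r).
  by apply: MP_mul => //; apply: MP_mul => //; apply: MP_gtr.
have MP2 i k r' : MP (fun S => Psi (gtr S) * wprod (gent S) ((i + k)%N :: r')) by apply: MP_mul.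
rewrite -(haar_rsum w MP1).
have -> : rsum (fun i r => rsum (fun k r' => E (fun S => Psi (gtr S) * wprod (gent S) ((i + k)%N :: r'))) r) w =
    E (fun S => rsum (fun i r => rsum (fun k r' => Psi (gtr S) * wprod (gent S) ((i + k)%N :: r')) r) w).
  rewrite haar_rsum => [|i r]; last exact: MP_rsum.
  by apply: eq_rsum => i r; rewrite haar_rsum.
have M1 : MP (fun S => rsum (fun i r => Psi (gtr S) * gtr S i * wprod (gent S) r) w) by apply: MP_rsum.
have M2 : MP (fun S => rsum (fun i r => rsum (fun k r' => Psi (gtr S) * wprod (gent S) ((i + k)%N :: r')) r) w).
  by apply: MP_rsum => i r; apply: MP_rsum.
rewrite -(haarD hE M1 M2); congr E; apply/funext => S.
rewrite mulrDr !rsum_mull; congr (_ + _); apply: eq_rsum => i r; first by rewrite mulrA.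
by rewrite rsum_mull; apply: eq_rsum => k r'; rewrite /wprod big_cons.
Qed.
End Gram.
End HaarFunctional.

(** * From the projection to the Jacobi law by deleting rows *)

Lemma tr_exp_comm (C : comNzRingType) p q (X : 'M[C]_(p, q)) (Y : 'M[C]_(q, p)) j : (0 < j)%N ->
  \tr ((X *m Y) ^+ j) = \tr ((Y *m X) ^+ j).
Proof.
case: j => // j _.
have -> : (X *m Y) ^+ j.+1 = X *m ((Y *m X) ^+ j *m Y).
  elim: j => [|j IH]; first by rewrite expr1 expr0 mul1mx.
  by rewrite exprS -mulmxE IH exprS -mulmxE !mulmxA.
by rewrite mxtrace_mulC exprSr -mulmxE mulmxA.
Qed.

Lemma isometry_square (C : numClosedFieldType) m N (F : 'M[C]_(m, N)) : m = N ->
  F *m adj F = 1%:M -> adj F *m F = 1%:M.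
Proof. by move=> e; subst N; apply: mulmx1C. Qed.

Lemma tr_one_sub (C : comNzRingType) n (X Y : 'M[C]_n) j :
  \tr ((1%:M - X *m Y) ^+ j) = \tr ((1%:M - Y *m X) ^+ j).
Proof.
have H (A B : 'M[C]_n) : \tr ((1%:M + A *m B) ^+ j) = \sum_(i < j.+1) \tr ((A *m B) ^+ i) *+ 'C(j, i).
  rewrite exprDn_comm; last by rewrite /GRing.comm -!mulmxE mul1mx mulmx1.
  by rewrite raddf_sum; apply: eq_bigr => i _; rewrite /= expr1n mul1r raddfMn.
have -> : 1%:M - X *m Y = 1%:M + (- X) *m Y by rewrite mulNmx.
have -> : 1%:M - Y *m X = 1%:M + Y *m (- X) by rewrite mulmxN.
rewrite !H; apply: eq_bigr => [[[|i] hi]] _ /=; first by rewrite !expr0.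
by rewrite tr_exp_comm.
Qed.

Section Chain.
Variables (R : realType) (nstar n : nat).
Local Notation C := R[i].
Local Notation N := (nstar + n)%N.
Hypothesis hnn : (n <= nstar)%N.

(** For positive k the order is nstar + k - 1, ..., nstar, followed by 0, ..., nstar - 1, so that
    deleting the first row of [fmat k.+1] gives [fmat k], and k = 0 leaves the top nstar rows. *)
Definition frow k i := if (i < k)%N then (nstar + (k - i.+1))%N else (i - k)%N.

Definition fmat k : 'M[C]_(k + nstar, N) := \matrix_(i, j) ((j : nat) == frow k i)%:R.

Lemma frow_lt k i : (k <= n)%N -> (i < k + nstar)%N -> (frow k i < N)%N.
Proof. by move=> ? ?; rewrite /frow; case: (ltnP i k) => ?; lia. Qed.

Lemma frow_inj k i j : (k <= n)%N -> (i < k + nstar)%N -> (j < k + nstar)%N -> frow k i = frow k j -> i = j.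
Proof. by move=> ? ? ?; rewrite /frow; case: (ltnP i k) => ?; case: (ltnP j k) => ?; lia. Qed.

Lemma fmat_mul k p (A : 'M[C]_(N, p)) i j (hk : (k <= n)%N) :
  (fmat k *m A) i j = A (Ordinal (frow_lt hk (ltn_ord i))) j.
Proof.
rewrite mxE (bigD1 (Ordinal (frow_lt hk (ltn_ord i)))) //= mxE eqxx mul1r big1 ?addr0 // => l.
by rewrite mxE -(inj_eq val_inj) /= => /negPf ->; rewrite mul0r.
Qed.

Lemma fmat_iso k : (k <= n)%N -> fmat k *m adj (fmat k) = 1%:M.
Proof.
move=> hk; apply/matrixP => i j; rewrite (fmat_mul _ _ _ hk) adjE !mxE /= rmorph_nat; congr (_%:R).
have [->|ij] := eqVneq i j; first by rewrite eqxx.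
by case: eqP => // H; case/eqP: ij; apply: val_inj; apply: (frow_inj hk _ _ H).
Qed.

Lemma fmat_row' k : (k < n)%N -> row' 0 (fmat k.+1 : 'M[C]_((k + nstar).+1, N)) = fmat k.
Proof.
move=> hk; apply/matrixP => i j; rewrite !mxE /frow /= /bump /= add1n ltnS subSS.
by congr ((_ == _)%:R).
Qed.

Definition Jr : 'M[C]_(N, n) := col_mx 0 1%:M.
Definition Jl : 'M[C]_(N, nstar) := col_mx 1%:M 0.

Lemma gram_corner k S : (k < n)%N ->
  gram (fmat k) Jr S = row' 0 (col' 0 (gram (fmat k.+1 : 'M[C]_((k + nstar).+1, N)) Jr S)).
Proof.
move=> hk; rewrite /gram -fmat_row' //.
apply/matrixP => i j; rewrite !mxE; apply: eq_bigr => l _; rewrite !mxE; congr (_ * Num.conj _).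
  by apply: eq_bigr => l' _; congr (_ * _); rewrite !mxE; apply: eq_bigr => l'' _; rewrite !mxE.
by apply: eq_bigr => l' _; congr (_ * _); rewrite !mxE; apply: eq_bigr => l'' _; rewrite !mxE.
Qed.

Lemma gent_real m l (F : 'M[C]_(m.+1, N)) (J : 'M[C]_(N, l)) S j :
  (gram F J S ^+ j) 0 0 = (gent F J S j)%:C%C.
Proof.
rewrite /gent RRe_real //; apply/CrealP.
by rewrite -adjE gram_adj.
Qed.

Lemma gtr_real m l (F : 'M[C]_(m, N)) (J : 'M[C]_(N, l)) S j :
  \tr (gram F J S ^+ j) = (gtr F J S j)%:C%C.
Proof.
rewrite /gtr RRe_real // /mxtrace; apply: sum_real => i _; apply/CrealP.
by rewrite -adjE gram_adj.
Qed.

Lemma gtr_corner k S j : (k < n)%N -> (0 < j)%N ->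
  gtr (fmat k) Jr S j = gtr (fmat k.+1) Jr S j +
    newt (gent (fmat k.+1 : 'M[C]_((k + nstar).+1, N)) Jr S) j.
Proof.
move=> hk j0; apply: (@complexI R).
rewrite -gtr_real gram_corner // trace_corner // rmorphD /= -gtr_real; congr (_ + _).
rewrite newt_morph; congr newt; apply/funext => i /=.
by rewrite gent_real.
Qed.

(** With all rows kept, the n selected columns are orthonormal, and the Gram matrix is a projection
    of rank n. *)
Lemma gtr_full S j : S \is unitarymx -> (0 < j)%N -> gtr (fmat n) Jr S j = n%:R.
Proof.
move=> US j0; rewrite /gtr /gram (tr_exp_comm (fmat n *m S *m Jr) _ j0).
have -> : adj (fmat n *m S *m Jr) *m (fmat n *m S *m Jr) = 1%:M.
  have FF := isometry_square (addnC n nstar) (fmat_iso (leqnn n)).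
  have -> : adj (fmat n *m S *m Jr) *m (fmat n *m S *m Jr) =
     adj Jr *m (adj S *m ((adj (fmat n) *m fmat n) *m (S *m Jr))).
    by rewrite !adj_mul !mulmxA.
  rewrite FF mul1mx (mulmxA (adj S)) adj_unitary // mul1mx.
  rewrite /adj /Jr tr_col_mx map_row_mx mul_row_col trmx0 map_mx0 mul0mx add0r trmx1 map_mx1 mul1mx.
  by [].
rewrite expr1n mxtrace1; exact: (raddfMn (@complex.Re R) n 1).
Qed.

Variable E : ('M[C]_N -> R) -> R.
Hypotheses (hE : haarE E) (E1 : E (fun _ => 1) = 1).

Lemma haar_const c : E (fun _ => c) = c.
Proof.
have -> : (fun _ : 'M[C]_N => c) = (fun _ => c * 1) by apply/funext => S; rewrite mulr1.
by rewrite (haarZ hE) ?E1 ?mulr1 //; apply: MP_const.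
Qed.

Lemma MP_TPgtr m l (F : 'M[C]_(m, N)) (J : 'M[C]_(N, l)) Psi : TP Psi -> MP (fun S => Psi (gtr F J S)).
Proof. by move=> TPs; apply: (MP_TP (p := fun j S => gtr F J S j) TPs) => j; apply: MP_gtr. Qed.

(** After kap deletions the eigenvalue 1 is left with multiplicity n - kap and the eigenvalue 0 with
    multiplicity nstar - kap, and these are the exponents of 1 - v and v. In the inductive step the
    [Gt] of [elimination] is used twice, for the matrix through [haar_good] and for the functional
    through [chain_step]. *)
Lemma haar_chain kap : (kap <= n)%N -> exists C0 : R, forall Psi, TP Psi ->
  E (fun S => Psi (gtr (fmat (n - kap)) Jr S)) =
  C0 * momf (@leb R _) (fun v : 'I_kap -> R => Psi (fun j => (n - kap)%:R + psum v j) *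
    \prod_j (v j ^+ (nstar - kap) * (1 - v j) ^+ (n - kap)) * vdm v ^+ 2).
Proof.
elim: kap => [|k IH] hk.
  exists 1 => Psi TPs; rewrite mul1r subn0.
  transitivity (Psi (fun=> n%:R)).
    rewrite -[RHS]haar_const; apply: (haar_eq hE); [exact: MP_TPgtr|exact: MP_const|].
    move=> S US; apply: TP_ext => // j j0; exact: gtr_full.
  have -> : (fun v : 'I_0 -> R => Psi (fun j => n%:R + psum v j) * \prod_j (v j ^+ (nstar - 0) * (1 - v j) ^+ n) * vdm v ^+ 2) =
     (fun v => Psi (fun=> n%:R) * mono [ffun _ => 0%N] v).
    apply/funext => v; rewrite /vdm det_mx00 expr1n mulr1 /mono !big_ord0; congr (Psi _ * _).
    by apply/funext => j; rewrite /psum big_ord0 addr0.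
  rewrite momfZ ?momf_mono; last exact: pf_mono.
  by rewrite /leb /pmom big_ord0 mulr1.
have [C0 HC] := IH (ltnW hk).
set a' := (n - k.+1)%N; set b' := (nstar - k.+1)%N.
have ea : (n - k = a'.+1)%N by rewrite /a'; lia.
have eb : (nstar - k = b'.+1)%N by rewrite /b'; lia.
exists (C0 * (chain_c R k a' b' * (((k.+1)`!)%:R^-1 * (-1) ^+ k))) => Psi TPs.
have T2 : TP2 (fun p t : nat -> R => Psi (fun j => 1 * p j + newt t j)).
  apply: (TP_subst (q := fun j p t => 1 * p j + newt t j)) => // j j0.
  by apply: TP2_add; [apply: TP2_scale; apply: TP2_var|apply: TP2_newt].
have s0 : 0 < (a'.+1 + k + b'.+1)%:R :> R by rewrite ltr0n addnS.
have [Gt TPG HG] := elimination s0 T2.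
rewrite -mulrA -(chain_step TPs TPG HG).
have := HC Gt TPG; rewrite ea eb => <-.
have hk1 : (a' < n)%N by rewrite /a'; lia.
transitivity (E (fun S => Psi (fun j => 1 * gtr (fmat a'.+1 : 'M[C]_((a' + nstar).+1, N)) Jr S j +
    newt (gent (fmat a'.+1 : 'M[C]_((a' + nstar).+1, N)) Jr S) j))).
  by congr E; apply/funext => S; apply: TP_ext => // j j0; rewrite gtr_corner // mul1r.
have FF : (fmat a'.+1 : 'M[C]_((a' + nstar).+1, N)) *m adj (fmat a'.+1 : 'M[C]_((a' + nstar).+1, N)) = 1%:M.
  exact: (fmat_iso hk1).
have := haar_good Jr hE FF.
have -> : (a' + nstar).+1%:R = (a'.+1 + k + b'.+1)%:R :> R by congr (_%:R); rewrite /a' /b'; lia.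
exact: HG.
Qed.

(** Let X be the top block of the last n columns and q the block below it. Orthonormality of the
    columns gives X^dagger X = 1 - q^dagger q, orthonormality of the rows gives t t^dagger = 1 - q
    q^dagger, and [tr_one_sub] identifies the traces. *)
Lemma gtr_lower S j : S \is unitarymx -> (0 < j)%N ->
  gtr (fmat 0) Jr S j = complex.Re (\tr ((tsub S *m adj (tsub S)) ^+ j)).
Proof.
move=> US j0; rewrite /gtr /gram; congr (complex.Re _).
pose q : 'M[C]_n := \matrix_(i, k) S (rshift nstar i) (rshift nstar k).
rewrite (tr_exp_comm (fmat 0 *m S *m Jr) _ j0).
have -> : adj (fmat 0 *m S *m Jr) *m (fmat 0 *m S *m Jr) = 1%:M - adj q *m q.
  apply/eqP; rewrite eq_sym subr_eq eq_sym; apply/eqP/matrixP => i k.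
  have /matrixP /(_ (rshift nstar i) (rshift nstar k)) := adj_unitary US.
  rewrite mxE [X in _ = X]mxE (inj_eq (@rshift_inj _ _)) => H1.
  rewrite mxE [in RHS]mxE -H1 big_split_ord mxE [X in _ + X]mxE; congr (_ + _).
    apply: eq_bigr => l _; rewrite !adjE.
    have H k' : (fmat 0 *m S *m Jr) l k' = S (lshift n l) (rshift nstar k').
      rewrite -mulmxA (fmat_mul _ _ _ (leq0n n)) mxE big_split_ord /= big1 ?add0r; last first.
        by move=> x _; rewrite /Jr col_mxEu mxE mulr0.
      rewrite (bigD1 k') //= /Jr col_mxEd mxE eqxx mulr1 big1 ?addr0; last first.
        by move=> x /negPf xk; rewrite col_mxEd mxE xk mulr0.
      by congr (S _ _); apply: val_inj; rewrite /= /frow subn0.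
    by rewrite !H.
  by apply: eq_bigr => l _; rewrite !adjE !mxE.
have -> : tsub S *m adj (tsub S) = 1%:M - q *m adj q.
  apply/eqP; rewrite eq_sym subr_eq eq_sym; apply/eqP/matrixP => i k.
  have /unitary_adj/matrixP /(_ (rshift nstar i) (rshift nstar k)) := US.
  rewrite mxE [X in _ = X]mxE (inj_eq (@rshift_inj _ _)) => H1.
  rewrite mxE [in RHS]mxE -H1 big_split_ord mxE [X in _ + X]mxE.
  by congr (_ + _); apply: eq_bigr => l _; rewrite !adjE !mxE.
exact: (tr_one_sub (adj q) q j).
Qed.

Lemma haar_jacobi : exists C0 : R, forall Psi, TP Psi ->
  E (fun S => Psi (fun j => complex.Re (\tr ((tsub S *m adj (tsub S)) ^+ j)))) =
  C0 * momf (@leb R _) (fun y : 'I_n -> R => Psi (psum y) * \prod_j (y j ^+ (nstar - n)) * vdm y ^+ 2).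
Proof.
have [C0 HC] := haar_chain (leqnn n); exists C0 => Psi TPs.
have := HC Psi TPs; rewrite subnn => H.
transitivity (E (fun S => Psi (gtr (fmat 0) Jr S))).
  apply: (haar_eq hE); [|exact: MP_TPgtr|].
    apply: (MP_TP (p := fun j S => complex.Re (\tr ((tsub S *m adj (tsub S)) ^+ j))) TPs) => j.
    have MPt : MA (@MP R N) (fun S : 'M[C]_N => tsub S).
      move=> i k; have -> : (fun S : 'M[C]_N => tsub S i k) = (fun S => S (rshift nstar i) (lshift n k)).
        by apply/funext => S; rewrite mxE.
      exact: MPM_id.
    have MPtt : MA (@MP R N) (fun S : 'M[C]_N => tsub S *m adj (tsub S)) by apply: MPM_mul => //; apply: MPM_adj.
    by case: (MPC_tr (MPM_exp j MPtt)).
  by move=> S US; apply: TP_ext => // j j0; rewrite gtr_lower.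
rewrite H; congr (_ * momf _ _); apply/funext => v; congr (_ * _ * _).
  by apply: TP_ext => // j j0; rewrite add0r.
by apply: eq_bigr => j _; rewrite expr0 mulr1.
Qed.

End Chain.

(** * Laws and bounded expectations *)

Section Boxes.
Variables (R : realType) (n : nat).
Implicit Types (a b : 'I_n -> R).

Definition tbox a b : set (n.-tuple R) := [set t | forall i, a i < tnth t i <= b i].

Definition tboxes : set (set (n.-tuple R)) := [set A | exists a b, A = tbox a b].

Lemma tboxE a b : tbox a b = \big[setI/setT]_(i < n) ((@tnth n R ^~ i) @^-1` `]a i, b i]).
Proof.
rewrite -bigcap_seq; apply/seteqP; split => [t tab i _|t H i].
  by rewrite /= in_itv /=; exact: tab.
by have := H i (mem_index_enum i); rewrite /= in_itv.
Qed.

Lemma tbox_measurable a b : measurable (tbox a b).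
Proof.
rewrite tboxE; apply: bigsetI_measurable => i _; rewrite -[X in measurable X]setTI.
exact: measurable_tnth.
Qed.

Lemma tbox_setI : setI_closed tboxes.
Proof.
move=> _ _ [a [b ->]] [a' [b' ->]].
exists (fun i => Num.max (a i) (a' i)), (fun i => Num.min (b i) (b' i)).
apply/seteqP; split => t /=.
  move=> [H H'] i; have /andP[h1 h2] := H i; have /andP[h3 h4] := H' i.
  by rewrite gt_max le_min h1 h2 h3 h4.
move=> H; split => i; have := H i; rewrite gt_max le_min => /andP[/andP[h1 h2] /andP[h3 h4]].
  by rewrite h1.
by rewrite h2.
Qed.

(** The hypotheses on S and g speak of bounded boxes only; a condition on one coordinate is a
    countable union of boxes whose other sides grow. *)
Lemma tuple_measurable_boxes (A : set (n.-tuple R)) : measurable A -> <<s tboxes >> A.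
Proof.
apply: smallest_sub; first exact: smallest_sigma_algebra.
rewrite -bigcup_seq => B [i _] [C mC <-].
have : preimage_set_system setT (@tnth n R ^~ i) (<<s @ocitv R >>) (setT `&` (@tnth n R ^~ i) @^-1` C).
  by exists C.
rewrite -(@g_sigma_preimageE (n.-tuple R) (ocitv_type R) setT (@tnth n R ^~ i) (@ocitv R)); apply: smallest_sub; first exact: smallest_sigma_algebra.
move=> D [_ [[x y] _ <-] <-] /=; rewrite setTI.
have -> : (@tnth n R ^~ i) @^-1` `]x, y]%classic = \bigcup_m tbox (fun j => if j == i then x else - m%:R)
    (fun j => if j == i then y else m%:R).
  apply/seteqP; split => t /=.
    rewrite in_itv /= => H.
    have [m Hm] : exists m : nat, forall j, `|tnth t j| < m%:R.
      exists (\max_(j < n) (Num.truncn `|tnth t j|).+1)%N => j.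
      apply: (lt_le_trans (truncnS_gt _)); rewrite ler_nat.
      exact: (leq_bigmax j).
    exists m => // j /=; case: eqP => [->//|_].
    by have := Hm j; rewrite ltr_norml => /andP[-> /ltW].
  by move=> [m _] /(_ i) /=; rewrite eqxx in_itv.
have [_ _ Hcup] := smallest_sigma_algebra setT tboxes.
apply: Hcup => m; apply: sub_sigma_algebra; by eexists; eexists.
Qed.

Lemma tuple_measure_unique (m1 m2 : {measure set (n.-tuple R) -> \bar R}) :
  (forall a b, m1 (tbox a b) = m2 (tbox a b)) -> (m1 setT < +oo)%E ->
  forall A, measurable A -> m1 A = m2 A.
Proof.
move=> H fin A mA.
apply: (@g_sigma_algebra_measure_unique _ _ _ tboxes _ (fun k => tbox (fun _ => - k%:R) (fun _ => k%:R))).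
- by move=> _ [a [b ->]]; apply: tbox_measurable.
- by move=> k; eexists; eexists.
- apply/seteqP; split => // t _.
  exists (\max_(j < n) (Num.truncn `|tnth t j|).+1)%N => // j.
  have : `|tnth t j| < (\max_(j < n) (Num.truncn `|tnth t j|).+1)%:R.
    apply: (lt_le_trans (truncnS_gt _)); rewrite ler_nat; exact: (leq_bigmax j).
  by rewrite ltr_norml => /andP[-> /ltW].
- exact: tbox_setI.
- by move=> _ [a [b ->]].
- move=> k; apply: le_lt_trans fin; exact: (le_measure m1 (mem_set (tbox_measurable _ _)) (mem_set measurableT) (@subsetT _ _)).
- exact: tuple_measurable_boxes.
Qed.
End Boxes.

Section LawUnique.
Variables (R : realType) (I : finType).
Variables (d d' : measure_display) (T : measurableType d) (T' : measurableType d').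
Variables (P : probability T R) (P' : probability T' R).
Variables (X : T -> I -> R) (Y : T' -> I -> R).
Hypothesis mX : forall i, measurable_fun setT (X ^~ i).
Hypothesis mY : forall i, measurable_fun setT (Y ^~ i).
Hypothesis XY : forall a b : I -> R, P [set w | forall i, a i < X w i <= b i] = P' [set w | forall i, a i < Y w i <= b i].

Definition tup (x : I -> R) : #|I|.-tuple R := [tuple x (enum_val k) | k < #|I|].
Definition untup (t : #|I|.-tuple R) (i : I) : R := tnth t (enum_rank i).

Lemma tupK x : untup (tup x) = x.
Proof. by apply/funext => i; rewrite /untup tnth_mktuple enum_rankK. Qed.

Lemma measurable_tup (d0 : measure_display) (T0 : measurableType d0) (Z : T0 -> I -> R) :
  (forall i, measurable_fun setT (Z ^~ i)) -> measurable_fun setT (fun w => tup (Z w)).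
Proof.
move=> mZ; apply/measurable_fun_tnthP => k.
rewrite (_ : _ \o _ = Z ^~ (enum_val k)); first exact: mZ.
by apply/funext => w /=; rewrite tnth_mktuple.
Qed.

Lemma measurable_untup i : measurable_fun setT (fun t => untup t i).
Proof. exact: measurable_tnth. Qed.

Lemma law_eq A : measurable A -> P ((fun w => tup (X w)) @^-1` A) = P' ((fun w => tup (Y w)) @^-1` A).
Proof.
have mtX := measurable_tup mX; have mtY := measurable_tup mY.
move=> mA.
pose fX : {mfun T >-> #|I|.-tuple R} := HB.pack (fun w => tup (X w)) (isMeasurableFun.Build _ _ _ _ _ mtX).
pose fY : {mfun T' >-> #|I|.-tuple R} := HB.pack (fun w => tup (Y w)) (isMeasurableFun.Build _ _ _ _ _ mtY).
apply: (@tuple_measure_unique _ _ (pushforward P fX) (pushforward P' fY)) => //; last first.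
  by rewrite /pushforward; apply: (le_lt_trans (probability_le1 _ _)); rewrite ?ltry //; exact: (measurable_funPTI fX).
have H (T0 : Type) (Z : T0 -> I -> R) a b : (fun w => tup (Z w)) @^-1` (tbox a b) =
    [set w | forall i, a (enum_rank i) < Z w i <= b (enum_rank i)].
  apply/seteqP; split => w /= Hw i.
    by have := Hw (enum_rank i); rewrite tnth_mktuple enum_rankK.
  by have := Hw (enum_val i); rewrite enum_valK tnth_mktuple.
move=> a b; transitivity (P [set w | forall i, a (enum_rank i) < X w i <= b (enum_rank i)]).
  by rewrite -H.
by rewrite XY -H.
Qed.

(** [tup] moves the family to tuples, where boxes determine a law; positive and negative parts are
    then compared through the image measures. *)
Lemma law_integral (G : (I -> R) -> R) : measurable_fun setT (G \o untup) ->
  (\int[P]_w (G (X w))%:E = \int[P']_w (G (Y w))%:E)%E.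
Proof.
move=> mG.
have mtX := measurable_tup mX; have mtY := measurable_tup mY.
pose fX : {mfun T >-> #|I|.-tuple R} := HB.pack (fun w => tup (X w)) (isMeasurableFun.Build _ _ _ _ _ mtX).
pose fY : {mfun T' >-> #|I|.-tuple R} := HB.pack (fun w => tup (Y w)) (isMeasurableFun.Build _ _ _ _ _ mtY).
have key (g : #|I|.-tuple R -> \bar R) : measurable_fun [set: #|I|.-tuple R] g -> (forall t, 0 <= g t)%E ->
   (\int[P]_w (g (fX w)) = \int[P']_w (g (fY w)))%E.
  move=> mg g0.
  have := @ge0_integral_pushforward _ _ _ _ R fX mtX P setT g measurableT mg (fun t _ => g0 t).
  have := @ge0_integral_pushforward _ _ _ _ R fY mtY P' setT g measurableT mg (fun t _ => g0 t).
  rewrite !preimage_setT => <- <-.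
  by apply: eq_measure_integral => A mA _; exact: law_eq.
have mGE : measurable_fun setT (EFin \o (G \o untup)) by apply/measurable_EFinP.
have EX : (fun w => (G (X w))%:E) = (EFin \o (G \o untup)) \o fX by apply/funext => w /=; rewrite tupK.
have EY : (fun w => (G (Y w))%:E) = (EFin \o (G \o untup)) \o fY by apply/funext => w /=; rewrite tupK.
have key2 (g : #|I|.-tuple R -> \bar R) : measurable_fun [set: #|I|.-tuple R] g ->
   (\int[P]_w ((g \o fX) w) = \int[P']_w ((g \o fY) w))%E.
  move=> mg; rewrite integralE [in RHS]integralE.
  rewrite (funepos_comp g fX) (funepos_comp g fY) (funeneg_comp g fX) (funeneg_comp g fY); congr (_ - _)%E.
    by apply: (key g^\+%E); [exact: measurable_funepos|move=> t; exact: funepos_ge0].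
  by apply: (key g^\-%E); [exact: measurable_funeneg|move=> t; exact: funeneg_ge0].
by have := key2 _ mGE; rewrite -EX -EY.
Qed.

End LawUnique.

Section BoundedIntegral.
Variables (R : realType) (d : measure_display) (T : measurableType d).

Definition bm (f : T -> R) := measurable_fun setT f /\ exists M, forall t, `|f t| <= M.

Lemma bm_cst c : bm (fun _ => c).
Proof. by split; [exact: measurable_cst|exists `|c|]. Qed.

Lemma bmD f g : bm f -> bm g -> bm (fun t => f t + g t).
Proof.
move=> [mf [M HM]] [mg [M' HM']]; split; first exact: measurable_funD.
by exists (M + M') => t; rewrite (le_trans (ler_normD _ _)) // lerD.
Qed.

Lemma bmM f g : bm f -> bm g -> bm (fun t => f t * g t).
Proof.
move=> [mf [M HM]] [mg [M' HM']]; split; first exact: measurable_funM.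
by exists (M * M') => t; rewrite normrM ler_pM.
Qed.

Lemma bmZ c f : bm f -> bm (fun t => c * f t).
Proof. by move=> bf; apply: bmM => //; apply: bm_cst. Qed.

Lemma bm_falg : falg bm.
Proof. by split; [exact: bm_cst|exact: bmD|exact: bmM]. Qed.

Lemma measurable_falg : falg (fun f : T -> R => measurable_fun setT f).
Proof.
by split=> *; [exact: measurable_cst|exact: measurable_funD|exact: measurable_funM].
Qed.

Variables (mu : {measure set T -> \bar R}) (w : T -> R).
Hypothesis iw : mu.-integrable setT (EFin \o w).

(** Serves as expectation for w = 1 and as integral against the density for w = [rho], so that one
    argument can compare the two laws. *)
Definition wint (f : T -> R) : R := Rintegral mu setT (fun t => f t * w t).

Lemma wint_integrable f : bm f -> mu.-integrable setT (EFin \o (fun t => f t * w t)).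
Proof.
move=> [mf [M HM]]; have := @integrableMl _ _ _ mu setT measurableT _ f iw mf.
have Hb : [bounded f x | x in setT].
  exists M; split; first exact: num_real.
  by move=> x Mx t _ /=; rewrite (le_trans (HM t)) // ltW.
move=> /(_ Hb); apply: eq_integrable => // t _ /=.
by rewrite -EFinM mulrC.
Qed.

Lemma wintD f g : bm f -> bm g -> wint (fun t => f t + g t) = wint f + wint g.
Proof.
move=> bf bg; rewrite /wint -RintegralD //; try exact: wint_integrable.
by apply: eq_Rintegral => t _; rewrite mulrDl.
Qed.

Lemma wintZ c f : bm f -> wint (fun t => c * f t) = c * wint f.
Proof.
move=> bf; rewrite /wint -RintegralZl //; last exact: wint_integrable.
by apply: eq_Rintegral => t _; rewrite mulrA.
Qed.

Lemma wint_sum (I : Type) (r : seq I) (F : I -> T -> R) :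
  (forall i, bm (F i)) -> wint (fun t => \sum_(i <- r) F i t) = \sum_(i <- r) wint (F i).
Proof.
move=> H; elim: r => [|i r IH].
  rewrite big_nil (_ : (fun t => _) = fun _ => 0 * 0); first by rewrite wintZ ?mul0r //; exact: bm_cst.
  by apply/funext => t; rewrite big_nil mul0r.
rewrite big_cons -IH -wintD //; last exact: (fa_sum bm_falg).
by congr wint; apply/funext => t; rewrite big_cons.
Qed.

Lemma wint_dominated (f_ : nat -> T -> R) (f : T -> R) (M : R) : (forall m, measurable_fun setT (f_ m)) ->
  (forall m t, w t != 0 -> `|f_ m t| <= M) ->
  (forall t, w t != 0 -> f_ ^~ t @ \oo --> f t) -> measurable_fun setT f ->
  (fun m => wint (f_ m)) @ \oo --> wint f.
Proof.
move=> mf_ fM cf mf.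
have mw : measurable_fun setT w by have /integrableP[/measurable_EFinP] := iw.
have mM (g : T -> R) : measurable_fun setT g -> measurable_fun setT (fun t => (g t * w t)%:E).
  by move=> mg; apply/measurable_EFinP; apply: measurable_funM.
have cvg0 : {ae mu, forall t, setT t -> (fun m => (f_ m t * w t)%:E) @ \oo --> (f t * w t)%:E}.
  apply: aeW => t _; apply: cvg_EFin; first by near=> m.
  have [w0|w0] := eqVneq (w t) 0.
    rewrite w0 mulr0 (_ : fine \o _ = fun=> 0); first exact: cvg_cst.
    by apply/funext => m /=; rewrite mulr0.
  exact: (cvgM (cf t w0) (cvg_cst _)).
have ig : mu.-integrable setT (fun t => (M * `|w t|)%:E).
  have := integrableZl measurableT M (integrable_abse iw).
  by apply: eq_integrable => // t _; rewrite /= EFinM.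
have dom : {ae mu, forall t (m : nat), setT t -> (`|(f_ m t * w t)%:E| <= (M * `|w t|)%:E)%E}.
  apply: aeW => t m _; rewrite /= lee_fin normrM.
  have [->|w0] := eqVneq (w t) 0; first by rewrite normr0 !mulr0.
  by rewrite ler_wpM2r // fM.
have [If _ H] := dominated_convergence measurableT (fun m => mM _ (mf_ m)) (mM _ mf) cvg0 ig dom.
apply: fine_cvg; rewrite fineK; last exact: integrable_fin_num.
exact: H.
Unshelve. all: by end_near. Qed.

Lemma wint_ge0 f : (forall t, 0 <= f t * w t) -> 0 <= wint f.
Proof. by move=> H; apply: Rintegral_ge0. Qed.

End BoundedIntegral.

Section Expectation.
Variables (R : realType) (d : measure_display) (T : measurableType d) (P : probability T R).

Definition Ex (f : T -> R) : R := wint P (fun=> 1) f.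

Lemma integrable_one : P.-integrable setT (EFin \o (fun=> 1 : R)).
Proof. exact: finite_measure_integrable_cst. Qed.

Lemma ExE f : Ex f = fine (\int[P]_w (f w)%:E).
Proof. by rewrite /Ex /wint /Rintegral; congr fine; apply: eq_integral => t _; rewrite mulr1. Qed.

Lemma Ex_cst c : Ex (fun=> c) = c.
Proof.
have PT : (P : set T -> \bar R) setT = 1%E := probability_setT P.
by rewrite ExE integral_cst //= [P _]PT mule1.
Qed.

Lemma Ex_integral f : bm f -> (\int[P]_w (f w)%:E)%E = (Ex f)%:E.
Proof.
move=> bf; rewrite ExE fineK //.
have := wint_integrable integrable_one bf => /(integrable_fin_num measurableT).
by congr (_ \is a fin_num); apply: eq_integral => t _; rewrite /= mulr1.
Qed.

Lemma eq_Ex f g : f =1 g -> Ex f = Ex g.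
Proof. by move=> fg; congr Ex; apply/funext. Qed.

Lemma ExD f g : bm f -> bm g -> Ex (fun t => f t + g t) = Ex f + Ex g.
Proof. exact: (wintD integrable_one). Qed.

Lemma ExZ c f : bm f -> Ex (fun t => c * f t) = c * Ex f.
Proof. exact: (wintZ integrable_one). Qed.

End Expectation.

Section MatrixEntries.
Variables (R : realType) (N : nat).
Local Notation C := R[i].

Definition sent (A : 'M[C]_N) (k : 'I_N * 'I_N * bool) : R :=
  if k.2 then complex.Re (A k.1.1 k.1.2) else complex.Im (A k.1.1 k.1.2).

Definition smat (x : 'I_N * 'I_N * bool -> R) : 'M[C]_N :=
  \matrix_(i, j) (x (i, j, true) +i* x (i, j, false))%C.

Lemma sentK A : smat (sent A) = A.
Proof. by apply/matrixP => i j; rewrite mxE /sent /=; case: (A i j). Qed.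

Lemma inbox_sent (a b : 'I_N * 'I_N * bool -> R) A :
  (forall k, a k < sent A k <= b k) <->
  inboxC (\matrix_(i, j) a (i, j, true)) (\matrix_(i, j) b (i, j, true))
    (\matrix_(i, j) a (i, j, false)) (\matrix_(i, j) b (i, j, false)) A.
Proof.
split=> [H i j|H [[i j] c]].
  by rewrite !mxE; split; [exact: (H (i, j, true))|exact: (H (i, j, false))].
by have := H i j; rewrite !mxE => -[? ?]; case: c.
Qed.

Definition measurable_mx (d : measure_display) (T : measurableType d) p q (Z : T -> 'M[C]_(p, q)) :=
  MA (fun f : T -> R => measurable_fun setT f) Z.

Lemma measurable_sent (d : measure_display) (T : measurableType d) (Z : T -> 'M[C]_N) :
  measurable_mx Z -> forall k, measurable_fun setT (fun w => sent (Z w) k).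
Proof. by move=> mZ [[i j] []]; have [? ?] := mZ i j. Qed.

Lemma MP_falg_comp (T : Type) (A : (T -> R) -> Prop) (Z : T -> 'M[C]_N) f : falg A ->
  MA A Z -> MP f -> A (fun w => f (Z w)).
Proof.
move=> hA mZ; elim=> [c|i j|i j|{}f g _ Hf _ Hg|{}f g _ Hf _ Hg].
- exact: (fa_const hA).
- by case: (mZ i j).
- by case: (mZ i j).
- exact: (fa_add hA).
- exact: (fa_mul hA).
Qed.

Lemma measurable_smat (I : finType) (h : 'I_N * 'I_N * bool -> I) :
  measurable_mx (fun t : #|I|.-tuple R => smat (untup t \o h)).
Proof.
move=> i j; split.
  have -> : (fun t : #|I|.-tuple R => complex.Re (smat (untup t \o h) i j)) = (fun t => untup t (h (i, j, true))).
    by apply/funext => t; rewrite mxE.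
  exact: measurable_untup.
have -> : (fun t : #|I|.-tuple R => complex.Im (smat (untup t \o h) i j)) = (fun t => untup t (h (i, j, false))).
  by apply/funext => t; rewrite mxE.
exact: measurable_untup.
Qed.

Lemma unitary_entry (A : 'M[C]_N) i j : A \is unitarymx -> `|complex.Re (A i j)| <= 1 /\ `|complex.Im (A i j)| <= 1.
Proof.
move=> /unitary_adj /matrixP /(_ i i); rewrite !mxE eqxx => /(congr1 (@complex.Re R)).
rewrite (raddf_sum (@complex.Re R)) /= => H.
have Hk k : complex.Re (A i k * adj A k i) = complex.Re (A i k) ^+ 2 + complex.Im (A i k) ^+ 2.
  by rewrite adjE; case: (A i k) => x y /=; rewrite mulrN opprK.
have : complex.Re (A i j) ^+ 2 + complex.Im (A i j) ^+ 2 <= 1.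
  rewrite -H (bigD1 j) //= -Hk lerDl sumr_ge0 // => k _.
  by rewrite Hk addr_ge0 ?sqr_ge0.
move=> le1; split; rewrite -(@ler_pXn2r _ 2) ?nnegrE // expr1n real_normK ?num_real //.
  by apply: le_trans le1; rewrite lerDl sqr_ge0.
by apply: le_trans le1; rewrite lerDr sqr_ge0.
Qed.

End MatrixEntries.

(** * The laws of S and g and their independence *)

Section HaarLaw.
Variables (R : realType) (N D : nat) (d : measure_display) (Omega : measurableType d) (P : probability Omega R).
Variables (S : Omega -> 'M[R[i]]_N) (g : Omega -> 'cV[R]_D).
Hypothesis mS : forall i j, measurable_fun setT (fun w => complex.Re (S w i j)) /\
                    measurable_fun setT (fun w => complex.Im (S w i j)).
Hypothesis mg : forall k, measurable_fun setT (fun w => g w k 0).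
Hypothesis Sunit : forall w, S w \is unitarymx.
Hypothesis Shaar : forall U : 'M[R[i]]_N, U \is unitarymx ->
     forall lr hr li hi,
       P [set w | inboxC lr hr li hi (U *m S w)] =
       P [set w | inboxC lr hr li hi (S w)].

Lemma bm_S : MA (@bm R d Omega) S.
Proof.
move=> i j; split; split; try by case: (mS i j).
  by exists 1 => w; case: (unitary_entry i j (Sunit w)).
by exists 1 => w; case: (unitary_entry i j (Sunit w)).
Qed.

Lemma bm_MP f : MP f -> bm (fun w => f (S w)).
Proof. exact: (MP_falg_comp (@bm_falg R d Omega) bm_S). Qed.

Lemma haarE_Ex : haarE (fun f => Ex P (fun w => f (S w))).
Proof.
split.
- by move=> f f' Mf Mf'; apply: ExD; apply: bm_MP.
- by move=> c f Mf; apply: ExZ; apply: bm_MP.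
- move=> U f HU Mf; rewrite !ExE; congr fine.
  have mS' : measurable_mx S by move=> i j; exact: mS.
  have mUS : measurable_mx (fun w => U *m S w).
    by apply: (MA_mul (@measurable_falg R d Omega)) => //; apply: (MA_const (@measurable_falg R d Omega)).
  have := @law_integral R _ _ _ _ _ P P (fun w => sent (U *m S w)) (fun w => sent (S w))
    (measurable_sent mUS) (measurable_sent mS') _ (fun x => f (smat x)).
  under eq_integral do rewrite sentK.
  move=> ->; first by apply: eq_integral => w _; rewrite sentK.
    move=> a b.
    have := Shaar HU (\matrix_(i, j) a (i, j, true)) (\matrix_(i, j) b (i, j, true))
      (\matrix_(i, j) a (i, j, false)) (\matrix_(i, j) b (i, j, false)).
    by congr (P _ = P _); apply/seteqP; split => w /=; rewrite inbox_sent.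
  have mm := @measurable_smat R N _ id.
  apply: (MP_falg_comp _ mm Mf); exact: measurable_falg.
- by move=> f f' Mf Mf' H; apply: eq_Ex => w; exact: H.
Qed.

Lemma haarE1 : Ex P (fun w => 1) = 1.
Proof. exact: Ex_cst. Qed.

Hypothesis gGauss : forall lr hr li hi (c e : 'cV[R]_D),
     P [set w | inboxC lr hr li hi (S w) /\ inboxV c e (g w)] =
     (P [set w | inboxC lr hr li hi (S w)] *
      \prod_(k < D)
         \int[@lebesgue_measure R]_(x in `]c k ord0, e k ord0]) (normal_pdf 0%R 1%R x)%:E)%E.

Lemma gauss_box (a b : 'I_D -> R) : P [set w | forall k, a k < g w k 0 <= b k] =
  (\prod_(k < D) normal_prob 0 1 `]a k, b k])%E.
Proof.
(* Entries of a unitary matrix lie in [-1, 1], so the half-open box from -2 to 2 puts no condition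
   on S and only the law of g remains. *)
have := gGauss (const_mx (-2)) (const_mx 2) (const_mx (-2)) (const_mx 2) (\col_k a k) (\col_k b k).
have H w : inboxC (const_mx (-2)) (const_mx 2) (const_mx (-2)) (const_mx 2) (S w).
  move=> i j; rewrite !mxE; have [] := unitary_entry i j (Sunit w).
  by rewrite !ler_norml => /andP[h1 h2] /andP[h3 h4]; split; lra.
have -> : [set w | inboxC (const_mx (-2)) (const_mx 2) (const_mx (-2)) (const_mx 2) (S w)] = setT.
  by apply/seteqP; split => // w _; exact: H.
rewrite probability_setT mul1e => E.
transitivity (P [set w | inboxC (const_mx (-2)) (const_mx 2) (const_mx (-2)) (const_mx 2) (S w) /\
   inboxV (\col_k a k) (\col_k b k) (g w)]).
  congr (P _); apply/seteqP; split => w /=.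
    by move=> Hw; split=> // k; rewrite !mxE.
  by move=> [_ Hw] k; have := Hw k; rewrite !mxE.
by rewrite E; apply: eq_bigr => k _; rewrite !mxE.
Qed.

(** By independence, evaluating g at a second, independent sample point leaves the joint law
    unchanged; the two laws agree on boxes. *)
Lemma joint_law (G : 'M[R[i]]_N -> ('I_D -> R) -> R) :
  measurable_fun setT (fun t : #|{: ('I_N * 'I_N * bool) + 'I_D}|.-tuple R =>
     G (smat (untup t \o inl)) (untup t \o inr)) ->
  (\int[P]_w (G (S w) (fun k => g w k 0))%:E =
   \int[(P \x P)%E]_z (G (S z.1) (fun k => g z.2 k 0))%:E)%E.
Proof.
move=> mG.
pose X w (k : ('I_N * 'I_N * bool) + 'I_D) := match k with inl k' => sent (S w) k' | inr k' => g w k' 0 end.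
pose Y (z : Omega * Omega) (k : ('I_N * 'I_N * bool) + 'I_D) := match k with inl k' => sent (S z.1) k' | inr k' => g z.2 k' 0 end.
have mS' : measurable_mx S by move=> i j; exact: mS.
have mX k : measurable_fun setT (X ^~ k) by case: k => k; [exact: measurable_sent|exact: mg].
have mY k : measurable_fun setT (Y ^~ k).
  case: k => k.
    exact: (measurableT_comp (measurable_sent mS' k) measurable_fst).
  exact: (measurableT_comp (mg k) measurable_snd).
pose G' (x : ('I_N * 'I_N * bool) + 'I_D -> R) := G (smat (x \o inl)) (x \o inr).
have := @law_integral R _ _ _ _ _ P (P \x P)%E X Y mX mY _ G' mG.
have GX w : G' (X w) = G (S w) (fun k => g w k 0) by rewrite /G' /X; congr G; rewrite -[RHS]sentK.
have GY z : G' (Y z) = G (S z.1) (fun k => g z.2 k 0) by rewrite /G' /Y; congr G; rewrite -[RHS]sentK.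
under eq_integral do rewrite GX.
move=> ->; first by apply: eq_integral => z _; rewrite GY.
move=> a b.
have -> : [set w | forall i, a i < X w i <= b i] =
  [set w | inboxC (\matrix_(i, j) a (inl (i, j, true))) (\matrix_(i, j) b (inl (i, j, true)))
    (\matrix_(i, j) a (inl (i, j, false))) (\matrix_(i, j) b (inl (i, j, false))) (S w) /\
    inboxV (\col_k a (inr k)) (\col_k b (inr k)) (g w)].
  apply/seteqP; split => w /=.
    move=> H; split; first by apply/(inbox_sent (a \o inl) (b \o inl)) => k; exact: (H (inl k)).
    by move=> k; rewrite !mxE; exact: (H (inr k)).
  move=> [/(inbox_sent (a \o inl) (b \o inl)) H1 H2] [k|k]; first exact: H1.
  by have := H2 k; rewrite !mxE.
rewrite gGauss.
pose A := [set w | forall k, (a \o inl) k < sent (S w) k <= (b \o inl) k].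
pose B := [set w | forall k, (a \o inr) k < g w k 0 <= (b \o inr) k].
have mA : measurable A.
  have -> : A = \big[setI/setT]_(k : 'I_N * 'I_N * bool) ((fun w => sent (S w) k) @^-1` `](a \o inl) k, (b \o inl) k]).
    rewrite -bigcap_seq; apply/seteqP; split => [w tab i _|w H i]; first by rewrite /= in_itv /=; exact: tab.
    by have := H i (mem_index_enum i); rewrite /= in_itv.
  apply: bigsetI_measurable => i _; rewrite -[X in measurable X]setTI.
  exact: (measurable_sent mS' i).
have mB : measurable B.
  have -> : B = \big[setI/setT]_(k : 'I_D) ((fun w => g w k 0) @^-1` `](a \o inr) k, (b \o inr) k]).
    rewrite -bigcap_seq; apply/seteqP; split => [w tab i _|w H i]; first by rewrite /= in_itv /=; exact: tab.
    by have := H i (mem_index_enum i); rewrite /= in_itv.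
  by apply: bigsetI_measurable => i _; rewrite -[X in measurable X]setTI; exact: mg.
have -> : [set z | forall i, a i < Y z i <= b i] = A `*` B.
  apply/seteqP; split => z /=.
    by move=> H; split => k; [exact: (H (inl k))|exact: (H (inr k))].
  by move=> [H1 H2] [k|k]; [exact: H1|exact: H2].
have PB : P B = _ := gauss_box (a \o inr) (b \o inr).
transitivity (P A * P B)%E; last by rewrite [RHS]product_measure1E.
rewrite PB; congr (P _ * _)%E.
  by apply/seteqP; split => w /= Hw; exact/(inbox_sent (a \o inl) (b \o inl)).
by apply: eq_bigr => k _; rewrite !mxE.
Qed.

Lemma joint_fubini (G : 'M[R[i]]_N -> ('I_D -> R) -> R) (M : R) :
  measurable_fun setT (fun t : #|{: ('I_N * 'I_N * bool) + 'I_D}|.-tuple R =>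
     G (smat (untup t \o inl)) (untup t \o inr)) ->
  (forall w x, `|G (S w) x| <= M) ->
  Ex P (fun w => G (S w) (fun k => g w k 0)) =
  Ex P (fun w2 => Ex P (fun w1 => G (S w1) (fun k => g w2 k 0))).
Proof.
move=> mG GM; rewrite ExE joint_law //.
have mS' : measurable_mx S by move=> i j; exact: mS.
pose Y (z : Omega * Omega) (k : ('I_N * 'I_N * bool) + 'I_D) := match k with inl k' => sent (S z.1) k' | inr k' => g z.2 k' 0 end.
have mY k : measurable_fun setT (Y ^~ k).
  case: k => k.
    exact: (measurableT_comp (measurable_sent mS' k) measurable_fst).
  exact: (measurableT_comp (mg k) measurable_snd).
have mGz : measurable_fun setT (fun z : Omega * Omega => G (S z.1) (fun k => g z.2 k 0)).
  have := measurableT_comp mG (measurable_tup mY).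
  congr (measurable_fun _ _); apply/funext => z /=; rewrite tupK; congr G.
  by rewrite -[RHS]sentK.
have bz : bm (fun z : Omega * Omega => G (S z.1) (fun k => g z.2 k 0)) by split => //; exists M.
have iz : (P \x P)%E.-integrable setT (EFin \o (fun z : Omega * Omega => G (S z.1) (fun k => g z.2 k 0))).
  have := wint_integrable (integrable_one (P \x P)%E) bz.
  by apply: eq_integrable => // z _; rewrite /= mulr1.
rewrite -(integral21_prod_meas1 iz) [in RHS]ExE; congr fine; apply: eq_integral => w2 _.
rewrite /fubini_G /= Ex_integral //; split; last by exists M.
exact: (measurableT_comp mGz (pair2_measurable w2)).
Qed.

End HaarLaw.

(** * Gaussian vectors *)

Section Stein1.
Variable R : realType.
Local Notation mu := (@lebesgue_measure R).
Local Notation gam := (normal_prob (0 : R) 1).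
Local Notation pdf := (normal_pdf (0 : R) 1).

Lemma integral_gauss (f : R -> \bar R) : measurable_fun setT f -> (forall x, 0 <= f x)%E ->
  (\int[gam]_x f x = \int[mu]_x (f x * (pdf x)%:E))%E.
Proof.
move=> mf f0.
have dom : gam `<< mu := @normal_prob_dominates R 0 1.
rewrite -(Radon_Nikodym_SigmaFinite.change_of_variables dom f0 measurableT mf).
have irn := Radon_Nikodym_SigmaFinite.f_integrable dom.
have mpdf : measurable_fun setT (fun x => (pdf x)%:E).
  by apply/measurable_EFinP; exact: measurable_normal_pdf.
apply: ae_eq_integral => //.
- by apply: emeasurable_funM => //; exact: measurable_int irn.
- exact: emeasurable_funM.
apply: ae_eqe_mul2l; apply: integral_ae_eq => // E _ mE.
by rewrite -Radon_Nikodym_SigmaFinite.f_integral.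
Qed.

Definition gexp (s x : R) : R := expR (- (x ^+ 2 / s)).

Lemma gexp_integrable s : 0 < s -> mu.-integrable setT (EFin \o gexp s).
Proof.
move=> s0; pose sg := Num.sqrt (s / 2).
have sg2 : sg ^+ 2 *+ 2 = s by rewrite sqr_sqrtr ?divr_ge0 ?ltW // -mulr_natl mulrCA mulfV ?mulr1.
have sg0 : sg != 0 by rewrite gt_eqF // sqrtr_gt0 divr_gt0.
have := integrableZl measurableT (normal_peak sg)^-1 (integrable_normal_pdf 0 sg).
apply: eq_integrable => // x _; rewrite normal_pdfE // /normal_fun subr0 sg2 /= -EFinM.
by rewrite mulKf ?gt_eqF ?normal_peak_gt0 // /gexp mulNr.
Qed.

Lemma pdfE x : pdf x = normal_peak 1 * gexp 2 x.
Proof. by rewrite normal_pdfE ?oner_eq0 // /normal_fun subr0 /gexp expr1n mulNr. Qed.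

(** The Gaussian is the square of exp (-x^2/4), and one of the two factors absorbs x^2 by u <= exp u
    with u = x^2/4. *)
Lemma gexp2_le4 x : x ^+ 2 * gexp 2 x <= 4 * gexp 4 x.
Proof.
have E : gexp 2 x = gexp 4 x * gexp 4 x by rewrite /gexp -expRD; congr expR; field.
have H : x ^+ 2 * gexp 4 x <= 4.
  have := expR_ge1Dx (x ^+ 2 / 4) => H1.
  have : x ^+ 2 / 4 <= expR (x ^+ 2 / 4) by apply: le_trans H1; rewrite lerDr.
  rewrite ler_pdivrMr // => H2.
  by rewrite /gexp expRN ler_pdivrMr ?expR_gt0 // mulrC.
by rewrite E mulrA ler_wpM2r // expR_ge0.
Qed.

Lemma is_derive_gexp2 (x : R) : is_derive x (1 : R) (gexp 2) (- x * gexp 2 x).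
Proof.
have H : is_derive x (1 : R) (- ((2^-1 : R) *: (@idfun R ^+ 2))) (- x).
  by apply: is_derive_eq; rewrite /GRing.scale /= expr1; field.
have := is_derive1_comp (is_derive_expR _) H.
have -> : expR \o (- ((2^-1 : R) *: (@idfun R ^+ 2))) = gexp 2.
  by apply/funext => y; rewrite /gexp /= mulrC.
by move=> H1; apply: (is_derive_eq H1); rewrite mulrC /gexp; congr (_ * expR _); rewrite /= /GRing.scale /= mulrC.
Qed.

Section Stein.
Variables (phi dphi : R -> R) (M : R).
Hypothesis dphiE : forall x : R, is_derive x (1 : R) phi (dphi x).
Hypothesis cdphi : continuous dphi.
Hypothesis bdphi : forall x, `|dphi x| <= M.
Hypothesis bphi : forall x, `|phi x| <= M * `|x|.

Let h x := phi x * gexp 2 x.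
Let dh x := (dphi x - x * phi x) * gexp 2 x.

Let cphi : continuous phi.
Proof. by move=> x; apply/differentiable_continuous/derivable1_diffP; case: (dphiE x). Qed.

Let cgexp : continuous (gexp 2).
Proof. by move=> x; apply/differentiable_continuous/derivable1_diffP; case: (is_derive_gexp2 x). Qed.

Let derh (x : R) : is_derive x (1 : R) h (dh x).
Proof.
have := is_deriveM (dphiE x) (is_derive_gexp2 x).
move=> H; apply: (is_derive_eq H); rewrite /dh /GRing.scale /=; ring.
Qed.

Let cdh : continuous dh.
Proof.
move=> x; apply: cvgM; last exact: cgexp.
by apply: cvgB; [exact: cdphi|apply: cvgM; [exact: cvg_id|exact: cphi]].
Qed.

Let M0 : 0 <= M.
Proof. exact: le_trans (normr_ge0 _) (bdphi 0). Qed.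

Let idh : mu.-integrable setT (EFin \o dh).
Proof.
have i1 := integrableZl measurableT M (gexp_integrable (s := 2) ltac:(lra)).
have i2 := integrableZl measurableT (4 * M) (gexp_integrable (s := 4) ltac:(lra)).
apply: le_integrable (integrableD measurableT i1 i2) => //.
  by apply/measurable_EFinP; exact: continuous_measurable_fun.
move=> x _; rewrite -[(_ + _)%E]/((M * gexp 2 x + 4 * M * gexp 4 x)%:E) /= lee_fin.
have e2 : 0 <= gexp 2 x by exact: expR_ge0.
have e4 : 0 <= gexp 4 x by exact: expR_ge0.
rewrite [X in _ <= X]ger0_norm; last by rewrite addr_ge0 // mulr_ge0 // mulr_ge0.
rewrite normrM (ger0_norm e2) (le_trans (ler_wpM2r e2 (ler_normB _ _))) // mulrDl lerD ?ler_wpM2r //.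
rewrite normrM -mulrA.
have := gexp2_le4 x; have := bphi x => H1 H2.
have : `|x| * (`|phi x| * gexp 2 x) <= `|x| * (M * `|x| * gexp 2 x).
  by rewrite ler_wpM2l // ler_wpM2r.
move/le_trans; apply.
have -> : `|x| * (M * `|x| * gexp 2 x) = M * (x ^+ 2 * gexp 2 x).
  by rewrite -[x ^+ 2]real_normK ?num_real //; ring.
have -> : 4 * M * gexp 4 x = M * (4 * gexp 4 x) by ring.
by rewrite ler_wpM2l.
Qed.

Let ftc (m : nat) : (\int[mu]_(x in `[(- m.+1%:R)%R, (m.+1%:R)%R]) (dh x)%:E = (h m.+1%:R - h (- m.+1%:R))%:E)%E.
Proof.
have lt : - m.+1%:R < m.+1%:R :> R by rewrite -subr_gt0 opprK addr_gt0.
rewrite (continuous_FTC2 (F := h) lt) ?EFinB //.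
- by apply: continuous_subspaceT; exact: cdh.
- have ch : continuous h by move=> x; apply: cvgM; [exact: cphi|exact: cgexp].
  split; first by move=> x _; case: (derh x).
  + by apply: cvg_at_right_filter; exact: ch.
  + by apply: cvg_at_left_filter; exact: ch.
- by move=> x _; rewrite derive1E; case: (derh x).
Qed.

Let hbound (m : nat) : `|h m.+1%:R - h (- m.+1%:R)| <= 4 * M / m.+1%:R.
Proof.
have key (x : R) : `|x| = m.+1%:R -> `|h x| <= 2 * M / m.+1%:R.
  move=> Hx; rewrite normrM (ger0_norm (expR_ge0 _)).
  rewrite (le_trans (ler_wpM2r (expR_ge0 _) (bphi x))) // Hx.
  have H : (m.+1%:R : R) ^+ 2 * gexp 2 x <= 2.
    rewrite -Hx real_normK ?num_real // /gexp expRN ler_pdivrMr ?expR_gt0 //.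
    have H1 := expR_ge1Dx (x ^+ 2 / 2).
    have : x ^+ 2 / 2 <= expR (x ^+ 2 / 2) by apply: le_trans H1; rewrite lerDr.
    by rewrite ler_pdivrMr // mulrC.
  rewrite ler_pdivlMr //.
  have -> : M * m.+1%:R * gexp 2 x * m.+1%:R = M * (m.+1%:R ^+ 2 * gexp 2 x) by ring.
  by rewrite [2 * M]mulrC ler_wpM2l.
rewrite (le_trans (ler_normB _ _)) //.
have -> : 4 * M / m.+1%:R = 2 * M / m.+1%:R + 2 * M / m.+1%:R by field; rewrite nat1r pnatr_eq0.
by rewrite lerD // key // ?normrN ger0_norm.
Qed.

Let h0 : (fun m : nat => h m.+1%:R - h (- m.+1%:R)) @ \oo --> (0 : R).
Proof.
apply/cvgr0Pnorm_le => e e0.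
have : (fun m : nat => (4 * M) * (m.+1%:R)^-1) @ \oo --> (4 * M) * (0 : R).
  by apply: cvgM; [exact: cvg_cst|exact: cvg_harmonic].
rewrite mulr0 => /cvgr0Pnorm_le /(_ e e0); apply: filterS => m.
by apply: le_trans; rewrite (le_trans (hbound m)) // ler_norm.
Qed.

Let dh0 : Rintegral mu setT dh = 0.
Proof.
pose f_ (m : nat) : R -> R := \1_(`[- m.+1%:R, m.+1%:R] : set R).
have H : (fun m => wint mu dh (f_ m)) @ \oo --> wint mu dh (fun=> 1).
  apply: (wint_dominated idh (M := 1)) => //.
  - by move=> m; apply: measurable_indic; exact: measurable_itv.
  - move=> m t _; rewrite /f_ indicE; by case: (_ \in _); rewrite ?normr1 ?normr0.
  - move=> t _; apply: cvg_near_cst.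
    exists (Num.truncn `|t|) => // m /= tm; rewrite /f_ indicE mem_set //= in_itv /=.
    have : `|t| <= m.+1%:R.
      by rewrite (le_trans (ltW (truncnS_gt _))) // ler_nat.
    by rewrite ler_norml.
have E m : wint mu dh (f_ m) = h m.+1%:R - h (- m.+1%:R).
  transitivity (Rintegral mu `[- m.+1%:R, m.+1%:R] dh); last by rewrite /Rintegral ftc.
  rewrite Rintegral_mkcond /wint; apply: eq_Rintegral => x _.
  by rewrite /f_ patchE indicE; case: (_ \in _); rewrite ?mul1r ?mul0r.
have -> : Rintegral mu setT dh = wint mu dh (fun=> 1).
  by rewrite /wint; apply: eq_Rintegral => x _; rewrite mul1r.
move: H; have -> : (fun m => wint mu dh (f_ m)) = (fun m => h m.+1%:R - h (- m.+1%:R)).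
  by apply/funext => m; rewrite E.
by move=> H; apply: (cvg_unique _ H h0).
Qed.

(** h = phi exp (-x^2/2) has the derivative (phi' - x phi) exp (-x^2/2). Its integral over [-m, m]
    tends to 0, because the growth bound on phi makes h of order 1/m at the ends. *)
Lemma stein1 : (forall x, 0 <= x * phi x) ->
  (\int[gam]_x (dphi x)%:E = \int[gam]_x (x * phi x)%:E)%E.
Proof.
move=> xphi0.
have c0 : 0 <= normal_peak (1 : R) by exact: normal_peak_ge0.
have mphi : measurable_fun setT phi by exact: continuous_measurable_fun.
have mdphi : measurable_fun setT dphi by exact: continuous_measurable_fun.
have mxphi : measurable_fun setT (fun x : R => x * phi x) by apply: measurable_funM.
have mg : measurable_fun setT (gexp 2) by exact: continuous_measurable_fun.
have i1 : mu.-integrable setT (EFin \o gexp 2) := gexp_integrable (s := 2) ltac:(lra).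
have idp : mu.-integrable setT (EFin \o (fun x => dphi x * gexp 2 x)).
  by apply: (wint_integrable i1); split=> //; exists M.
have ixp : mu.-integrable setT (EFin \o (fun x => x * phi x * gexp 2 x)).
  have := integrableB measurableT idp idh.
  by apply: eq_integrable => // x _; rewrite /dh /= -EFinB; congr (_%:E); ring.
have imd : gam.-integrable setT (EFin \o dphi).
  have := wint_integrable (integrable_one gam) (f := dphi).
  move=> H; have {}H := H (conj mdphi (ex_intro _ M bdphi)).
  by move: H; apply: eq_integrable => // x _; rewrite /= mulr1.
(* [integral_gauss] is stated for nonnegative functions; adding the bound M makes the integrand
   nonnegative. *)
have E1 : (\int[gam]_x (dphi x + M)%:E = (normal_peak 1 * Rintegral mu setT (fun x => (dphi x + M) * gexp 2 x))%:E)%E.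
  rewrite integral_gauss //; last 2 first.
  - by apply/measurable_EFinP; apply: measurable_funD.
  - by move=> x; rewrite lee_fin -lerBlDr sub0r; have := bdphi x; rewrite ler_norml => /andP[].
  have im : mu.-integrable setT (EFin \o (fun x => (dphi x + M) * gexp 2 x)).
    apply: (wint_integrable i1); split; first exact: measurable_funD.
    by exists (M + M) => x; rewrite (le_trans (ler_normD _ _)) // lerD // ger0_norm.
  rewrite EFinM /Rintegral fineK; last exact: integrable_fin_num.
  rewrite -integralZl //; apply: eq_integral => x _; rewrite pdfE -!EFinM; congr (_%:E); ring.
have E2 : (\int[gam]_x (x * phi x)%:E = (normal_peak 1 * Rintegral mu setT (fun x => x * phi x * gexp 2 x))%:E)%E.
  rewrite integral_gauss //; last by apply/measurable_EFinP.
  rewrite EFinM /Rintegral fineK; last exact: integrable_fin_num.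
  rewrite -integralZl //; apply: eq_integral => x _; rewrite pdfE -!EFinM; congr (_%:E); ring.
have E3 : (\int[gam]_x (M)%:E = (normal_peak 1 * Rintegral mu setT (fun x => M * gexp 2 x))%:E)%E.
  rewrite integral_gauss //.
  rewrite EFinM /Rintegral fineK; last exact: (integrable_fin_num measurableT (integrableZl measurableT M i1)).
  rewrite -integralZl //; last exact: (integrableZl measurableT M i1).
  by apply: eq_integral => x _; rewrite pdfE -!EFinM; congr (_%:E); ring.
have iM : gam.-integrable setT (EFin \o (fun=> M)) by exact: finite_measure_integrable_cst.
have E4 : (\int[gam]_x (dphi x + M)%:E = \int[gam]_x (dphi x)%:E + \int[gam]_x (M)%:E)%E.
  by rewrite -integralD_EFin.
have fM : (\int[gam]_x (M)%:E)%E \is a fin_num by rewrite E3.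
have iMg : mu.-integrable setT (EFin \o (fun x => M * gexp 2 x)) by exact: (integrableZl measurableT M i1).
have E5 : Rintegral mu setT (fun x => (dphi x + M) * gexp 2 x) =
   Rintegral mu setT (fun x => x * phi x * gexp 2 x) + Rintegral mu setT (fun x => M * gexp 2 x).
  rewrite -[X in X + _]add0r -dh0 -RintegralD // -RintegralD //.
    by apply: eq_Rintegral => x _; rewrite /dh; ring.
  have := integrableD measurableT idh ixp.
  by apply: eq_integrable => // x _; rewrite /= -EFinD.
apply/eqP; rewrite -(addeK (\int[gam]_x (dphi x)%:E)%E fM) -E4 E1 E5 E2.
by rewrite E3 -EFinB mulrDr addrK.
Qed.

End Stein.
End Stein1.

(** A pointwise limit of the continuous functions x / (x^2 + 1/(m+1)); at 0 they vanish, in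
    agreement with the convention for the inverse of 0. *)
Lemma measurable_invr (R : realType) : measurable_fun setT (fun x : R => x^-1).
Proof.
pose f_ (m : nat) (x : R) := x * (x ^+ 2 + m.+1%:R^-1)^-1.
have p0 (m : nat) (x : R) : 0 < x ^+ 2 + m.+1%:R^-1 by rewrite ltr_wpDl ?sqr_ge0 // invr_gt0.
apply: (measurable_fun_cvg (h := f_)).
  move=> m; apply: continuous_measurable_fun => x; apply: cvgM; first exact: cvg_id.
  apply: cvgV; first by rewrite gt_eqF.
  by apply: cvgD; [exact: sqr_continuous|exact: cvg_cst].
move=> x _; have [->|x0] := eqVneq x 0.
  by rewrite invr0; apply: cvg_near_cst; near=> m; rewrite /f_ mul0r.
have -> : x^-1 = x * (x ^+ 2 + 0)^-1 by rewrite addr0 expr2 invfM mulrA mulfV // mul1r.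
apply: cvgM; first exact: cvg_cst.
apply: cvgV; first by rewrite addr0 expf_neq0.
by apply: cvgD; [exact: cvg_cst|exact: cvg_harmonic].
Unshelve. all: by end_near. Qed.

Section GaussLaw.
Variables (R : realType) (D : nat) (d : measure_display) (Omega : measurableType d) (P : probability Omega R).
Variable g : Omega -> 'I_D -> R.
Hypothesis mg : forall k, measurable_fun setT (fun w => g w k).
Hypothesis gbox : forall a b : 'I_D -> R, P [set w | forall k, a k < g w k <= b k] =
  (\prod_(k < D) normal_prob 0 1 `]a k, b k])%E.
Local Notation gam := (normal_prob (0 : R) 1).

Lemma measurable_gbox (Q : pred 'I_D) (a b : 'I_D -> R) :
  measurable [set w | forall k, Q k -> a k < g w k <= b k].
Proof.
have -> : [set w | forall k, Q k -> a k < g w k <= b k] =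
   \big[setI/setT]_(k <- index_enum 'I_D | Q k) ((fun w => g w k) @^-1` `]a k, b k]).
  rewrite -bigcap_seq_cond; apply/seteqP; split => [w tab i /= /andP[_ Qi]|w H i Qi].
    by rewrite /= in_itv /=; exact: tab.
  by have := H i; rewrite /= mem_index_enum Qi in_itv; apply.
by apply: bigsetI_measurable => i _; rewrite -[X in measurable X]setTI; exact: mg.
Qed.

(** The side of the box in direction k grows to the whole line, whose Gaussian measure is 1. *)
Lemma gauss_others k (a b : 'I_D -> R) : P [set w | forall j, j != k -> a j < g w j <= b j] =
  (\prod_(j < D | j != k) normal_prob 0 1 `]a j, b j])%E.
Proof.
set C := (\prod_(j < D | _) _)%E.
have fC : C \is a fin_num.
  apply: (big_ind (fun x : \bar R => x \is a fin_num)) => //; first by move=> x y; exact: fin_numM.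
  by move=> j _; apply: fin_num_measure.
pose am m j := if j == k then - m%:R else a j.
pose bm m j := if j == k then m%:R else b j.
pose A (m : nat) := [set w | forall j, am m j < g w j <= bm m j].
have PA m : P (A m) = (C * gam `](- m%:R)%R, m%:R])%E.
  rewrite /A gbox (bigD1 k) //= /am /bm eqxx muleC; congr (_ * _)%E.
  by apply: eq_bigr => j /negPf ->.
have cvg1 : P (A m) @[m --> \oo] --> P [set w | forall j, j != k -> a j < g w j <= b j].
  have -> : [set w | forall j, j != k -> a j < g w j <= b j] = \bigcup_m A m.
    apply/seteqP; split => w /=.
      move=> H; exists (Num.truncn `|g w k|).+1 => // j; rewrite /am /bm.
      case: eqP => [->|/eqP jk]; last exact: H.
      have := truncnS_gt `|g w k|; rewrite ltr_norml => /andP[-> /ltW].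
      by rewrite andTb.
    by move=> [m _ H] j jk; have := H j; rewrite /am /bm (negPf jk).
  apply: nondecreasing_cvg_mu.
  - move=> m; have := measurable_gbox predT (am m) (bm m).
    by congr measurable; apply/seteqP; split => w /= H j; [exact: H|move=> _; exact: H].
  - apply: bigcupT_measurable => m; have := measurable_gbox predT (am m) (bm m).
    by congr measurable; apply/seteqP; split => w /= H j; [exact: H|move=> _; exact: H].
  - move=> m n mn; apply/subsetPset => w H j; have := H j; rewrite /am /bm; case: eqP => // _ /andP[h1 h2].
    have mn' : (m%:R : R) <= n%:R by rewrite ler_nat.
    by rewrite (le_lt_trans _ h1) ?lerN2 // (le_trans h2).
have cvg2 : gam `](- m%:R)%R, m%:R] @[m --> \oo] --> (1 : \bar R)%E.
  have -> : 1%E = gam setT by rewrite probability_setT.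
  have -> : [set: R] = \bigcup_m `](- m%:R)%R, m%:R].
    apply/seteqP; split => // x _; exists (Num.truncn `|x|).+1 => //=; rewrite in_itv /=.
    by have := truncnS_gt `|x|; rewrite ltr_norml => /andP[-> /ltW ->].
  apply: nondecreasing_cvg_mu.
  - by move=> m; exact: measurable_itv.
  - by apply: bigcupT_measurable => m; exact: measurable_itv.
  - move=> m n mn; apply/subsetPset => x /=; rewrite !in_itv /= => /andP[h1 h2].
    have mn' : (m%:R : R) <= n%:R by rewrite ler_nat.
    by rewrite (le_lt_trans _ h1) ?lerN2 // (le_trans h2).
have cvg3 : P (A m) @[m --> \oo] --> C.
  rewrite (_ : (fun m => P (A m)) = (fun m => C * gam `](- m%:R)%R, m%:R])%E); last by apply/funext => m; rewrite PA.
  have := cvgeZl fC cvg2; by rewrite mule1.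
exact: (cvg_unique _ cvg1 cvg3).
Qed.

Definition upd (x : 'I_D -> R) k t j := if j == k then t else x j.

(** Coordinate k can be resampled independently, so an identity for one Gaussian variable can be
    integrated over the other coordinates. *)
Lemma upd_law k (G : ('I_D -> R) -> R) : measurable_fun setT (G \o @untup R 'I_D) ->
  (\int[P]_w (G (g w))%:E = \int[(P \x gam)%E]_z (G (upd (g z.1) k z.2))%:E)%E.
Proof.
move=> mG; apply: law_integral => //.
  move=> j; rewrite /upd; case: eqP => _; first exact: measurable_snd.
  exact: (measurableT_comp (mg j) measurable_fst).
move=> a b.
have -> : [set z | forall i, a i < upd (g z.1) k z.2 i <= b i] =
   [set w | forall j, j != k -> a j < g w j <= b j] `*` `]a k, b k].
  apply/seteqP; split => z /=.
    move=> H; split; first by move=> j jk; have := H j; rewrite /upd (negPf jk).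
    by have := H k; rewrite /upd eqxx in_itv.
  by move=> [H1 H2] j; rewrite /upd; case: eqP => [->|/eqP jk]; [move: H2; rewrite in_itv|exact: H1].
rewrite gbox (bigD1 k) //= -gauss_others muleC [RHS]product_measure1E //.
exact: measurable_gbox.
Qed.

Lemma measurable_upd k : forall j, measurable_fun setT (fun z : Omega * R => upd (g z.1) k z.2 j).
Proof.
move=> j; rewrite /upd; case: eqP => _; first exact: measurable_snd.
exact: (measurableT_comp (mg j) measurable_fst).
Qed.

Lemma gauss_neq0 k : {ae P, forall w, g w k != 0}.
Proof.
have mA : measurable [set w | g w k = 0].
  rewrite -[X in measurable X]setTI; exact: (mg k measurableT (measurable_set1 0)).
have mi : measurable_fun setT (\1_([set 0] : set R) : R -> R).
  by apply: measurable_indic; exact: measurable_set1.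
have mA' : measurable_fun setT ((fun x : 'I_D -> R => \1_[set 0] (x k) : R) \o @untup R 'I_D).
  exact: (measurableT_comp mi (measurable_untup k)).
have PA : P [set w | g w k = 0] = 0%E.
  transitivity (\int[P]_w (\1_[set 0] (g w k) : R)%:E)%E.
    have := integral_indic P measurableT mA; rewrite setIT => <-; apply: eq_integral => w _.
    by rewrite !indicE; congr (_%:R%:E); apply/idP/idP; rewrite !in_setE.
  rewrite (upd_law k mA') fubini_tonelli1 //; last first.
    apply/measurable_EFinP.
    exact: (measurableT_comp mi (measurable_upd k k)).
  apply: integral0_eq => w _; rewrite /fubini_F /= /upd eqxx integral_indic // setIT.
  have /null_content_dominatesP dom := @normal_prob_dominates R 0 1.
  by apply: dom => //; exact: lebesgue_measure_set1.
by exists [set w | g w k = 0]; split => // w /= /negP; rewrite negbK => /eqP.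
Qed.

(** * Moments of the squared length ratio of a Gaussian vector *)

Section Ratio.
Variable V : pred 'I_D.
Hypothesis D2 : forall k : 'I_D, exists j, j != k.

Definition r2 (x : 'I_D -> R) := \sum_k x k ^+ 2.
Definition v2 (x : 'I_D -> R) := \sum_(k | V k) x k ^+ 2.
Definition rho12 x := v2 x / r2 x.
(** The partial derivative in x_k of x_k rho12^K, where [rho12] is |v|^2 / |x|^2. [stein_r] is x_k
    times the same function, so both have the same Gaussian expectation. *)
Definition stein_l K k x := rho12 x ^+ K + (2 * K)%:R * rho12 x ^+ K.-1 * (x k ^+ 2 / r2 x) * ((V k)%:R - rho12 x).
Definition stein_r K k x := x k ^+ 2 * rho12 x ^+ K.

Lemma r2_ge0 x : 0 <= r2 x.
Proof. by apply: sumr_ge0 => k _; rewrite sqr_ge0. Qed.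

Lemma v2_ge0 x : 0 <= v2 x.
Proof. by apply: sumr_ge0 => k _; rewrite sqr_ge0. Qed.

Lemma v2_le x : v2 x <= r2 x.
Proof. by rewrite /r2 (bigID V) /= lerDl sumr_ge0 // => k _; rewrite sqr_ge0. Qed.

Lemma rho12_ge0 x : 0 <= rho12 x.
Proof. by rewrite divr_ge0 ?v2_ge0 ?r2_ge0. Qed.

Lemma rho12_le1 x : rho12 x <= 1.
Proof.
rewrite /rho12; have [->|r0] := eqVneq (r2 x) 0; first by rewrite invr0 mulr0.
by rewrite ler_pdivrMr ?mul1r ?v2_le // lt_neqAle eq_sym r0 r2_ge0.
Qed.

Lemma measurable_r2 : measurable_fun setT (r2 \o @untup R 'I_D).
Proof.
apply: (fa_sum (@measurable_falg R _ _) _ _ (F := fun k t => untup t k ^+ 2)) => k.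
apply: (fa_exp (@measurable_falg R _ _)); exact: measurable_untup.
Qed.

Lemma measurable_v2 : measurable_fun setT (v2 \o @untup R 'I_D).
Proof.
apply: (fa_sum (@measurable_falg R _ _) _ _ (F := fun k t => untup t k ^+ 2)) => k.
apply: (fa_exp (@measurable_falg R _ _)); exact: measurable_untup.
Qed.

Lemma measurable_rho12 : measurable_fun setT (rho12 \o @untup R 'I_D).
Proof.
apply: measurable_funM; first exact: measurable_v2.
exact: (measurableT_comp (@measurable_invr R) measurable_r2).
Qed.

Lemma measurable_stein_l K k : measurable_fun setT (stein_l K k \o @untup R 'I_D).
Proof.
have mr := measurable_rho12.
have mu k' := measurable_untup (R := R) (I := 'I_D) k'.
have A := @measurable_falg R _ (#|'I_D|.-tuple R : measurableType _).
apply: (fa_add A (f := fun t => rho12 (untup t) ^+ K)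
  (g := fun t => (2 * K)%:R * rho12 (untup t) ^+ K.-1 * (untup t k ^+ 2 / r2 (untup t)) * ((V k)%:R - rho12 (untup t)))).
  exact: (fa_exp A).
apply: (fa_mul A (f := fun t => (2 * K)%:R * rho12 (untup t) ^+ K.-1 * (untup t k ^+ 2 / r2 (untup t)))
   (g := fun t => ((V k)%:R - rho12 (untup t)))); last first.
  by apply: (fa_add A (f := fun _ => (V k)%:R)); [exact: (fa_const A)|exact: (fa_opp A)].
apply: (fa_mul A (f := fun t => (2 * K)%:R * rho12 (untup t) ^+ K.-1)).
  apply: (fa_mul A (f := fun t => (2 * K)%:R)); first exact: (fa_const A).
  exact: (fa_exp A).
apply: (fa_mul A (f := fun t => untup t k ^+ 2)); first exact: (fa_exp A).
exact: (measurableT_comp (@measurable_invr R) measurable_r2).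
Qed.

Lemma measurable_stein_r K k : measurable_fun setT (stein_r K k \o @untup R 'I_D).
Proof.
have A := @measurable_falg R _ (#|'I_D|.-tuple R : measurableType _).
apply: (fa_mul A (f := fun t => untup t k ^+ 2) (g := fun t => rho12 (untup t) ^+ K)).
  apply: (fa_exp A); exact: measurable_untup.
apply: (fa_exp A); exact: measurable_rho12.
Qed.

Lemma u_bound k x : 0 <= x k ^+ 2 / r2 x <= 1.
Proof.
rewrite divr_ge0 ?sqr_ge0 ?r2_ge0 //=.
have [->|r0] := eqVneq (r2 x) 0; first by rewrite invr0 mulr0.
rewrite ler_pdivrMr ?mul1r ?lt_neqAle ?[0 == _]eq_sym ?r0 ?r2_ge0 //.
by rewrite /r2 (bigD1 k) //= lerDl sumr_ge0 // => j _; rewrite sqr_ge0.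
Qed.

Lemma stein_l_bound K k x : `|stein_l K k x| <= 1 + (2 * K)%:R.
Proof.
have := rho12_ge0 x; have := rho12_le1 x => r1 r0.
rewrite (le_trans (ler_normD _ _)) // lerD //.
  by rewrite normrX ger0_norm // exprn_ile1.
have /andP[] := u_bound k x; move: (x k ^+ 2 / r2 x) => u u0 u1.
rewrite !normrM (ger0_norm u0) ger0_norm // ger0_norm ?exprn_ge0 //.
have h1 : rho12 x ^+ K.-1 <= 1 by rewrite exprn_ile1.
have h2 : `|(V k)%:R - rho12 x| <= 1 by rewrite ler_norml; case: (V k) => /=; apply/andP; split; lra.
have -> : (2 * K)%:R * rho12 x ^+ K.-1 * u * `|(V k)%:R - rho12 x| =
   (2 * K)%:R * (rho12 x ^+ K.-1 * u * `|(V k)%:R - rho12 x|) by rewrite !mulrA.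
rewrite ler_piMr // mulr_ile1 ?mulr_ge0 ?exprn_ge0 //.
by rewrite mulr_ile1 ?exprn_ge0.
Qed.

Section OneCoordinate.
Variables (k : 'I_D) (x : 'I_D -> R) (K : nat).
Let A := \sum_(j | V j && (j != k)) x j ^+ 2.
Let B := \sum_(j | j != k) x j ^+ 2.
Hypothesis B0 : 0 < B.
Let chi : R := (V k)%:R.

Let r2E t : r2 (upd x k t) = t ^+ 2 + B.
Proof.
rewrite /r2 (bigD1 k) //= /upd eqxx; congr (_ + _).
by apply: eq_bigr => j /negPf ->.
Qed.

Let v2E t : v2 (upd x k t) = chi * t ^+ 2 + A.
Proof.
rewrite /v2 /A /chi /upd; case Vk : (V k).
  rewrite (bigD1 k) //= eqxx mul1r; congr (_ + _).
  by apply: eq_bigr => j /andP[_ /negPf ->].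
rewrite mul0r add0r; apply: eq_big => j; last by case: eqP => // ->; rewrite Vk.
by case: eqP => [->|_]; rewrite ?Vk // andbT.
Qed.

Let rk t := (chi * t ^+ 2 + A) / (t ^+ 2 + B).

Let den t : t ^+ 2 + B != 0.
Proof. by rewrite gt_eqF // ltr_wpDl ?sqr_ge0. Qed.

Let derk (t : R) : is_derive t (1 : R) rk (2 * t * (chi - rk t) / (t ^+ 2 + B)).
Proof.
have H1 : is_derive t (1 : R) (chi *: (@idfun R ^+ 2) + cst A) (2 * chi * t).
  by apply: is_derive_eq; rewrite /GRing.scale /= expr1; ring.
have H2 : is_derive t (1 : R) (@idfun R ^+ 2 + cst B) (2 * t).
  by apply: is_derive_eq; rewrite /GRing.scale /= expr1; ring.
have H3 := is_deriveV (f := @idfun R ^+ 2 + cst B) (x := t) (den t) H2.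
have := is_deriveM H1 H3.
have -> : (chi *: (@idfun R ^+ 2) + cst A) * (fun y : R => ((@idfun R ^+ 2 + cst B) y)^-1) = rk by [].
move=> H4; apply: (is_derive_eq H4); rewrite /rk /GRing.scale /=.
have := den t; move=> d0.
rewrite -[(@idfun R ^+ 2 + cst B) t]/(t ^+ 2 + B) -[(_ + cst A) t]/(chi * t ^+ 2 + A).
by field.
Qed.

Let dphi t := stein_l K k (upd x k t).
Let phi t := t * rk t ^+ K.

Let rhoE t : rho12 (upd x k t) = rk t.
Proof. by rewrite /rho12 r2E v2E. Qed.

Let dphiE t : dphi t = rk t ^+ K + (2 * K)%:R * rk t ^+ K.-1 * (t ^+ 2 / (t ^+ 2 + B)) * (chi - rk t).
Proof. by rewrite /dphi /stein_l rhoE r2E {1}/upd eqxx. Qed.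

Let derphi (t : R) : is_derive t (1 : R) phi (dphi t).
Proof.
have := is_deriveM (is_derive_id t (1 : R)) (is_deriveX K (derk t)).
have XE u : (rk ^+ K) u = rk u ^+ K by elim: (K) => [|m IH]; rewrite ?expr0 // !exprS -IH.
have -> : (id : R -> R) * rk ^+ K = phi by apply/funext => u; rewrite /phi -XE.
move=> H; apply: (is_derive_eq H); rewrite dphiE /GRing.scale /= natrM.
rewrite XE.
have := den t; move: (rk t) (rk t ^+ K) (rk t ^+ K.-1) => a b c d0.
by field.
Qed.

Lemma stein_coord : (\int[normal_prob (0 : R) 1]_t (stein_l K k (upd x k t))%:E =
  \int[normal_prob (0 : R) 1]_t (stein_r K k (upd x k t))%:E)%E.
Proof.
have crk : continuous rk.
  by move=> t; apply/differentiable_continuous/derivable1_diffP; case: (derk t).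
have E t : stein_r K k (upd x k t) = t * phi t.
  by rewrite /stein_r /phi /rho12 r2E v2E /upd eqxx mulrA -expr2.
have rk01 t : 0 <= rk t <= 1.
  by rewrite /rk -r2E -v2E rho12_ge0 rho12_le1.
under [RHS]eq_integral do rewrite E.
apply: (@stein1 _ phi dphi (1 + (2 * K)%:R) derphi).
- have -> : dphi = (fun t => rk t ^+ K + (2 * K)%:R * rk t ^+ K.-1 * (t ^+ 2 / (t ^+ 2 + B)) * (chi - rk t)).
    by apply/funext => t; rewrite dphiE.
  have cX n : continuous (fun t => rk t ^+ n).
    by move=> t; apply: (continuous_comp (f := rk) (g := fun y => y ^+ n)); [exact: crk|exact: exprn_continuous].
  move=> t; apply: cvgD; first exact: cX.
  apply: cvgM; last by apply: cvgB; [exact: cvg_cst|exact: crk].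
  apply: cvgM; first by apply: cvgM; [exact: cvg_cst|exact: cX].
  apply: cvgM; first exact: sqr_continuous.
  by apply: cvgV => //; apply: cvgD; [exact: sqr_continuous|exact: cvg_cst].
- by move=> t; exact: stein_l_bound.
- move=> t; rewrite /phi normrM mulrC ler_wpM2r //.
  have /andP[h0 h1] := rk01 t.
  by rewrite normrX ger0_norm // ?exprn_ge0 // (le_trans (exprn_ile1 _ h0 h1)) // lerDl.
- move=> t; rewrite -E /stein_r mulr_ge0 ?sqr_ge0 // exprn_ge0 //; exact: rho12_ge0.
Qed.

End OneCoordinate.

(** Some other coordinate is almost surely nonzero, which keeps |x|^2 away from 0 while x_k varies
    and makes the ratio smooth in x_k. *)
Lemma stein_gauss K k : (\int[P]_w (stein_l K k (g w))%:E = \int[P]_w (stein_r K k (g w))%:E)%E.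
Proof.
rewrite (upd_law k (measurable_stein_l K k)) (upd_law k (measurable_stein_r K k)).
have mz (G : ('I_D -> R) -> R) : measurable_fun setT (G \o @untup R 'I_D) ->
    measurable_fun setT (fun z : Omega * R => G (upd (g z.1) k z.2)).
  move=> mG; have := measurableT_comp mG (measurable_tup (measurable_upd k)).
  by congr (measurable_fun _ _); apply/funext => z /=; rewrite tupK.
have ml := mz _ (measurable_stein_l K k).
have mr := mz _ (measurable_stein_r K k).
have bl : bm (fun z : Omega * R => stein_l K k (upd (g z.1) k z.2)).
  by split => //; exists (1 + (2 * K)%:R) => z; exact: stein_l_bound.
have il : (P \x gam)%E.-integrable setT (EFin \o (fun z : Omega * R => stein_l K k (upd (g z.1) k z.2))).
  have := wint_integrable (integrable_one (P \x gam)%E) bl.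
  by apply: eq_integrable => // z _; rewrite /= mulr1.
rewrite -(integral12_prod_meas1 il) fubini_tonelli1 //; last 2 first.
- by apply/measurable_EFinP.
- by move=> z; rewrite lee_fin mulr_ge0 ?sqr_ge0 // exprn_ge0 // rho12_ge0.
apply: ae_eq_integral => //.
- exact: (measurable_int _ (integrable_fubini_F il)).
- apply: measurable_fun_fubini_tonelli_F => //; first by apply/measurable_EFinP.
  by move=> z; rewrite lee_fin mulr_ge0 ?sqr_ge0 // exprn_ge0 // rho12_ge0.
have [j jk] := D2 k.
apply: filterS (gauss_neq0 j) => w gw _; rewrite /fubini_F /=; apply: stein_coord.
by rewrite (bigD1 j) //= ltr_wpDr ?exprn_even_gt0 //= sumr_ge0 // => i _; rewrite sqr_ge0.
Qed.

Lemma measurable_comp_g (G : ('I_D -> R) -> R) : measurable_fun setT (G \o @untup R 'I_D) ->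
  measurable_fun setT (fun w => G (g w)).
Proof.
move=> mG; have := measurableT_comp mG (measurable_tup mg).
by congr (measurable_fun _ _); apply/funext => z /=; rewrite tupK.
Qed.

Lemma bm_stein_l K k : bm (fun w => stein_l K k (g w)).
Proof.
split; first exact: (measurable_comp_g (measurable_stein_l K k)).
by exists (1 + (2 * K)%:R) => w; exact: stein_l_bound.
Qed.

Lemma bm_rho12 : bm (fun w => rho12 (g w)).
Proof.
split; first exact: (measurable_comp_g measurable_rho12).
by exists 1 => w; rewrite ger0_norm ?rho12_ge0 // rho12_le1.
Qed.

Lemma stein_sum K (Q : pred 'I_D) : (Ex P (fun w => \sum_(k | Q k) stein_l K k (g w)))%:E =
  (\int[P]_w ((\sum_(k | Q k) g w k ^+ 2) * rho12 (g w) ^+ K)%:E)%E.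
Proof.
rewrite -Ex_integral; last first.
  by apply: (fa_sum (@bm_falg R d Omega) _ _ (F := fun k w => stein_l K k (g w))) => k; exact: bm_stein_l.
have iS k : P.-integrable setT (EFin \o (fun w => stein_l K k (g w))).
  have := wint_integrable (integrable_one P) (bm_stein_l K k).
  by apply: eq_integrable => // w _; rewrite /= mulr1.
have -> : (\int[P]_w (\sum_(k | Q k) stein_l K k (g w))%:E = \sum_(k | Q k) \int[P]_w (stein_l K k (g w))%:E)%E.
  rewrite -big_filter; under [RHS]eq_bigr do over.
  rewrite -[in RHS]integral_sum //.
  by apply: eq_integral => w _; rewrite sumEFin big_filter.
transitivity (\sum_(k | Q k) \int[P]_w (stein_r K k (g w))%:E)%E.
  by apply: eq_bigr => k _; exact: stein_gauss.
rewrite -big_filter -ge0_integral_sum //.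
- by apply: eq_integral => w _; rewrite sumEFin big_filter /stein_r mulr_suml.
- by move=> k; apply/measurable_EFinP; exact: (measurable_comp_g (measurable_stein_r K k)).
- by move=> k w _; rewrite lee_fin mulr_ge0 ?sqr_ge0 // exprn_ge0 // rho12_ge0.
Qed.

(** The moment recursion of a Beta law. Since |x|^2 rho^(K+1) = |v|^2 rho^K, Stein's identity summed
    over all coordinates with exponent K.+1 has the same right side as the one summed over V with
    exponent K. *)
Lemma rho12_moment K :
  (D%:R + 2 * K%:R) * Ex P (fun w => rho12 (g w) ^+ K.+1) =
  (#|V|%:R + 2 * K%:R) * Ex P (fun w => rho12 (g w) ^+ K).
Proof.
have bX n : bm (fun w => rho12 (g w) ^+ n) by apply: (fa_exp (@bm_falg R d Omega)); exact: bm_rho12.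
have su (Q : pred 'I_D) x : \sum_(k | Q k) x k ^+ 2 / r2 x = (\sum_(k | Q k) x k ^+ 2) / r2 x.
  by rewrite mulr_suml.
have r00 x : r2 x = 0 -> rho12 x = 0 by rewrite /rho12 => ->; rewrite invr0 mulr0.
(* Euler's relation: the ratio is homogeneous of degree 0, so its derivative terms cancel in the sum
   over all coordinates. *)
have L1 x : \sum_k stein_l K.+1 k x = D%:R * rho12 x ^+ K.+1.
  rewrite /stein_l big_split /= sumr_const card_ord -[_ *+ D]mulr_natl.
  have -> : \sum_k (2 * K.+1)%:R * rho12 x ^+ K * (x k ^+ 2 / r2 x) * ((V k)%:R - rho12 x) =
     (2 * K.+1)%:R * rho12 x ^+ K * (\sum_(k | V k) x k ^+ 2 / r2 x - (\sum_k x k ^+ 2 / r2 x) * rho12 x).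
    rewrite [\sum_(k | V k) _]big_mkcond mulr_suml -sumrB mulr_sumr; apply: eq_bigr => k _.
    by case: (V k) => /=; ring.
  rewrite !su -/(v2 x) -/(r2 x) -/(rho12 x).
  have [r0|r0] := eqVneq (r2 x) 0; first by rewrite r00 // mulr0 subrr mulr0 addr0.
  by rewrite divff // mul1r subrr mulr0 addr0.
have L2 x : \sum_(k | V k) stein_l K k x = (#|V|%:R + 2 * K%:R) * rho12 x ^+ K - 2 * K%:R * rho12 x ^+ K.+1.
  rewrite /stein_l big_split /= sumr_const -[rho12 x ^+ K *+ _]mulr_natl.
  have -> : \sum_(k | V k) (2 * K)%:R * rho12 x ^+ K.-1 * (x k ^+ 2 / r2 x) * ((V k)%:R - rho12 x) =
     (2 * K)%:R * rho12 x ^+ K.-1 * (\sum_(k | V k) x k ^+ 2 / r2 x) * (1 - rho12 x).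
    by rewrite mulr_sumr mulr_suml; apply: eq_bigr => k ->.
  rewrite su -/(v2 x) -/(rho12 x); case: K {L1} => [|n] /=; first by rewrite muln0 !mulr0 !mul0r subr0 !addr0.
  by rewrite natrM !exprS; ring.
have E1 := stein_sum K.+1 predT.
have E2 := stein_sum K V.
have E12 : (\int[P]_w ((\sum_k g w k ^+ 2) * rho12 (g w) ^+ K.+1)%:E =
    \int[P]_w ((\sum_(k | V k) g w k ^+ 2) * rho12 (g w) ^+ K)%:E)%E.
  apply: eq_integral => w _; congr (_%:E); rewrite -/(r2 (g w)) -/(v2 (g w)) exprS mulrA; congr (_ * _).
  rewrite /rho12; have [r0|r0] := eqVneq (r2 (g w)) 0; last by rewrite mulrCA mulfV ?mulr1.
  by rewrite r0 mul0r; apply/esym/eqP; rewrite eq_le v2_ge0 andbT -r0 v2_le.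
move: E1; rewrite E12 -E2 => -[].
under eq_Ex do rewrite L1.
under [in RHS]eq_Ex do rewrite L2.
rewrite ExZ //.
have -> : (fun w => (#|V|%:R + 2 * K%:R) * rho12 (g w) ^+ K - 2 * K%:R * rho12 (g w) ^+ K.+1) =
   (fun w => (#|V|%:R + 2 * K%:R) * rho12 (g w) ^+ K + (- (2 * K%:R)) * rho12 (g w) ^+ K.+1).
  by apply/funext => w; rewrite mulNr.
rewrite ExD ?ExZ //; try by apply: bmZ.
by move=> H; rewrite mulrDl H; ring.
Qed.

End Ratio.
End GaussLaw.

(** * The projected matrix *)

Section Realification.
Variables (R : realType).
Local Notation C := R[i].

Lemma mxentryE (V : nmodType) m k (A : 'M[V]_(m, k)) (i : 'I_m) (j : 'I_k) : mxentry A i j = A i j.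
Proof. by rewrite /mxentry !valK. Qed.

Section Pairs.
Variables (n D : nat) (hD : (2 * n <= D)%N).

Lemma evP (i : 'I_n) : (2 * i < D)%N.
Proof. by have := ltn_ord i; lia. Qed.
Lemma odP (i : 'I_n) : ((2 * i).+1 < D)%N.
Proof. by have := ltn_ord i; lia. Qed.
Definition ev i : 'I_D := Ordinal (evP i).
Definition od i : 'I_D := Ordinal (odP i).

Lemma sum_pairs (V : nmodType) (f : 'I_D -> V) : (forall k : 'I_D, (2 * n <= k)%N -> f k = 0) ->
  \sum_k f k = \sum_i (f (ev i) + f (od i)).
Proof.
move=> f0; pose f' k := oapp f 0 (insub k : option 'I_D).
have fE (k : 'I_D) : f k = f' k by rewrite /f' valK.
under eq_bigr do rewrite fE.
under [RHS]eq_bigr do rewrite !fE /=.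
rewrite -(big_mkord predT f') -(big_mkord predT (fun k => f' (2 * k)%N + f' (2 * k).+1)).
rewrite (big_cat_nat (leq0n _) hD) /= [X in _ + X]big_nat [X in _ + X]big1; last first.
  move=> k /andP[k1 k2]; rewrite /f' insubT /=; exact: f0.
rewrite addr0; elim: (n) => [|q IH]; first by rewrite muln0 !big_geq.
by rewrite mulnS addnC addn2 !big_nat_recr //= IH addrA.
Qed.

(* The real 2x2 block of z acts on these complex coordinates as multiplication by z. *)
Definition cplx (v : 'cV[R]_D) : 'cV[C]_n := \col_i (v (ev i) 0 +i* - v (od i) 0)%C.

Lemma cplx_dot (u v : 'cV[R]_D) : (forall k : 'I_D, (2 * n <= k)%N -> v k 0 = 0) ->
  (u^T *m v) 0 0 = complex.Re ((adj (cplx u) *m cplx v) 0 0).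
Proof.
move=> v0; rewrite !mxE (@raddf_sum _ _ (@complex.Re R)) /=.
rewrite sum_pairs; last by move=> k hk; rewrite v0 ?mulr0.
by apply: eq_bigr => i _; rewrite !mxE /=; ring.
Qed.

End Pairs.

Section Hat.
Variables (nstar n n0 : nat) (t : 'M[C]_(n, nstar)).
Local Notation D := (2 * n + n0)%N.
Let hD : (2 * n <= D)%N := leq_addr _ _.
Let hs : (2 * nstar <= 2 * nstar)%N := leqnn _.
Let T := that n0 t.


Lemma that_blocks i c : [/\ T (ev hD i) (ev hs c) = complex.Re (t i c),
  T (ev hD i) (od hs c) = complex.Im (t i c),
  T (od hD i) (ev hs c) = - complex.Im (t i c) &
  T (od hD i) (od hs c) = complex.Re (t i c)].
Proof.
have oE k : odd (2 * k) = false by rewrite oddM.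
have h1 : (2 * i < 2 * n)%N by rewrite ltn_mul2l ltn_ord.
have h2 : ((2 * i).+1 < 2 * n)%N by have := ltn_ord i; lia.
have d1 k : (2 * k)./2 = k by rewrite mul2n doubleK.
have d2 k : uphalf (2 * k) = k by rewrite mul2n uphalf_double.
by split; rewrite mxE /= ?h1 ?h2 ?oE /= ?d1 ?d2 mxentryE.
Qed.

Lemma that_tail (k : 'I_D) c : (2 * n <= k)%N -> T k c = 0.
Proof. by move=> hk; rewrite mxE ltnNge hk. Qed.

Lemma cplx_that (v : 'cV[R]_(2 * nstar)) : cplx hD (T *m v) = t *m cplx hs v.
Proof.
apply/matrixP => i j; rewrite !mxE !(sum_pairs hs); try by move=> k; rewrite leqNgt ltn_ord.
apply/eqP; rewrite eq_complex (@raddf_sum _ _ (@complex.Re R)) (@raddf_sum _ _ (@complex.Im R)) /=.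
apply/andP; split; apply/eqP; last rewrite -sumrN.
  apply: eq_bigr => c _; rewrite [cplx _ _ _ _]mxE; have [-> -> _ _] := that_blocks i c.
  by case: (t i c) => x y /=; ring.
apply: eq_bigr => c _; rewrite [cplx _ _ _ _]mxE; have [_ _ -> ->] := that_blocks i c.
by case: (t i c) => x y /=; ring.
Qed.

Lemma cplx_thatT (v : 'cV[R]_D) : cplx hs (T^T *m v) = adj t *m cplx hD v.
Proof.
apply/matrixP => c j; rewrite !mxE !(sum_pairs hD); try by move=> k hk; rewrite mxE that_tail ?mul0r.
apply/eqP; rewrite eq_complex (@raddf_sum _ _ (@complex.Re R)) (@raddf_sum _ _ (@complex.Im R)) /=.
apply/andP; split; apply/eqP; last rewrite -sumrN.
  apply: eq_bigr => i _; rewrite [cplx _ _ _ _]mxE adjE ![T^T _ _]mxE; have [-> _ -> _] := that_blocks i c.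
  by case: (t i c) => x y /=; ring.
apply: eq_bigr => i _; rewrite [cplx _ _ _ _]mxE adjE ![T^T _ _]mxE; have [_ -> _ ->] := that_blocks i c.
by case: (t i c) => x y /=; ring.
Qed.

Lemma cplx_gram (v : 'cV[R]_D) j : cplx hD ((T *m T^T) ^+ j *m v) = (t *m adj t) ^+ j *m cplx hD v.
Proof.
elim: j v => [|j IH] v; first by rewrite !expr0 !mul1mx.
by rewrite exprSr -!mulmxA IH cplx_that cplx_thatT exprSr -!mulmxA.
Qed.

Lemma that_quad (v : 'cV[R]_D) j : (0 < j)%N ->
  (v^T *m (T *m T^T) ^+ j *m v) 0 0 = complex.Re ((adj (cplx hD v) *m (t *m adj t) ^+ j *m cplx hD v) 0 0).
Proof.
case: j => // j _; rewrite -!mulmxA (@cplx_dot _ _ hD) ?cplx_gram //.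
move=> k hk; rewrite exprS -!mulmxA mxE big1 // => c _; by rewrite that_tail ?mul0r.
Qed.

(** The real basis vectors in positions 2i and 2i.+1 become the complex vectors e_i and -i e_i (the
    second i the imaginary unit), which give the same quadratic form; the last n0 basis vectors
    become 0. *)
Lemma that_trace j : (0 < j)%N -> \tr ((T *m T^T) ^+ j) = 2 * complex.Re (\tr ((t *m adj t) ^+ j)).
Proof.
move=> j0; rewrite /mxtrace.
have E (k : 'I_D) : ((T *m T^T) ^+ j) k k =
    complex.Re ((adj (cplx hD (delta_mx k 0)) *m (t *m adj t) ^+ j *m cplx hD (delta_mx k 0)) 0 0).
  by rewrite -that_quad // trmx_delta -mulmxA -colE mxE (bigD1 k) //= !mxE !eqxx mul1r big1 ?addr0 // => i /negPf ik; rewrite !mxE eqxx ik mul0r.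
under eq_bigr do rewrite E.
rewrite (sum_pairs hD); last first.
  move=> k hk; suff -> : cplx hD (delta_mx k 0) = 0 by rewrite mulmx0 mxE.
  apply/matrixP => i i'; rewrite !mxE /= !andbT; have hi := ltn_ord i.
  have -> : (ev hD i == k) = false by apply/negbTE; rewrite -val_eqE /=; lia.
  have -> : (od hD i == k) = false by apply/negbTE; rewrite -val_eqE /=; lia.
  by rewrite oppr0.
rewrite (@raddf_sum _ _ (@complex.Re R)) mulr_sumr; apply: eq_bigr => i _.
have -> : cplx hD (delta_mx (ev hD i) 0) = delta_mx i 0.
  apply/matrixP => l l'; rewrite !mxE ord1 !eqxx !andbT -!val_eqE /=.
  have -> : (2 * l)%N == (2 * i)%N = (l == i :> nat) by lia.
  have -> : (2 * l).+1 == (2 * i)%N = false by lia.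
  by rewrite oppr0; case: (_ == _).
have -> : cplx hD (delta_mx (od hD i) 0) = (0 +i* (-1))%C *: delta_mx i 0.
  apply/matrixP => l l'; rewrite !mxE ord1 !eqxx !andbT -!val_eqE /=.
  have -> : (2 * l)%N == (2 * i).+1 = false by lia.
  have -> : (2 * l).+1 == (2 * i).+1 = (l == i :> nat) by lia.
  by case: (_ == _); rewrite ?mulr1 ?mulr0 //= oppr0.
rewrite adjZ -scalemxAr -!scalemxAl.
have -> : adj (delta_mx i 0 : 'cV[C]_n) = delta_mx 0 i.
  by apply/matrixP => l l'; rewrite adjE !mxE andbC; case: (_ && _); rewrite ?rmorph1 ?rmorph0.
rewrite -rowE -colE !mxE.
by case: (((t *m adj t) ^+ j) i i) => x y /=; ring.
Qed.

End Hat.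

(** Cyclicity brings the last projection to the front, where Q Q = Q for a unit vector x; what
    remains is a rank-one compression as in [trace_newt]. *)
Lemma compressed_trace D p (x : 'cV[R]_D) (T : 'M[R]_(D, p)) j : (0 < j)%N -> x^T *m x = 1%:M ->
  let Q := 1%:M - x *m x^T in
  \tr ((Q *m T *m T^T *m Q) ^+ j) =
  \tr ((T *m T^T) ^+ j) + newt (fun i => (x^T *m (T *m T^T) ^+ i *m x) 0 0) j.
Proof.
move=> j0 xx Q; rewrite tr_exp_comm //.
have -> : Q *m (Q *m T *m T^T) = (1%:M - x *m x^T) *m (T *m T^T).
  rewrite !mulmxA; congr (_ *m _ *m _).
  by rewrite /Q mulmxBl mul1mx mulmxBr mulmx1 -mulmxA (mulmxA x^T) xx mul1mx subrr subr0.
exact: trace_newt.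
Qed.

Lemma unitvec_norm D (g : 'cV[R]_D) : g != 0 -> (unitvec g)^T *m unitvec g = 1%:M.
Proof.
move=> g0; apply/matrixP => i j; rewrite !ord1 !mxE eqxx.
set s := \sum_(k < D) g k 0 ^+ 2.
have s0 : 0 < s.
  rewrite lt_neqAle sumr_ge0 ?andbT; last by move=> k _; rewrite sqr_ge0.
  apply: contra g0 => /eqP/esym/eqP; rewrite psumr_eq0; last by move=> k _; rewrite sqr_ge0.
  move=> /allP H; apply/eqP/matrixP => k l; rewrite ord1 mxE; apply/eqP.
  by rewrite -sqrf_eq0; exact: (H k (mem_index_enum _)).
under eq_bigr do rewrite !mxE -/s mulrACA -expr2 -[X in _ * X]expr2.
by rewrite -mulr_sumr -/s exprVn sqr_sqrtr ?ltW // mulVf ?gt_eqF.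
Qed.

Lemma Mmat_trace nstar n n0 (S : 'M[C]_(nstar + n)) (g : 'cV[R]_(2 * n + n0)) j : (0 < j)%N -> g != 0 ->
  let H := tsub S *m adj (tsub S) in let h := cplx (leq_addr n0 (2 * n)) (unitvec g) in
  \tr (Mmat S g ^+ j) = 2 * complex.Re (\tr (H ^+ j)) +
    newt (fun i => complex.Re ((adj h *m H ^+ i *m h) 0 0)) j.
Proof.
move=> j0 g0 H h; rewrite /Mmat /projPi compressed_trace ?unitvec_norm // that_trace //.
by congr (_ + _); apply: newt_ext => i i0; rewrite that_quad.
Qed.

Lemma cplx_norm n D (hD : (2 * n <= D)%N) (g : 'cV[R]_D) :
  complex.Re ((adj (cplx hD (unitvec g)) *m cplx hD (unitvec g)) 0 0) =
  rho12 (fun k : 'I_D => (k < 2 * n)%N) (fun k => g k 0).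
Proof.
rewrite mxE (@raddf_sum _ _ (@complex.Re R)) /= /rho12 /v2 /r2.
set s := \sum_k g k 0 ^+ 2.
rewrite [in RHS]big_mkcond [in RHS](sum_pairs hD) /=; last by move=> k hk; rewrite ltnNge hk.
rewrite mulr_suml; apply: eq_bigr => i _; rewrite adjE ![cplx _ _ _ _]mxE /=.
have [-> ->] : (2 * i < 2 * n)%N /\ ((2 * i).+1 < 2 * n)%N by have := ltn_ord i; lia.
have s0 : 0 <= s by apply: sumr_ge0 => k _; rewrite sqr_ge0.
have sE : (Num.sqrt s)^-1 * (Num.sqrt s)^-1 = s^-1 by rewrite -invfM -expr2 sqr_sqrtr.
rewrite !mxE -/s -sE; move: (Num.sqrt s)^-1 => q; ring.
Qed.

End Realification.

Section BoundedAlgebra.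
Variables (R : realType) (T : Type).

Definition bounded_on (f : T -> R) := exists M, forall t, `|f t| <= M.

Lemma bounded_on_falg : falg bounded_on.
Proof.
split=> [c|f g [M hM] [M' hM']|f g [M hM] [M' hM']]; first by exists `|c|.
  by exists (M + M') => t; rewrite (le_trans (ler_normD _ _)) // lerD.
by exists (M * M') => t; rewrite normrM ler_pM.
Qed.

End BoundedAlgebra.

Lemma sqrt_entry_le (R : realType) D (g : 'cV[R]_D) k : `|unitvec g k 0| <= 1.
Proof.
rewrite mxE; set s := \sum_(k < D) g k 0 ^+ 2.
have le : g k 0 ^+ 2 <= s.
  by rewrite /s (bigD1 k) //= lerDl sumr_ge0 // => i _; rewrite sqr_ge0.
have [s0|s0] := eqVneq s 0; first by rewrite s0 sqrtr0 invr0 mul0r normr0.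
have sp : 0 < Num.sqrt s by rewrite sqrtr_gt0 lt_neqAle eq_sym s0 /= (le_trans _ le) ?sqr_ge0.
have -> : `|(Num.sqrt s)^-1 * g k 0| = `|g k 0| / Num.sqrt s by rewrite normrM mulrC [`|_^-1|]gtr0_norm ?invr_gt0.
rewrite ler_pdivrMr // mul1r.
by rewrite -sqrtr_sqr ler_wsqrtr.
Qed.

(** * The trace functional of the Haar block and the Gaussian direction *)

Section RealStepExpectation.
Variables (R : realType) (nstar m n0 : nat).
Local Notation n := m.+1.
Local Notation N := (nstar + n)%N.
Local Notation D := (2 * n + n0)%N.
Variables (d : measure_display) (Omega : measurableType d) (P : probability Omega R).
Variables (S : Omega -> 'M[R[i]]_N) (g : Omega -> 'cV[R]_D).
Hypothesis mS : forall i j, measurable_fun setT (fun w => complex.Re (S w i j)) /\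
                    measurable_fun setT (fun w => complex.Im (S w i j)).
Hypothesis mg : forall k, measurable_fun setT (fun w => g w k 0).
Hypothesis Sunit : forall w, S w \is unitarymx.
Hypothesis Shaar : forall U : 'M[R[i]]_N, U \is unitarymx ->
     forall lr hr li hi,
       P [set w | inboxC lr hr li hi (U *m S w)] =
       P [set w | inboxC lr hr li hi (S w)].
Hypothesis gGauss : forall lr hr li hi (c e : 'cV[R]_D),
     P [set w | inboxC lr hr li hi (S w) /\ inboxV c e (g w)] =
     (P [set w | inboxC lr hr li hi (S w)] *
      \prod_(k < D)
         \int[@lebesgue_measure R]_(x in `]c k ord0, e k ord0]) (normal_pdf 0%R 1%R x)%:E)%E.

Let hD : (2 * n <= D)%N := leq_addr _ _.
Let rows : 'M[R[i]]_(n, N) := row_mx 0 1%:M.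
Let J := Jl R nstar n.
Let xi (x : 'I_D -> R) := cplx hD (unitvec (\col_k x k)).
Let E0 (f : 'M[R[i]]_N -> R) := Ex P (fun w => f (S w)).
Let Gq Psi wd A x := Psi (gtr rows J A) * wprod (gquad rows J (xi x) A) wd.

Let rowsK : rows *m adj rows = 1%:M.
Proof.
have -> : adj rows = col_mx 0 1%:M.
  rewrite /adj /rows tr_row_mx map_col_mx trmx0 trmx1 map_mx0 map_mx1 //.
by rewrite mul_row_col mul0mx mul1mx add0r.
Qed.

Let gramE A : gram rows J A = tsub A *m adj (tsub A).
Proof.
rewrite /gram; suff -> : rows *m A *m J = tsub A by [].
apply/matrixP => i j; rewrite /rows /J /Jl -[A]submxK mul_row_block mul_row_col.
by rewrite !mul0mx !mul1mx !add0r mulmx1 mulmx0 addr0 [RHS]mxE block_mxEdl.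
Qed.

Let measurable_unitvec (d' : measure_display) (T : measurableType d') (x : T -> 'I_D -> R) :
  (forall k, measurable_fun setT (x ^~ k)) -> forall k, measurable_fun setT (fun t => unitvec (\col_k x t k) k 0).
Proof.
move=> mx k; under eq_fun do rewrite !mxE.
apply: measurable_funM => //; apply: (measurableT_comp (@measurable_invr R)).
apply: measurableT_comp; first exact: (continuous_measurable_fun (@sqrt_continuous R)).
under eq_fun do under eq_bigr do rewrite mxE.
by apply: measurable_sum => i; apply: measurable_funX.
Qed.

Let MA_xi (T : Type) (A : (T -> R) -> Prop) (x : T -> 'I_D -> R) : falg A ->
  (forall k, A (fun t => unitvec (\col_k x t k) k 0)) -> MA A (fun t => xi (x t)).
Proof.
move=> fA hx i j; split; rewrite /xi /cplx; under eq_fun do rewrite mxE /=; first exact: hx.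
by apply: (fa_opp fA); exact: hx.
Qed.

Let gquad_falg (T : Type) (A : (T -> R) -> Prop) (Z : T -> 'M[R[i]]_N) (x : T -> 'I_D -> R) j :
  falg A -> MA A Z -> (forall k, A (fun t => unitvec (\col_k x t k) k 0)) ->
  A (fun t => gquad rows J (xi (x t)) (Z t) j).
Proof.
move=> fA hZ hx.
suff [] : CA A (fun t => (adj (xi (x t)) *m gram rows J (Z t) ^+ j *m xi (x t)) 0 0) by [].
have mx := MA_xi fA hx.
apply: (MA_mul fA) => //; apply: (MA_mul fA); first exact: (MA_adj fA).
by move=> k l; split; [have [H _] := @MPM_gram R N n nstar rows J j k l|have [_ H] := @MPM_gram R N n nstar rows J j k l];
  exact: (MP_falg_comp fA hZ H).
Qed.

Let Gq_falg (T : Type) (A : (T -> R) -> Prop) (Z : T -> 'M[R[i]]_N) (x : T -> 'I_D -> R) Psi wd :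
  falg A -> TP Psi -> MA A Z -> (forall k, A (fun t => unitvec (\col_k x t k) k 0)) ->
  A (fun t => Gq Psi wd (Z t) (x t)).
Proof.
move=> fA hP hZ hx; apply: (fa_mul fA).
  by apply: (MP_falg_comp fA hZ (f := fun B => Psi (gtr rows J B))); apply: MP_TP => // j; exact: MP_gtr.
by apply: (fa_prod fA) => j; exact: gquad_falg.
Qed.

Let Gq_measurable Psi wd : TP Psi ->
  measurable_fun setT (fun t : #|{: ('I_N * 'I_N * bool) + 'I_D}|.-tuple R =>
     Gq Psi wd (smat (untup t \o inl)) (untup t \o inr)).
Proof.
move=> hP; have := Gq_falg (x := fun t : #|{: ('I_N * 'I_N * bool) + 'I_D}|.-tuple R => untup t \o inr) wd
  (@measurable_falg R _ _) hP (measurable_smat R inl).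
apply.
by apply: measurable_unitvec => k; exact: measurable_untup.
Qed.

Let bounded_S : MA (@bounded_on R (Omega * ('I_D -> R))) (fun z => S z.1).
Proof.
by move=> i j; split; exists 1 => z; have [] := unitary_entry i j (Sunit z.1).
Qed.

Let Gq_bounded Psi wd : TP Psi -> bounded_on (fun z : Omega * ('I_D -> R) => Gq Psi wd (S z.1) z.2).
Proof.
move=> hP; apply: (Gq_falg wd (bounded_on_falg _ _) hP bounded_S) => k.
by exists 1 => z; exact: sqrt_entry_le.
Qed.

Let rhoP (x : 'I_D -> R) : R := rho12 (fun k : 'I_D => (k < 2 * n)%N) x.
Let gf w k := g w k 0.

Let xi_norm x : complex.Re ((adj (xi x) *m xi x) 0 0) = rhoP x.
Proof. by rewrite /xi cplx_norm; congr (rho12 _ _); apply/funext => k; rewrite mxE. Qed.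

(** For fixed g the Haar average depends on xi only through |xi|^2, by [haar_quad]; the average over
    g is then a moment of the length ratio. *)
Let moment_split Psi wd : TP Psi -> Ex P (fun w => Gq Psi wd (S w) (gf w)) =
  Ex P (fun w => rhoP (gf w) ^+ size wd) * E0 (fun A => Psi (gtr rows J A) * wprod (gent rows J A) wd).
Proof.
move=> hP; have [M hM] := Gq_bounded wd hP.
rewrite (joint_fubini mS mg Sunit gGauss (Gq_measurable wd hP) (M := M)); last by move=> w x; exact: (hM (w, x)).
have hE := haarE_Ex mS Sunit Shaar.
under eq_Ex => w2.
  rewrite (_ : Ex P _ = E0 (fun A => Psi (gtr rows J A) * wprod (gent rows J A) wd) * rhoP (gf w2) ^+ size wd); first over.
  by rewrite [LHS](haar_quad J hE rowsK wd (xi (gf w2)) hP) mulrC xi_norm.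
rewrite ExZ 1?mulrC //; apply: (fa_exp (@bm_falg R d Omega)).
exact: (bm_rho12 (g := gf)).
Qed.


Let bm_unitvec k : bm (fun w => unitvec (g w) k 0).
Proof.
split; last by exists 1 => w; exact: sqrt_entry_le.
have := measurable_unitvec (x := gf) mg k; congr (measurable_fun _ _).
by apply/funext => w; congr (unitvec _ k 0); apply/matrixP => i j; rewrite ord1 mxE.
Qed.

Let bm_unitvec' k : bm (fun w => unitvec (\col_k gf w k) k 0).
Proof.
have := bm_unitvec k; congr bm; apply/funext => w; congr (unitvec _ k 0).
by apply/matrixP => i j; rewrite ord1 mxE.
Qed.

Let bm_pair F2 : TP2 F2 -> bm (fun w => F2 (gtr rows J (S w)) (gquad rows J (xi (gf w)) (S w))).
Proof.
move=> hF; apply: (fa_TP2 (@bm_falg R d Omega)) => // j.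
  exact: (bm_MP mS Sunit (@MP_gtr R N n nstar rows J j)).
apply: (gquad_falg j (@bm_falg R d Omega) (bm_S mS Sunit)) => k; exact: bm_unitvec'.
Qed.

(** By [moment_split] a word of length K carries the factor r_K = E rho12^K. Words on the right of
    the recursion are one letter shorter than those on the left, and (n + n0/2 + K) r_(K+1) = (n +
    K) r_K turns the parameter n of [haar_good] into n + n0/2. *)
Lemma gauss_good : good (n%:R + n0%:R / 2)
  (fun F2 => Ex P (fun w => F2 (gtr rows J (S w)) (gquad rows J (xi (gf w)) (S w)))).
Proof.
split=> [F G hF hG|c F hF|Psi w hP hw].
- by apply: ExD; exact: bm_pair.
- by apply: ExZ; exact: bm_pair.
have hE := haarE_Ex mS Sunit Shaar.
have G0 := goodR (haar_good J hE rowsK) hP hw.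
case: w hw G0 => [|i0 w] hw G0; first by rewrite !mul0r /= add0r.
pose K := size w; set ww := i0 :: w in hw G0 *.
pose rk m := Ex P (fun w => rhoP (gf w) ^+ m).
have E1 Psi' w' : TP Psi' -> Ex P (fun w => Psi' (gtr rows J (S w)) * wprod (gquad rows J (xi (gf w)) (S w)) w') =
  rk (size w') * Ex P (fun w => Psi' (gtr rows J (S w)) * wprod (gent rows J (S w)) w') by exact: moment_split.
rewrite E1 //.
have rK : (n%:R + n0%:R / 2 + K%:R) * rk K.+1 = (n%:R + K%:R) * rk K.
  have D2 (k : 'I_D) : exists j, j != k.
    have [k0|k0] := eqVneq (k : nat) 0%N.
      have h : (1 < D)%N by lia.
      by exists (Ordinal h); rewrite -val_eqE /= k0.
    have h : (0 < D)%N by lia.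
    by exists (Ordinal h); rewrite -val_eqE /= eq_sym.
  have := rho12_moment (g := gf) mg (gauss_box Sunit gGauss) (fun k : 'I_D => (k < 2 * n)%N) D2 K.
  have -> : #|(fun k : 'I_D => (k < 2 * n)%N)| = (2 * n)%N.
    rewrite -sum1_card -(big_mkord (fun k => (k < 2 * n)%N) (fun=> 1%N)).
    rewrite -(big_nat_widen 0 _ _ xpredT) ?leq_addr //.
    by rewrite sum_nat_const_nat subn0 muln1.
  rewrite -/(rk K) -/(rk K.+1) natrD natrM => H.
  apply: (mulfI (x := 2)); first by rewrite pnatr_eq0.
  rewrite !mulrA !mulrDr mulrCA mulfV ?pnatr_eq0 // mulr1 H; ring.
have -> : rsum (fun i r => Ex P (fun w => Psi (gtr rows J (S w)) * gtr rows J (S w) i *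
     wprod (gquad rows J (xi (gf w)) (S w)) r)) ww = rk K * rsum (fun i r => Ex P (fun w =>
     Psi (gtr rows J (S w)) * gtr rows J (S w) i * wprod (gent rows J (S w)) r)) ww.
  rewrite rsum_mull; apply: (eq_rsum_in hw) => i r i0' _ [sr].
  by rewrite (E1 (fun p => Psi p * p i)) ?sr //; apply: TP_mul => //; exact: TP_var.
have -> : rsum (fun i r => rsum (fun k r' => Ex P (fun w => Psi (gtr rows J (S w)) *
     wprod (gquad rows J (xi (gf w)) (S w)) ((i + k)%N :: r'))) r) ww = rk K * rsum (fun i r => rsum (fun k r' => Ex P (fun w =>
     Psi (gtr rows J (S w)) * wprod (gent rows J (S w)) ((i + k)%N :: r'))) r) ww.
  rewrite rsum_mull; apply: (eq_rsum_in hw) => i r _ hr [sr].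
  rewrite rsum_mull; apply: (eq_rsum_in hr) => k r' _ _ sr'.
  by rewrite E1 //= sr' sr.
rewrite -mulrDr -G0 /= -/K.
have -> : n%:R + n0%:R / 2 + K.+1%:R - 1 = n%:R + n0%:R / 2 + K%:R :> R by rewrite -[K.+1]addn1 natrD; ring.
have -> : n%:R + K.+1%:R - 1 = n%:R + K%:R :> R by rewrite -[K.+1]addn1 natrD; ring.
rewrite -[LHS]mulrA [X in _ * X]mulrA rK; ring.
Qed.

Definition RA (T : Type) (A : (T -> R) -> Prop) p q (M : T -> 'M[R]_(p, q)) := forall i j, A (fun x => M x i j).

Lemma RA_mul (T : Type) (A : (T -> R) -> Prop) p q r (M : T -> 'M[R]_(p, q)) (M' : T -> 'M[R]_(q, r)) :
  falg A -> RA A M -> RA A M' -> RA A (fun x => M x *m M' x).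
Proof.
move=> fA hM hM' i j; under eq_fun do rewrite mxE.
by apply: (fa_sum fA) => k; apply: (fa_mul fA).
Qed.

Lemma bm_traceM j : bm (fun w => \tr (Mmat (S w) (g w) ^+ j)).
Proof.
have fA := @bm_falg R d Omega.
have RT p q (M : Omega -> 'M[R]_(p, q)) : RA (@bm R d Omega) M -> RA (@bm R d Omega) (fun w => (M w)^T).
  by move=> h i k; under eq_fun do rewrite mxE; exact: h.
have RQ : RA (@bm R d Omega) (fun w => projPi (g w)).
  move=> i k; under eq_fun do rewrite !mxE.
  apply: (fa_add fA); first exact: (fa_const fA).
  apply: (fa_opp fA); apply: (fa_sum fA) => l; apply: (fa_mul fA); last under eq_fun do rewrite mxE.
    by rewrite ord1; exact: bm_unitvec.
  by rewrite ord1; exact: bm_unitvec.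
have RTt : RA (@bm R d Omega) (fun w => that n0 (tsub (S w))).
  move=> i k; under eq_fun do rewrite mxE; case: (i < 2 * n)%N; last exact: (fa_const fA).
  have h i' k' : CA (@bm R d Omega) (fun w => mxentry (tsub (S w)) i' k').
    rewrite /mxentry; case: insubP => [u _ _|_]; last exact: (CA_const fA).
    case: insubP => [v _ _|_]; last exact: (CA_const fA).
    have := bm_S mS Sunit (rshift nstar u) (lshift n v).
    by move=> [h1 h2]; split; under eq_fun do rewrite mxE.
  have [h1 h2] := h i./2 k./2.
  by rewrite /=; case: (_ == _) => //; case: (~~ _) => //; exact: (fa_opp fA).
have RM : RA (@bm R d Omega) (fun w => Mmat (S w) (g w)).
  rewrite /Mmat; apply: (RA_mul fA) => //; apply: (RA_mul fA); last exact: RT.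
  exact: (RA_mul fA).
have RX : RA (@bm R d Omega) (fun w => Mmat (S w) (g w) ^+ j).
  elim: j => [|j IH]; first by move=> i k; under eq_fun do rewrite mxE; exact: (fa_const fA).
  by under eq_fun do rewrite exprS; exact: (RA_mul fA).
by apply: (fa_sum fA) => k; exact: RX.
Qed.

Let traceM_gram w j : (0 < j)%N -> g w != 0 -> \tr (Mmat (S w) (g w) ^+ j) =
  2 * gtr rows J (S w) j + newt (gquad rows J (xi (gf w)) (S w)) j.
Proof.
move=> j0 g0; rewrite (Mmat_trace (S w) j0 g0) -gramE.
have -> : xi (gf w) = cplx (leq_addr n0 (2 * n)) (unitvec (g w)).
  rewrite /xi; suff -> : \col_k gf w k = g w by [].
  by apply/matrixP => k l; rewrite ord1 mxE.
reflexivity.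
Qed.

(** [Gt] is the link: [gauss_good] brings traces of M down to traces of H, [haar_jacobi] evaluates
    these under the Jacobi functional, and [real_step] leads back up to y together with z. *)
Lemma trace_expectation (hnn : (n <= nstar)%N) (hn0 : (0 < n0)%N) : exists C0 : R, forall F, TP F ->
  Ex P (fun w => F (fun j => \tr (Mmat (S w) (g w) ^+ j))) =
  C0 * momf (nmom (n0%:R / 2)) (@yzfun R n (nstar - n) F).
Proof.
have hE := haarE_Ex mS Sunit Shaar.
have [C0 HC] := haar_jacobi hnn hE (haarE1 P).
pose b : R := n0%:R / 2.
have b0 : 0 < b by rewrite divr_gt0 ?ltr0n.
exists (C0 * (\prod_(i < n) (i%:R + b) * n`!%:R)) => F TF.
have s0 : 0 < n%:R + b by rewrite addr_gt0 ?ltr0n.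
have Tq j : (0 < j)%N -> TP2 (fun (p t : nat -> R) => 2 * p j + newt t j).
  by move=> j0; apply: TP2_add; [exact: TP2_scale (TP2_var _ j0)|exact: TP2_newt].
have [Gt TG HG] := elimination s0 (TP_subst Tq TF).
rewrite -!mulrA [X in C0 * X]mulrA -(real_step (nstar - n) b0 TF TG); last by move=> L hL; apply: HG; rewrite addrC.
rewrite -HC //.
transitivity (Ex P (fun w => F (fun j => 2 * gtr rows J (S w) j + newt (gquad rows J (xi (gf w)) (S w)) j))); last first.
  rewrite (HG _ gauss_good); apply: eq_Ex => w; apply: (congr1 Gt); apply/funext => j.
  by rewrite /gtr gramE.
(* The trace formula for M needs g != 0, which holds almost surely since the first coordinate is
   almost surely nonzero. *)
rewrite !ExE; congr fine; apply: ae_eq_integral => //.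
- by apply/measurable_EFinP; apply: (fa_TP (@bm_falg R d Omega) TF bm_traceM).1.
- apply/measurable_EFinP; have [] // := bm_pair (TP_subst Tq TF).
have h0 : (0 < D)%N by lia.
apply: filterS (gauss_neq0 (g := gf) mg (gauss_box Sunit gGauss) (Ordinal h0)) => w gw _.
congr (_%:E); apply: (TP_ext TF) => j j0; apply: traceM_gram => //.
by apply: contraNneq gw => g0; rewrite /gf g0 mxE.
Qed.

End RealStepExpectation.

(** * Moments of the density *)

(** For G < 1 the integrand is unbounded at 0, so the fundamental theorem is applied on [u/(m+2), u]
    and the limit is monotone. *)
Lemma integral_powR (R : realType) (G u : R) : 0 < G -> 0 < u ->
  (\int[@lebesgue_measure R]_(x in `]0%R, u]) (x `^ (G - 1))%:E = (u `^ G / G)%:E)%E.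
Proof.
move=> G0 u0; pose F (m : nat) : set R := `[u / m.+2%:R, u].
have am m : 0 < u / m.+2%:R by rewrite divr_gt0 ?ltr0n.
have amu m : u / m.+2%:R < u by rewrite ltr_pdivrMr ?ltr0n // ltr_pMr // ltr1n.
have mF i : measurable (F i) by exact: measurable_itv.
have nF : nondecreasing_seq F.
  apply/nondecreasing_seqP => m; rewrite subsetEset; apply: subset_itvr => /=.
  by rewrite bnd_simp ler_pM2l // lef_pV2 ?posrE ?ltr0n // ler_nat.
have UF : \bigcup_i F i = `]0, u].
  apply/seteqP; split => x; rewrite /F /=.
    by move=> [m _]; rewrite /= !in_itv /= => /andP[h ->]; rewrite andbT (lt_le_trans (am m)).
  rewrite in_itv /= => /andP[x0 xu].
  exists (Num.bound (u / x)) => //; rewrite /= in_itv /= xu andbT.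
  rewrite ler_pdivrMr ?ltr0n // mulrC -ler_pdivrMr //.
  have h : u / x < (Num.bound (u / x))%:R by rewrite archi_boundP // divr_ge0 ?ltW.
  by rewrite (le_trans (ltW h)) // ler_nat; lia.
have cpow (p x : R) : 0 < x -> {for x, continuous (fun y => y `^ p)}.
  move=> x0; apply: differentiable_continuous; apply/derivable1_diffP.
  by apply: derivable_powR; rewrite in_itv /= x0.
have IF m : (\int[@lebesgue_measure R]_(x in F m) (x `^ (G - 1))%:E =
    (u `^ G / G)%:E - ((u / m.+2%:R) `^ G / G)%:E)%E.
  apply: (continuous_FTC2 (F := fun x => x `^ G / G)) => //.
  - apply: continuous_in_subspaceT => x /set_mem; rewrite /= in_itv /= => /andP[h _].
    by apply: cpow; exact: (lt_le_trans (am m)).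
  - split => //.
    + move=> x; rewrite in_itv /= => /andP[h _]; apply: derivableM; last exact: derivable_cst.
      by apply: derivable_powR; rewrite in_itv /= (lt_trans (am m)).
    + apply: cvg_at_right_filter; apply: cvgM; [exact: cpow|exact: cvg_cst].
    + apply: cvg_at_left_filter; apply: cvgM; [exact: cpow|exact: cvg_cst].
  - move=> x; rewrite in_itv /= => /andP[h _]; have x0 := lt_trans (am m) h.
    have H : is_derive x (1 : R) (fun y => y `^ G) (G * x `^ (G - 1)) by exact: is_derive1_powR.
    have H2 : is_derive x (1 : R) (fun y => y `^ G / G) (x `^ (G - 1)).
      have := is_deriveZ (f := fun y => y `^ G) G^-1 (x := x) (v := 1).
      move=> HZ; have -> : (fun y => y `^ G / G) = G^-1 *: (fun y => y `^ G).
        by apply/funext => y; rewrite /= mulrC.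
      by apply: is_derive_eq; rewrite /GRing.scale /= mulrA mulVf ?gt_eqF // mul1r.
    by rewrite derive1E; exact: (@derive_val _ _ _ _ _ _ _ H2).
have C1 : (\int[@lebesgue_measure R]_(x in F m) (x `^ (G - 1))%:E)%E @[m --> \oo] -->
    (\int[@lebesgue_measure R]_(x in \bigcup_m F m) (x `^ (G - 1))%:E)%E.
  apply: ge0_nondecreasing_set_cvg_integral => //.
    move=> m; apply/measurable_EFinP; apply: measurable_funTS; exact: measurable_powR.
  by move=> m x _; rewrite lee_fin powR_ge0.
have CE : (fun m => (\int[@lebesgue_measure R]_(x in F m) (x `^ (G - 1))%:E)%E) =
    (fun m => (u `^ G / G - (u / m.+2%:R) `^ G / G)%:E).
  by apply/funext => m; rewrite IF.
rewrite -UF; apply: (@cvg_unique _ (@ereal_hausdorff R) _ _ _ _ C1); rewrite CE.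
apply: cvg_EFin; first by near=> m.
rewrite /comp /=.
rewrite [X in _ --> X](_ : u `^ G / G = u `^ G / G - 0 / G); last by rewrite mul0r subr0.
apply: cvgB; first exact: cvg_cst.
apply: cvgM; last exact: cvg_cst.
have := powR_cvg0 G0 => /cvg_at_rightP; apply; split; first by move=> m; exact: am.
rewrite -[X in _ --> X](mulr0 u); apply: cvgM; first exact: cvg_cst.
have := @cvg_harmonic R; rewrite -(cvg_shiftS (@harmonic R)); exact.
Unshelve. all: by end_near. Qed.

Lemma sigma_finite_prod (R : realType) (d1 d2 : measure_display) (T1 : measurableType d1) (T2 : measurableType d2)
  (m1 : {sigma_finite_measure set T1 -> \bar R}) (m2 : {sigma_finite_measure set T2 -> \bar R}) :
  sigma_finite setT (m1 \x m2)%E.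
Proof.
have /sigma_finiteP[F [TF ndF Foo]] := sigma_finiteT m1.
have /sigma_finiteP[G [TG ndG Goo]] := sigma_finiteT m2.
exists (fun n => F n `*` G n).
  rewrite -setXTT TF TG; apply/seteqP; split => -[x y] /=; last by move=> [n _ []]; split; exists n.
  move=> [[n _ Fn] [k _ Gk]]; exists (maxn n k) => //; split.
    exact: (subsetPset _ _ (ndF _ _ (leq_maxl n k))).
  exact: (subsetPset _ _ (ndG _ _ (leq_maxr n k))).
move=> k; have [mF Fk] := Foo k; have [mG Gk] := Goo k; split; first exact: measurableX.
by rewrite product_measure1E // lte_mul_pinfty // ge0_fin_numE.
Qed.

Section IteratedIntegral.
Variable R : realType.

Lemma iint0 k (B : nat -> set R) : iint k B (fun _ => 0) = 0%E.
Proof. by elim: k B => [//|k IH] B /=; under eq_integral do rewrite IH; rewrite integral0. Qed.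

Lemma eq_iint k (B : nat -> set R) f g : f =1 g -> iint k B f = iint k B g.
Proof. by move=> fg; congr iint; apply/funext. Qed.

(** Tonelli turns the iterated integral into one integral over a single sigma-finite measure space
    with coordinates [c], where dominated convergence is available. The space is left existential
    because its type grows with k. *)
Lemma iint_measure k : exists (d : measure_display) (T : measurableType d)
  (mu : {sigma_finite_measure set T -> \bar R}) (c : T -> seq R),
  [/\ forall t, size (c t) = k,
      forall i, measurable_fun setT (fun t => (c t)`_i) &
      forall (B : nat -> set R) (f : seq R -> R), (forall j, measurable (B j)) -> (forall s, 0 <= f s) ->
        measurable_fun setT (f \o c) ->
        iint k B f = (\int[mu]_(t in [set t | forall j, (j < k)%N -> B j (c t)`_j]) (f (c t))%:E)%E].
Proof.
elim: k => [|k [d [T [mu [c [sc mc IH]]]]]].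
  exists _, unit, (@dirac _ unit tt R), (fun=> [::]); split=> //.
    move=> B f _ f0 _ /=.
    have -> : [set t | forall j, (j < 0)%N -> B j ([::] : seq R)`_j] = [set: unit] by apply/seteqP; split.
    by rewrite integral_dirac // diracT mul1e.
have sf : sigma_finite setT ((@lebesgue_measure R) \x mu)%E by exact: sigma_finite_prod.
pose mu' : {sigma_finite_measure set (measurableTypeR R * T)%type -> \bar R} :=
  HB.pack_for {sigma_finite_measure set (measurableTypeR R * T)%type -> \bar R} ((@lebesgue_measure R) \x mu)%E
    (Measure_isSigmaFinite.Build _ _ _ _ sf).
exists _, (measurableTypeR R * T)%type, mu', (fun z => z.1 :: c z.2); split=> [z|i|B f mB f0 mf].
- by rewrite /= sc.
- by case: i => [|i] /=; [exact: measurable_fst|exact: (measurableT_comp (mc i) measurable_snd)].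
pose E := [set t | forall j, (j < k)%N -> B j.+1 (c t)`_j].
have mE : measurable E.
  have -> : E = \bigcap_(j in `I_k) ((fun t => (c t)`_j) @^-1` B j.+1) by [].
  by apply: bigcap_measurableType => j _; rewrite -[X in measurable X]setTI; exact: mc.
have -> : [set t | forall j, (j < k.+1)%N -> B j ((t.1 :: c t.2) : seq R)`_j] = B 0%N `*` E.
  apply/seteqP; split => -[x t] /=.
    by move=> H; split; [exact: (H 0%N)|move=> j jk; exact: (H j.+1)].
  by move=> [H1 H2] [|j] jk //=; exact: H2.
have mBE : measurable (B 0%N `*` E) by exact: measurableX.
rewrite integral_mkcond fubini_tonelli1 //; first last.
- by move=> z; rewrite patchE; case: ifP => // _; rewrite lee_fin.
- by apply/(measurable_restrictT _ mBE); apply: measurable_funTS; apply/measurable_EFinP.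
rewrite /= integral_mkcond; apply: eq_integral => x _; rewrite patchE /fubini_F.
have mfx : measurable_fun setT ((fun s => f (x :: s)) \o c).
  exact: (measurableT_comp mf (pair1_measurable x)).
case: ifPn => [xB|xB].
  rewrite (IH _ (fun s => f (x :: s))) // [LHS]integral_mkcond; apply: eq_integral => t _; rewrite !patchE /=.
  by congr (if _ then _ else _); apply/idP/idP; rewrite !in_setE /=; [move=> ?; split=> //; rewrite -in_setE|case].
rewrite integral0_eq // => t _; rewrite patchE ifF //; apply/negbTE; apply: contra xB.
by rewrite !in_setE => -[].
Qed.

Definition pint (k : nat) (gam : nat -> R) (u : R) (s : seq R) : R :=
  if (size s == k) && sorted (fun x y => y < x) (u :: rcons s 0) then
    \prod_(i < k) (s`_i `^ (gam i - 1)) else 0.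

Lemma gt_trans_rel : transitive (fun x y : R => y < x).
Proof. by move=> y x z h1 h2; exact: lt_trans h2 h1. Qed.

(** The first variable is the outermost and the largest: for fixed x the others integrate to a
    multiple of a power of x, so every integration is that of one power. Positivity is required of
    the tail sums, while a single gam_i may be negative. *)
Lemma iint_pint k (gam : nat -> R) (u K : R) : 0 < u -> 0 <= K ->
  (forall j, (j < k)%N -> 0 < \sum_(i < k | (j <= i)%N) gam i) ->
  iint k (fun=> setT) (fun s => K * pint k gam u s) =
  (K * u `^ (\sum_(i < k) gam i) / \prod_(j < k) \sum_(i < k | (j <= i)%N) gam i)%:E.
Proof.
elim: k gam u K => [|k IH] gam u K u0 K0 G0.
  by rewrite /= /pint /= u0 !big_ord0 powRr0 divr1.
pose G := \sum_(i < k.+1) gam i; pose T := \prod_(j < k) \sum_(i < k | (j <= i)%N) gam i.+1.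
have tail0 j : \sum_(i < k.+1 | (j.+1 <= i)%N) gam i = \sum_(i < k | (j <= i)%N) gam i.+1.
  by rewrite big_mkcond big_ord_recl /= add0r [RHS]big_mkcond.
have T0 : 0 < T by apply: prodr_gt0 => j _; rewrite -tail0 G0 // ltnS ltn_ord.
have Gp : 0 < G by have := G0 0%N isT; rewrite /G; congr (_ < _); apply: eq_bigl.
have -> : \prod_(j < k.+1) \sum_(i < k.+1 | (j <= i)%N) gam i = G * T.
  rewrite big_ord_recl /=; congr (_ * _); apply: eq_bigr => j _; exact: tail0.
pose h (x : R) := K / T * x `^ (G - 1).
transitivity (\int[@lebesgue_measure R]_(x in `]0%R, u[) (h x)%:E)%E.
  rewrite /= [RHS]integral_mkcond; apply: eq_integral => x _; rewrite patchE.
  have pS s : pint k.+1 gam u (x :: s) = if x < u then x `^ (gam 0%N - 1) * pint k (fun i => gam i.+1) x s else 0.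
    rewrite /pint /= eqSS big_ord_recl /=; case: (x < u); last by rewrite andbF.
    by rewrite /=; case: ifP => _; rewrite ?mulr0.
  case: ifPn => [|]; rewrite ?notin_setE ?in_setE /= in_itv /=.
    move=> /andP[x0 xu].
    rewrite (@eq_iint _ _ _ (fun s => (K * x `^ (gam 0%N - 1)) * pint k (fun i => gam i.+1) x s)); last first.
      by move=> s; rewrite pS xu mulrA.
    rewrite IH ?mulr_ge0 ?powR_ge0 // => [|j jk]; last by rewrite -tail0 G0.
    rewrite -/T /h; congr (_%:E); rewrite -[K * _ * _]mulrA -powRD; last by rewrite (gt_eqF x0) implybT.
    have -> : gam 0%N - 1 + \sum_(i < k) gam i.+1 = G - 1 by rewrite /G big_ord_recl addrAC.
    by rewrite mulrAC.
  move=> nx; rewrite (@eq_iint _ _ _ (fun=> 0)) ?iint0 // => s; rewrite pS.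
  case: ifP => [xu|_]; last by rewrite mulr0.
  rewrite /pint; case: ifP => [/andP[_ ps]|_]; last by rewrite !mulr0.
  case: nx; rewrite xu andbT; move: ps => /= /(order_path_min gt_trans_rel) /allP; apply.
  by rewrite mem_rcons mem_head.
have mh : measurable_fun setT h.
  by apply: measurable_funM => //; exact: measurable_powR.
rewrite integral_itv_bndo_bndc; last by apply: measurable_funTS; apply/measurable_EFinP.
under eq_integral do rewrite EFinM.
rewrite ge0_integralZl_EFin //; last 3 first.
- by move=> x _; rewrite lee_fin powR_ge0.
- by apply: measurable_funTS; apply/measurable_EFinP; exact: measurable_powR.
- by rewrite divr_ge0 // ltW.
rewrite integral_powR // -EFinM -/G; congr (_%:E); rewrite invfM; ring.
Qed.

End IteratedIntegral.

Lemma big_pairs (T : Type) (idx : T) (op : Monoid.law idx) n (f : nat -> T) :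
  \big[op/idx]_(i < 2 * n) f i = \big[op/idx]_(l < n) op (f (2 * l)%N) (f (2 * l).+1).
Proof.
rewrite -(big_mkord predT f) -(big_mkord predT (fun l => op (f (2 * l)%N) (f (2 * l).+1))).
elim: n => [|n IH]; first by rewrite muln0 !big_geq.
by rewrite mulnS addnC addn2 !big_nat_recr //= IH Monoid.mulmA.
Qed.

Section Density.
Variables (R : realType) (n n0 a : nat).
Local Notation b := (n0%:R / 2 : R).

Definition ordered (s : seq R) := (size s == 2 * n)%N && sorted (fun x y => y < x) (1 :: rcons s 0).
(** One plus the exponent of the weight, which is y^(-b) on the larger and z^(b-1) on the smaller
    member of each pair. *)
Definition gam0 (i : nat) : R := if odd i then b else 1 - b.
Definition gamx (e : {ffun 'I_n + 'I_n -> nat}) (i : nat) : nat :=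
  oapp (fun l => e (if odd i then inr l else inl l)) 0%N (insub i./2).
(** The default 0 off the chamber keeps all values in [0, 1], so that polynomials in them are
    bounded everywhere; the weight vanishes there. *)
Definition yz (s : seq R) (k : 'I_n + 'I_n) : R :=
  if ordered s then match k with inl j => s`_(2 * j) | inr j => s`_(2 * j).+1 end else 0.
Definition wt (s : seq R) := pint (2 * n) gam0 1 s.

Lemma gamx_even e (l : 'I_n) : gamx e (2 * l) = e (inl l).
Proof. by rewrite /gamx oddM /= mul2n doubleK valK. Qed.
Lemma gamx_odd e (l : 'I_n) : gamx e (2 * l).+1 = e (inr l).
Proof. by rewrite /gamx /= oddM /= mul2n uphalf_double valK. Qed.

Lemma ordered_nth s i j : ordered s -> (i < j)%N -> (j < 2 * n)%N -> [/\ 0 < s`_j, s`_j < s`_i & s`_i < 1].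
Proof.
move=> /andP[/eqP sz so] ij jn; have := sorted_ltn_nth (@gt_trans_rel R) 0 so.
move=> H; have szr : size (1 :: rcons s 0) = (2 * n).+2 by rewrite /= size_rcons sz.
have nthE k : (k < 2 * n)%N -> nth 0 (1 :: rcons s 0) k.+1 = s`_k by move=> kn; rewrite /= nth_rcons sz kn.
split.
- have := H j.+1 (2 * n).+1; rewrite !inE szr (nthE j jn) /= nth_rcons sz ltnn eqxx; apply; lia.
- have := H i.+1 j.+1; rewrite !inE szr (nthE j jn) (nthE i (ltn_trans ij jn)); apply; lia.
- have := H 0%N i.+1; rewrite !inE szr nthE //; [apply; lia|lia].
Qed.

Lemma ordered_nth1 s i : ordered s -> (i < 2 * n)%N -> 0 < s`_i < 1.
Proof.
move=> os hi; case: (ltnP i.+1 (2 * n)) => h.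
  by have [h1 h2 h3] := ordered_nth os (ltnSn i) h; rewrite h3 (lt_trans h1 h2).
case: i hi h => [|i] hi h; last by have [h1 h2 h3] := ordered_nth os (ltnSn i) hi; rewrite h1 (lt_trans h2 h3).
exfalso; lia.
Qed.

Lemma yz_bound s k : 0 <= yz s k <= 1.
Proof.
rewrite /yz; case: ifP => [os|_]; last by rewrite lexx ler01.
suff H i : (i < 2 * n)%N -> 0 <= s`_i <= 1 by case: k => j; apply: H; have := ltn_ord j; lia.
by move=> /(ordered_nth1 os)/andP[h1 h2]; rewrite !ltW.
Qed.

Lemma pint_mono e s : pint (2 * n) (fun i => gam0 i + (gamx e i)%:R) 1 s = mono e (yz s) * wt s.
Proof.
rewrite /wt /pint -/(ordered s); case: ifP => [os|_]; last by rewrite mulr0.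
rewrite /mono big_sumType /=.
have -> : \prod_i yz s (inl i) ^+ e (inl i) * \prod_i yz s (inr i) ^+ e (inr i) =
   \prod_(i < 2 * n) s`_i ^+ gamx e i.
  rewrite (big_pairs _ n (fun i => s`_i ^+ gamx e i)) -big_split /=; apply: eq_bigr => l _.
  by rewrite gamx_even gamx_odd /yz os.
rewrite -big_split /=; apply: eq_bigr => i _; rewrite mulrC.
have /andP[s0 _] := ordered_nth1 os (ltn_ord i).
rewrite addrAC [LHS]powRD; last by rewrite (gt_eqF s0) implybT.
by rewrite powR_mulrn ?ltW.
Qed.

Let al (e : {ffun 'I_n + 'I_n -> nat}) (i : 'I_n) : R := (e (inl i))%:R - b + 1.
Let be (e : {ffun 'I_n + 'I_n -> nat}) (j : 'I_n) : R := (e (inr j))%:R + b.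

Let gamE e (l : 'I_n) : gam0 (2 * l) + (gamx e (2 * l))%:R = al e l /\
  gam0 (2 * l).+1 + (gamx e (2 * l).+1)%:R = be e l.
Proof. by rewrite gamx_even gamx_odd /gam0 /= oddM /= /al /be; split; ring. Qed.

Let tail_even e (l : 'I_n) : \sum_(i < 2 * n | (2 * l <= i)%N) (gam0 i + (gamx e i)%:R) =
  \sum_(i < n | (l <= i)%N) (al e i + be e i).
Proof.
rewrite big_mkcond (big_pairs _ n (fun i => if (2 * l <= i)%N then gam0 i + (gamx e i)%:R else 0)) [RHS]big_mkcond.
apply: eq_bigr => i _ /=; have [-> ->] := gamE e i.
have -> : (2 * l <= 2 * i)%N = (l <= i)%N by lia.
have -> : (2 * l <= (2 * i).+1)%N = (l <= i)%N by lia.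
by case: ifP => _ //; rewrite addr0.
Qed.

Let tail_odd e (l : 'I_n) : \sum_(i < 2 * n | ((2 * l).+1 <= i)%N) (gam0 i + (gamx e i)%:R) =
  be e l + \sum_(i < n | (l < i)%N) (al e i + be e i).
Proof.
rewrite big_mkcond (big_pairs _ n (fun i => if ((2 * l).+1 <= i)%N then gam0 i + (gamx e i)%:R else 0)).
rewrite [X in _ = _ + X]big_mkcond (bigD1 l) //= [in RHS](bigD1 l) //= !ltnn !add0r ltnSn.
have [_ ->] := gamE e l; congr (_ + _); apply: eq_bigr => i il /=; have [-> ->] := gamE e i.
have -> : (2 * l < 2 * i)%N = (l < i)%N by lia.
have -> : (2 * l < (2 * i).+1)%N = (l < i)%N.
  by move: il; rewrite -val_eqE /=; lia.
by case: ifP => _ //; rewrite addr0.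
Qed.

Let al_be0 e i : 0 < al e i + be e i.
Proof.
have -> : al e i + be e i = (e (inl i) + e (inr i)).+1%:R by rewrite /al /be -addn1 !natrD; ring.
by rewrite ltr0n.
Qed.

Hypothesis hn0 : (0 < n0)%N.

Let b0 : 0 < b. Proof. by rewrite divr_gt0 ?ltr0n. Qed.

(** The tail sums starting at an even or an odd position are the two kinds of factors in [nest]. All
    are positive because b cancels in every complete pair. *)
Lemma iint_mono e : iint (2 * n) (fun=> setT) (fun s => mono e (yz s) * wt s) = (nmom b e)%:E.
Proof.
rewrite (@eq_iint _ _ _ _ (fun s => 1 * pint (2 * n) (fun i => gam0 i + (gamx e i)%:R) 1 s)); last first.
  by move=> s; rewrite mul1r pint_mono.
rewrite iint_pint //.
  rewrite mul1r powR1 mul1r; congr (_%:E).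
  rewrite (big_pairs _ n (fun j => \sum_(i < 2 * n | (j <= i)%N) (gam0 i + (gamx e i)%:R))) -prodfV.
  by apply: eq_bigr => l _; rewrite /= tail_even tail_odd.
move=> j hj; have h : (j./2 < n)%N by lia.
have [jo|jo] := boolP (odd j).
  have -> : j = (2 * Ordinal h).+1 :> nat by rewrite /= mul2n -[LHS]odd_double_half jo.
  rewrite tail_odd ltr_wpDr // ?sumr_ge0 //; first by move=> i _; rewrite ltW.
  by rewrite /be ltr_wpDl ?ler0n.
have -> : j = (2 * Ordinal h)%N :> nat by rewrite /= mul2n -[LHS]odd_double_half (negPf jo).
rewrite tail_even (bigD1 (Ordinal h)) //= ltr_wpDr //; by apply: sumr_ge0 => i _; rewrite ltW.
Qed.

(** With A = a - n0 + 1 the exponents are (a - 1 + A)/2 = a - n0/2 on the larger member of a pair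
    and (a - 1 - A)/2 = n0/2 - 1 on the smaller one. The differences form two Vandermonde
    determinants whose signs cancel. *)
Lemma rho_wt s : rho (a + n) n n0 s = yzfun a (fun=> 1) (yz s) * wt s.
Proof.
rewrite /rho /wt /pint -/(ordered s); case: ifP => [os|_]; last by rewrite mulr0.
have -> : (a + n)%:R - n%:R = a%:R :> R by rewrite natrD addrK.
rewrite (big_pairs _ n (fun j => s`_j `^ ((a%:R - 1) / 2))) (big_pairs _ n (fun j => s`_j `^ (gam0 j - 1))) /=.
have -> : yzfun a (fun=> 1) (yz s) = (\prod_(l < n) s`_(2 * l) ^+ a) *
   \prod_(j < n) \prod_(k < n | (j < k)%N) ((s`_(2 * j) - s`_(2 * k)) * (s`_(2 * j).+1 - s`_(2 * k).+1)).
  rewrite /yzfun mul1r !vdmE -[LHS]mulrA -big_split /=; congr (_ * _).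
    by apply: eq_bigr => l _; rewrite /yz os.
  by apply: eq_bigr => i _; rewrite -big_split /=; apply: eq_bigr => j _ /=; rewrite /yz os; ring.
rewrite [RHS]mulrAC; congr (_ * _); rewrite -!big_split /=; apply: eq_bigr => l _; rewrite /gam0 /= !oddM /=.
have hl := ltn_ord l.
have /andP[y0 _] : 0 < s`_(2 * l) < 1 by apply: ordered_nth1 => //; lia.
have /andP[z0 _] : 0 < s`_(2 * l).+1 < 1 by apply: ordered_nth1 => //; lia.
rewrite powRM ?invr_ge0 ?ltW // -[(s`_(2 * l))^-1]powR_inv1 ?ltW // -powRrM -powR_mulrn ?ltW //.
have pD (x p q : R) : 0 < x -> x `^ p * x `^ q = x `^ (p + q) by move=> x0; rewrite powRD // (gt_eqF x0) implybT.
rewrite [X in _ * X]mulrC mulrACA !pD // [RHS]mulrA pD //; congr (_ `^ _ * _ `^ _); by field.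
Qed.

Lemma rho_ge0 nstar (s : seq R) : 0 <= rho nstar n n0 s.
Proof.
rewrite /rho -/(ordered s); case: ifP => // os; rewrite mulr_ge0 //.
  by rewrite mulr_ge0 // prodr_ge0 // => i _; exact: powR_ge0.
apply: prodr_ge0 => j _; apply: prodr_ge0 => k jk.
have hj := ltn_ord j; have hk := ltn_ord k.
have [||_ h1 _] := @ordered_nth s (2 * j) (2 * k) os; [lia|lia|].
have [||_ h2 _] := @ordered_nth s (2 * j).+1 (2 * k).+1 os; [lia|lia|].
by rewrite mulr_ge0 // subr_ge0 ltW.
Qed.

Variables (d : measure_display) (T : measurableType d) (mu : {sigma_finite_measure set T -> \bar R}) (c : T -> seq R).
Hypothesis sc : forall t, size (c t) = (2 * n)%N.
Hypothesis mc : forall i, measurable_fun setT (fun t => (c t)`_i).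
Hypothesis iintE : forall (B : nat -> set R) (f : seq R -> R), (forall j, measurable (B j)) -> (forall s, 0 <= f s) ->
  measurable_fun setT (f \o c) ->
  iint (2 * n) B f = (\int[mu]_(t in [set t | forall j, (j < 2 * n)%N -> B j (c t)`_j]) (f (c t))%:E)%E.

Lemma measurable_ordered : measurable_fun setT (ordered \o c).
Proof.
pose r (t : T) k := nth 0 (1 :: rcons (c t) 0) k.
have mr k : measurable_fun setT (fun t => r t k).
  case: k => [|k] /=; first exact: measurable_cst.
  have -> : (fun t => r t k.+1) = (fun t => (c t)`_k).
    apply/funext => t; rewrite /r /= nth_rcons; case: ltnP => // h; rewrite nth_default //.
    by case: (_ == _).
  exact: mc.
have -> : ordered \o c = (fun t => all (fun k => r t k.+1 < r t k) (iota 0 (2 * n).+1)).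
  apply/funext => t; rewrite /comp /ordered sc eqxx andTb.
  apply/(sortedP 0)/allP => [H k|H k].
    by rewrite mem_iota add0n => /andP[_ hk]; apply: H; rewrite /= size_rcons sc.
  by rewrite /= size_rcons sc => hk; apply: H; rewrite mem_iota add0n; lia.
elim: (iota _ _) => [|k l IH] /=; first exact: measurable_cst.
by apply: measurable_and => //; apply: measurable_fun_ltr.
Qed.

Lemma measurable_yz k : measurable_fun setT (fun t => yz (c t) k).
Proof.
rewrite /yz; apply: measurable_fun_ifT; [exact: measurable_ordered| |exact: measurable_cst].
by case: k => j; exact: mc.
Qed.

Lemma bm_yz k : bm (fun t => yz (c t) k).
Proof.
split; first exact: measurable_yz.
by exists 1 => t; have /andP[h1 h2] := yz_bound (c t) k; rewrite ger0_norm.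
Qed.

Lemma wt_ge0 s : 0 <= wt s.
Proof. by rewrite /wt /pint; case: ifP => // _; apply: prodr_ge0 => i _; exact: powR_ge0. Qed.

Lemma measurable_wt : measurable_fun setT (wt \o c).
Proof.
rewrite /wt /pint /comp; apply: measurable_fun_ifT; [exact: measurable_ordered| |exact: measurable_cst].
apply: (fa_prod (@measurable_falg R _ _)) => i; exact: (measurableT_comp (measurable_powR _) (mc i)).
Qed.

Lemma pf_falg (U : Type) (A : (U -> R) -> Prop) (I : finType) (f : (I -> R) -> R) (x : U -> I -> R) :
  falg A -> pf f -> (forall i, A (x^~ i)) -> A (fun u => f (x u)).
Proof.
move=> fA [l Hl] hx; under eq_fun do rewrite Hl.
apply: (fa_sum fA) => t; apply: (fa_mul fA); first exact: (fa_const fA).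
by apply: (fa_prod fA) => i; apply: (fa_exp fA).
Qed.

Let mono_wt e : (\int[mu]_t (mono e (yz (c t)) * wt (c t))%:E = (nmom b e)%:E)%E.
Proof.
rewrite -iint_mono (iintE (B := fun=> setT)) //.
- by congr integral; apply/seteqP; split.
- by move=> s; rewrite mulr_ge0 ?wt_ge0 // prodr_ge0 // => i _; rewrite exprn_ge0 //; case/andP: (yz_bound s i).
- apply: measurable_funM; last exact: measurable_wt.
  apply: (pf_falg (x := fun t => yz (c t)) (@measurable_falg R _ _) (pf_mono R e)); exact: measurable_yz.
Qed.

Lemma integrable_wt : mu.-integrable setT (EFin \o (wt \o c)).
Proof.
apply/integrableP; split; first by apply/measurable_EFinP; exact: measurable_wt.
suff -> : (\int[mu]_x `|(EFin \o (wt \o c)) x| = (nmom b [ffun _ : 'I_n + 'I_n => 0%N])%:E)%E by rewrite ltry.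
rewrite -mono_wt; apply: eq_integral => t _.
by rewrite gee0_abs ?lee_fin ?wt_ge0 // /mono big1 ?mul1r // => i _; rewrite ffunE expr0.
Qed.

Lemma wint_wt f : pf f -> wint mu (wt \o c) (fun t => f (yz (c t))) = momf (nmom b) f.
Proof.
move=> pff; have [l Hl] := pff; rewrite (momfE (nmom b) pff (l := l)) => [|x _]; last exact: Hl.
have bme e : bm (fun t => mono e (yz (c t))).
  by apply: (pf_falg (x := fun t => yz (c t)) (@bm_falg R _ _) (pf_mono R e)); exact: bm_yz.
under eq_fun do rewrite Hl.
rewrite (wint_sum integrable_wt l (F := fun u t => u.1 * mono u.2 (yz (c t)))); last first.
  by move=> u; apply: bmZ.
apply: eq_bigr => u _; rewrite (wintZ integrable_wt) //; congr (_ * _).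
by rewrite /wint /Rintegral mono_wt.
Qed.

Let g0 t := yzfun a (fun=> 1) (yz (c t)).

Let bm_g0 : bm g0.
Proof. by apply: (pf_falg (x := fun t => yz (c t)) (@bm_falg R _ _) (pf_yzfun n a (TP_const 1))); exact: bm_yz. Qed.

Let rhoE t : rho (a + n) n n0 (c t) = g0 t * wt (c t).
Proof. exact: rho_wt. Qed.

Lemma integrable_rho : mu.-integrable setT (EFin \o (rho (a + n) n n0 \o c)).
Proof.
have := wint_integrable integrable_wt bm_g0; apply: eq_integrable => // t _ /=.
by rewrite rhoE.
Qed.

Lemma iint_rho (B : nat -> set R) : (forall j, measurable (B j)) ->
  iint (2 * n) B (rho (a + n) n n0) =
  (\int[mu]_(t in [set t | forall j, (j < 2 * n)%N -> B j (c t)`_j]) (rho (a + n) n n0 (c t))%:E)%E.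
Proof.
move=> mB; apply: iintE => //; first exact: rho_ge0.
have [h _] := integrableP _ _ _ integrable_rho; exact/measurable_EFinP.
Qed.

Lemma wint_rho (F : (nat -> R) -> R) : TP F -> wint mu (rho (a + n) n n0 \o c) (fun t => F (psum (yz (c t)))) = momf (nmom b) (@yzfun R n a F).
Proof.
move=> TF; rewrite -wint_wt; last exact: pf_yzfun.
rewrite /wint; apply: eq_Rintegral => t _.
by rewrite /= rhoE mulrA /g0 /yzfun mul1r !mulrA.
Qed.

Lemma rho_ordered nstar (s : seq R) : rho nstar n n0 s != 0 -> ordered s.
Proof. by rewrite /rho -/(ordered s); case: ifP => //; rewrite eqxx. Qed.

End Density.

(** * From traces to the law of the spectrum *)

Section OrderEvent.
Variables (R : realType) (L : nat).

(** For a decreasing list, a_j < e_j means that more than j entries exceed a_j, and e_j <= b_j that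
    at most j entries exceed b_j. In this form the condition is symmetric in the entries and uses
    counting functions only. *)
Definition box (a b : nat -> R) (e : seq R) :=
  all (fun j => (j < count (fun y => a j < y)%R e)%N && (count (fun y => b j < y)%R e <= j)%N) (iota 0 L).
(** Strict decrease between positions j and j.+1 is witnessed by a number that exactly j.+1 entries
    exceed. Rational witnesses suffice, so the event is a limit over the finite sets [rats m]. *)
Definition sep (rs : seq R) (e : seq R) :=
  all (fun j => has (fun r => count (fun y => r < y)%R e == j.+1) rs) (iota 0 L.-1).
Definition rats m : seq R := [seq ratr q | q <- pmap unpickle (iota 0 m)].
Definition evt a b (e : seq R) := box a b e && `[< exists m, sep (rats m) e >].

Lemma has_rats (p : pred R) m m' : (m <= m')%N -> has p (rats m) -> has p (rats m').
Proof.
move=> mm /hasP[x /mapP[q qm ->] px]; apply/hasP; exists (ratr q) => //; apply: map_f.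
move: qm; rewrite !mem_pmap => /mapP[k km E]; rewrite E; apply: map_f.
by move: km; rewrite !mem_iota !add0n => /andP[_ h]; rewrite /= (leq_trans h).
Qed.

Lemma sep_mono m m' e : (m <= m')%N -> sep (rats m) e -> sep (rats m') e.
Proof. by move=> mm /allP H; apply/allP => j /H; exact: has_rats. Qed.

Lemma count_nth (c : R) e j : sorted (fun x y => y <= x) e -> (j < size e)%N ->
  (j < count (fun y => c < y)%R e)%N = (c < e`_j).
Proof.
elim: e j => [//|x e IH] j se hj.
have le_e y : y \in e -> y <= x.
  by move: se => /= /(order_path_min (fun a b c h1 h2 => le_trans h2 h1)) /allP; apply.
have se' : sorted (fun x y => y <= x) e by move: se => /= /path_sorted.
case: j hj => [|j] hj /=.
  case: ltP => cx //=; rewrite add0n; apply/negbTE; rewrite -leqNgt leqn0 -leqn0 leqNgt -has_count.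
  by apply/hasPn => y /le_e yx; rewrite -leNgt (le_trans yx).
case: ltP => cx /=; first by rewrite add1n ltnS IH.
rewrite add0n; have -> : count (fun y => c < y)%R e = 0%N.
  by apply/eqP; rewrite -leqn0 leqNgt -has_count; apply/hasPn => y /le_e yx; rewrite -leNgt (le_trans yx).
by rewrite ltn0; apply/esym/negbTE; rewrite -leNgt (le_trans _ cx) // le_e // mem_nth.
Qed.

Lemma evtP a b e : sorted (fun x y => y <= x) e -> size e = L ->
  reflect (sorted (fun x y => y < x) e /\ forall j, (j < L)%N -> a j < e`_j <= b j) (evt a b e).
Proof.
move=> se sz; have cE c j := @count_nth c e j se.
have boxE : box a b e <-> forall j, (j < L)%N -> a j < e`_j <= b j.
  split=> [/allP H j jL|H].
    have jI : j \in iota 0 L by rewrite mem_iota.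
    by have /andP[h1 h2] := H j jI; rewrite -cE ?sz // h1 leNgt -cE ?sz // -leqNgt.
  apply/allP => j; rewrite mem_iota /= add0n => jL; have /andP[h1 h2] := H j jL.
  by rewrite cE ?sz // h1 leqNgt cE ?sz // -leNgt.
have sepE : (exists m, sep (rats m) e) <-> sorted (fun x y => y < x) e.
  split=> [[m /allP H]|H].
    apply/(sortedP 0) => j; rewrite sz => hj.
    have jI : j \in iota 0 L.-1 by rewrite mem_iota /= add0n; lia.
    have /hasP[r _ /eqP cr] := H j jI.
    have h1 : r < e`_j by rewrite -cE ?sz ?cr //; lia.
    by rewrite (le_lt_trans _ h1) // leNgt -cE ?sz ?cr // ltnn.
  have ex j : (j < L.-1)%N -> exists m, has (fun r => count (fun y => r < y)%R e == j.+1) (rats m).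
    move=> hj; have h : e`_j.+1 < e`_j by move/(sortedP 0): H; apply; rewrite sz; lia.
    have [q] := rat_in_itvoo h; rewrite in_itv /= => /andP[q1 q2].
    exists (pickle q).+1; apply/hasP; exists (ratr q).
      apply: map_f; rewrite mem_pmap; apply/mapP; exists (pickle q); last by rewrite pickleK.
      by rewrite mem_iota add0n /=.
    have c1 : (j < count (fun y => ratr q < y)%R e)%N by rewrite cE // sz; lia.
    have c2 : ~~ (j.+1 < count (fun y => ratr q < y)%R e)%N by rewrite cE ?sz -?leNgt ?ltW //; lia.
    by rewrite eqn_leq leqNgt c2.
  have all_ex s : all (fun j => j < L.-1)%N s ->
      exists m, all (fun j => has (fun r => count (fun y => r < y)%R e == j.+1) (rats m)) s.
    elim: s => [|j s IH] /=; first by exists 0%N.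
    move=> /andP[/ex[mj hj] /IH[ms hs]]; exists (maxn mj ms).
    rewrite (has_rats (leq_maxl _ _) hj); apply/allP => i /(allP hs); exact: has_rats (leq_maxr _ _).
  by apply: all_ex; apply/allP => j; rewrite mem_iota add0n.
apply: (iffP andP) => [[/boxE hb /asboolP/sepE hs] //|[hs hb]].
by split; [exact/boxE|apply/asboolP/sepE].
Qed.

Lemma evt_perm a b e e' : perm_eq e e' -> evt a b e = evt a b e'.
Proof.
move=> pe; have cE c : count (fun y => c < y)%R e = count (fun y => c < y)%R e' by move/seq.permP: pe; apply.
rewrite /evt /box /sep; congr (_ && _); first by apply: eq_all => j; rewrite !cE.
by congr asbool; congr ex; apply/funext => m; congr is_true; apply: eq_all => j; apply: eq_has => r; rewrite cE.
Qed.

End OrderEvent.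

(** * From trace moments to counting functions *)

Section Transfer.
Variable R : realType.
Variables (L : nat) (K : R).

Definition valid (e : seq R) := size e = L /\ forall y, y \in e -> `|y| <= K.
Definition ps (e : seq R) (j : nat) : R := \sum_(y <- e) y ^+ j.

Variables (d1 d2 : measure_display) (T1 : measurableType d1) (T2 : measurableType d2).
Variables (mu1 : {measure set T1 -> \bar R}) (mu2 : {measure set T2 -> \bar R}).
Variables (w1 : T1 -> R) (w2 : T2 -> R) (e1 : T1 -> seq R) (e2 : T2 -> seq R).
Hypotheses (iw1 : mu1.-integrable setT (EFin \o w1)) (iw2 : mu2.-integrable setT (EFin \o w2)).
Hypotheses (v1 : forall t, valid (e1 t)) (v2 : forall t, valid (e2 t)).
Hypotheses (m1 : forall j, measurable_fun setT (fun t => ps (e1 t) j))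
  (m2 : forall j, measurable_fun setT (fun t => ps (e2 t) j)).
Variable C0 : R.
Hypothesis ps_transfer : forall F, TP F -> wint mu1 w1 (fun t => F (ps (e1 t))) = C0 * wint mu2 w2 (fun t => F (ps (e2 t))).

Lemma ps_bound e j : valid e -> `|ps e j| <= L%:R * K ^+ j.
Proof.
move=> [sz hK]; rewrite -sz /ps; elim: e {sz} hK => [|y e IH] hK; first by rewrite big_nil normr0 mul0r.
rewrite big_cons (le_trans (ler_normD _ _)) //= -[(size e).+1]addn1 natrD mulrDl mul1r addrC lerD //.
  by apply: IH => z ze; apply: hK; rewrite in_cons ze orbT.
by rewrite normrX lerXn2r ?nnegrE // ?hK ?mem_head // (le_trans _ (hK y (mem_head _ _))).
Qed.

Let bm1 F : TP F -> bm (fun t => F (ps (e1 t))).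
Proof.
move=> TF; apply: (fa_TP (@bm_falg R _ _) TF) => j; split; first exact: m1.
by exists (L%:R * K ^+ j) => t; exact: ps_bound.
Qed.
Let bm2 F : TP F -> bm (fun t => F (ps (e2 t))).
Proof.
move=> TF; apply: (fa_TP (@bm_falg R _ _) TF) => j; split; first exact: m2.
by exists (L%:R * K ^+ j) => t; exact: ps_bound.
Qed.

(* The law of e1 under w1 agrees with C0 times that of e2 under w2, tested on Psi and trace polynomials. *)
Definition transfers (Psi : seq R -> R) := [/\ bm (Psi \o e1), bm (Psi \o e2) & forall F, TP F ->
  wint mu1 w1 (fun t => F (ps (e1 t)) * Psi (e1 t)) = C0 * wint mu2 w2 (fun t => F (ps (e2 t)) * Psi (e2 t))].
(** Admissible functions are defined as multipliers of [transfers], which makes closure under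
    products immediate; [transfers] itself is a linear condition. *)
Definition Adm (Psi : seq R -> R) := forall Psi', transfers Psi' -> transfers (fun e => Psi e * Psi' e).

Lemma transfers_one : transfers (fun=> 1).
Proof.
split; [exact: bm_cst|exact: bm_cst|move=> F TF].
by under eq_fun do rewrite mulr1; rewrite ps_transfer //; congr (_ * wint _ _ _); apply/funext => t; rewrite mulr1.
Qed.

Lemma Adm_transfers Psi : Adm Psi -> transfers Psi.
Proof. by move=> /(_ _ transfers_one); congr transfers; apply/funext => e; rewrite mulr1. Qed.

Lemma Adm_falg : falg Adm.
Proof.
split=> [c|f g Af Ag|f g Af Ag] Psi GP.
- have [b1 b2 tr] := GP; split; [exact: bmZ|exact: bmZ|move=> F TF].
  have E (T : Type) (e : T -> seq R) : (fun t => F (ps (e t)) * (c * Psi (e t))) = (fun t => c * (F (ps (e t)) * Psi (e t))).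
    by apply/funext => t; rewrite mulrCA.
  by rewrite !E !wintZ ?tr //; [rewrite mulrCA|apply: bmM => //; exact: bm2|apply: bmM => //; exact: bm1].
- have [f1 f2 ftr] := Af _ GP; have [g1 g2 gtr] := Ag _ GP; split.
  + by have := bmD f1 g1; congr bm; apply/funext => t /=; rewrite mulrDl.
  + by have := bmD f2 g2; congr bm; apply/funext => t /=; rewrite mulrDl.
  move=> F TF.
  have E (T : Type) (e : T -> seq R) : (fun t => F (ps (e t)) * ((f (e t) + g (e t)) * Psi (e t))) =
     (fun t => F (ps (e t)) * (f (e t) * Psi (e t)) + F (ps (e t)) * (g (e t) * Psi (e t))).
    by apply/funext => t; rewrite mulrDl mulrDr.
  rewrite !E !wintD ?ftr ?gtr ?mulrDr //; apply: bmM => //; (exact: bm1 || exact: bm2).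
- by have := Af _ (Ag _ GP); congr transfers; apply/funext => e; rewrite mulrA.
Qed.

Lemma Adm_ps j : (0 < j)%N -> Adm (fun e => ps e j).
Proof.
move=> j0 Psi [b1 b2 tr]; split.
- by apply: bmM => //; exact: (bm1 (TP_var R j0)).
- by apply: bmM => //; exact: (bm2 (TP_var R j0)).
move=> F TF.
have E (T : Type) (e : T -> seq R) : (fun t => F (ps (e t)) * (ps (e t) j * Psi (e t))) =
     (fun t => (F (ps (e t)) * ps (e t) j) * Psi (e t)).
  by apply/funext => t; rewrite mulrA.
by rewrite !E; apply: (tr (fun p => F p * p j)); apply: TP_mul => //; exact: TP_var.
Qed.

(** Dominated convergence on both sides; bounds on valid lists suffice because e1 and e2 take only
    such values. *)
Lemma Adm_lim (f_ : nat -> seq R -> R) (f : seq R -> R) (M : R) : (forall m, Adm (f_ m)) ->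
  (forall m e, valid e -> `|f_ m e| <= M) -> (forall e, valid e -> f_ ^~ e @ \oo --> f e) -> Adm f.
Proof.
move=> Af fM cf Psi GP.
have bound e : valid e -> `|f e| <= M.
  move=> ve; apply: (@closed_cvg _ _ _ eventually_filter (fun m => `|f_ m e|) [set x | x <= M]).
  - exact: closed_le.
  - by near=> m; exact: fM.
  - exact: cvg_norm (cf e ve).
have bmf (d : measure_display) (T : measurableType d) (e : T -> seq R) : (forall t, valid (e t)) ->
   (forall m, bm (fun t => f_ m (e t) * Psi (e t))) -> bm (Psi \o e) -> bm (fun t => f (e t) * Psi (e t)).
  move=> ve mf bP; split.
    apply: (measurable_fun_cvg (h := fun m t => f_ m (e t) * Psi (e t))); first by move=> m; case: (mf m).
    by move=> t _; apply: cvgM; [exact: cf|exact: cvg_cst].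
  have [_ [M' hM']] := bP; exists (M * M') => t; rewrite normrM ler_pM //; [exact: bound|exact: hM'].
have G m := Af m _ GP; have [b1 b2 _] := GP.
have [M1 hM1] := b1.2; have [M2 hM2] := b2.2.
split.
- by apply: (bmf _ _ e1) => // m; case: (G m).
- by apply: (bmf _ _ e2) => // m; case: (G m).
move=> F TF.
have [Mf hMf] := (bm1 TF).2; have [Mg hMg] := (bm2 TF).2.
have c1 : (fun m => wint mu1 w1 (fun t => F (ps (e1 t)) * (f_ m (e1 t) * Psi (e1 t)))) @ \oo -->
    wint mu1 w1 (fun t => F (ps (e1 t)) * (f (e1 t) * Psi (e1 t))).
  apply: (wint_dominated iw1 (M := Mf * (M * M1))).
  - by move=> m; apply: measurable_funM; [case: (bm1 TF)|case: (G m) => -[]].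
  - by move=> m t _; rewrite normrM ler_pM // normrM ler_pM //; [exact: fM|exact: hM1].
  - by move=> t _; apply: cvgM; [exact: cvg_cst|apply: cvgM; [exact: cf|exact: cvg_cst]].
  - by apply: measurable_funM; [case: (bm1 TF)|apply: (bmf _ _ e1 _ _ b1).1 => // m; case: (G m)].
have c2 : (fun m => wint mu2 w2 (fun t => F (ps (e2 t)) * (f_ m (e2 t) * Psi (e2 t)))) @ \oo -->
    wint mu2 w2 (fun t => F (ps (e2 t)) * (f (e2 t) * Psi (e2 t))).
  apply: (wint_dominated iw2 (M := Mg * (M * M2))).
  - by move=> m; apply: measurable_funM; [case: (bm2 TF)|case: (G m) => _ []].
  - by move=> m t _; rewrite normrM ler_pM // normrM ler_pM //; [exact: fM|exact: hM2].
  - by move=> t _; apply: cvgM; [exact: cvg_cst|apply: cvgM; [exact: cf|exact: cvg_cst]].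
  - by apply: measurable_funM; [case: (bm2 TF)|apply: (bmf _ _ e2 _ _ b2).1 => // m; case: (G m)].
apply: (cvg_unique _ c1); first exact: Rhausdorff.
have -> : (fun m => wint mu1 w1 (fun t => F (ps (e1 t)) * (f_ m (e1 t) * Psi (e1 t)))) =
  (fun m => C0 * wint mu2 w2 (fun t => F (ps (e2 t)) * (f_ m (e2 t) * Psi (e2 t)))).
  by apply/funext => m; case: (G m) => _ _; apply.
by apply: cvgM => //; exact: cvg_cst.
Unshelve. all: by end_near. Qed.

Lemma Adm_ext f g : (forall e, valid e -> f e = g e) -> Adm f -> Adm g.
Proof.
move=> fg Af Psi GP; have [b1 b2 tr] := Af Psi GP; split.
- by move: b1; congr bm; apply/funext => t /=; rewrite fg.
- by move: b2; congr bm; apply/funext => t /=; rewrite fg.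
move=> F /tr H.
have E (T : Type) (e : T -> seq R) : (forall t, valid (e t)) -> (fun t => F (ps (e t)) * (g (e t) * Psi (e t))) =
  (fun t => F (ps (e t)) * (f (e t) * Psi (e t))) by move=> ve; apply/funext => t; rewrite fg.
by rewrite !E.
Qed.

Definition stat (h : R -> R) (e : seq R) : R := \sum_(y <- e) h y.

(** Trace polynomials have no variable of index 0, so the constant term is treated apart: the power
    sum of index 0 is L. *)
Lemma Adm_poly (q : {poly R}) : Adm (stat (fun y => q.[y])).
Proof.
apply: (@Adm_ext (fun e => \sum_(k < size q) q`_k * (if k == 0%N :> nat then L%:R else ps e k))).
  move=> e [sz _]; rewrite /stat; under [RHS]eq_bigr do rewrite horner_coef.
  rewrite exchange_big /=; apply: eq_bigr => k _; rewrite -mulr_sumr; congr (_ * _).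
  case: eqP => [->|//]; rewrite -sz; under eq_bigr do rewrite expr0.
  by rewrite big_const_seq count_predT iter_addr_0.
apply: (fa_sum Adm_falg) => k; apply: (fa_mul Adm_falg); first exact: (fa_const Adm_falg).
by case: eqP => [_|/eqP k0]; [exact: (fa_const Adm_falg)|apply: Adm_ps; rewrite lt0n].
Qed.

Lemma stat_lim (h_ : nat -> R -> R) (h : R -> R) (M : R) : (forall m, Adm (stat (h_ m))) ->
  (forall m y, `|y| <= K -> `|h_ m y| <= M) -> (forall y, `|y| <= K -> h_ ^~ y @ \oo --> h y) -> Adm (stat h).
Proof.
move=> Ah hM ch; apply: (Adm_lim (f_ := fun m => stat (h_ m)) (M := L%:R * M)) => //.
  move=> m e [<- ve]; rewrite /stat; elim: e ve => [|y e IH] ve; first by rewrite big_nil normr0 mul0r.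
  rewrite big_cons (le_trans (ler_normD _ _)) //= -[(size e).+1]addn1 natrD mulrDl mul1r addrC lerD //.
    by apply: IH => z ze; apply: ve; rewrite in_cons ze orbT.
  by apply: hM; apply: ve; exact: mem_head.
move=> e [_ ve]; rewrite /stat; elim: e ve => [|y e IH] ve.
  by under eq_fun do rewrite big_nil; rewrite big_nil; exact: cvg_cst.
under eq_fun do rewrite big_cons; rewrite big_cons; apply: cvgD.
  by apply: ch; apply: ve; exact: mem_head.
by apply: IH => z ze; apply: ve; rewrite in_cons ze orbT.
Qed.

(* The iteration x |-> x + (y^2 - x^2)/2 started at 0 approximates |y| from below on [-1, 1]. *)
Fixpoint abs_poly (q : {poly R}) (m : nat) : {poly R} :=
  if m is m'.+1 then abs_poly q m' + 2^-1 *: (q ^+ 2 - abs_poly q m' ^+ 2) else 0.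

(** With y = |q(x)| and p the current value, a step multiplies the error y - p by 1 - (y + p)/2,
    which lies between 0 and 1 - y/2. *)
Lemma abs_polyP q m x : `|q.[x]| <= 1 ->
  0 <= (abs_poly q m).[x] <= `|q.[x]| /\ `|q.[x]| - (abs_poly q m).[x] <= `|q.[x]| * (1 - `|q.[x]| / 2) ^+ m.
Proof.
move=> q1; elim: m => [|m [/andP[h1 h2] h3]]; first by rewrite /= horner0 lexx normr_ge0 subr0 expr0 mulr1 lexx.
rewrite /= !hornerE -[q.[x] ^+ 2]real_normK ?num_real //.
have q0 := normr_ge0 q.[x].
move: h1 h2 h3; set p := (abs_poly q m).[x]; set y := `|q.[x]| in q0 q1 *; move=> h1 h2 h3.
have E : y - (p + 2^-1 * (y ^+ 2 - p ^+ 2)) = (y - p) * (1 - (y + p) / 2) by field.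
split.
  apply/andP; split; first by rewrite addr_ge0 // mulr_ge0 // subr_ge0 lerXn2r ?nnegrE.
  rewrite -subr_ge0 E mulr_ge0 ?subr_ge0 //; lra.
rewrite E exprSr mulrA ler_pM ?subr_ge0 //; lra.
Qed.

Lemma abs_poly_cvg q x : `|q.[x]| <= 1 -> (abs_poly q m).[x] @[m --> \oo] --> `|q.[x]|.
Proof.
move=> q1; have q0 := normr_ge0 q.[x].
have c0 : `|q.[x]| * (1 - `|q.[x]| / 2) ^+ m @[m --> \oo] --> (0 : R).
  have [->|y0] := eqVneq `|q.[x]| 0; first by under eq_fun do rewrite mul0r; exact: cvg_cst.
  have yp : 0 < `|q.[x]| by rewrite lt_neqAle eq_sym y0.
  rewrite -[X in _ --> X](mulr0 `|q.[x]|); apply: cvgM; first exact: cvg_cst.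
  apply: cvg_expr; rewrite ger0_norm; lra.
have c1 : `|q.[x]| - `|q.[x]| * (1 - `|q.[x]| / 2) ^+ m @[m --> \oo] --> `|q.[x]|.
  by rewrite -[X in _ --> X](subr0 `|q.[x]|); apply: cvgB => //; exact: cvg_cst.
apply: (squeeze_cvgr _ c1 (cvg_cst _)); near=> m.
have [/andP[_ h2] h3] := abs_polyP m q1; rewrite h2 andbT; lra.
Unshelve. all: by end_near. Qed.

(** Two nested limits: polynomials converge to the positive part [pos] of a scaled y - c, and 1 - (1
    - pos)^l tends to the indicator of y > c because pos lies in [0, 1] and vanishes exactly for y
    <= c. *)
Lemma Adm_above (c : R) : Adm (stat (fun y : R => (c < y)%R%:R)).
Proof.
(* An upper bound for |y - c| when |y| <= K; dividing by it puts q into [-1, 1], where [abs_poly]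
   converges. The summand 1 keeps it positive. *)
pose D0 : R := 1 + `|K| + `|c|.
have D0p : 0 < D0 by rewrite /D0 -addrA ltr_pwDl // addr_ge0.
pose s : R := D0^-1.
have s0 : 0 < s by rewrite invr_gt0.
pose q : {poly R} := s *: ('X - c%:P).
have qE y : q.[y] = s * (y - c) by rewrite !hornerE.
have q1 y : `|y| <= K -> `|q.[y]| <= 1.
  move=> yK; have h : `|y - c| <= D0.
    rewrite (le_trans (ler_normB _ _)) // lerD // (le_trans yK) // (le_trans (ler_norm K)) //.
    by rewrite lerDr.
  by rewrite qE normrM (gtr0_norm s0) mulrC /s ler_pdivrMr // mul1r.
pose pos y := (q.[y] + `|q.[y]|) / 2.
apply: (stat_lim (h_ := fun l y => 1 - (1 - pos y) ^+ l) (M := 1)).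
- move=> l.
  apply: (stat_lim (h_ := fun m y => (1 - (1 - 2^-1 *: (q + abs_poly q m)) ^+ l).[y]) (M := 1 + 2 ^+ l)).
  + by move=> m; exact: Adm_poly.
  + move=> m y yK; have [/andP[h1 h2] _] := abs_polyP m (q1 y yK); have q1y := q1 y yK.
    rewrite !hornerE -qE (le_trans (ler_normB _ _)) // normr1 lerD // normrX lerXn2r ?nnegrE //.
    have := ler_norm q.[y]; have := ler_norm (- q.[y]); rewrite normrN => n1 n2.
    by rewrite ler_norml; apply/andP; split; lra.
  + move=> y yK.
    have -> : (fun m => (1 - (1 - 2^-1 *: (q + abs_poly q m)) ^+ l).[y]) =
      (fun m => 1 - (1 - 2^-1 * (q.[y] + (abs_poly q m).[y])) ^+ l).
      by apply/funext => m; rewrite !hornerE.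
    apply: cvgB; first exact: cvg_cst.
    apply: (@continuous_cvg _ _ _ _ _ (fun m => 1 - 2^-1 * (q.[y] + (abs_poly q m).[y])) (fun x : R => x ^+ l)).
      exact: exprn_continuous.
    apply: cvgB; first exact: cvg_cst.
    rewrite /pos [_ / 2]mulrC; apply: cvgM; first exact: cvg_cst.
    by apply: cvgD; [exact: cvg_cst|apply: abs_poly_cvg; exact: q1].
- move=> l y yK; have q1y := q1 y yK.
  have := ler_norm q.[y]; have := ler_norm (- q.[y]); rewrite normrN => n1 n2.
  have p1 : 0 <= 1 - pos y <= 1 by rewrite /pos; apply/andP; split; lra.
  have /andP[p2 p3] := p1.
  have : 0 <= (1 - pos y) ^+ l <= 1 by rewrite exprn_ge0 // exprn_ile1.
  by move=> /andP[h1 h2]; rewrite ger0_norm; lra.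
move=> y yK; have q1y := q1 y yK; case: ltP => cy.
  have p0 : 0 < q.[y] by rewrite qE mulr_gt0 // subr_gt0.
  have -> : (fun l => 1 - (1 - pos y) ^+ l) = (fun l => 1 - (1 - q.[y]) ^+ l).
    apply/funext => l; rewrite /pos (gtr0_norm p0); suff -> : (q.[y] + q.[y]) / 2 = q.[y] by [].
    by move: q.[y] => u; field.
  rewrite -[X in _ --> X](subr0 1); apply: cvgB; first exact: cvg_cst.
  apply: cvg_expr; rewrite gtr0_norm // in q1y; rewrite ger0_norm; lra.
have p0 : q.[y] <= 0 by rewrite qE mulr_ge0_le0 ?subr_le0 // ltW.
have -> : (fun l => 1 - (1 - pos y) ^+ l) = (fun l => 0).
  by apply/funext => l; rewrite /pos ler0_norm // subrr mul0r subr0 expr1n subrr.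
exact: cvg_cst.
Qed.

Lemma Adm_cnt (c : R) : Adm (fun e => (count (fun y => c < y) e)%:R).
Proof.
have := Adm_above c; congr Adm; apply/funext => e; rewrite /stat.
by elim: e => [|y e IH]; rewrite ?big_nil // big_cons IH /= natrD.
Qed.

(** A count takes values in {0, ..., L}, on which every predicate is a polynomial by Lagrange
    interpolation. *)
Lemma Adm_cnt_pred (c : R) (p : pred nat) : Adm (fun e => (p (count (fun y => c < y) e))%:R).
Proof.
pose f e := count (fun y : R => c < y) e.
have lag (v : 'I_L.+1) e : valid e ->
    \prod_(u < L.+1 | u != v) (((f e)%:R - u%:R) / (v%:R - u%:R)) = (f e == v)%:R :> R.
  move=> [sz _]; have fL : (f e < L.+1)%N by rewrite ltnS -sz count_size.
  case: eqP => [->|/eqP fv].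
    by apply: big1 => u uv; rewrite divff // subr_eq0 eqr_nat eq_sym.
  have uv : Ordinal fL != v by rewrite -val_eqE.
  by rewrite (bigD1 (Ordinal fL) uv) /= subrr !mul0r.
apply: (@Adm_ext (fun e => \sum_(v < L.+1) (p v)%:R *
    \prod_(u < L.+1 | u != v) (((f e)%:R - u%:R) / (v%:R - u%:R)))).
  move=> e ve; have [sz _] := ve; have fL : (f e < L.+1)%N by rewrite ltnS -sz count_size.
  under eq_bigr => v _ do rewrite lag //.
  rewrite (bigD1 (Ordinal fL)) //= eqxx mulr1 big1 ?addr0 // => v.
  by rewrite -val_eqE /= eq_sym => /negPf ->; rewrite mulr0.
apply: (fa_sum Adm_falg) => v; apply: (fa_mul Adm_falg); first exact: (fa_const Adm_falg).
apply: (fa_prod Adm_falg) => u; apply: (fa_mul Adm_falg); last exact: (fa_const Adm_falg).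
by apply: (fa_add Adm_falg); [exact: Adm_cnt|exact: (fa_const Adm_falg)].
Qed.

Lemma Adm_and (p q : pred (seq R)) : Adm (fun e => (p e)%:R) -> Adm (fun e => (q e)%:R) -> Adm (fun e => (p e && q e)%:R).
Proof. by move=> Ap Aq; have := fa_mul Adm_falg Ap Aq; congr Adm; apply/funext => e; rewrite -natrM mulnb. Qed.

Lemma Adm_not (p : pred (seq R)) : Adm (fun e => (p e)%:R) -> Adm (fun e => (~~ p e)%:R).
Proof.
move=> Ap; have := fa_add Adm_falg (fa_const Adm_falg 1) (fa_opp Adm_falg Ap); congr Adm.
by apply/funext => e; case: (p e); rewrite ?subrr ?subr0.
Qed.

Lemma Adm_all (I : Type) (s : seq I) (p : I -> pred (seq R)) : (forall i, Adm (fun e => (p i e)%:R)) ->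
  Adm (fun e => (all (p^~ e) s)%:R).
Proof.
move=> Ap; elim: s => [|i s IH] /=; first exact: (fa_const Adm_falg).
exact: (Adm_and (p := p i)).
Qed.

Lemma Adm_has (I : Type) (s : seq I) (p : I -> pred (seq R)) : (forall i, Adm (fun e => (p i e)%:R)) ->
  Adm (fun e => (has (p^~ e) s)%:R).
Proof.
move=> Ap; have := @Adm_not _ (@Adm_all _ s (fun i e => ~~ p i e) (fun i => Adm_not (Ap i))).
congr Adm; apply/funext => e; rewrite (_ : all _ s = ~~ has (p^~ e) s) ?negbK //; exact: all_predC.
Qed.

Lemma Adm_box a b : Adm (fun e => (box L a b e)%:R).
Proof.
apply: (@Adm_all _ (iota 0 L) (fun j e => (j < count (fun y => a j < y)%R e)%N && (count (fun y => b j < y)%R e <= j)%N)) => j.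
apply: Adm_and; first exact: (Adm_cnt_pred (a j) (fun k => (j < k)%N)).
exact: (Adm_cnt_pred (b j) (fun k => (k <= j)%N)).
Qed.

Lemma Adm_sep rs : Adm (fun e => (sep L rs e)%:R).
Proof.
apply: (@Adm_all _ (iota 0 L.-1) (fun j e => has (fun r => count (fun y => r < y)%R e == j.+1) rs)) => j.
apply: (@Adm_has _ rs (fun r e => count (fun y => r < y)%R e == j.+1)) => r.
exact: (Adm_cnt_pred r (fun k => k == j.+1)).
Qed.

Lemma Adm_evt a b : Adm (fun e => (evt L a b e)%:R).
Proof.
apply: Adm_and; first exact: Adm_box.
apply: (Adm_lim (f_ := fun m e => (sep L (rats R m) e)%:R) (M := 1)) => [m|m e _|e _].
- exact: Adm_sep.
- by case: (sep _ _); rewrite ?normr1 ?normr0 ?ler01.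
apply: cvg_near_cst; case: asboolP => [[m0 hm]|nm].
  by exists m0 => // m /= mm; rewrite (sep_mono mm hm).
near=> m; case: (boolP (sep L (rats R m) e)) => // hm; case: nm; by exists m.
Unshelve. all: by end_near. Qed.

Lemma evt_transfer a b : measurable_fun setT (fun t => (evt L a b (e1 t))%:R : R) /\
  wint mu1 w1 (fun t => (evt L a b (e1 t))%:R) = C0 * wint mu2 w2 (fun t => (evt L a b (e2 t))%:R).
Proof.
have [[H1 _] _ H2] := Adm_transfers (Adm_evt a b); split=> //.
have := H2 _ (TP_const 1); under eq_fun do rewrite mul1r; move=> ->.
by congr (_ * wint _ _ _); apply/funext => t; rewrite mul1r.
Qed.

End Transfer.

Lemma card_diag_rank (F : fieldType) D (s : 'rV[F]_D) : (#|[pred i : 'I_D | s 0%R i != 0%R]| <= \rank (diag_mx s))%N.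
Proof.
set Z := [pred i | _]; pose f (k : 'I_#|Z|) : 'I_D := enum_val k.
pose E := rowsub f (colsub f (diag_mx s)).
have rE : (\rank E <= \rank (diag_mx s))%N.
  rewrite (leq_trans (mxrankS (rowsub_sub _ _))) // -mxrank_tr -[X in (_ <= X)%N]mxrank_tr.
  have -> : (colsub f (diag_mx s))^T = rowsub f (diag_mx s)^T by apply/matrixP => i j; rewrite !mxE.
  exact: mxrankS (rowsub_sub _ _).
rewrite (leq_trans _ rE) //.
have -> : E = diag_mx (\row_j s 0 (f j)).
  by apply/matrixP => i j; rewrite !mxE (inj_eq enum_val_inj).
rewrite mxrank_unit // unitmxE det_diag unitfE; apply/prodf_neq0 => i _; rewrite mxE.
by have := enum_valP i; rewrite inE.
Qed.

(** * The spectrum of the projected matrix *)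

Section Spectrum.
Variable R : realType.
Local Notation C := R[i].

(** The complexified matrix is normal, so the spectral theorem applies; the diagonal form is again a
    Gram matrix, whence nonnegative eigenvalues, and its rank bounds the number of nonzero ones. *)
Lemma gram_spectrum D p (A : 'M[R]_(D, p)) : exists2 s : seq R, char_poly (A *m A^T) = \prod_(y <- s) ('X - y%:P) &
  [/\ size s = D, (forall y, y \in s -> 0 <= y) & (count (fun y => y != 0)%R s <= \rank A)%N].
Proof.
pose B : 'M[C]_(D, p) := map_mx (real_complex R) A.
have Badj : adj B = map_mx (real_complex R) A^T.
  by apply/matrixP => i j; rewrite adjE !mxE; apply/eqP; rewrite eq_complex /= oppr0 !eqxx.
pose Mc := B *m adj B.
have McE : Mc = map_mx (real_complex R) (A *m A^T) by rewrite /Mc Badj map_mxM.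
have Mn : Mc \is normalmx.
  have h : adj Mc = Mc by rewrite /Mc adj_mul adjK.
  apply/normalmxP; change (Mc *m adj Mc = adj Mc *m Mc); by rewrite h.
set P := spectralmx Mc; set sp := spectral_diag Mc.
have PU : P \is unitarymx by exact: spectral_unitarymx.
have Pu : P \in unitmx by exact: spectral_unit.
have Minv : Mc = invmx P *m diag_mx sp *m P by exact/orthomx_spectralP.
have iP : invmx P = adj P by rewrite invmx_unitary.
have dE : diag_mx sp = (P *m B) *m adj (P *m B).
  rewrite adj_mul !mulmxA -(mulmxA P) -/Mc -iP Minv !mulmxA mulmxV // mul1mx -mulmxA mulmxV //.
  by rewrite mulmx1.
pose dd (i : 'I_D) : R := complex.Re (sp 0 i).
have spE i : sp 0 i = (dd i)%:C%C /\ 0 <= dd i.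
  have h : 0 <= sp 0 i.
    have := congr1 (fun X : 'M[C]_D => X i i) dE; rewrite !mxE eqxx mulr1n => ->.
    apply: sumr_ge0 => k _; rewrite adjE; exact: mul_conjC_ge0.
  move: h; rewrite /dd; case: (sp 0 i) => x y; by rewrite lecE /= => /andP[/eqP -> ->].
have dR : \prod_i ('X - (dd i)%:P) = char_poly (A *m A^T).
  apply: (map_poly_inj (real_complex R)); rewrite map_char_poly -McE Minv.
  rewrite -{2}(invmxK P) char_poly_similar ?unitmx_inv // char_poly_trig ?diag_mx_is_trig //.
  rewrite map_prod_XsubC; apply: eq_bigr => i _; rewrite mxE eqxx mulr1n; congr ('X - _%:P).
  by have [-> _] := spE i.
exists [seq dd i | i <- enum 'I_D].
  by rewrite -dR big_map big_enum.
split; first by rewrite size_map size_enum_ord.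
  by move=> y /mapP[i _ ->]; have [] := spE i.
have rA : (\rank (diag_mx sp) <= \rank A)%N.
  rewrite dE (leq_trans (mxrankM_maxl _ _)) // (leq_trans (mxrankM_maxr _ _)) //.
  by rewrite /B mxrank_map.
apply: leq_trans rA; apply: leq_trans (card_diag_rank sp).
rewrite -sum1_count big_map big_enum_cond -sum1_card; apply/eq_leq/eq_bigl => i /=.
have [spi _] := spE i; rewrite inE /= spi; congr (~~ _); apply/eqP/eqP => [->//|h].
exact: (complexI h).
Qed.

(** At most q eigenvalues are nonzero and none is negative, so in decreasing order all those from
    position q on are 0. *)
Lemma top_spectrum D p q (A : 'M[R]_(q + D, p)) : (\rank A <= q)%N -> exists e : seq R,
  [/\ size e = q, sorted (fun x y => y <= x) e, (forall y, y \in e -> 0 <= y) &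
      char_poly (A *m A^T) = 'X^D * \prod_(y <- e) ('X - y%:P)].
Proof.
move=> rA; have [s cs [sz s0 cn]] := gram_spectrum A.
pose l := sort (fun x y : R => y <= x) s.
have tot : total (fun x y : R => y <= x) by move=> x y; exact: le_total.
have pl : perm_eq l s by rewrite perm_sort.
have sl : sorted (fun x y => y <= x) l by exact: sort_sorted.
have szl : size l = (q + D)%N by rewrite size_sort.
have l0 y : y \in l -> 0 <= y by rewrite mem_sort; exact: s0.
have dl : drop q l = nseq D 0.
  apply: (@eq_from_nth _ 0); first by rewrite size_drop szl addKn size_nseq.
  move=> i; rewrite size_drop szl addKn => iD; rewrite nth_nseq iD nth_drop.
  have h : (q + i < size l)%N by rewrite szl ltn_add2l.
  apply/eqP; rewrite eq_le l0 ?mem_nth // andbT leNgt -count_nth // -leqNgt.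
  rewrite (leq_trans _ (leq_addr _ _)) // (leq_trans _ rA) // (leq_trans _ cn) //.
  have /seq.permP -> := pl; apply: sub_count => y /=; exact: lt0r_neq0.
exists (take q l); split.
- by rewrite size_take szl; case: ltnP => // h; lia.
- exact: take_sorted.
- by move=> y /mem_take; exact: l0.
rewrite cs -(perm_big _ pl) -[l in LHS](cat_take_drop q) big_cat /= dl mulrC; congr (_ * _).
by rewrite big_nseq subr0 iter_mulr_1.
Qed.

(** M = A A^T with A = Pi T, and A has rank at most 2n since the last n0 rows of T are zero. *)
Lemma Mmat_spectrum nstar n n0 (S : 'M[C]_(nstar + n)) (g : 'cV[R]_(2 * n + n0)) : exists e : seq R,
  [/\ size e = (2 * n)%N, sorted (fun x y => y <= x) e, (forall y, y \in e -> 0 <= y) &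
      char_poly (Mmat S g) = 'X^n0 * \prod_(y <- e) ('X - y%:P)].
Proof.
pose T := that n0 (tsub S); pose A := projPi g *m T.
have -> : Mmat S g = A *m A^T.
  rewrite /Mmat /A trmx_mul !mulmxA; congr (_ *m _).
  by rewrite /projPi linearB /= trmx1 trmx_mul trmxK.
apply: top_spectrum; rewrite (leq_trans (mxrankM_maxr _ _)) //.
have -> : T = col_mx 1%:M 0 *m usubmx T.
  rewrite mul_col_mx mul1mx mul0mx -[LHS]vsubmxK; congr col_mx.
  by apply/matrixP => i j; rewrite !mxE /= ltnNge leq_addr.
by rewrite (leq_trans (mxrankM_maxr _ _)) // rank_leq_row.
Qed.

End Spectrum.

Section Final.
Variables (R : realType) (nstar m n0 : nat).
Local Notation n := m.+1.
Variables (d : measure_display) (Omega : measurableType d) (P : probability Omega R).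
Variables (S : Omega -> 'M[R[i]]_(nstar + n)) (g : Omega -> 'cV[R]_(2 * n + n0)).
Hypotheses (hnn : (n <= nstar)%N) (hn0 : (0 < n0)%N).
Hypothesis mS : forall i j, measurable_fun setT (fun w => complex.Re (S w i j)) /\
                    measurable_fun setT (fun w => complex.Im (S w i j)).
Hypothesis mg : forall k, measurable_fun setT (fun w => g w k 0).
Hypothesis Sunit : forall w, S w \is unitarymx.
Hypothesis Shaar : forall U : 'M[R[i]]_(nstar + n), U \is unitarymx ->
     forall lr hr li hi,
       P [set w | inboxC lr hr li hi (U *m S w)] =
       P [set w | inboxC lr hr li hi (S w)].
Hypothesis gGauss : forall lr hr li hi (c e : 'cV[R]_(2 * n + n0)),
     P [set w | inboxC lr hr li hi (S w) /\ inboxV c e (g w)] =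
     (P [set w | inboxC lr hr li hi (S w)] *
      \prod_(k < 2 * n + n0)
         \int[@lebesgue_measure R]_(x in `]c k ord0, e k ord0]) (normal_pdf 0%R 1%R x)%:E)%E.

Definition spec w : seq R := projT1 (cid (Mmat_spectrum (S w) (g w))).

Lemma specP w : [/\ size (spec w) = (2 * n)%N, sorted (fun x y => y <= x) (spec w),
  (forall y, y \in spec w -> 0 <= y) & char_poly (Mmat (S w) (g w)) = 'X^n0 * \prod_(y <- spec w) ('X - y%:P)].
Proof. by rewrite /spec; case: cid. Qed.

Lemma ps_spec w j : (0 < j)%N -> ps (spec w) j = \tr (Mmat (S w) (g w) ^+ j).
Proof.
move=> j0; have [_ _ _ cp] := specP w.
rewrite (trace_pow (e := spec w ++ nseq n0 0)).
  by rewrite big_cat big_nseq expr0n gtn_eqF //= iter_addr_0 mul0rn addr0.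
by rewrite cp big_cat big_nseq subr0 iter_mulr_1 mulrC.
Qed.

(** After cancelling X^n0, unique factorization makes the list of the event a permutation of
    [spec w], and [evt] does not see permutations. *)
Lemma eig_eventE a b : eig_event S g a b = [set w | evt (2 * n) a b (spec w)].
Proof.
apply/seteqP; split => w.
  move=> [s [sz ss hs cs]]; have [sz1 s1 _ c1] := specP w.
  have pe : perm_eq (spec w) s.
    by apply: prod_XsubC_eq; apply: (mulfI (x := 'X^n0)); rewrite ?expf_neq0 ?polyX_eq0 // -c1 cs.
  have ss' : sorted (fun x y => y <= x) s by apply: sub_sorted ss => x y; exact: ltW.
  by rewrite /= (evt_perm _ _ _ pe); apply/(evtP _ _ ss' sz).
have [sz s1 _ c1] := specP w.
by move=> /= /(evtP _ _ s1 sz)[ss hs]; exists (spec w).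
Qed.

Lemma jacobi_law : let Z := iint (2 * n) (fun _ => setT) (rho nstar n n0) in
  (0 < Z < +oo)%E /\
  forall a b : nat -> R,
    measurable (eig_event S g a b) /\
    P (eig_event S g a b) =
    (((fine Z)^-1)%:E * iint (2 * n) (fun j => `]a j, b j]) (rho nstar n n0))%E.
Proof.
pose aa := (nstar - n)%N; have -> : rho nstar n n0 = rho (aa + n) n n0 :> (seq R -> R) by rewrite subnK.
have [C0 HC] := trace_expectation mS mg Sunit Shaar gGauss hnn hn0.
have [d' [T [mu [c [sc mc iE]]]]] := iint_measure R (2 * n).
pose r := rho (aa + n) n n0 \o c.
have ir : mu.-integrable setT (EFin \o r) by exact: (integrable_rho aa hn0 sc mc iE).
have r0 t : 0 <= r t by exact: rho_ge0.
pose e2 t := [seq yz (c t) k | k <- enum {: 'I_n + 'I_n}].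
have pe2 t j : ps (e2 t) j = psum (@yz R n (c t)) j by rewrite /ps /psum big_map big_enum.
have [_ [M hM]] := bm_traceM mS mg Sunit 2.
(* The square of an eigenvalue is at most the trace of the squared matrix, hence at most the bound
   [M]; this gives y <= 1 + |M|. *)
pose K := 1 + `|M|.
have v1 w : valid (2 * n) K (spec w).
  have [sz _ s0 _] := specP w; split=> // y ys.
  have y2 : y ^+ 2 <= M.
    rewrite (le_trans _ (hM w)) // (le_trans _ (ler_norm _)) // -ps_spec //.
    rewrite /ps (perm_big _ (perm_to_rem ys)) big_cons lerDl sumr_ge0 // => x _; exact: sqr_ge0.
  rewrite ger0_norm ?s0 // /K; have := ler_norm M; have := s0 y ys; nra.
have v2 t : valid (2 * n) K (e2 t).
  split; first by rewrite size_map -cardE card_sum !card_ord mul2n addnn.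
  move=> y /mapP[k _ ->]; have /andP[h1 h2] := yz_bound (c t) k.
  by rewrite ger0_norm // (le_trans h2) // lerDl.
have m1 j : measurable_fun setT (fun w => ps (spec w) j).
  case: j => [|j]; last by under eq_fun do rewrite ps_spec //; case: (bm_traceM mS mg Sunit j.+1).
  have -> : (fun w => ps (spec w) 0) = (fun=> (2 * n)%:R).
    apply/funext => w; have [sz _ _ _] := specP w; rewrite /ps; under eq_bigr do rewrite expr0.
    by rewrite big_const_seq count_predT sz iter_addr_0.
  exact: measurable_cst.
have m2 j : measurable_fun setT (fun t => ps (e2 t) j).
  under eq_fun do rewrite pe2.
  by apply: (pf_falg (x := fun t => yz (c t)) (@measurable_falg R _ _) (pf_psum R _ j)); exact: (measurable_yz hn0 sc mc).
have tr F : TP F -> wint P (fun=> 1) (fun w => F (ps (spec w))) = C0 * wint mu r (fun t => F (ps (e2 t))).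
  move=> TF; have -> : (fun t => F (ps (e2 t))) = (fun t => F (psum (@yz R n (c t)))).
    by apply/funext => t; congr F; apply/funext => j; exact: pe2.
  rewrite [wint mu r _](wint_rho aa hn0 sc mc iE TF) -HC //.
  by apply: eq_Ex => w; apply: (TP_ext TF) => j j0; exact: ps_spec.
have iR : (\int[mu]_t (r t)%:E = (wint mu r (fun=> 1))%:E)%E.
  rewrite /wint /Rintegral; under [in RHS]eq_integral do rewrite mul1r.
  by rewrite fineK //; exact: integrable_fin_num.
have ZE : iint (2 * n) (fun=> setT) (rho (aa + n) n n0) = (wint mu r (fun=> 1))%:E.
  rewrite (iint_rho aa hn0 sc mc iE) // -iR; congr integral; first by apply/seteqP; split.
(* The test function 1 identifies the constant: [C0] is the inverse of the total mass of the
   density, which is Z. *)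
have C0Z : C0 * wint mu r (fun=> 1) = 1 by rewrite -(tr _ (TP_const 1)) [LHS]Ex_cst.
have Z0 : 0 < wint mu r (fun=> 1).
  rewrite lt_neqAle wint_ge0 ?andbT //; last by move=> t; rewrite mul1r.
  by apply/eqP => z0; move: C0Z; rewrite -z0 mulr0 => /eqP; rewrite eq_sym oner_eq0.
rewrite ZE; split; first by rewrite lte_fin Z0 ltry.
move=> a b; rewrite eig_eventE.
have [mE tE] := evt_transfer (integrable_one P) ir v1 v2 m1 m2 tr a b.
set A := [set w | _].
have AE : (fun w => (evt (2 * n) a b (spec w))%:R) = \1_A :> (Omega -> R).
  apply/funext => w; rewrite indicE; congr (nat_of_bool _)%:R; apply/idP/idP.
    by move=> h; rewrite in_setE.
  by rewrite in_setE.
have mA : measurable A.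
  have -> : A = (fun w => (evt (2 * n) a b (spec w))%:R : R) @^-1` [set 1].
    apply/seteqP; split => w /=; rewrite /A /=; first by move=> ->.
    by case: (evt _ _ _ _) => // /eqP; rewrite eq_sym oner_eq0.
  by rewrite -[X in measurable X]setTI; apply: mE => //; exact: measurable_set1.
split=> //.
have PA : P A = (wint P (fun=> 1) (fun w => (evt (2 * n) a b (spec w))%:R))%:E.
  rewrite AE -[wint _ _ _]/(Ex P _) -Ex_integral; last first.
    by split; [rewrite -AE|exists 1 => w; rewrite indicE; case: (_ \in _); rewrite ?normr1 ?normr0 ?ler01].
  by rewrite integral_indic // setIT.
rewrite PA tE EFinM; congr (_ * _)%E.
  by congr (_%:E) => /=; apply: (mulIf (x := wint mu r (fun=> 1))); rewrite ?gt_eqF // C0Z mulVf ?gt_eqF.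
have mB j : measurable (`]a j, b j] : set R) by exact: measurable_itv.
rewrite (iint_rho aa hn0 sc mc iE mB).
have be2 : bm (fun t => (evt (2 * n) a b (e2 t))%:R : R).
  by have [_ ? _] := Adm_transfers tr (Adm_evt (integrable_one P) ir v1 v2 m1 m2 a b).
rewrite /wint /Rintegral fineK; last by apply: integrable_fin_num => //; exact: (wint_integrable ir be2).
rewrite [RHS]integral_mkcond; apply: eq_integral => t _; rewrite patchE.
(* Where the density vanishes both integrands do. Elsewhere the point lies in the chamber and its
   list is strictly decreasing, so that the event reduces to the box condition. *)
have [rt0|rt0] := eqVneq (r t) 0; first by rewrite rt0 mulr0; case: ifP => // _; rewrite -[rho _ _ _ _]/(r t) rt0.
have os := rho_ordered rt0; have /andP[/eqP sz so] := os.
have pe : perm_eq (e2 t) (c t).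
  apply/seq.permP => p; rewrite -!sum1_count big_map big_enum_cond big_mkcond big_sumType /=.
  rewrite [RHS]big_mkcond [RHS](big_nth 0) sz big_mkord (big_pairs _ n (fun i => if p (c t)`_i then 1%N else 0%N)).
  by rewrite -big_split /=; apply: eq_bigr => l _; rewrite /yz os.
have sc0 : sorted (fun x y => y < x) (c t).
  apply: (subseq_sorted (@gt_trans_rel R) _ so).
  exact: subseq_trans (subseq_rcons _ _) (subseq_cons _ _).
rewrite (evt_perm _ _ _ pe).
have sc1 : sorted (fun x y => y <= x) (c t) by apply: sub_sorted sc0 => x y; exact: ltW.
case: ifPn => [/set_mem /= h|]; last rewrite notin_setE /= => h.
  have -> : evt (2 * n) a b (c t) by apply/(evtP _ _ sc1 sz); split => // j hj; have := h j hj; rewrite /= in_itv.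
  by rewrite mul1r.
have -> : evt (2 * n) a b (c t) = false.
  by apply/negbTE/negP => /(evtP _ _ sc1 sz)[_ h2]; apply: h => j hj; rewrite /= in_itv; exact: h2.
by rewrite mul0r.
Qed.

End Final.

Theorem theorem11 (R : realType) (nstar n n0 : nat)
  (hn : (1 <= n)%N) (hnn : (n <= nstar)%N) (hn0 : (1 <= n0)%N)
  (d : measure_display) (Omega : measurableType d) (P : probability Omega R)
  (S : Omega -> 'M[R[i]]_(nstar + n))
  (g : Omega -> 'cV[R]_(2 * n + n0))
  (* S and g are random variables *)
  (mS : forall i j, measurable_fun setT (fun w => complex.Re (S w i j)) /\
                    measurable_fun setT (fun w => complex.Im (S w i j)))
  (mg : forall k, measurable_fun setT (fun w => g w k 0))
  (* S is Haar distributed on the unitary group U(n*+n): unitary valued and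
     its law is invariant under left multiplication by unitaries *)
  (Sunit : forall w, S w \is unitarymx)
  (Shaar : forall U : 'M[R[i]]_(nstar + n), U \is unitarymx ->
     forall lr hr li hi,
       P [set w | inboxC lr hr li hi (U *m S w)] =
       P [set w | inboxC lr hr li hi (S w)])
  (* g has i.i.d. standard Gaussian entries and is independent of S *)
  (gGauss : forall lr hr li hi (c e : 'cV[R]_(2 * n + n0)),
     P [set w | inboxC lr hr li hi (S w) /\ inboxV c e (g w)] =
     (P [set w | inboxC lr hr li hi (S w)] *
      \prod_(k < 2 * n + n0)
         \int[@lebesgue_measure R]_(x in `]c k ord0, e k ord0]) (normal_pdf 0%R 1%R x)%:E)%E) :
  let Z := iint (2 * n) (fun _ => setT) (rho nstar n n0) in
  (0 < Z < +oo)%E /\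
  forall a b : nat -> R,
    measurable (eig_event S g a b) /\
    P (eig_event S g a b) =
    (((fine Z)^-1)%:E * iint (2 * n) (fun j => `]a j, b j]) (rho nstar n n0))%E.
Proof.
case: n hn S g hnn mS mg Sunit Shaar gGauss => [//|m] _ S g hnn mS mg Sunit Shaar gGauss.
exact: jacobi_law.
Qed.
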